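(* There exists $\epsilon>0$ such that for all $G\in(-\epsilon,\epsilon)$ and all sufficiently large $H$ there exists a solution (for some constants $\Omega,B,Q\in\mathbb R$) of the finite-depth water wave problem $$\Delta\psi=-\Omega \ \text{ in } D,\qquad \psi=0\ \text{ on } S,\qquad \tfrac12|\nabla\psi|^2+Gy=B\ \text{ on } S,\qquad \psi=Q\ \text{ on } \{y=-H\},$$ whose profile $S$ intersects itself tangentially, enclosing a small bubble of air.
   Context: Here $G,\Omega,B,Q$ are real constants (dimensionless gravity, constant vorticity, Bernoulli constant, and an a priori unknown constant value of $\psi$ on the bottom), and $H>0$. Solutions. For $0<d<\infty$ let $\mathbb S_d=\{\alpha+i\beta\in\mathbb C:-d<\beta<0\}$ and identify $\mathbb R^2$ with $\mathbb C$. A solution consists of $\Omega,B,Q\in\mathbb R$, a domain $D\subset\mathbb R^2$ which is $2\pi$-periodic in $x$, bounded below by the line $\{y=-H\}$ and bounded above by a free surface $S$, and a stream function $\psi$ on $\overline D$, such that the displayed equations hold. $D$ and $\psi$ are $2\pi$-periodic in $x$ and symmetric under reflection in the vertical lines beneath the crest and the trough. The domain is described by a unique $d\in(0,\infty)$ and a conformal bijection $z=x+iy:\mathbb S_d\to D$ that extends continuously to $\{\beta=-d\}$, mapping it onto $\{y=-H\}$, and extends in a $C^1$ fashion to $\{\beta=0\}$ with $z_\alpha\ne0$ there, such that $x-\alpha$ and $y$ are $2\pi$-periodic in $\alpha$ and $S$ is the curve $\alpha\mapsto z(\alpha+i0)$. The map $\alpha\mapsto z(\alpha+i0)$ is allowed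 to be non-injective, and values of $\nabla\psi$ on $S$ are limits from inside $D$ along the corresponding part of $S$. ''Intersects itself tangentially, enclosing a small bubble of air'' means: modulo the period, there is exactly one pair $\alpha_1<\alpha_2$ with $z(\alpha_1+i0)=z(\alpha_2+i0)$, the tangent lines of $S$ there coincide, and the closed loop $z([\alpha_1,\alpha_2])$ encloses a bounded region not belonging to $D$ (the word ''small'' carries no quantitative requirement). *)

(* Defs.v *)
From Stdlib Require Import Reals ZArith.
From Coquelicot Require Import Coquelicot.
Open Scope R_scope.

(** The plane is identified with [C], which in Coquelicot is [R * R]; the point
    [x + iy] is the pair [(x, y)]. *)

(** * Planar topology *)

(** Stated with [~ locally], in the style of Coquelicot's [closed]. *)
Definition adherent (D : C -> Prop) (p : C) : Prop :=
  ~ locally p (fun q => ~ D q).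

Definition frontier (D : C -> Prop) (p : C) : Prop :=
  adherent D p /\ ~ locally p D.

Definition connected (D : C -> Prop) : Prop :=
  forall U V : C -> Prop, open U -> open V ->
    (forall p, D p -> U p \/ V p) ->
    (exists p, D p /\ U p) -> (exists p, D p /\ V p) ->
    exists p, D p /\ U p /\ V p.

Definition is_domain (D : C -> Prop) : Prop :=
  (exists p, D p) /\ open D /\ connected D.

Definition bounded_set (D : C -> Prop) : Prop :=
  exists M : R, forall p, D p -> Cmod p <= M.

(** * Conformal description of the fluid domain *)

Definition strip (d : R) (w : C) : Prop := - d < Im w < 0.
Definition strip_with_top (d : R) (w : C) : Prop := - d < Im w <= 0.
Definition closed_strip (d : R) (w : C) : Prop := - d <= Im w <= 0.

Definition surface (z : C -> C) (p : C) : Prop := exists a : R, p = z (a, 0).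

(** [z] carries its boundary values on [Im w = 0] and [Im w = - d], and [dz] is
    its complex derivative together with the limits of the latter on
    [Im w = 0].  Since [z] is holomorphic, [dz] is the partial derivative of [z]
    in [alpha] and [Ci * dz] the one in [beta], so continuity of [z] and [dz] up
    to [Im w = 0] is the [C^1] extension; only the values of [z] on
    [closed_strip d] and of [dz] on [strip_with_top d] matter. *)
Record conformal_description (D : C -> Prop) (H d : R) (z dz : C -> C) : Prop := {
  cd_depth : 0 < d;
  cd_holomorphic : forall w, strip d w ->
    is_derive (K := C_AbsRing) (V := C_NormedModule) z w (dz w) /\ dz w <> RtoC 0;
  cd_injective : forall w1 w2, strip d w1 -> strip d w2 -> z w1 = z w2 -> w1 = w2;
  cd_image : forall p, D p <-> exists w, strip d w /\ p = z w;
  cd_continuous : continuous_on (closed_strip d) z;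
  cd_bottom : forall p, Im p = - H <-> exists w, Im w = - d /\ p = z w;
  cd_dz_continuous : continuous_on (strip_with_top d) dz;
  cd_dz_top : forall a : R,
    is_derive (fun t : R => z (t, 0)) a (dz (a, 0)) /\ dz (a, 0) <> RtoC 0;
  cd_periodic : forall a b : R, closed_strip d (a, b) ->
    Re (z (a + 2 * PI, b)) - (a + 2 * PI) = Re (z (a, b)) - a /\
    Im (z (a + 2 * PI, b)) = Im (z (a, b));
  cd_surface_above_bottom : forall p, surface z p -> - H < Im p
}.

(** The crest is the highest point of the surface, the trough the lowest. *)
Definition is_crest (z : C -> C) (a : R) : Prop :=
  forall b : R, Im (z (b, 0)) <= Im (z (a, 0)).
Definition is_trough (z : C -> C) (a : R) : Prop :=
  forall b : R, Im (z (a, 0)) <= Im (z (b, 0)).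

Definition symmetric_about (D : C -> Prop) (psi : R -> R -> R) (c : R) : Prop :=
  (forall x y, D (x, y) <-> D (2 * c - x, y)) /\
  (forall x y, adherent D (x, y) -> psi (2 * c - x) y = psi x y).

(** * The water wave problem *)

Definition laplacian (psi : R -> R -> R) (x y : R) : R :=
  partial_derive 2 0 psi x y + partial_derive 0 2 psi x y.

(** Meaningful only where [psi] is differentiable, as [Derive] is total. *)
Definition grad (psi : R -> R -> R) (p : C) : C :=
  (Derive (fun x => psi x (Im p)) (Re p), Derive (fun y => psi (Re p) y) (Im p)).

Record water_wave (G H Omega B Q : R) (D : C -> Prop) (psi : R -> R -> R)
    (d : R) (z dz : C -> C) : Prop := {
  ww_domain : is_domain D;
  ww_periodic_domain : forall x y, D (x, y) <-> D (x + 2 * PI, y);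
  ww_above_bottom : forall p, D p -> - H < Im p;
  ww_boundary : forall p, frontier D p <-> Im p = - H \/ surface z p;
  ww_conformal : conformal_description D H d z dz;
  ww_depth_unique : forall (d' : R) (z' dz' : C -> C),
    conformal_description D H d' z' dz' -> d' = d;
  ww_psi_continuous : continuous_on (adherent D) (fun p : C => psi (Re p) (Im p));
  ww_psi_C2 : forall x y, D (x, y) -> ex_diff_n psi 2 x y;
  ww_psi_periodic : forall x y, adherent D (x, y) -> psi (x + 2 * PI) y = psi x y;
  ww_symmetric : exists a_crest a_trough : R,
    is_crest z a_crest /\ is_trough z a_trough /\
    symmetric_about D psi (Re (z (a_crest, 0))) /\
    symmetric_about D psi (Re (z (a_trough, 0)));
  ww_vorticity : forall x y, D (x, y) -> laplacian psi x y = - Omega;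
  ww_kinematic_surface : forall x y, surface z (x, y) -> psi x y = 0;
  (** The surface may touch itself, so the boundary value of [grad psi] is taken
      along the parametrisation and may differ between two parameters with the
      same image. *)
  ww_bernoulli : forall a : R, exists g : C,
    filterlim (fun w => grad psi (z w)) (within (strip d) (locally (a, 0))) (locally g) /\
    / 2 * Cmod g ^ 2 + G * Im (z (a, 0)) = B;
  ww_kinematic_bottom : forall x y, y = - H -> psi x y = Q
}.

(** * Tangential self-intersection *)

Definition tangent_line (z dz : C -> C) (a : R) (p : C) : Prop :=
  exists t : R, p = Cplus (z (a, 0)) (Cmult (RtoC t) (dz (a, 0))).

Definition loop (z : C -> C) (a1 a2 : R) (p : C) : Prop :=
  exists a : R, a1 <= a <= a2 /\ p = z (a, 0).

(** For a simple closed curve [L], this says that [A] is its Jordan interior. *)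
Definition encloses (L A : C -> Prop) : Prop :=
  is_domain A /\ bounded_set A /\ (forall p, frontier A p <-> L p).

Definition touches_enclosing_bubble (D : C -> Prop) (z dz : C -> C) : Prop :=
  exists a1 a2 : R,
    a1 < a2 /\ z (a1, 0) = z (a2, 0) /\
    (forall b1 b2 : R, b1 < b2 -> z (b1, 0) = z (b2, 0) ->
       exists k : Z, b1 = a1 + 2 * PI * IZR k /\ b2 = a2 + 2 * PI * IZR k) /\
    (forall p, tangent_line z dz a1 p <-> tangent_line z dz a2 p) /\
    (exists A : C -> Prop, encloses (loop z a1 a2) A /\ forall p, A p -> ~ D p).

(* Main.v *)
Require Import Defs.
From Stdlib Require Import Reals Ranalysis5 ZArith Lra Lia List ClassicalEpsilon FunctionalExtensionality.
From Coquelicot Require Import Coquelicot.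
Open Scope R_scope.

(** The vorticity is [Omega = -1].  In terms of the conformal map [z], with [Z = z'] and
    [y = Im z - yc] of mean zero on the surface, the stream function is [y^2 / 2 + Re P]
    with [P' = - i u Z] for a function [u] holomorphic in the strip and real on its bottom,
    and the free boundary problem becomes the single equation [Z (u + y)^2 = (q - 2 G y) conj Z]
    on the surface.  For [G = 0] and infinite depth it is solved by Crapper's capillary
    profile [Z = ((1 - A t) / (1 + A t))^2], [t = exp (- i w)], which touches itself for one
    value of [A].  At Crapper's wave the linearized equation reduces to an ODE with rational
    coefficients in [t], which gives an explicit right inverse, so a contraction in a weighted
    Wiener algebra yields, for small [G] and [e = exp (- 2 d)], a family of solutions following
    the tangent of Crapper's family.  Along it the minimum of the abscissa over the right half
    of the surface near the contact point changes sign, and where it vanishes the profile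
    touches itself.  Only [y] enters, so the vertical shift [yc] is free and one [d] serves for
    all depths [H].

    On half a period [Im Z > 0], so [z] is injective there by the Noshiro-Warschawski argument;
    reflection and periodicity extend this to the strip, and the same inequality separates the
    bubble from the fluid. *)

(** * Unconditional sums *)

(** The kinematic and Bernoulli conditions merge because, with [V = u + y], the derivative of the
    stream function along the surface is [Im (V Z)] and [|grad psi| = |V|]; together they say
    [(V Z)^2 = (q - 2 G y) |Z|^2]. Depth is a small parameter like gravity: it enters only through
    Schwarz reflection in the bottom, which weights the n-th mode by [e^n]. Real Laurent
    coefficients encode the symmetry about crest and trough. The linearization at Crapper's wave has
    a kernel, the variation of [A]; hence only a right inverse is available, and the kernel
    direction stays as the parameter that later restores the contact. Requiring the variation of [u]
    to be analytic leaves a first-order ODE for a primitive of the variation of [Z]. It has a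
    regular singular point with exponent 2 at [t = - A], inside the disc, so analytic solutions
    exist only after some constants are adjusted; the variation of [q] supplies one of them. Contact
    is a double zero of the abscissa, which is why its minimum is followed and not its value at a
    fixed point. *)

Definition lsum {I : Type} (f : I -> R) (l : list I) : R :=
  fold_right (fun i s => f i + s) 0 l.

(** Convergence along the directed set of finite subsets. No order of summation is chosen, so
    reflections of [Z] and shears of [Z * Z] act freely on sums. *)
Definition is_sum {I : Type} (f : I -> R) (s : R) : Prop :=
  forall e, 0 < e -> exists l0, forall l, NoDup l -> incl l0 l -> Rabs (lsum f l - s) < e.

Definition summable {I : Type} (f : I -> R) : Prop :=
  exists M, forall l, NoDup l -> lsum (fun i => Rabs (f i)) l <= M.

(** [epsilon] makes the sum total; for a family without a sum the value is an unspecified real. *)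
Definition Sum {I : Type} (f : I -> R) : R := epsilon (inhabits 0) (is_sum f).

Definition dec_eq {I : Type} (x y : I) : {x = y} + {x <> y} :=
  excluded_middle_informative (x = y).

Lemma lsum_ext {I} (f g : I -> R) l : (forall i, In i l -> f i = g i) -> lsum f l = lsum g l.
Proof.
  induction l as [|a l IH]; simpl; intros H; [easy|].
  rewrite (H a), IH; auto.
Qed.

Lemma lsum_plus {I} (f g : I -> R) l : lsum (fun i => f i + g i) l = lsum f l + lsum g l.
Proof. induction l as [|a l IH]; simpl; lra. Qed.

Lemma lsum_scal {I} c (f : I -> R) l : lsum (fun i => c * f i) l = c * lsum f l.
Proof. induction l as [|a l IH]; simpl; [ring|rewrite IH; ring]. Qed.

Lemma lsum_le {I} (f g : I -> R) l : (forall i, f i <= g i) -> lsum f l <= lsum g l.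
Proof. intros H; induction l as [|a l IH]; simpl; [lra|specialize (H a); lra]. Qed.

Lemma lsum_app {I} (f : I -> R) l m : lsum f (l ++ m) = lsum f l + lsum f m.
Proof. induction l as [|a l IH]; simpl; lra. Qed.

Lemma lsum_abs {I} (f : I -> R) l : Rabs (lsum f l) <= lsum (fun i => Rabs (f i)) l.
Proof.
  induction l as [|a l IH]; simpl; [rewrite Rabs_R0; lra|].
  generalize (Rabs_triang (f a) (lsum f l)); lra.
Qed.

Lemma lsum_pos {I} (f : I -> R) l : (forall i, 0 <= f i) -> 0 <= lsum f l.
Proof. intros H; induction l as [|a l IH]; simpl; [lra|specialize (H a); lra]. Qed.

Lemma lsum_map {I J} (f : J -> R) (h : I -> J) l : lsum f (map h l) = lsum (fun i => f (h i)) l.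
Proof. induction l as [|a l IH]; simpl; lra. Qed.

Lemma lsum_incl {I} (f : I -> R) l m : (forall i, 0 <= f i) -> NoDup l -> incl l m -> lsum f l <= lsum f m.
Proof.
  intros Hf Hl; revert m; induction Hl as [|a l Ha Hl IH]; intros m Hm; simpl.
  - now apply lsum_pos.
  - destruct (in_split a m) as (p & q & ->); [apply Hm; now left|].
    assert (lsum f l <= lsum f (p ++ q)).
    { apply IH; intros x Hx.
      assert (Hx' : In x (p ++ a :: q)) by (apply Hm; now right).
      apply in_app_or in Hx'; apply in_or_app.
      destruct Hx' as [|[->|]]; auto; now elim Ha. }
    rewrite lsum_app in *; simpl; lra.
Qed.

Lemma is_sum_unique {I} (f : I -> R) s t : is_sum f s -> is_sum f t -> s = t.
Proof.
  intros Hs Ht; apply NNPP; intros Hn.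
  assert (He : 0 < Rabs (s - t) / 2) by (apply Rdiv_lt_0_compat; [apply Rabs_pos_lt|]; lra).
  destruct (Hs _ He) as [l1 H1], (Ht _ He) as [l2 H2].
  set (l := nodup dec_eq (l1 ++ l2)).
  assert (Hl : NoDup l) by apply NoDup_nodup.
  specialize (H1 l Hl); specialize (H2 l Hl).
  assert (Rabs (lsum f l - s) < Rabs (s - t) / 2).
  { apply H1; intros x Hx; apply nodup_In, in_or_app; now left. }
  assert (Rabs (lsum f l - t) < Rabs (s - t) / 2).
  { apply H2; intros x Hx; apply nodup_In, in_or_app; now right. }
  assert (Rabs (s - t) <= Rabs (lsum f l - s) + Rabs (lsum f l - t)); [|lra].
  replace (s - t) with (- (lsum f l - s) + (lsum f l - t)) by ring.
  rewrite <- (Rabs_Ropp (lsum f l - s)); apply Rabs_triang.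
Qed.

Lemma is_sum_plus {I} (f g : I -> R) s t :
  is_sum f s -> is_sum g t -> is_sum (fun i => f i + g i) (s + t).
Proof.
  intros Hs Ht e He.
  destruct (Hs (e / 2)) as [l1 H1]; [lra|]; destruct (Ht (e / 2)) as [l2 H2]; [lra|].
  exists (l1 ++ l2); intros l Hl Hi; rewrite lsum_plus.
  specialize (H1 l Hl (fun x Hx => Hi x (in_or_app _ _ _ (or_introl Hx)))).
  specialize (H2 l Hl (fun x Hx => Hi x (in_or_app _ _ _ (or_intror Hx)))).
  replace (_ - _) with ((lsum f l - s) + (lsum g l - t)) by ring.
  eapply Rle_lt_trans; [apply Rabs_triang|lra].
Qed.

Lemma is_sum_scal {I} c (f : I -> R) s : is_sum f s -> is_sum (fun i => c * f i) (c * s).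
Proof.
  intros Hs e He.
  assert (Hc : 0 < Rabs c + 1) by (generalize (Rabs_pos c); lra).
  destruct (Hs (e / (Rabs c + 1))) as [l1 H1]; [now apply Rdiv_lt_0_compat|].
  exists l1; intros l Hl Hi; rewrite lsum_scal, <- Rmult_minus_distr_l, Rabs_mult.
  specialize (H1 l Hl Hi).
  apply Rmult_lt_compat_l with (1 := Hc) in H1.
  replace ((Rabs c + 1) * (e / (Rabs c + 1))) with e in H1 by (field; lra).
  generalize (Rabs_pos (lsum f l - s)); nra.
Qed.

Lemma is_sum_ext {I} (f g : I -> R) s : (forall i, f i = g i) -> is_sum f s -> is_sum g s.
Proof. intros H; apply functional_extensionality in H; now subst. Qed.

Lemma is_sum_le {I} (f g : I -> R) s t : (forall i, f i <= g i) -> is_sum f s -> is_sum g t -> s <= t.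
Proof.
  intros H Hs Ht; apply Rnot_lt_le; intros Hn.
  destruct (Hs ((s - t) / 2)) as [l1 H1]; [lra|]; destruct (Ht ((s - t) / 2)) as [l2 H2]; [lra|].
  set (l := nodup dec_eq (l1 ++ l2)).
  assert (Hl : NoDup l) by apply NoDup_nodup.
  specialize (H1 l Hl); specialize (H2 l Hl).
  assert (K1 : Rabs (lsum f l - s) < (s - t) / 2).
  { apply H1; intros x Hx; apply nodup_In, in_or_app; now left. }
  assert (K2 : Rabs (lsum g l - t) < (s - t) / 2).
  { apply H2; intros x Hx; apply nodup_In, in_or_app; now right. }
  apply Rabs_def2 in K1; apply Rabs_def2 in K2.
  generalize (lsum_le f g l H); lra.
Qed.

Lemma is_sum_lsum_le {I} (f : I -> R) s l : (forall i, 0 <= f i) -> is_sum f s -> NoDup l -> lsum f l <= s.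
Proof.
  intros H Hs Hl; apply Rnot_lt_le; intros Hn.
  destruct (Hs (lsum f l - s)) as [l1 H1]; [lra|].
  set (m := nodup dec_eq (l1 ++ l)).
  assert (K : Rabs (lsum f m - s) < lsum f l - s).
  { apply H1; [apply NoDup_nodup|]; intros x Hx; apply nodup_In, in_or_app; now left. }
  apply Rabs_def2 in K.
  assert (lsum f l <= lsum f m); [|lra].
  apply lsum_incl; auto; intros x Hx; apply nodup_In, in_or_app; now right.
Qed.

Lemma is_sum_nonneg_ex {I} (f : I -> R) M :
  (forall i, 0 <= f i) -> (forall l, NoDup l -> lsum f l <= M) -> exists s, is_sum f s.
Proof.
  intros Hf HM.
  destruct (completeness (fun x => exists l, NoDup l /\ x = lsum f l)) as [s [Hs1 Hs2]].
  - exists M; intros x (l & Hl & ->); auto.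
  - exists 0, nil; split; [constructor|easy].
  - exists s; intros e He.
    assert (exists l, NoDup l /\ s - e < lsum f l) as (l0 & Hl0 & H0).
    { apply NNPP; intros Hn.
      assert (s <= s - e); [|lra].
      apply Hs2; intros x (l & Hl & ->); apply Rnot_lt_le; intros Hlt; apply Hn; eauto. }
    exists l0; intros l Hl Hi.
    assert (lsum f l <= s) by (apply Hs1; eauto).
    assert (lsum f l0 <= lsum f l) by now apply lsum_incl.
    apply Rabs_def1; lra.
Qed.

Lemma summable_abs_sum {I} (f : I -> R) : summable f -> exists s, is_sum (fun i => Rabs (f i)) s.
Proof. intros [M HM]; apply (is_sum_nonneg_ex _ M); auto; intros; apply Rabs_pos. Qed.

Lemma summable_is_sum {I} (f : I -> R) : summable f -> is_sum f (Sum f).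
Proof.
  intros H; unfold Sum; apply epsilon_spec.
  destruct (summable_abs_sum f H) as [s Hs].
  destruct H as [M HM].
  (* [f + |f|] and [|f|] are nonnegative families whose difference is [f]. *)
  destruct (is_sum_nonneg_ex (fun i => f i + Rabs (f i)) (2 * M)) as [t Ht].
  - intros i; generalize (Rle_abs (- f i)); rewrite Rabs_Ropp; lra.
  - intros l Hl; specialize (HM l Hl).
    apply Rle_trans with (2 * lsum (fun i => Rabs (f i)) l); [|lra].
    rewrite <- lsum_scal; apply lsum_le; intros i; generalize (Rle_abs (f i)); lra.
  - exists (t + -1 * s).
    apply (is_sum_ext (fun i => (f i + Rabs (f i)) + -1 * Rabs (f i))); [intros; ring|].
    apply is_sum_plus; auto; now apply is_sum_scal.
Qed.

Lemma Sum_unique {I} (f : I -> R) s : is_sum f s -> Sum f = s.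
Proof.
  intros H; apply (is_sum_unique f); auto.
  unfold Sum; apply epsilon_spec; eauto.
Qed.

Lemma summable_le {I} (f g : I -> R) : (forall i, Rabs (f i) <= g i) -> summable g -> summable f.
Proof.
  intros H [M HM]; exists M; intros l Hl.
  apply Rle_trans with (2 := HM l Hl), lsum_le; intros i.
  apply Rle_trans with (1 := H i), Rle_abs.
Qed.

Lemma summable_abs {I} (f : I -> R) : summable f -> summable (fun i => Rabs (f i)).
Proof.
  intros [M HM]; exists M; intros l Hl; erewrite lsum_ext; [now apply HM|].
  intros; apply Rabs_Rabsolu.
Qed.

Lemma summable_plus {I} (f g : I -> R) : summable f -> summable g -> summable (fun i => f i + g i).
Proof.
  intros [M HM] [N HN]; exists (M + N); intros l Hl.
  apply Rle_trans with (lsum (fun i => Rabs (f i) + Rabs (g i)) l).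
  - apply lsum_le; intros; apply Rabs_triang.
  - rewrite lsum_plus; specialize (HM l Hl); specialize (HN l Hl); lra.
Qed.

Lemma summable_scal {I} c (f : I -> R) : summable f -> summable (fun i => c * f i).
Proof.
  intros [M HM]; exists (Rabs c * M); intros l Hl.
  rewrite (lsum_ext _ (fun i => Rabs c * Rabs (f i))) by (intros; apply Rabs_mult).
  rewrite lsum_scal; apply Rmult_le_compat_l; [apply Rabs_pos|auto].
Qed.

Lemma summable_ext {I} (f g : I -> R) : (forall i, f i = g i) -> summable f -> summable g.
Proof. intros H; apply functional_extensionality in H; now subst. Qed.

Lemma summable_bounded_mult {I} C (f g : I -> R) :
  (forall i, Rabs (g i) <= C) -> summable f -> summable (fun i => f i * g i).
Proof.
  intros HC Hf; apply (summable_le _ (fun i => C * Rabs (f i))).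
  - intros i; rewrite Rabs_mult, Rmult_comm; apply Rmult_le_compat_r; [apply Rabs_pos|auto].
  - apply summable_scal, summable_abs; auto.
Qed.

Lemma Sum_plus {I} (f g : I -> R) : summable f -> summable g -> Sum (fun i => f i + g i) = Sum f + Sum g.
Proof. intros; apply Sum_unique, is_sum_plus; now apply summable_is_sum. Qed.

Lemma Sum_scal {I} c (f : I -> R) : summable f -> Sum (fun i => c * f i) = c * Sum f.
Proof. intros; apply Sum_unique, is_sum_scal; now apply summable_is_sum. Qed.

Lemma Sum_ext {I} (f g : I -> R) : (forall i, f i = g i) -> Sum f = Sum g.
Proof. intros H; apply functional_extensionality in H; now subst. Qed.

Lemma Sum_le {I} (f g : I -> R) : summable f -> summable g -> (forall i, f i <= g i) -> Sum f <= Sum g.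
Proof. intros Hf Hg H; apply (is_sum_le f g); auto; now apply summable_is_sum. Qed.

Lemma Sum_zero {I} (f : I -> R) : (forall i, f i = 0) -> Sum f = 0.
Proof.
  intros H; apply Sum_unique; intros e He; exists nil; intros l _ _.
  rewrite (lsum_ext f (fun _ => 0 * 0)) by (intros; rewrite H; ring).
  rewrite lsum_scal, Rmult_0_l, Rminus_0_r, Rabs_R0; auto.
Qed.

Lemma Sum_pos {I} (f : I -> R) : summable f -> (forall i, 0 <= f i) -> 0 <= Sum f.
Proof.
  intros Hf H; change 0 with (lsum f nil).
  apply is_sum_lsum_le; auto; [now apply summable_is_sum|constructor].
Qed.

Lemma Sum_abs {I} (f : I -> R) : summable f -> Rabs (Sum f) <= Sum (fun i => Rabs (f i)).
Proof.
  intros Hf.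
  assert (H1 : Sum f <= Sum (fun i => Rabs (f i))).
  { apply Sum_le; auto using summable_abs; intros; apply Rle_abs. }
  assert (H2 : Sum (fun i => -1 * f i) <= Sum (fun i => Rabs (f i))).
  { apply Sum_le; auto using summable_abs, summable_scal.
    intros i; rewrite <- Rabs_Ropp; replace (-1 * f i) with (- f i) by ring; apply Rle_abs. }
  rewrite Sum_scal in H2; auto; apply Rabs_le; lra.
Qed.

Lemma Sum_single {I} (f : I -> R) i0 : (forall i, i <> i0 -> f i = 0) -> is_sum f (f i0).
Proof.
  intros H e He; exists (i0 :: nil); intros l Hl Hi.
  assert (Hin : In i0 l) by (apply Hi; now left).
  replace (lsum f l) with (f i0); [rewrite Rminus_diag, Rabs_R0; auto|].
  clear Hi; induction Hl as [|a l Ha Hl IH]; [easy|]; simpl.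
  destruct Hin as [->|Hin].
  - rewrite (lsum_ext f (fun _ => 0 * 0)), lsum_scal; [ring|].
    intros i Hi; rewrite H; [ring|congruence].
  - rewrite (H a), <- IH; [ring| auto | congruence].
Qed.

Lemma summable_single {I} (f : I -> R) i0 : (forall i, i <> i0 -> f i = 0) -> summable f.
Proof.
  intros H; exists (Rabs (f i0)); intros l Hl.
  apply is_sum_lsum_le; auto; [intros; apply Rabs_pos|].
  apply (Sum_single (fun i => Rabs (f i)) i0).
  intros i Hi; rewrite H, Rabs_R0; auto.
Qed.

Lemma is_sum_reindex {I J} (h : I -> J) (k : J -> I) (f : J -> R) s :
  (forall i, k (h i) = i) -> (forall j, h (k j) = j) -> is_sum f s -> is_sum (fun i => f (h i)) s.
Proof.
  intros Hk Hh Hs e He; destruct (Hs e He) as [l0 H0].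
  exists (map k l0); intros l Hl Hi; rewrite <- lsum_map; apply H0.
  - apply NoDup_map_NoDup_ForallPairs; auto.
    intros x y _ _ E; rewrite <- (Hk x), E; auto.
  - intros j Hj; rewrite <- (Hh j); apply in_map, Hi, in_map; auto.
Qed.

Lemma summable_inj {I J} (h : I -> J) (f : J -> R) :
  (forall i i', h i = h i' -> i = i') -> summable f -> summable (fun i => f (h i)).
Proof.
  intros Hh [M HM]; exists M; intros l Hl.
  rewrite <- (lsum_map (fun j => Rabs (f j))); apply HM.
  apply NoDup_map_NoDup_ForallPairs; auto; intros x y _ _; apply Hh.
Qed.

Lemma Sum_reindex {I J} (h : I -> J) (k : J -> I) (f : J -> R) :
  (forall i, k (h i) = i) -> (forall j, h (k j) = j) -> summable f -> Sum (fun i => f (h i)) = Sum f.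
Proof. intros; apply Sum_unique, (is_sum_reindex h k); auto using summable_is_sum. Qed.

(** A single finite set of pairs is compared with both sides: it is close to the total sum because
    it contains [l0], and close to the sum of the rows in [l] because each of these rows is
    truncated late. *)
Lemma fubini {I J} (F : I * J -> R) :
  summable F -> is_sum (fun i => Sum (fun j => F (i, j))) (Sum F).
Proof.
  intros HF e He.
  assert (Hrow : forall i, summable (fun j => F (i, j))).
  { intros i; apply (summable_inj (fun j => (i, j))); auto; intros j j' E; now inversion E. }
  destruct (summable_is_sum F HF (e / 2)) as [l0 H0]; [lra|].
  exists (map fst l0); intros l Hl Hi.
  (* At most [length l] rows, each with error [eta], contribute less than [e / 2]. *)
  set (eta := e / 2 / (INR (length l) + 1)).
  assert (Hlen : 0 < INR (length l) + 1) by (generalize (pos_INR (length l)); lra).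
  assert (Heta : 0 < eta) by (apply Rdiv_lt_0_compat; lra).
  assert (exists B, NoDup B /\ (forall p, In p B -> In (fst p) l) /\
    (forall p, In p l0 -> In (fst p) l -> In p B) /\
    Rabs (lsum F B - lsum (fun i => Sum (fun j => F (i, j))) l) <= INR (length l) * eta) as (B & HB1 & _ & HB3 & HB4).
  { clear Hi Hlen H0; clearbody eta; induction Hl as [|a l Ha Hl IH].
    - exists nil; repeat split; simpl; try easy; [constructor|].
      rewrite Rminus_diag, Rabs_R0; lra.
    - destruct IH as (B & HB1 & HB2 & HB3 & HB4).
      destruct (summable_is_sum _ (Hrow a) eta Heta) as [j0 Hj0].
      set (j := nodup dec_eq (j0 ++ map snd l0)).
      assert (Hj : Rabs (lsum (fun j => F (a, j)) j - Sum (fun j => F (a, j))) < eta).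
      { apply Hj0; [apply NoDup_nodup|]; intros x Hx; apply nodup_In, in_or_app; now left. }
      exists (map (pair a) j ++ B); repeat split.
      + apply NoDup_app; auto.
        * apply NoDup_map_NoDup_ForallPairs; [|apply NoDup_nodup].
          intros x y _ _ E; now inversion E.
        * intros p Hp Hp'; apply in_map_iff in Hp; destruct Hp as (x & <- & _).
          apply Ha, (HB2 _ Hp').
      + intros p Hp; apply in_app_or in Hp; destruct Hp as [Hp|Hp]; [|right; auto].
        apply in_map_iff in Hp; destruct Hp as (x & <- & _); now left.
      + intros [p1 p2] Hp [Hp1|Hp1]; simpl in *; apply in_or_app; [left|right; auto].
        subst p1; apply in_map, nodup_In, in_or_app; right.
        apply in_map_iff; now exists (a, p2).
      + change (length (a :: l)) with (S (length l)).
        rewrite lsum_app, lsum_map, S_INR; simpl.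
        replace (_ - _) with ((lsum (fun j => F (a, j)) j - Sum (fun j => F (a, j))) +
          (lsum F B - lsum (fun i => Sum (fun j => F (i, j))) l)) by ring.
        eapply Rle_trans; [apply Rabs_triang|]; lra. }
  assert (K : Rabs (lsum F B - Sum F) < e / 2).
  { apply H0; auto; intros p Hp; apply HB3; auto; apply Hi, in_map; auto. }
  assert (K' : INR (length l) * eta < e / 2).
  { apply Rlt_le_trans with ((INR (length l) + 1) * eta); [lra|].
    right; unfold eta; field; lra. }
  replace (_ - _) with ((lsum F B - Sum F) - (lsum F B - lsum (fun i => Sum (fun j => F (i, j))) l)) by ring.
  eapply Rle_lt_trans; [apply Rabs_triang|]; rewrite Rabs_Ropp; lra.
Qed.

Lemma fubini_summable {I J} (F : I * J -> R) : summable F -> summable (fun i => Sum (fun j => F (i, j))).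
Proof.
  intros HF.
  assert (Hrow : forall i, summable (fun j => F (i, j))).
  { intros i; apply (summable_inj (fun j => (i, j))); auto; intros j j' E; now inversion E. }
  apply (summable_le _ (fun i => Sum (fun j => Rabs (F (i, j))))).
  { intros i; apply Sum_abs; auto. }
  exists (Sum (fun p => Rabs (F p))); intros l Hl.
  rewrite (lsum_ext _ (fun i => Sum (fun j => Rabs (F (i, j))))).
  - apply is_sum_lsum_le; auto.
    + intros; apply Sum_pos; [apply summable_abs; auto|intros; apply Rabs_pos].
    + apply (fubini (fun p => Rabs (F p))), summable_abs; auto.
  - intros; apply Rabs_pos_eq, Sum_pos; [apply summable_abs; auto|intros; apply Rabs_pos].
Qed.

Lemma lsum_list_prod {I J} (a : I -> R) (b : J -> R) l m :
  lsum (fun p => a (fst p) * b (snd p)) (list_prod l m) = lsum a l * lsum b m.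
Proof.
  induction l as [|x l IH]; simpl; [ring|].
  rewrite lsum_app, IH, lsum_map; simpl; rewrite lsum_scal; ring.
Qed.

Lemma summable_prod {I J} (a : I -> R) (b : J -> R) :
  summable a -> summable b -> summable (fun p : I * J => a (fst p) * b (snd p)).
Proof.
  intros [M HM] [N HN]; exists (M * N); intros l Hl.
  set (l1 := nodup dec_eq (map fst l)); set (l2 := nodup dec_eq (map snd l)).
  apply Rle_trans with (lsum (fun p => Rabs (a (fst p)) * Rabs (b (snd p))) (list_prod l1 l2)).
  - rewrite (lsum_ext _ (fun p => Rabs (a (fst p)) * Rabs (b (snd p)))) by (intros; apply Rabs_mult).
    apply lsum_incl; auto.
    + intros; apply Rmult_le_pos; apply Rabs_pos.
    + intros [i j] Hp; apply in_prod; apply nodup_In, in_map_iff; now exists (i, j).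
  - rewrite (lsum_list_prod (fun i => Rabs (a i)) (fun j => Rabs (b j))).
    apply Rmult_le_compat; try (apply lsum_pos; intros; apply Rabs_pos).
    + apply HM, NoDup_nodup.
    + apply HN, NoDup_nodup.
Qed.

Lemma Sum_prod {I J} (a : I -> R) (b : J -> R) :
  summable a -> summable b -> Sum (fun p : I * J => a (fst p) * b (snd p)) = Sum a * Sum b.
Proof.
  intros Ha Hb; symmetry.
  rewrite Rmult_comm, <- Sum_scal; auto.
  rewrite <- (Sum_unique _ _ (fubini _ (summable_prod a b Ha Hb))).
  apply Sum_ext; intros i; simpl; rewrite Sum_scal; auto; ring.
Qed.

(** * Convolution *)

Definition cv (a b : Z -> R) (n : Z) : R := Sum (fun k => a k * b (n - k)%Z).

(** Pulled back along this bijection, a product family has the terms of the convolution as its rows,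
    so [fubini] gives both the summability and the total sum of [cv]. *)
Definition shear (p : Z * Z) : Z * Z := (snd p, (fst p - snd p)%Z).
Definition unshear (p : Z * Z) : Z * Z := ((fst p + snd p)%Z, fst p).

Lemma unshear_shear p : unshear (shear p) = p.
Proof. destruct p; unfold shear, unshear; simpl; f_equal; lia. Qed.

Lemma shear_unshear p : shear (unshear p) = p.
Proof. destruct p; unfold shear, unshear; simpl; f_equal; lia. Qed.

Lemma summable_shear (a b : Z -> R) : summable a -> summable b ->
  summable (fun p : Z * Z => a (snd p) * b (fst p - snd p)%Z).
Proof.
  intros Ha Hb.
  apply (summable_inj shear (fun p => a (fst p) * b (snd p))); [|now apply summable_prod].
  intros p p' E; rewrite <- (unshear_shear p), E; apply unshear_shear.
Qed.

Lemma summable_cv_term (a b : Z -> R) n : summable a -> summable b -> summable (fun k => a k * b (n - k)%Z).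
Proof.
  intros Ha Hb; apply (summable_inj (fun k => (n, k)) (fun p => a (snd p) * b (fst p - snd p)%Z)).
  - intros k k' E; now inversion E.
  - now apply summable_shear.
Qed.

Lemma summable_cv (a b : Z -> R) : summable a -> summable b -> summable (cv a b).
Proof. intros Ha Hb; apply (fubini_summable _ (summable_shear a b Ha Hb)). Qed.

Lemma Sum_cv (a b : Z -> R) : summable a -> summable b -> Sum (cv a b) = Sum a * Sum b.
Proof.
  intros Ha Hb; rewrite <- Sum_prod; auto.
  rewrite <- (Sum_reindex shear unshear) by auto using unshear_shear, shear_unshear, summable_prod.
  apply Sum_unique, (fubini _ (summable_shear a b Ha Hb)).
Qed.

(** * Fourier series *)

(** For [w = x + i y], [exp (- i n w) = exp (n y) (cos (n x) - i sin (n x))]: [eC] is the real part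
    and [eS] is minus the imaginary part. *)
Definition eC (n : Z) (w : C) : R := exp (IZR n * Im w) * cos (IZR n * Re w).
Definition eS (n : Z) (w : C) : R := exp (IZR n * Im w) * sin (IZR n * Re w).

(** The sum of [a n * exp (- i n w)]. *)
Definition ev (a : Z -> R) (w : C) : C :=
  (Sum (fun n => a n * eC n w), - Sum (fun n => a n * eS n w)).

(** Absolute convergence of [ev a] on the whole line [Im w = b], where
    [|exp (- i n w)| = exp (n b)]. *)
Definition sm (a : Z -> R) (b : R) : Prop := summable (fun n => a n * exp (IZR n * b)).

Lemma eC_bound n w : Rabs (eC n w) <= exp (IZR n * Im w).
Proof.
  unfold eC; rewrite Rabs_mult, (Rabs_pos_eq (exp _)) by (left; apply exp_pos).
  rewrite <- (Rmult_1_r (exp _)) at 2; apply Rmult_le_compat_l; [left; apply exp_pos|].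
  apply Rabs_le, COS_bound.
Qed.

Lemma eS_bound n w : Rabs (eS n w) <= exp (IZR n * Im w).
Proof.
  unfold eS; rewrite Rabs_mult, (Rabs_pos_eq (exp _)) by (left; apply exp_pos).
  rewrite <- (Rmult_1_r (exp _)) at 2; apply Rmult_le_compat_l; [left; apply exp_pos|].
  apply Rabs_le, SIN_bound.
Qed.

Lemma summable_mult_le (a f g : Z -> R) : (forall n, Rabs (f n) <= g n) ->
  summable (fun n => a n * g n) -> summable (fun n => a n * f n).
Proof.
  intros H Hs; apply (summable_le _ (fun n => Rabs (a n * g n))); [|now apply summable_abs].
  intros n; rewrite !Rabs_mult; apply Rmult_le_compat_l; [apply Rabs_pos|].
  apply Rle_trans with (1 := H n), Rle_abs.
Qed.

Lemma sm_C a w : sm a (Im w) -> summable (fun n => a n * eC n w).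
Proof. apply summable_mult_le; intros n; apply eC_bound. Qed.

Lemma sm_S a w : sm a (Im w) -> summable (fun n => a n * eS n w).
Proof. apply summable_mult_le; intros n; apply eS_bound. Qed.

Lemma eC_plus m n w : eC (m + n) w = eC m w * eC n w - eS m w * eS n w.
Proof.
  unfold eC, eS; rewrite plus_IZR, !Rmult_plus_distr_r, exp_plus, cos_plus; ring.
Qed.

Lemma eS_plus m n w : eS (m + n) w = eS m w * eC n w + eC m w * eS n w.
Proof.
  unfold eC, eS; rewrite plus_IZR, !Rmult_plus_distr_r, exp_plus, sin_plus; ring.
Qed.

Lemma sm_term a b y n : sm a y -> sm b y -> summable (fun k => a k * b (n - k)%Z).
Proof.
  intros Ha Hb.
  apply (summable_ext (fun k => exp (- (IZR n * y)) *
        (a k * exp (IZR k * y) * (b (n - k)%Z * exp (IZR (n - k) * y))))).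
  - intros k.
    replace (- (IZR n * y)) with (- (IZR k * y) + - (IZR (n - k) * y)) by (rewrite minus_IZR; ring).
    rewrite exp_plus, !exp_Ropp; field; split; apply Rgt_not_eq, exp_pos.
  - apply summable_scal, (summable_cv_term _ _ n Ha Hb).
Qed.

Lemma sm_cv a b y : sm a y -> sm b y -> sm (cv a b) y.
Proof.
  intros Ha Hb; eapply summable_ext; [|apply (summable_cv _ _ Ha Hb)].
  intros n; unfold cv; rewrite (Rmult_comm (Sum (fun k => a k * b (n - k)%Z))).
  rewrite <- Sum_scal by now apply (sm_term _ _ y).
  apply Sum_ext; intros k.
  replace (IZR n * y) with (IZR k * y + IZR (n - k) * y) by (rewrite minus_IZR; ring).
  rewrite exp_plus; ring.
Qed.

Lemma cv_C a b w n : sm a (Im w) -> sm b (Im w) ->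
  cv a b n * eC n w = cv (fun k => a k * eC k w) (fun k => b k * eC k w) n
    + -1 * cv (fun k => a k * eS k w) (fun k => b k * eS k w) n.
Proof.
  intros Ha Hb; unfold cv.
  rewrite Rmult_comm, <- Sum_scal by now apply (sm_term _ _ (Im w)).
  rewrite <- Sum_scal; [|apply (summable_cv_term (fun k => a k * eS k w) (fun k => b k * eS k w)); now apply sm_S].
  rewrite <- Sum_plus.
  - apply Sum_ext; intros k; replace n with (k + (n - k))%Z at 1 by ring; rewrite eC_plus; ring.
  - apply (summable_cv_term (fun k => a k * eC k w) (fun k => b k * eC k w)); now apply sm_C.
  - apply summable_scal, (summable_cv_term (fun k => a k * eS k w) (fun k => b k * eS k w)); now apply sm_S.
Qed.

Lemma cv_S a b w n : sm a (Im w) -> sm b (Im w) ->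
  cv a b n * eS n w = cv (fun k => a k * eS k w) (fun k => b k * eC k w) n
    + cv (fun k => a k * eC k w) (fun k => b k * eS k w) n.
Proof.
  intros Ha Hb; unfold cv.
  rewrite Rmult_comm, <- Sum_scal by now apply (sm_term _ _ (Im w)).
  rewrite <- Sum_plus.
  - apply Sum_ext; intros k; replace n with (k + (n - k))%Z at 1 by ring; rewrite eS_plus; ring.
  - apply (summable_cv_term (fun k => a k * eS k w) (fun k => b k * eC k w)); auto using sm_S, sm_C.
  - apply (summable_cv_term (fun k => a k * eC k w) (fun k => b k * eS k w)); auto using sm_S, sm_C.
Qed.

Lemma ev_cv a b w : sm a (Im w) -> sm b (Im w) -> ev (cv a b) w = Cmult (ev a w) (ev b w).
Proof.
  intros Ha Hb; unfold ev, Cmult; simpl; f_equal.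
  - rewrite (Sum_ext _ _ (fun n => cv_C a b w n Ha Hb)), Sum_plus, Sum_scal, !Sum_cv;
      auto using summable_scal, summable_cv, sm_C, sm_S; ring.
  - rewrite (Sum_ext _ _ (fun n => cv_S a b w n Ha Hb)), Sum_plus, !Sum_cv;
      auto using summable_scal, summable_cv, sm_C, sm_S; ring.
Qed.

Lemma ev_plus a b w : sm a (Im w) -> sm b (Im w) -> ev (fun n => a n + b n) w = Cplus (ev a w) (ev b w).
Proof.
  intros Ha Hb; unfold ev, Cplus; simpl; f_equal.
  - rewrite <- Sum_plus by now apply sm_C.
    apply Sum_ext; intros; ring.
  - rewrite <- Ropp_plus_distr, <- Sum_plus by now apply sm_S.
    f_equal; apply Sum_ext; intros; ring.
Qed.

Lemma ev_scal c a w : sm a (Im w) -> ev (fun n => c * a n) w = Cmult (RtoC c) (ev a w).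
Proof.
  intros Ha; unfold ev, Cmult, RtoC; simpl; f_equal.
  - replace (_ - _) with (c * Sum (fun n => a n * eC n w)) by ring.
    rewrite <- Sum_scal by now apply sm_C.
    apply Sum_ext; intros; ring.
  - replace (_ + _) with (- (c * Sum (fun n => a n * eS n w))) by ring.
    rewrite <- Sum_scal by now apply sm_S.
    f_equal; apply Sum_ext; intros; ring.
Qed.

Lemma ev_single a w k : (forall n, n <> k -> a n = 0) ->
  ev a w = (a k * eC k w, - (a k * eS k w)).
Proof.
  intros H; unfold ev; f_equal; [|f_equal];
    (apply Sum_unique, (Sum_single (fun n => a n * _ n w) k); intros i Hi; rewrite H; auto; ring).
Qed.

Lemma lsum_incl_diff {I} (f : I -> R) l m : NoDup l -> incl l m ->
  Rabs (lsum f m - lsum f l) <= lsum (fun i => Rabs (f i)) m - lsum (fun i => Rabs (f i)) l.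
Proof.
  intros Hl; revert m; induction Hl as [|a l Ha Hl IH]; intros m Hm; simpl.
  - rewrite !Rminus_0_r; apply lsum_abs.
  - destruct (in_split a m) as (p & q & ->); [apply Hm; now left|].
    specialize (IH (p ++ q)); rewrite !lsum_app in *; simpl.
    replace (_ - _) with (lsum f p + lsum f q - lsum f l) by ring.
    eapply Rle_trans; [apply IH|lra].
    intros x Hx; assert (Hx' : In x (p ++ a :: q)) by (apply Hm; now right).
    apply in_app_or in Hx'; apply in_or_app.
    destruct Hx' as [|[->|]]; auto; now elim Ha.
Qed.

Lemma Sum_tail {I} (f : I -> R) l : summable f -> NoDup l ->
  Rabs (Sum f - lsum f l) <= Sum (fun i => Rabs (f i)) - lsum (fun i => Rabs (f i)) l.
Proof.
  intros Hf Hl; apply le_epsilon; intros e He.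
  destruct (summable_is_sum f Hf e He) as [l0 H0].
  set (m := nodup dec_eq (l0 ++ l)).
  assert (Hm : NoDup m) by apply NoDup_nodup.
  assert (H1 : Rabs (lsum f m - Sum f) < e).
  { apply H0; auto; intros x Hx; apply nodup_In, in_or_app; now left. }
  assert (H2 := lsum_incl_diff f l m Hl).
  assert (H3 : incl l m) by (intros x Hx; apply nodup_In, in_or_app; now right).
  specialize (H2 H3).
  assert (H4 : lsum (fun i => Rabs (f i)) m <= Sum (fun i => Rabs (f i))).
  { apply is_sum_lsum_le; auto; [intros; apply Rabs_pos|].
    apply summable_is_sum, summable_abs, Hf. }
  replace (Sum f - lsum f l) with (- (lsum f m - Sum f) + (lsum f m - lsum f l)) by ring.
  eapply Rle_trans; [apply Rabs_triang|]; rewrite Rabs_Ropp; lra.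
Qed.

Lemma is_RInt_cos_Z (k : Z) : k <> 0%Z -> is_RInt (fun x => cos (IZR k * x)) 0 (2 * PI) 0.
Proof.
  intros Hk; assert (Hk' : IZR k <> 0) by now apply not_0_IZR.
  replace 0 with (minus (sin (IZR k * (2 * PI)) / IZR k) (sin (IZR k * 0) / IZR k)) at 2.
  - apply (is_RInt_derive (fun x => sin (IZR k * x) / IZR k)).
    + intros x _; auto_derive; auto; field; auto.
    + intros x _; apply (ex_derive_continuous (fun x => cos (IZR k * x))); auto_derive; auto.
  - unfold minus, plus, opp; simpl.
    replace (IZR k * (2 * PI)) with (0 + 2 * IZR k * PI) by ring.
    assert (sin (0 + 2 * IZR k * PI) = sin 0) as ->; [|rewrite Rmult_0_r, sin_0; field; auto].
    destruct (Z_le_dec 0 k).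
    + rewrite <- (Z2Nat.id k), <- INR_IZR_INZ by auto; apply sin_period.
    + rewrite <- (sin_period _ (Z.to_nat (- k))).
      rewrite INR_IZR_INZ, Z2Nat.id, opp_IZR by lia; f_equal; ring.
Qed.

(** The mean of the sum of [a k cos ((k - n) x)] over a period is [a n]. Only a finite truncation is
    integrated: its mean is still [a n], but it lies within [|a n| / 2] of the full sum, which
    vanishes. *)
Lemma fourier_zero a : summable a -> (forall x : R, ev a (x, 0) = RtoC 0) -> forall n, a n = 0.
Proof.
  intros Ha H n.
  apply NNPP; intros Hn; assert (He : 0 < Rabs (a n)) by now apply Rabs_pos_lt.
  destruct (summable_is_sum _ (summable_abs _ Ha) (Rabs (a n) / 2)) as [l0 H0]; [lra|].
  set (l := nodup dec_eq (n :: l0)).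
  assert (Hl : NoDup l) by apply NoDup_nodup.
  assert (Hnl : In n l) by (apply nodup_In; now left).
  assert (H1 : Rabs (lsum (fun i => Rabs (a i)) l - Sum (fun i => Rabs (a i))) < Rabs (a n) / 2).
  { apply H0; auto; intros x Hx; apply nodup_In; now right. }
  apply Rabs_def2 in H1.
  assert (Hs : forall f : R -> R, (forall x, Rabs (f x) <= 1) -> forall g : Z -> R, summable (fun k => a k * f (g k))).
  { intros f Hf g; apply (summable_bounded_mult 1); auto. }
  assert (Hc : forall x, Rabs (lsum (fun k => a k * cos (IZR (k - n) * x)) l) <= Rabs (a n) / 2).
  { intros x.
    (* This sum is the real part of [exp (i n x)] times [ev a (x, 0)]. *)
    assert (HS : Sum (fun k => a k * cos (IZR (k - n) * x)) = 0).
    { specialize (H x); unfold ev in H; injection H as HC HS.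
      rewrite (Sum_ext _ (fun k => cos (IZR n * x) * (a k * eC k (x, 0)) + sin (IZR n * x) * (a k * eS k (x, 0)))).
      - rewrite Sum_plus, !Sum_scal, HC.
        + replace (Sum (fun k => a k * eS k (x, 0))) with 0 by lra; ring.
        + apply sm_S; apply (summable_ext a); auto; intros; simpl; rewrite Rmult_0_r, exp_0; ring.
        + apply sm_C; apply (summable_ext a); auto; intros; simpl; rewrite Rmult_0_r, exp_0; ring.
        + apply summable_scal, sm_C; apply (summable_ext a); auto; intros; simpl; rewrite Rmult_0_r, exp_0; ring.
        + apply summable_scal, sm_S; apply (summable_ext a); auto; intros; simpl; rewrite Rmult_0_r, exp_0; ring.
      - intros k; unfold eC, eS; simpl; rewrite Rmult_0_r, exp_0, minus_IZR, Rmult_minus_distr_r, cos_minus; ring. }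
    assert (Hsc : summable (fun k => a k * cos (IZR (k - n) * x))).
    { apply (Hs cos); intros; apply Rabs_le, COS_bound. }
    assert (HT := Sum_tail (fun k => a k * cos (IZR (k - n) * x)) l Hsc Hl).
    rewrite HS, Rminus_0_l, Rabs_Ropp in HT.
    eapply Rle_trans; [exact HT|].
    assert (K := Sum_plus (fun k => Rabs (a k)) (fun k => -1 * Rabs (a k * cos (IZR (k - n) * x)))
       (summable_abs _ Ha) (summable_scal _ _ (summable_abs _ Hsc))).
    rewrite Sum_scal in K by now apply summable_abs.
    assert (K2 : lsum (fun k => Rabs (a k) + -1 * Rabs (a k * cos (IZR (k - n) * x))) l <=
      Sum (fun k => Rabs (a k) + -1 * Rabs (a k * cos (IZR (k - n) * x)))).
    { apply is_sum_lsum_le; auto.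
      - intros k; rewrite Rabs_mult.
        assert (Rabs (cos (IZR (k - n) * x)) <= 1) by apply Rabs_le, COS_bound.
        generalize (Rabs_pos (a k)); nra.
      - apply summable_is_sum, summable_plus; [now apply summable_abs|now apply summable_scal, summable_abs]. }
    rewrite lsum_plus, lsum_scal in K2; lra. }
  assert (HI : is_RInt (fun x => lsum (fun k => a k * cos (IZR (k - n) * x)) l) 0 (2 * PI)
     (lsum (fun k => if Z.eq_dec k n then 2 * PI * a n else 0) l)).
  { clear Hl Hnl H1 Hc; clearbody l; induction l as [|k l IH]; simpl.
    - assert (K := is_RInt_const (V := R_NormedModule) 0 (2 * PI) 0).
      change (scal (2 * PI - 0) 0) with ((2 * PI - 0) * 0) in K; rewrite Rmult_0_r in K; exact K.
    - apply (is_RInt_plus (V := R_NormedModule) (fun x => a k * cos (IZR (k - n) * x)));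
        [|exact IH].
      destruct (Z.eq_dec k n) as [->|Hk].
      + apply (is_RInt_ext (fun _ => a n)).
        * intros; rewrite Z.sub_diag, Rmult_0_l, cos_0; symmetry; apply Rmult_1_r.
        * assert (K := is_RInt_const (V := R_NormedModule) 0 (2 * PI) (a n)).
          change (scal (2 * PI - 0) (a n)) with ((2 * PI - 0) * a n) in K; rewrite Rminus_0_r in K; exact K.
      + assert (K := is_RInt_scal (V := R_NormedModule) (fun x => cos (IZR (k - n) * x)) 0 (2 * PI) (a k) 0
          (is_RInt_cos_Z (k - n) ltac:(lia))).
        change (scal (a k) 0) with (a k * 0) in K; rewrite Rmult_0_r in K; exact K. }
  assert (HV : lsum (fun k => if Z.eq_dec k n then 2 * PI * a n else 0) l = 2 * PI * a n).
  { clear HI Hc H1; induction Hl as [|k l Hk Hl IH]; [easy|]; simpl.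
    destruct (Z.eq_dec k n) as [->|Hkn].
    - rewrite (lsum_ext _ (fun _ => 0 * 0)), lsum_scal; [ring|].
      intros i Hi; destruct (Z.eq_dec i n) as [->|]; [easy|ring].
    - destruct Hnl; [easy|]; rewrite IH; auto; ring. }
  rewrite HV in HI.
  assert (HP := PI_RGT_0).
  assert (HN := norm_RInt_le_const (V := R_NormedModule) (fun x => lsum (fun k => a k * cos (IZR (k - n) * x)) l) 0 (2 * PI) _ (Rabs (a n) / 2) ltac:(lra) (fun x _ => Hc x) HI).
  change (Rabs (2 * PI * a n) <= (2 * PI - 0) * (Rabs (a n) / 2)) in HN.
  rewrite Rabs_mult, (Rabs_pos_eq (2 * PI)) in HN by lra; nra.
Qed.

(** * A weighted Wiener algebra *)

(** The ratio 3/2 leaves a margin for the poles: Crapper's parameter satisfies [0 < A < 1 / 2], so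
    the poles in [t], of modulus [A] and [1 / A], stay outside the annulus
    [2 / 3 <= |t| <= 3 / 2]. *)
Definition Lr : R := ln (3 / 2).
Definition wt (n : Z) : R := exp (Lr * Rabs (IZR n)).

(** Real Laurent coefficients in [t = exp (- i alpha)], weighted so that the
    series converge for [Rabs beta <= Lr]. *)
Record W : Type := mkW { co :> Z -> R; co_summable : summable (fun n => co n * wt n) }.

Declare Scope W_scope.
Delimit Scope W_scope with W.
Bind Scope W_scope with W.

Lemma exp_mono x y : x <= y -> exp x <= exp y.
Proof. intros [H| ->]; [left; now apply exp_increasing|apply Rle_refl]. Qed.

Lemma Lr_pos : 0 < Lr.
Proof. unfold Lr; rewrite <- ln_1; apply ln_increasing; lra. Qed.

Lemma wt_pos n : 0 < wt n.
Proof. apply exp_pos. Qed.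

Lemma wt_ge_1 n : 1 <= wt n.
Proof.
  unfold wt; rewrite <- exp_0 at 1; apply exp_mono.
  apply Rmult_le_pos; [left; apply Lr_pos|apply Rabs_pos].
Qed.

Lemma wt_opp n : wt (- n) = wt n.
Proof. unfold wt; now rewrite opp_IZR, Rabs_Ropp. Qed.

Lemma wt_0 : wt 0 = 1.
Proof. unfold wt; rewrite Rabs_R0, Rmult_0_r; apply exp_0. Qed.

Lemma wt_plus m n : wt (m + n) <= wt m * wt n.
Proof.
  unfold wt; rewrite <- exp_plus; apply exp_mono.
  rewrite <- Rmult_plus_distr_l, plus_IZR; apply Rmult_le_compat_l; [left; apply Lr_pos|apply Rabs_triang].
Qed.

Lemma wt_nat n : wt (Z.of_nat n) = (3 / 2) ^ n.
Proof.
  unfold wt; rewrite <- INR_IZR_INZ, Rabs_pos_eq by apply pos_INR.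
  rewrite <- (exp_ln (3 / 2)) by lra; fold Lr.
  induction n; [simpl; rewrite Rmult_0_r; apply exp_0|].
  rewrite S_INR, Rmult_plus_distr_l, Rmult_1_r, exp_plus, IHn; simpl; ring.
Qed.

Lemma W_eq (a b : W) : (forall n, a n = b n) -> a = b.
Proof.
  destruct a as [a Ha], b as [b Hb]; simpl; intros H.
  apply functional_extensionality in H; subst; f_equal; apply proof_irrelevance.
Qed.

Lemma W_sm (a : W) y : Rabs y <= Lr -> sm a y.
Proof.
  intros Hy; apply (summable_mult_le _ _ wt); [|apply co_summable].
  intros n; rewrite Rabs_pos_eq by (left; apply exp_pos); apply exp_mono.
  apply Rle_trans with (1 := Rle_abs _); rewrite Rabs_mult, Rmult_comm.
  apply Rmult_le_compat_r; [apply Rabs_pos|auto].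
Qed.

Lemma W_sm0 (a : W) : sm a 0.
Proof. apply W_sm; rewrite Rabs_R0; left; apply Lr_pos. Qed.

Lemma W_summable (a : W) : summable a.
Proof. apply (summable_ext (fun n => a n * exp (IZR n * 0))), W_sm0; intros; rewrite Rmult_0_r, exp_0; ring. Qed.

Definition nrm (a : W) : R := Sum (fun n => Rabs (a n) * wt n).

Lemma W_abs_summable (a : W) : summable (fun n => Rabs (a n) * wt n).
Proof.
  apply (summable_ext (fun n => Rabs (a n * wt n))), summable_abs, co_summable.
  intros n; rewrite Rabs_mult, (Rabs_pos_eq (wt n)); auto; left; apply wt_pos.
Qed.

Lemma nrm_pos a : 0 <= nrm a.
Proof.
  apply Sum_pos; [apply W_abs_summable|]; intros; apply Rmult_le_pos; [apply Rabs_pos|left; apply wt_pos].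
Qed.

Lemma nrm_lsum (a : W) l : NoDup l -> lsum (fun n => Rabs (a n) * wt n) l <= nrm a.
Proof.
  apply is_sum_lsum_le; [|apply summable_is_sum, W_abs_summable].
  intros; apply Rmult_le_pos; [apply Rabs_pos|left; apply wt_pos].
Qed.

Lemma nrm_co (a : W) n : Rabs (a n) * wt n <= nrm a.
Proof.
  generalize (nrm_lsum a (n :: nil) (NoDup_cons n (@in_nil _ n) (NoDup_nil _))); simpl; lra.
Qed.

Lemma nrm_co' (a : W) n : Rabs (a n) <= nrm a.
Proof. generalize (nrm_co a n) (wt_ge_1 n) (Rabs_pos (a n)); nra. Qed.

Lemma zero_summable : summable (fun n => 0 * wt n).
Proof. apply (summable_single _ 0%Z); intros; ring. Qed.

(** Outside the weighted space the value defaults to the zero series; the [co_] lemmas discharge the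
    summability once for each operation. *)
Definition toW (f : Z -> R) : W :=
  match excluded_middle_informative (summable (fun n => f n * wt n)) with
  | left H => mkW f H
  | right _ => mkW (fun _ => 0) zero_summable
  end.

Lemma co_toW f n : summable (fun n => f n * wt n) -> toW f n = f n.
Proof. intros H; unfold toW; destruct excluded_middle_informative; easy. Qed.

Lemma summable_star (a : W) : summable (fun n => a (- n)%Z * wt n).
Proof.
  apply (summable_ext (fun n => a (- n)%Z * wt (- n))); [intros; now rewrite wt_opp|].
  apply (summable_inj Z.opp (fun n => a n * wt n)); [lia|apply co_summable].
Qed.

(** The shape of the bound covers multipliers combined with the reflection [n -> - n], which is what
    [Kop], [Yop], [Pge] and [diag] are. *)
Lemma op_summable (a : W) f C D : (forall n, Rabs (f n) <= C * Rabs (a n) + D * Rabs (a (- n)%Z)) ->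
  summable (fun n => f n * wt n).
Proof.
  intros H; apply (summable_le _ (fun n => C * Rabs (a n * wt n) + D * Rabs (a (- n)%Z * wt n))).
  - intros n; rewrite !Rabs_mult, (Rabs_pos_eq (wt n)) by (left; apply wt_pos).
    specialize (H n); generalize (wt_pos n); nra.
  - apply summable_plus; apply summable_scal, summable_abs; [apply co_summable|apply summable_star].
Qed.

Lemma op_nrm (a : W) f C D : (forall n, Rabs (f n) <= C * Rabs (a n) + D * Rabs (a (- n)%Z)) ->
  nrm (toW f) <= (C + D) * nrm a.
Proof.
  intros H; assert (Hs := op_summable a f C D H).
  assert (E : Sum (fun n => Rabs (a (- n)%Z) * wt n) = nrm a).
  { unfold nrm; rewrite <- (Sum_reindex Z.opp Z.opp (fun n => Rabs (a n) * wt n));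
      try apply W_abs_summable; try (intros; lia).
    apply Sum_ext; intros; now rewrite wt_opp. }
  assert (S2 : summable (fun n => Rabs (a (- n)%Z) * wt n)).
  { apply (summable_ext (fun n => Rabs (a (- n)%Z * wt n))), summable_abs, summable_star.
    intros; rewrite Rabs_mult, (Rabs_pos_eq (wt i)); auto; left; apply wt_pos. }
  rewrite Rmult_plus_distr_r; rewrite <- E at 2.
  unfold nrm; rewrite <- !Sum_scal, <- Sum_plus; auto using summable_scal, W_abs_summable.
  apply Sum_le.
  - apply W_abs_summable.
  - apply summable_plus; auto using summable_scal, W_abs_summable.
  - intros n; rewrite co_toW by auto; specialize (H n); generalize (wt_pos n); nra.
Qed.

Definition cst (c : R) : W := toW (fun n => if Z.eq_dec n 0 then c else 0).
Definition single (k : Z) : W := toW (fun n => if Z.eq_dec n k then 1 else 0).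
Definition wadd (a b : W) : W := toW (fun n => a n + b n).
Definition wopp (a : W) : W := toW (fun n => - a n).
Definition wmul (a b : W) : W := toW (cv a b).
Definition star (a : W) : W := toW (fun n => a (- n)%Z).

Notation "a + b" := (wadd a b) : W_scope.
Notation "- a" := (wopp a) : W_scope.
Notation "a - b" := (wadd a (wopp b)) : W_scope.
Notation "a * b" := (wmul a b) : W_scope.
Definition wzero : W := cst 0.
Definition wone : W := cst 1.
Notation "0" := wzero : W_scope.
Notation "1" := wone : W_scope.

Lemma single_summable k c : summable (fun n => (if Z.eq_dec n k then c else 0) * wt n).
Proof. apply (summable_single _ k); intros i Hi; destruct Z.eq_dec; [easy|ring]. Qed.

Lemma co_cst c n : cst c n = if Z.eq_dec n 0 then c else 0.
Proof. apply (co_toW (fun n => if Z.eq_dec n 0 then c else 0)), single_summable. Qed.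

Lemma co_single k n : single k n = if Z.eq_dec n k then 1 else 0.
Proof. apply (co_toW (fun n => if Z.eq_dec n k then 1 else 0)), single_summable. Qed.

Lemma co_add a b n : (a + b)%W n = a n + b n.
Proof.
  apply (co_toW (fun n => a n + b n)).
  apply (summable_ext (fun n => a n * wt n + b n * wt n)); [intros; ring|].
  apply summable_plus; apply co_summable.
Qed.

Lemma co_opp a n : (- a)%W n = - a n.
Proof.
  apply (co_toW (fun n => - a n)), (op_summable a _ 1 0); intros; rewrite Rabs_Ropp; lra.
Qed.

Lemma co_star a n : star a n = a (- n)%Z.
Proof. apply (co_toW (fun n => a (- n)%Z)), summable_star. Qed.

Lemma cv_wt_bound (a b : W) n :
  Rabs (cv a b n) * wt n <= cv (fun k => Rabs (a k) * wt k) (fun k => Rabs (b k) * wt k) n.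
Proof.
  unfold cv.
  assert (H := sm_term _ _ 0 n (W_sm0 a) (W_sm0 b)).
  apply Rle_trans with (Sum (fun k => Rabs (a k * b (n - k)%Z)) * wt n).
  - apply Rmult_le_compat_r; [left; apply wt_pos|now apply Sum_abs].
  - rewrite Rmult_comm, <- Sum_scal by now apply summable_abs.
    apply Sum_le.
    + now apply summable_scal, summable_abs.
    + apply (summable_cv_term (fun k => Rabs (a k) * wt k) (fun k => Rabs (b k) * wt k)); apply W_abs_summable.
    + intros k; rewrite Rabs_mult.
      assert (wt n <= wt k * wt (n - k)) by (replace n with (k + (n - k))%Z at 1 by ring; apply wt_plus).
      apply Rle_trans with ((wt k * wt (n - k)) * (Rabs (a k) * Rabs (b (n - k)%Z))); [|right; ring].
      apply Rmult_le_compat_r; auto; apply Rmult_le_pos; apply Rabs_pos.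
Qed.

Lemma mul_summable (a b : W) : summable (fun n => cv a b n * wt n).
Proof.
  apply (summable_le _ (cv (fun k => Rabs (a k) * wt k) (fun k => Rabs (b k) * wt k))).
  - intros n; rewrite Rabs_mult, (Rabs_pos_eq (wt n)) by (left; apply wt_pos); apply cv_wt_bound.
  - apply summable_cv; apply W_abs_summable.
Qed.

Lemma co_mul a b n : (a * b)%W n = cv a b n.
Proof. apply co_toW, mul_summable. Qed.

Lemma nrm_mul a b : nrm (a * b) <= nrm a * nrm b.
Proof.
  unfold nrm at 2 3; rewrite <- Sum_cv; try apply W_abs_summable.
  apply Sum_le; [apply W_abs_summable|apply summable_cv; apply W_abs_summable|].
  intros n; rewrite co_mul; apply cv_wt_bound.
Qed.

Lemma nrm_add a b : nrm (a + b) <= nrm a + nrm b.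
Proof.
  unfold nrm; rewrite <- Sum_plus; try apply W_abs_summable.
  apply Sum_le; [apply W_abs_summable|apply summable_plus; apply W_abs_summable|].
  intros n; rewrite co_add; generalize (Rabs_triang (a n) (b n)) (wt_pos n); nra.
Qed.

Lemma nrm_ext (a b : W) : (forall n, Rabs (a n) = Rabs (b n)) -> nrm a = nrm b.
Proof. intros H; apply Sum_ext; intros n; now rewrite H. Qed.

Lemma nrm_opp a : nrm (- a) = nrm a.
Proof. apply nrm_ext; intros; rewrite co_opp; apply Rabs_Ropp. Qed.

Lemma nrm_star a : nrm (star a) = nrm a.
Proof.
  unfold nrm; rewrite <- (Sum_reindex Z.opp Z.opp (fun n => Rabs (a n) * wt n));
    try apply W_abs_summable; try (intros; lia).
  apply Sum_ext; intros; now rewrite wt_opp, co_star.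
Qed.

Lemma nrm_cst c : nrm (cst c) = Rabs c.
Proof.
  unfold nrm; erewrite Sum_unique; [|apply (Sum_single _ 0%Z)].
  - rewrite co_cst, wt_0; simpl; ring.
  - intros i Hi; rewrite co_cst; destruct Z.eq_dec; [easy|rewrite Rabs_R0; ring].
Qed.

Lemma nrm_zero_eq a : nrm a = 0 -> a = cst 0.
Proof.
  intros H; apply W_eq; intros n; rewrite co_cst.
  generalize (nrm_co' a n); rewrite H; intros Hn.
  assert (a n = 0) as ->; [|destruct Z.eq_dec; auto].
  apply NNPP; intros K; apply Rabs_pos_lt in K; lra.
Qed.

(** ** Evaluation on the circle and the ring structure *)

Definition evw (a : W) (x : R) : C := ev a (x, 0).

Lemma evw_add a b x : evw (a + b) x = Cplus (evw a x) (evw b x).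
Proof.
  unfold evw; rewrite <- ev_plus; try apply W_sm0.
  f_equal; apply functional_extensionality; intros; apply co_add.
Qed.

Lemma evw_opp a x : evw (- a) x = Copp (evw a x).
Proof.
  unfold evw; replace (co (- a)%W) with (fun n => -1 * a n).
  - rewrite ev_scal by apply W_sm0; ring.
  - apply functional_extensionality; intros; rewrite co_opp; ring.
Qed.

Lemma evw_mul a b x : evw (a * b) x = Cmult (evw a x) (evw b x).
Proof.
  unfold evw; rewrite <- ev_cv; try apply W_sm0.
  f_equal; apply functional_extensionality; intros; apply co_mul.
Qed.

Lemma evw_cst c x : evw (cst c) x = RtoC c.
Proof.
  unfold evw; rewrite (ev_single _ _ 0).
  - rewrite co_cst; unfold eC, eS, RtoC; simpl; rewrite !Rmult_0_l, exp_0, cos_0, sin_0; f_equal; ring.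
  - intros n Hn; rewrite co_cst; destruct Z.eq_dec; easy.
Qed.

Lemma evw_star a x : evw (star a) x = Cconj (evw a x).
Proof.
  unfold evw, ev, Cconj; simpl; f_equal.
  - rewrite <- (Sum_reindex Z.opp Z.opp (fun n => a n * eC n (x, 0))); try (intros; lia).
    + apply Sum_ext; intros n; rewrite co_star; unfold eC; simpl.
      rewrite opp_IZR, !Rmult_0_r, Ropp_mult_distr_l_reverse, cos_neg; auto.
    + apply sm_C, W_sm0.
  - rewrite <- (Sum_reindex Z.opp Z.opp (fun n => a n * eS n (x, 0))); try (intros; lia).
    + rewrite <- (Rmult_1_l (Sum (fun i => a (- i)%Z * _))).
      replace 1 with (- -1) by ring; rewrite Ropp_mult_distr_l_reverse, <- Sum_scal.
      * rewrite Ropp_involutive; f_equal; apply Sum_ext; intros n; rewrite co_star; unfold eS; simpl.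
        rewrite opp_IZR, !Rmult_0_r, Ropp_mult_distr_l_reverse, sin_neg; ring.
      * apply (summable_inj Z.opp (fun n => a n * eS n (x, 0))); [lia|apply sm_S, W_sm0].
    + apply sm_S, W_sm0.
Qed.

Lemma W_ext a b : (forall x, evw a x = evw b x) -> a = b.
Proof.
  intros H; apply W_eq; intros n.
  assert ((a - b)%W n = 0); [|rewrite co_add, co_opp in H0; lra].
  apply fourier_zero; [apply W_summable|].
  intros x; change (evw (a - b) x = RtoC 0); rewrite evw_add, evw_opp, H; ring.
Qed.

(** Evaluation on the circle is injective by uniqueness of Fourier coefficients, so the axioms are
    inherited pointwise from the complex numbers. *)
Lemma W_ring : ring_theory (cst 0) (cst 1) wadd wmul (fun a b => (a - b)%W) wopp eq.
Proof.
  constructor; intros; try reflexivity; apply W_ext; intros;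
    rewrite ?evw_add, ?evw_mul, ?evw_opp, ?evw_add, ?evw_mul, ?evw_opp, ?evw_cst; ring.
Qed.

Add Ring W_ring_inst : W_ring.

Lemma cst_plus c d : cst (c + d) = (cst c + cst d)%W.
Proof. apply W_eq; intros; rewrite co_add, !co_cst; destruct Z.eq_dec; ring. Qed.

Lemma cst_opp c : cst (- c) = (- cst c)%W.
Proof. apply W_eq; intros; rewrite co_opp, !co_cst; destruct Z.eq_dec; ring. Qed.

Lemma cst_mult c d : cst (c * d) = (cst c * cst d)%W.
Proof. apply W_ext; intros; rewrite evw_mul, !evw_cst; apply RtoC_mult. Qed.

Lemma star_add a b : star (a + b) = (star a + star b)%W.
Proof. apply W_eq; intros; rewrite co_add, !co_star, co_add; auto. Qed.

Lemma star_opp a : star (- a) = (- star a)%W.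
Proof. apply W_eq; intros; rewrite co_opp, !co_star, co_opp; auto. Qed.

Lemma star_mul a b : star (a * b) = (star a * star b)%W.
Proof. apply W_ext; intros; rewrite evw_star, !evw_mul, !evw_star; apply Cmult_conj. Qed.

Lemma star_star a : star (star a) = a.
Proof. apply W_eq; intros; rewrite !co_star; f_equal; lia. Qed.

Lemma star_cst c : star (cst c) = cst c.
Proof. apply W_eq; intros; rewrite co_star, !co_cst; repeat destruct Z.eq_dec; lia || auto. Qed.

Lemma co_cst_mul c a n : (cst c * a)%W n = c * a n.
Proof.
  rewrite co_mul; unfold cv; erewrite Sum_unique; [|apply (Sum_single _ 0%Z)].
  - rewrite co_cst; simpl; do 2 f_equal; lia.
  - intros i Hi; rewrite co_cst; destruct Z.eq_dec; [easy|ring].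
Qed.

Lemma co_single_mul k a n : (single k * a)%W n = a (n - k)%Z.
Proof.
  rewrite co_mul; unfold cv; erewrite Sum_unique; [|apply (Sum_single _ k)].
  - rewrite co_single; destruct Z.eq_dec; [ring|easy].
  - intros i Hi; rewrite co_single; destruct Z.eq_dec; [easy|ring].
Qed.

(** ** Completeness and fixed points *)

Lemma nrm_le_of_lsum (a : W) M :
  (forall l, NoDup l -> lsum (fun n => Rabs (a n) * wt n) l <= M) -> nrm a <= M.
Proof.
  intros H; apply Rnot_lt_le; intros Hn.
  destruct (summable_is_sum _ (W_abs_summable a) (nrm a - M)) as [l0 H0]; [lra|].
  specialize (H0 (nodup dec_eq l0) (NoDup_nodup _ _) (fun x Hx => proj2 (nodup_In _ _ _) Hx)).
  specialize (H (nodup dec_eq l0) (NoDup_nodup _ _)).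
  apply Rabs_def2 in H0; fold (nrm a) in H0; lra.
Qed.

Lemma nrm_sub_comm a b : nrm (a - b) = nrm (b - a).
Proof. rewrite <- nrm_opp; f_equal; ring. Qed.

Lemma nrm_sub_trans a b c : nrm (a - c) <= nrm (a - b) + nrm (b - c).
Proof. replace (a - c)%W with ((a - b) + (b - c))%W by ring; apply nrm_add. Qed.

Lemma pow_half_small e C : 0 < e -> exists N, forall k, (N <= k)%nat -> C * (/ 2) ^ k < e.
Proof.
  intros He.
  assert (HC : 0 < Rabs C + 1) by (generalize (Rabs_pos C); lra).
  destruct (pow_lt_1_zero (/ 2) ltac:(rewrite Rabs_pos_eq; lra) (e / (Rabs C + 1))) as [N HN].
  { apply Rdiv_lt_0_compat; lra. }
  exists N; intros k Hk; specialize (HN k Hk).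
  rewrite Rabs_pos_eq in HN by (apply pow_le; lra).
  apply Rmult_lt_compat_l with (1 := HC) in HN.
  replace ((Rabs C + 1) * (e / (Rabs C + 1))) with e in HN by (field; lra).
  assert (0 <= (/ 2) ^ k) by (apply pow_le; lra).
  generalize (Rle_abs C); nra.
Qed.

(** The limit is taken coefficientwise; bounds on finite partial sums of the norm pass to the limit
    and give both membership in the space and the rate. *)
Lemma W_complete (u : nat -> W) C : (forall k, nrm (u (S k) - u k) <= C * (/ 2) ^ k) ->
  exists w : W, forall k, nrm (w - u k) <= 2 * C * (/ 2) ^ k.
Proof.
  intros H.
  assert (HC : 0 <= C) by (generalize (H 0%nat) (nrm_pos (u 1%nat - u 0%nat)); simpl; lra).
  assert (H1 : forall k m, nrm (u (k + m)%nat - u k) <= 2 * C * ((/ 2) ^ k - (/ 2) ^ (k + m))).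
  { intros k m; induction m as [|m IH].
    - rewrite Nat.add_0_r, Rminus_diag, Rmult_0_r; right.
      replace (u k - u k)%W with (cst 0) by ring; rewrite nrm_cst; apply Rabs_R0.
    - rewrite Nat.add_succ_r.
      eapply Rle_trans; [apply (nrm_sub_trans _ (u (k + m)%nat))|].
      specialize (H (k + m)%nat); simpl; lra. }
  assert (H2 : forall k m, (k <= m)%nat -> nrm (u m - u k) <= 2 * C * (/ 2) ^ k).
  { intros k m Hkm; replace m with (k + (m - k))%nat by lia.
    eapply Rle_trans; [apply H1|].
    apply Rmult_le_compat_l; [lra|].
    generalize (pow_le (/ 2) (k + (m - k)) ltac:(lra)); lra. }
  assert (Hex : forall n : Z, exists l : R, forall e, 0 < e -> exists N, forall k, (N <= k)%nat -> Rabs (u k n - l) < e).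
  { intros n; destruct (Rcomplete.R_complete (fun k : nat => u k n)) as [l Hl].
    - intros e He; destruct (pow_half_small e (4 * C) He) as [N HN].
      exists N; intros p q Hp Hq; unfold Rdist.
      assert (K : forall j, (N <= j)%nat -> Rabs (u j n - u N n) <= 2 * C * (/ 2) ^ N).
      { intros j Hj; eapply Rle_trans; [|apply (H2 N j Hj)].
        generalize (nrm_co' (u j - u N) n); rewrite co_add, co_opp; easy. }
      specialize (HN N (le_n _)).
      generalize (K p Hp) (K q Hq); intros K1 K2.
      replace (u p n - u q n) with ((u p n - u N n) - (u q n - u N n)) by ring.
      eapply Rle_lt_trans; [apply Rabs_triang|rewrite Rabs_Ropp; lra].
    - exists l; intros e He; destruct (Hl e He) as [N HN]; exists N; intros; now apply HN. }
  set (w := fun n => epsilon (inhabits 0) (fun l : R => forall e, 0 < e -> exists N, forall k, (N <= k)%nat -> Rabs (u k n - l) < e)).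
  assert (Hw : forall n e, 0 < e -> exists N, forall k, (N <= k)%nat -> Rabs (u k n - w n) < e).
  { intros n; unfold w; apply epsilon_spec, Hex. }
  assert (H3 : forall k l, NoDup l -> lsum (fun n => Rabs (w n - u k n) * wt n) l <= 2 * C * (/ 2) ^ k).
  { intros k l Hl; apply le_epsilon; intros e He.
    assert (exists N, forall j, (N <= j)%nat -> lsum (fun n => Rabs (u j n - w n) * wt n) l <= e) as [N HN].
    { clear Hl; revert e He; induction l as [|n l IH]; simpl; intros e He.
      - exists 0%nat; intros; lra.
      - destruct (IH (e / 2)) as [N1 HN1]; [lra|].
        destruct (Hw n (e / 2 / wt n)) as [N2 HN2]; [apply Rdiv_lt_0_compat; [lra|apply wt_pos]|].
        exists (N1 + N2)%nat; intros j Hj.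
        specialize (HN1 j ltac:(lia)); specialize (HN2 j ltac:(lia)).
        apply Rmult_lt_compat_r with (1 := wt_pos n) in HN2.
        replace (e / 2 / wt n * wt n) with (e / 2) in HN2 by (field; apply Rgt_not_eq, wt_pos); lra. }
    specialize (HN (N + k)%nat ltac:(lia)).
    assert (K := nrm_lsum (u (N + k)%nat - u k) l Hl).
    specialize (H2 k (N + k)%nat ltac:(lia)).
    apply Rle_trans with (lsum (fun n => Rabs ((u (N + k)%nat - u k)%W n) * wt n + Rabs (u (N + k)%nat n - w n) * wt n) l).
    - apply lsum_le; intros n; rewrite co_add, co_opp, <- Rmult_plus_distr_r.
      apply Rmult_le_compat_r; [left; apply wt_pos|].
      replace (w n - u k n) with ((u (N + k)%nat n + - u k n) - (u (N + k)%nat n - w n)) by ring.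
      eapply Rle_trans; [apply Rabs_triang|rewrite Rabs_Ropp; lra].
    - rewrite lsum_plus; lra. }
  assert (Hs : summable (fun n => w n * wt n)).
  { apply (summable_ext (fun n => (w n - u 0%nat n) * wt n + u 0%nat n * wt n)); [intros; ring|].
    apply summable_plus; [|apply co_summable].
    exists (2 * C * (/ 2) ^ 0); intros l Hl.
    erewrite lsum_ext; [apply (H3 0%nat l Hl)|].
    intros n _; simpl; rewrite Rabs_mult, (Rabs_pos_eq (wt n)); auto; left; apply wt_pos. }
  exists (mkW w Hs); intros k; apply nrm_le_of_lsum; intros l Hl.
  erewrite lsum_ext; [apply (H3 k l Hl)|].
  intros n _; simpl; rewrite co_add, co_opp; reflexivity.
Qed.

(** The iterates of 0 move by at most twice the first step in total, so they never leave the ball on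
    which [T] contracts. *)
Lemma W_fixed_point (T : W -> W) rho :
  (forall a b, nrm a <= rho -> nrm b <= rho -> nrm (T a - T b) <= / 2 * nrm (a - b)) ->
  2 * nrm (T (cst 0)) <= rho ->
  exists w, nrm w <= 2 * nrm (T (cst 0)) /\ T w = w.
Proof.
  intros HT H0; set (D := nrm (T (cst 0))) in *.
  assert (HD : 0 <= D) by apply nrm_pos.
  set (u := fun k => Nat.iter k T (cst 0)).
  assert (Hu0 : nrm (cst 0) = 0) by (rewrite nrm_cst; apply Rabs_R0).
  assert (H : forall k, nrm (u k) <= 2 * D * (1 - (/ 2) ^ k) /\ nrm (u (S k)) <= 2 * D * (1 - (/ 2) ^ (S k)) /\
    nrm (u (S k) - u k) <= D * (/ 2) ^ k).
  { assert (Hb : forall k, 2 * D * (1 - (/ 2) ^ k) <= rho).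
    { intros k; generalize (pow_le (/ 2) k ltac:(lra)); nra. }
    induction k as [|k (I1 & I2 & I3)].
    - simpl; rewrite Hu0.
      replace (T (cst 0) - cst 0)%W with (T (cst 0)) by ring; fold D; lra.
    - assert (I4 : nrm (u (S (S k)) - u (S k)) <= D * (/ 2) ^ (S k)).
      { eapply Rle_trans; [apply (HT (u (S k)) (u k))|]; try (eapply Rle_trans; [eassumption|apply Hb]).
        simpl in *; lra. }
      split; [auto|split; [|auto]].
      replace (u (S (S k))) with ((u (S (S k)) - u (S k)) + u (S k))%W by ring.
      eapply Rle_trans; [apply nrm_add|]; simpl in *; lra. }
  destruct (W_complete u D (fun k => proj2 (proj2 (H k)))) as [w Hw].
  assert (Hnw : nrm w <= 2 * D).
  { apply le_epsilon; intros e He; destruct (pow_half_small e (2 * D) He) as [N HN].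
    specialize (HN N (le_n _)).
    replace w with ((w - u N) + u N)%W by ring.
    eapply Rle_trans; [apply nrm_add|].
    generalize (Hw N) (proj1 (H N)) (pow_le (/ 2) N ltac:(lra)); nra. }
  exists w; split; auto.
  assert (nrm (T w - w) <= 0) as Hz.
  { apply le_epsilon; intros e He; destruct (pow_half_small e (3 * D) He) as [N HN].
    specialize (HN N (le_n _)).
    eapply Rle_trans; [apply (nrm_sub_trans _ (u (S N)))|].
    assert (nrm (T w - u (S N)) <= / 2 * nrm (w - u N)).
    { apply (HT w (u N)); [lra|].
      generalize (proj1 (H N)) (pow_le (/ 2) N ltac:(lra)); nra. }
    generalize (Hw N) (Hw (S N)) (pow_le (/ 2) N ltac:(lra)); rewrite (nrm_sub_comm (u (S N))), <- tech_pow_Rmult; lra. }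
  assert (E : (T w - w)%W = cst 0).
  { apply nrm_zero_eq; generalize (nrm_pos (T w - w)); lra. }
  replace (T w) with ((T w - w) + w)%W by ring; rewrite E; ring.
Qed.

#[global] Opaque wadd wopp wmul star cst single.

(** * Operators on the algebra *)

(** Since [|t| = exp (Im w)], nonnegative powers of [t] are exactly the modes that stay bounded in
    infinite depth. *)
Definition analytic (a : W) : Prop := forall n, (n < 0)%Z -> a n = 0.
Definition coanalytic (a : W) : Prop := forall n, (0 < n)%Z -> a n = 0.
(** The derivation [t d/dt]. It is a relation because the operator is unbounded on [W]. *)
Definition theta (a a' : W) : Prop := forall n, a' n = IZR n * a n.

Lemma analytic_add a b : analytic a -> analytic b -> analytic (a + b).
Proof. intros Ha Hb n Hn; rewrite co_add, Ha, Hb by auto; ring. Qed.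

Lemma analytic_opp a : analytic a -> analytic (- a).
Proof. intros Ha n Hn; rewrite co_opp, Ha by auto; ring. Qed.

Lemma analytic_cst c : analytic (cst c).
Proof. intros n Hn; rewrite co_cst; destruct Z.eq_dec; lia || auto. Qed.

Lemma analytic_mul a b : analytic a -> analytic b -> analytic (a * b).
Proof.
  intros Ha Hb n Hn; rewrite co_mul; apply Sum_zero; intros k.
  destruct (Z_lt_dec k 0); [rewrite Ha by auto; ring|rewrite Hb by lia; ring].
Qed.

Lemma analytic_single k : (0 <= k)%Z -> analytic (single k).
Proof. intros Hk n Hn; rewrite co_single; destruct Z.eq_dec; lia || auto. Qed.

Lemma analytic_star a : analytic a -> coanalytic (star a).
Proof. intros Ha n Hn; rewrite co_star; apply Ha; lia. Qed.

Lemma coanalytic_star a : coanalytic a -> analytic (star a).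
Proof. intros Ha n Hn; rewrite co_star; apply Ha; lia. Qed.

Lemma coanalytic_add a b : coanalytic a -> coanalytic b -> coanalytic (a + b).
Proof. intros Ha Hb n Hn; rewrite co_add, Ha, Hb by auto; ring. Qed.

Lemma coanalytic_opp a : coanalytic a -> coanalytic (- a).
Proof. intros Ha n Hn; rewrite co_opp, Ha by auto; ring. Qed.

Lemma coanalytic_cst c : coanalytic (cst c).
Proof. intros n Hn; rewrite co_cst; destruct Z.eq_dec; lia || auto. Qed.

Lemma coanalytic_cst_mul c a : coanalytic a -> coanalytic (cst c * a).
Proof. intros Ha n Hn; rewrite co_cst_mul, Ha by auto; ring. Qed.

#[global] Hint Resolve analytic_add analytic_opp analytic_cst analytic_mul analytic_single analytic_star
  coanalytic_star coanalytic_add coanalytic_opp coanalytic_cst coanalytic_cst_mul : wan.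

Lemma theta_cst c : theta (cst c) (cst 0).
Proof. intros n; rewrite !co_cst; destruct Z.eq_dec; subst; simpl; ring. Qed.

Lemma theta_add a a' b b' : theta a a' -> theta b b' -> theta (a + b) (a' + b').
Proof. intros Ha Hb n; rewrite !co_add, Ha, Hb; ring. Qed.

Lemma theta_mul a a' b b' : theta a a' -> theta b b' -> theta (a * b) (a' * b + a * b').
Proof.
  intros Ha Hb n; rewrite co_add, !co_mul; unfold cv.
  assert (S1 : forall a b : W, summable (fun k => a k * b (n - k)%Z)) by (intros; apply (sm_term _ _ 0); apply W_sm0).
  rewrite <- Sum_plus, <- Sum_scal by apply S1.
  apply Sum_ext; intros k; rewrite Ha, Hb, minus_IZR; ring.
Qed.

Definition Pge (m : Z) (a : W) : W := toW (fun n => if Z_le_dec m n then a n else 0).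

Lemma Pge_bound m (a : W) n : Rabs (if Z_le_dec m n then a n else 0) <= 1 * Rabs (a n) + 0 * Rabs (a (- n)%Z).
Proof. destruct Z_le_dec; [lra|rewrite Rabs_R0; generalize (Rabs_pos (a n)); lra]. Qed.

Lemma co_Pge m a n : Pge m a n = if Z_le_dec m n then a n else 0.
Proof. apply (co_toW (fun n => if Z_le_dec m n then a n else 0)), (op_summable a _ 1 0), Pge_bound. Qed.

Lemma analytic_Pge m a : (0 <= m)%Z -> analytic (Pge m a).
Proof. intros Hm n Hn; rewrite co_Pge; destruct Z_le_dec; lia || auto. Qed.

Definition eps_pow (e : R) (n : Z) : R := e ^ Z.abs_nat n.

(** Schwarz reflection in the bottom: for [e = exp (- 2 d)] the coefficients of negative index are
    the ones that make the series real on [Im w = - d]. At [e = 0], infinite depth, an analytic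
    series is unchanged. *)
Definition Kop (e : R) (a : W) : W :=
  toW (fun n => if Z_le_dec 0 n then a n else eps_pow e n * a (- n)%Z).

(** Elevation, of mean zero, of the surface whose conformal map has derivative [Kop e a]:
    integration divides the n-th mode by [n], the reflected mode contributes the factor [1 - e^n],
    and the half comes from writing a cosine as two exponentials. *)
Definition Yop (e : R) (a : W) : W :=
  toW (fun n => if Z.eq_dec n 0 then 0 else a (Z.abs n) * ((1 - eps_pow e n) / (2 * IZR (Z.abs n)))).

Lemma eps_pow_bound e n : 0 <= e <= 1 -> 0 <= eps_pow e n <= 1.
Proof.
  intros He; unfold eps_pow; split; [apply pow_le; lra|].
  rewrite <- (pow1 (Z.abs_nat n)); apply pow_incr; lra.
Qed.

Lemma eps_pow_le e n : 0 <= e <= 1 -> n <> 0%Z -> eps_pow e n <= e.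
Proof.
  intros He Hn; unfold eps_pow; destruct (Z.abs_nat n) as [|k] eqn:E; [lia|].
  simpl; rewrite <- (Rmult_1_r e) at 3; apply Rmult_le_compat_l; [lra|].
  rewrite <- (pow1 k); apply pow_incr; lra.
Qed.

Lemma Kop_bound e (a : W) n : 0 <= e <= 1 ->
  Rabs (if Z_le_dec 0 n then a n else eps_pow e n * a (- n)%Z) <= 1 * Rabs (a n) + 1 * Rabs (a (- n)%Z).
Proof.
  intros He; destruct Z_le_dec; [generalize (Rabs_pos (a (-n)%Z)); lra|].
  destruct (eps_pow_bound e n He); rewrite Rabs_mult, (Rabs_pos_eq (eps_pow e n)) by auto.
  generalize (Rabs_pos (a n)) (Rabs_pos (a (-n)%Z)); nra.
Qed.

Lemma co_Kop e a n : 0 <= e <= 1 -> Kop e a n = if Z_le_dec 0 n then a n else eps_pow e n * a (- n)%Z.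
Proof. intros He; apply co_toW, (op_summable a _ 1 1); intros; now apply Kop_bound. Qed.

Lemma Rabs_abs (a : W) n : Rabs (a (Z.abs n)) <= Rabs (a n) + Rabs (a (- n)%Z).
Proof.
  generalize (Rabs_pos (a n)) (Rabs_pos (a (-n)%Z)).
  destruct (Z_le_dec 0 n); [rewrite Z.abs_eq by auto|rewrite Z.abs_neq by lia]; lra.
Qed.

Lemma IZR_abs_ge_1 n : n <> 0%Z -> 1 <= IZR (Z.abs n).
Proof. intros; apply (IZR_le 1); lia. Qed.

Lemma Yop_mult_bound e n : 0 <= e <= 1 -> n <> 0%Z -> Rabs ((1 - eps_pow e n) / (2 * IZR (Z.abs n))) <= / 2.
Proof.
  intros He Hn; destruct (eps_pow_bound e n He); generalize (IZR_abs_ge_1 n Hn); intros H1.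
  assert (0 < / (2 * IZR (Z.abs n)) <= / 2) by (split; [apply Rinv_0_lt_compat|apply Rinv_le_contravar]; lra).
  unfold Rdiv; rewrite Rabs_pos_eq by (apply Rmult_le_pos; lra); nra.
Qed.

Lemma Yop_bound e (a : W) n : 0 <= e <= 1 ->
  Rabs (if Z.eq_dec n 0 then 0 else a (Z.abs n) * ((1 - eps_pow e n) / (2 * IZR (Z.abs n))))
    <= / 2 * Rabs (a n) + / 2 * Rabs (a (- n)%Z).
Proof.
  intros He; destruct Z.eq_dec as [|Hn].
  - rewrite Rabs_R0; generalize (Rabs_pos (a n)) (Rabs_pos (a (-n)%Z)); lra.
  - rewrite Rabs_mult; generalize (Yop_mult_bound e n He Hn) (Rabs_abs a n) (Rabs_pos (a (Z.abs n))); nra.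
Qed.

Lemma co_Yop e a n : 0 <= e <= 1 -> Yop e a n =
  if Z.eq_dec n 0 then 0 else a (Z.abs n) * ((1 - eps_pow e n) / (2 * IZR (Z.abs n))).
Proof.
  intros He; apply (co_toW (fun n => if Z.eq_dec n 0 then 0 else _)), (op_summable a _ (/2) (/2)).
  intros; now apply Yop_bound.
Qed.

Lemma nrm_bound (a b : W) C D : (forall n, Rabs (b n) <= C * Rabs (a n) + D * Rabs (a (- n)%Z)) ->
  nrm b <= (C + D) * nrm a.
Proof.
  intros H; rewrite <- (op_nrm a _ C D H); right; apply nrm_ext; intros n.
  rewrite co_toW; auto; now apply (op_summable a _ C D).
Qed.

Lemma Kop_add e a b : 0 <= e <= 1 -> Kop e (a + b) = (Kop e a + Kop e b)%W.
Proof. intros He; apply W_eq; intros n; rewrite co_add, !co_Kop, !co_add by auto; destruct Z_le_dec; ring. Qed.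

Lemma Yop_add e a b : 0 <= e <= 1 -> Yop e (a + b) = (Yop e a + Yop e b)%W.
Proof. intros He; apply W_eq; intros n; rewrite co_add, !co_Yop, !co_add by auto; destruct Z.eq_dec; ring. Qed.

Lemma Kop_opp e a : 0 <= e <= 1 -> Kop e (- a) = (- Kop e a)%W.
Proof. intros He; apply W_eq; intros n; rewrite co_opp, !co_Kop, !co_opp by auto; destruct Z_le_dec; ring. Qed.

Lemma Yop_opp e a : 0 <= e <= 1 -> Yop e (- a) = (- Yop e a)%W.
Proof. intros He; apply W_eq; intros n; rewrite co_opp, !co_Yop, !co_opp by auto; destruct Z.eq_dec; ring. Qed.

Lemma nrm_Kop e a : 0 <= e <= 1 -> nrm (Kop e a) <= 2 * nrm a.
Proof.
  intros He; replace 2 with (1 + 1) by ring; apply nrm_bound; intros n; rewrite co_Kop by auto; now apply Kop_bound.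
Qed.

Lemma nrm_Yop e a : 0 <= e <= 1 -> nrm (Yop e a) <= nrm a.
Proof.
  intros He; rewrite <- (Rmult_1_l (nrm a)); replace 1 with (/2 + /2) by field.
  apply nrm_bound; intros n; rewrite co_Yop by auto; now apply Yop_bound.
Qed.

(** Depth enters only through [e^|n|] with [n] nonzero, each at most [e]; hence finite depth is a
    perturbation of infinite depth of size [e] in operator norm. *)
Lemma nrm_Kop_sub e a : 0 <= e <= 1 -> analytic a -> nrm (Kop e a - a) <= e * nrm a.
Proof.
  intros He Ha; replace (e * nrm a) with ((0 + e) * nrm a) by ring.
  apply nrm_bound; intros n; rewrite co_add, co_opp, co_Kop by auto.
  generalize (Rabs_pos (a n)) (Rabs_pos (a (-n)%Z)); intros P1 P2.
  destruct Z_le_dec as [|Hn].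
  - rewrite Rplus_opp_r, Rabs_R0; nra.
  - rewrite (Ha n) by lia; rewrite Ropp_0, Rplus_0_r, Rabs_mult.
    destruct (eps_pow_bound e n He); rewrite (Rabs_pos_eq (eps_pow e n)) by auto.
    generalize (eps_pow_le e n He ltac:(lia)); rewrite Rabs_R0; nra.
Qed.

Lemma nrm_Yop_sub e a : 0 <= e <= 1 -> nrm (Yop e a - Yop 0 a) <= e * nrm a.
Proof.
  intros He; replace (e * nrm a) with ((e * / 2 + e * / 2) * nrm a) by field.
  apply nrm_bound; intros n; rewrite co_add, co_opp, !co_Yop by lra.
  generalize (Rabs_pos (a n)) (Rabs_pos (a (-n)%Z)); intros P1 P2.
  destruct Z.eq_dec as [|Hn].
  - rewrite Ropp_0, Rplus_0_r, Rabs_R0; nra.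
  - generalize (IZR_abs_ge_1 n Hn) (eps_pow_le e n He Hn) (Rabs_abs a n) (eps_pow_bound e n He); intros H1 H2 H3 H4.
    assert (E0 : eps_pow 0 n = 0) by (generalize (eps_pow_le 0 n ltac:(lra) Hn) (eps_pow_bound 0 n ltac:(lra)); lra).
    rewrite E0; replace (_ + _) with (- (a (Z.abs n) * (eps_pow e n * / (2 * IZR (Z.abs n))))) by (field; lra).
    assert (0 < / (2 * IZR (Z.abs n)) <= / 2) by (split; [apply Rinv_0_lt_compat|apply Rinv_le_contravar]; lra).
    rewrite Rabs_Ropp, Rabs_mult, (Rabs_pos_eq (_ * _)) by (apply Rmult_le_pos; lra).
    assert (0 <= eps_pow e n * / (2 * IZR (Z.abs n)) <= e * / 2) by (split; [apply Rmult_le_pos|apply Rmult_le_compat]; lra).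
    generalize (Rabs_pos (a (Z.abs n))); nra.
Qed.

(** In infinite depth the elevation is the real part of a primitive. This replaces [Yop] by [g] and
    its conjugate in the linearized equation and makes it an ODE for [g]. *)
Lemma Yop_theta (c g : W) : analytic g -> (forall n, (0 < n)%Z -> c n = IZR n * g n) ->
  (cst 2 * Yop 0 c)%W = ((g - cst (g 0%Z)) + star (g - cst (g 0%Z)))%W.
Proof.
  intros Hg H; apply W_eq; intros n.
  rewrite co_cst_mul, co_Yop, !co_add, co_star, co_add, !co_opp, !co_cst by lra.
  destruct (Z.eq_dec n 0) as [->|Hn].
  - simpl; ring.
  - destruct (Z.eq_dec (- n) 0); [lia|].
    assert (E0 : eps_pow 0 n = 0) by (generalize (eps_pow_le 0 n ltac:(lra) Hn) (eps_pow_bound 0 n ltac:(lra)); lra).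
    generalize (IZR_abs_ge_1 n Hn); intros H1.
    rewrite E0, H by lia.
    destruct (Z_le_dec 0 n); [rewrite (Hg (- n)%Z) by lia; rewrite Z.abs_eq in * by auto
      |rewrite (Hg n) by lia; rewrite Z.abs_neq in * by lia]; field; lra.
Qed.

(** ** Bounded additive maps *)

(** Additivity carries [F] over to differences, and an existential bound suffices because the
    constants only enter the choice of small parameters. *)
Definition blin (F : W -> W) : Prop :=
  (forall a b, F (a + b)%W = (F a + F b)%W) /\ exists C, 0 <= C /\ forall a, nrm (F a) <= C * nrm a.
Definition flin (f : W -> R) : Prop :=
  (forall a b, f (a + b)%W = f a + f b) /\ exists C, 0 <= C /\ forall a, Rabs (f a) <= C * nrm a.

Lemma blin_id : blin (fun a => a).
Proof. split; auto; exists 1; split; [lra|intros; lra]. Qed.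

Lemma blin_comp F G : blin F -> blin G -> blin (fun a => F (G a)).
Proof.
  intros [F1 (C & HC & F2)] [G1 (D & HD & G2)]; split; [intros; now rewrite G1, F1|].
  exists (C * D); split; [nra|]; intros a.
  specialize (F2 (G a)); specialize (G2 a); nra.
Qed.

Lemma flin_comp f G : flin f -> blin G -> flin (fun a => f (G a)).
Proof.
  intros [F1 (C & HC & F2)] [G1 (D & HD & G2)]; split; [intros; now rewrite G1, F1|].
  exists (C * D); split; [nra|]; intros a.
  specialize (F2 (G a)); specialize (G2 a); nra.
Qed.

Lemma blin_add F G : blin F -> blin G -> blin (fun a => F a + G a)%W.
Proof.
  intros [F1 (C & HC & F2)] [G1 (D & HD & G2)]; split; [intros; rewrite G1, F1; ring|].
  exists (C + D); split; [lra|]; intros a.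
  specialize (F2 a); specialize (G2 a); generalize (nrm_add (F a) (G a)); lra.
Qed.

Lemma blin_opp F : blin F -> blin (fun a => - F a)%W.
Proof.
  intros [F1 (C & HC & F2)]; split; [intros; rewrite F1; ring|].
  exists C; split; auto; intros; now rewrite nrm_opp.
Qed.

Lemma blin_mul b F : blin F -> blin (fun a => b * F a)%W.
Proof.
  intros [F1 (C & HC & F2)]; split; [intros; rewrite F1; ring|].
  exists (nrm b * C); split; [apply Rmult_le_pos; auto; apply nrm_pos|]; intros a.
  specialize (F2 a); generalize (nrm_mul b (F a)) (nrm_pos b); nra.
Qed.

Lemma blin_cst f : flin f -> blin (fun a => cst (f a)).
Proof.
  intros [F1 (C & HC & F2)]; split; [intros; rewrite F1; apply cst_plus|].
  exists C; split; auto; intros; now rewrite nrm_cst.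
Qed.

Lemma blin_star : blin star.
Proof. split; [apply star_add|]; exists 1; split; [lra|]; intros; rewrite nrm_star; lra. Qed.

Lemma blin_Pge m : blin (Pge m).
Proof.
  split.
  - intros a b; apply W_eq; intros n; rewrite co_add, !co_Pge, co_add; destruct Z_le_dec; ring.
  - exists (1 + 0); split; [lra|]; intros a; apply nrm_bound; intros n; rewrite co_Pge; apply Pge_bound.
Qed.

Lemma flin_co n : flin (fun a : W => a n).
Proof.
  split; [intros; apply co_add|]; exists 1; split; [lra|]; intros; generalize (nrm_co' a n); lra.
Qed.

Lemma flin_add f g : flin f -> flin g -> flin (fun a => f a + g a).
Proof.
  intros [F1 (C & HC & F2)] [G1 (D & HD & G2)]; split; [intros; rewrite G1, F1; ring|].
  exists (C + D); split; [lra|]; intros a.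
  specialize (F2 a); specialize (G2 a); generalize (Rabs_triang (f a) (g a)); lra.
Qed.

Lemma flin_scal c f : flin f -> flin (fun a => c * f a).
Proof.
  intros [F1 (C & HC & F2)]; split; [intros; rewrite F1; ring|].
  exists (Rabs c * C); split; [apply Rmult_le_pos; auto; apply Rabs_pos|]; intros a.
  rewrite Rabs_mult; specialize (F2 a); generalize (Rabs_pos c); nra.
Qed.

Lemma blin_sub F a b : blin F -> F (a - b)%W = (F a - F b)%W.
Proof.
  intros [F1 _]; replace (F a) with (F ((a - b) + b)%W) by (f_equal; ring); rewrite (F1 (a - b)%W b); ring.
Qed.

(** ** Geometric series *)

(** The power series of [1 / (1 - x t)], which lies in the algebra for [|x| < 2 / 3]. *)
Definition geo (x : R) : W := toW (fun n => if Z_le_dec 0 n then x ^ Z.to_nat n else 0).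
Definition t : W := single 1.
Definition s : W := single (-1).

Lemma summable_nat_Z (f : Z -> R) M : (forall n, (n < 0)%Z -> f n = 0) ->
  (forall N, lsum (fun k => Rabs (f (Z.of_nat k))) (seq 0 N) <= M) -> summable f.
Proof.
  intros H0 HM; exists M; intros l Hl.
  set (g := fun n => Rabs (f n)).
  assert (Hg : forall n, 0 <= g n) by (intros; apply Rabs_pos).
  replace (lsum g l) with (lsum g (filter (fun n => (0 <=? n)%Z) l)).
  - assert (exists N, incl (filter (fun n => (0 <=? n)%Z) l) (map Z.of_nat (seq 0 N))) as [N HN].
    { clear Hl; induction l as [|a l [N HN]]; [exists 0%nat; easy|].
      exists (N + S (Z.to_nat a))%nat; simpl.
      assert (Hm : incl (map Z.of_nat (seq 0 N)) (map Z.of_nat (seq 0 (N + S (Z.to_nat a))))).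
      { apply incl_map; intros x Hx; apply in_seq in Hx; apply in_seq; lia. }
      destruct (0 <=? a)%Z eqn:E.
      - intros x [<-|Hx]; [|auto]; apply in_map_iff; exists (Z.to_nat a); split; [lia|apply in_seq; lia].
      - intros x Hx; auto. }
    apply Rle_trans with (lsum g (map Z.of_nat (seq 0 N))).
    + apply lsum_incl; auto; now apply NoDup_filter.
    + rewrite lsum_map; apply HM.
  - clear Hl; induction l as [|a l IH]; [easy|]; simpl.
    destruct (0 <=? a)%Z eqn:E; simpl; rewrite IH; [ring|].
    unfold g at 2; rewrite H0 by lia; rewrite Rabs_R0; ring.
Qed.

Lemma geo_lsum y m N : 0 <= y < 1 -> lsum (fun k => y ^ k) (seq m N) <= y ^ m / (1 - y).
Proof.
  intros Hy; revert m; induction N as [|N IH]; intros m; simpl.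
  - apply Rdiv_le_0_compat; [apply pow_le|]; lra.
  - specialize (IH (S m)); simpl in IH.
    replace (y ^ m / (1 - y)) with (y ^ m + y * y ^ m / (1 - y)) by (field; lra); lra.
Qed.

Lemma geo_summable x : Rabs x < 2 / 3 -> summable (fun n => (if Z_le_dec 0 n then x ^ Z.to_nat n else 0) * wt n).
Proof.
  intros Hx; apply (summable_nat_Z _ ((Rabs x * (3 / 2)) ^ 0 / (1 - Rabs x * (3 / 2)))).
  - intros n Hn; destruct Z_le_dec; [lia|ring].
  - intros N; rewrite (lsum_ext _ (fun k => (Rabs x * (3 / 2)) ^ k)).
    + apply geo_lsum; generalize (Rabs_pos x); lra.
    + intros k _; destruct Z_le_dec; [|lia].
      rewrite Nat2Z.id, wt_nat, Rabs_mult, <- RPow_abs, (Rabs_pos_eq (_ ^ _)) by (apply pow_le; lra).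
      now rewrite Rpow_mult_distr.
Qed.

Lemma co_geo x n : Rabs x < 2 / 3 -> geo x n = if Z_le_dec 0 n then x ^ Z.to_nat n else 0.
Proof. intros Hx; apply (co_toW (fun n => if Z_le_dec 0 n then x ^ Z.to_nat n else 0)), geo_summable, Hx. Qed.

Lemma analytic_geo x : Rabs x < 2 / 3 -> analytic (geo x).
Proof. intros Hx n Hn; rewrite co_geo by auto; destruct Z_le_dec; lia || auto. Qed.

Lemma geo_inv x : Rabs x < 2 / 3 -> ((cst 1 - cst x * t) * geo x)%W = cst 1.
Proof.
  intros Hx; replace ((cst 1 - cst x * t) * geo x)%W with (geo x - cst x * (t * geo x))%W by ring.
  apply W_eq; intros n; unfold t; rewrite co_add, co_opp, co_cst_mul, co_single_mul, !co_geo, co_cst by auto.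
  destruct (Z_le_dec 0 n), (Z_le_dec 0 (n - 1)), (Z.eq_dec n 0); try lia; subst; simpl; try ring.
  replace (Z.to_nat n) with (S (Z.to_nat (n - 1))) by lia; simpl; ring.
Qed.

Lemma ts_inv : (t * s)%W = cst 1.
Proof.
  apply W_eq; intros n; unfold t, s; rewrite co_single_mul, co_single, co_cst.
  repeat destruct Z.eq_dec; lia || auto.
Qed.

Lemma star_t : star t = s.
Proof. apply W_eq; intros n; unfold t, s; rewrite co_star, !co_single; repeat destruct Z.eq_dec; lia || auto. Qed.

Lemma star_s : star s = t.
Proof. rewrite <- star_t; apply star_star. Qed.

#[global] Opaque Pge Kop Yop geo.

(** * Crapper's wave *)

Definition zeta (x : R) : C := (cos x, - sin x).

Lemma Cmod_zeta x : Cmod (zeta x) = 1.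
Proof.
  unfold Cmod, zeta; simpl; transitivity (sqrt 1); [f_equal|apply sqrt_1].
  generalize (sin2_cos2 x); unfold Rsqr; simpl; lra.
Qed.

Lemma zeta_nz x : zeta x <> RtoC 0.
Proof. intros E; generalize (Cmod_zeta x); rewrite E, Cmod_0; lra. Qed.

Lemma zeta_shift_nz x (a : R) : Rabs a < 1 -> (zeta x - a)%C <> RtoC 0.
Proof.
  intros Ha E; assert (E' : zeta x = RtoC a) by (rewrite <- (Cplus_0_r (RtoC a)), <- E; ring).
  generalize (Cmod_zeta x); rewrite E', Cmod_R; lra.
Qed.

Lemma zeta_shift_nz' x (a : R) : Rabs a < 1 -> (1 - a * zeta x)%C <> RtoC 0.
Proof.
  intros Ha E; assert (E' : (a * zeta x)%C = RtoC 1) by (rewrite <- (Cplus_0_r (a * zeta x)%C), <- E; ring).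
  assert (Cmod (a * zeta x)%C = 1) by (rewrite E', Cmod_R; apply Rabs_R1).
  rewrite Cmod_mult, Cmod_zeta, Cmod_R in H; lra.
Qed.

Lemma evw_t x : evw t x = zeta x.
Proof.
  unfold evw; rewrite (ev_single _ _ 1).
  - unfold t; rewrite co_single; unfold eC, eS, zeta; simpl.
    rewrite Rmult_0_r, exp_0, !Rmult_1_l; reflexivity.
  - intros n Hn; unfold t; rewrite co_single; destruct Z.eq_dec; easy.
Qed.

Lemma evw_s x : evw s x = (/ zeta x)%C.
Proof.
  assert (E : (evw t x * evw s x)%C = RtoC 1) by now rewrite <- evw_mul, ts_inv, evw_cst.
  rewrite evw_t in E; generalize (zeta_nz x); intros Hz.
  transitivity (/ zeta x * (zeta x * evw s x))%C; [field; auto|rewrite E; ring].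
Qed.

Lemma evw_geo y x : Rabs y < 2 / 3 -> evw (geo y) x = (/ (1 - y * zeta x))%C.
Proof.
  intros Hy; assert (E := f_equal (fun a => evw a x) (geo_inv y Hy)); simpl in E.
  rewrite evw_mul, evw_add, evw_opp, evw_mul, !evw_cst, evw_t in E.
  assert (Hz := zeta_shift_nz' x y ltac:(lra)).
  transitivity (/ (1 - y * zeta x) * ((1 + - (y * zeta x)) * evw (geo y) x))%C; [field; auto|rewrite E; ring].
Qed.

Lemma evw_star_geo y x : Rabs y < 2 / 3 -> evw (star (geo y)) x = (zeta x / (zeta x - y))%C.
Proof.
  intros Hy; assert (E := f_equal star (geo_inv y Hy)).
  rewrite star_mul, star_add, star_opp, star_mul, !star_cst, star_t in E.
  apply (f_equal (fun a => evw a x)) in E.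
  rewrite evw_mul, evw_add, evw_opp, evw_mul, !evw_cst, evw_s in E.
  assert (Hz := zeta_shift_nz x y ltac:(lra)); assert (Hz' := zeta_nz x).
  transitivity (zeta x / (zeta x - y) * ((1 + - (y * / zeta x)) * evw (star (geo y)) x))%C; [field; auto|rewrite E; ring].
Qed.

(** As rational functions of [t]: [eA = 1 / (1 + A t)], [eB = 1 / (1 - A t)], [m0 = 1 / f0],
    [kp = 1 / (t + A)], [km = 1 / (t - A)]. *)
Definition eA (A : R) : W := geo (- A).
Definition eB (A : R) : W := geo A.
Definition f0 (A : R) : W := (cst 1 - cst A * t) * eA A.
Definition m0 (A : R) : W := (cst 1 + cst A * t) * eB A.
Definition kp (A : R) : W := s * star (eA A).
Definition km (A : R) : W := s * star (eB A).
Definition tau (A : R) : W := t + cst A.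
(** The value for which [V0] and Crapper's elevation have the same pole [- 2 A / (t + A)] inside the
    disc, so that their difference [u0] is analytic. *)
Definition qq (A : R) : R := (1 + A * A) / (1 - A * A).

Definition Z0 (A : R) : W := f0 A * f0 A.
Definition u0 (A : R) : W :=
  cst (qq A) * m0 A - cst (4 * (A * A) / (1 - A * A)) * eB A - cst 2 * (eA A - cst 1).
Definition V0 (A : R) : W := cst (qq A) * (star (f0 A) * m0 A).
Definition Q0 (A : R) : W := cst (qq A * qq A).

(** Derivatives of [Z0], [u0], [Q0] and [V0] with respect to [A]. *)
Definition Z1 (A : R) : W := - (cst 4 * (t * (cst 1 - cst A * t) * (eA A * eA A * eA A))).
Definition q1 (A : R) : R := 4 * A / ((1 - A * A) * (1 - A * A)).
Definition u1 (A : R) : W :=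
  cst (q1 A) * m0 A + cst (qq A) * (t * eB A + (cst 1 + cst A * t) * (t * (eB A * eB A)))
  - cst (8 * A / ((1 - A * A) * (1 - A * A))) * eB A
  - cst (4 * (A * A) / (1 - A * A)) * (t * (eB A * eB A)) + cst 2 * (t * (eA A * eA A)).
Definition Q1 (A : R) : W := cst (2 * qq A * q1 A).
Definition V1 (A : R) : W := u1 A - cst 2 * (t * (eA A * eA A) + star (t * (eA A * eA A))).

Lemma star_sub a b : star (a - b) = (star a - star b)%W.
Proof. now rewrite star_add, star_opp. Qed.

Lemma HA_abs A : 0 < A < 1 / 2 -> Rabs A < 2 / 3.
Proof. intros; rewrite Rabs_pos_eq; lra. Qed.

Lemma HA_abs' A : 0 < A < 1 / 2 -> Rabs (- A) < 2 / 3.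
Proof. intros; rewrite Rabs_Ropp; now apply HA_abs. Qed.

Lemma RtoC_nz r : r <> 0 -> RtoC r <> RtoC 0.
Proof. intros H E; now injection E. Qed.

Lemma RtoC_1mAA A : 0 < A < 1 / 2 -> (1 - A * A)%C <> RtoC 0.
Proof. intros H; rewrite <- RtoC_mult, <- RtoC_minus; apply RtoC_nz; nra. Qed.

Lemma RtoC_1pAA A : 0 < A < 1 / 2 -> (1 + A * A)%C <> RtoC 0.
Proof. intros H; rewrite <- RtoC_mult, <- RtoC_plus; apply RtoC_nz; nra. Qed.

Lemma R_1mAA A : 0 < A < 1 / 2 -> 1 - A * A <> 0.
Proof. nra. Qed.

Lemma R_1pAA A : 0 < A < 1 / 2 -> 1 + A * A <> 0.
Proof. nra. Qed.

Ltac pushstar := rewrite ?star_mul, ?star_sub, ?star_add, ?star_opp, ?star_mul, ?star_sub, ?star_add, ?star_opp,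
  ?star_mul, ?star_sub, ?star_add, ?star_opp, ?star_mul, ?star_sub, ?star_add, ?star_opp, ?star_star,
  ?star_cst, ?star_t, ?star_s.

Ltac pushC HA := repeat match goal with
  | |- context [RtoC (?a + ?b)] => rewrite (RtoC_plus a b)
  | |- context [RtoC (?a - ?b)] => rewrite (RtoC_minus a b)
  | |- context [RtoC (?a * ?b)] => rewrite (RtoC_mult a b)
  | |- context [RtoC (- ?a)] => rewrite (RtoC_opp a)
  | |- context [RtoC (?a / ?b)] => rewrite (RtoC_div a b) by
      (generalize (R_1mAA _ HA) (R_1pAA _ HA); intros; repeat apply Rmult_integral_contrapositive_currified; first [assumption|lra])
  end.

(** Proves identities between rational functions of [t] in the algebra: on the circle they become
    field identities in [zeta x] and [A], whose denominators vanish nowhere because the poles 0,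
    [A], [- A], [1 / A], [- 1 / A] are off the circle. *)
Ltac wfield HA x :=
  unfold V0, V1, Z0, Z1, u0, u1, Q0, Q1, f0, m0, kp, km, tau, eA, eB, wone, wzero; pushstar; apply W_ext; intros x;
  rewrite ?evw_add, ?evw_mul, ?evw_opp;
  repeat (rewrite ?evw_add, ?evw_mul, ?evw_opp);
  rewrite ?evw_cst, ?evw_t, ?evw_s, ?(evw_geo _ _ (HA_abs _ HA)), ?(evw_geo _ _ (HA_abs' _ HA)),
    ?(evw_star_geo _ _ (HA_abs _ HA)), ?(evw_star_geo _ _ (HA_abs' _ HA));
  unfold qq, q1; pushC HA;
  let A := match type of HA with 0 < ?A < _ => A end in
  assert (N1 := zeta_nz x);
  assert (N2 := zeta_shift_nz x A ltac:(generalize (HA_abs A HA); lra));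
  assert (N3 := zeta_shift_nz x (- A) ltac:(generalize (HA_abs' A HA); lra));
  assert (N4 := zeta_shift_nz' x A ltac:(generalize (HA_abs A HA); lra));
  assert (N5 := zeta_shift_nz' x (- A) ltac:(generalize (HA_abs' A HA); lra));
  assert (N6 := RtoC_1mAA A HA); assert (N7 := RtoC_1pAA A HA);
  assert (N8 := RtoC_nz A ltac:(lra));
  rewrite RtoC_opp in N3, N5;
  generalize dependent (zeta x); intros ze N1 N2 N3 N4 N5; try field;
  repeat split; auto;
  try (intros N9; first [apply N2|apply N3|apply N4|apply N5|apply N6|apply N7]; rewrite <- N9; ring).

Lemma base_identity A : 0 < A < 1 / 2 -> (Z0 A * (V0 A * V0 A))%W = (Q0 A * star (Z0 A))%W.
Proof. intros HA; wfield HA x. Qed.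

(** The derivative of [base_identity] with respect to [A]; it puts the tangent of Crapper's family
    into the kernel of the linearization. *)
Lemma tangent_identity A : 0 < A < 1 / 2 ->
  (cst 2 * (Z0 A * V0 A * V1 A) + V0 A * V0 A * Z1 A - Q0 A * star (Z1 A) - Q1 A * star (Z0 A))%W = cst 0.
Proof. intros HA; wfield HA x. Qed.

Lemma V0_u0 A : 0 < A < 1 / 2 ->
  V0 A = (u0 A + (cst 2 * (eA A - cst 1) + star (cst 2 * (eA A - cst 1))))%W.
Proof. intros HA; wfield HA x. Qed.

Lemma tau_kp A : 0 < A < 1 / 2 -> (tau A * kp A)%W = cst 1.
Proof. intros HA; wfield HA x. Qed.

Lemma kp_m0 A : 0 < A < 1 / 2 -> (kp A * m0 A)%W = (cst (/ qq A) * kp A + cst (2 * A / (1 + A * A)) * eB A)%W.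
Proof.
  intros HA; replace (/ qq A) with ((1 - A * A) / (1 + A * A)).
  - wfield HA x.
  - unfold qq; field; split; nra.
Qed.

Lemma analytic_t : analytic t.
Proof. apply analytic_single; lia. Qed.

Lemma analytic_eA A : 0 < A < 1 / 2 -> analytic (eA A).
Proof. intros HA; apply analytic_geo, HA_abs', HA. Qed.

Lemma analytic_eB A : 0 < A < 1 / 2 -> analytic (eB A).
Proof. intros HA; apply analytic_geo, HA_abs, HA. Qed.

#[global] Hint Resolve analytic_t analytic_eA analytic_eB : wan.

Lemma co_eA A n : 0 < A < 1 / 2 -> eA A n = if Z_le_dec 0 n then (- A) ^ Z.to_nat n else 0.
Proof. intros HA; apply co_geo, HA_abs', HA. Qed.

Lemma co_eA2 A k : 0 < A < 1 / 2 -> (eA A * eA A)%W (Z.of_nat k) = (INR k + 1) * (- A) ^ k.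
Proof.
  intros HA.
  assert (E : (eA A * eA A + cst A * (t * (eA A * eA A)))%W = eA A) by wfield HA x.
  assert (Hn : forall n, (eA A * eA A)%W n + A * (eA A * eA A)%W (n - 1)%Z = eA A n).
  { intros n; rewrite <- E at 5; rewrite co_add, co_cst_mul; unfold t; now rewrite co_single_mul. }
  assert (Ha : analytic (eA A * eA A)) by auto with wan.
  induction k as [|k IH].
  - specialize (Hn 0%Z); rewrite (Ha (0 - 1)%Z), co_eA in Hn by auto with zarith; simpl in *; lra.
  - specialize (Hn (Z.of_nat (S k))); rewrite co_eA in Hn by auto.
    destruct Z_le_dec; [|lia]; rewrite Nat2Z.id in Hn.
    replace (Z.of_nat (S k) - 1)%Z with (Z.of_nat k) in Hn by lia.
    rewrite IH in Hn; rewrite S_INR; simpl in *; lra.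
Qed.

Lemma theta_eA A : 0 < A < 1 / 2 -> theta (eA A) (- (cst A * (t * (eA A * eA A)))).
Proof.
  intros HA n; rewrite co_opp, co_cst_mul; unfold t; rewrite co_single_mul, co_eA by auto.
  assert (Ha : analytic (eA A * eA A)) by auto with wan.
  destruct (Z_le_dec 1 n) as [H1|H1].
  - destruct Z_le_dec; [|lia].
    replace (n - 1)%Z with (Z.of_nat (Z.to_nat (n - 1))) by lia; rewrite co_eA2 by auto.
    replace (Z.to_nat n) with (S (Z.to_nat (n - 1))) by lia.
    rewrite INR_IZR_INZ, Z2Nat.id, minus_IZR by lia; simpl; ring.
  - rewrite Ha by lia; destruct Z_le_dec; [replace n with 0%Z by lia; simpl; ring|ring].
Qed.

Lemma theta_t : theta t t.
Proof. intros n; unfold t; rewrite co_single; destruct Z.eq_dec; subst; simpl; ring. Qed.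

Lemma cst_cancel (c : R) a b : c <> 0 -> (cst c * a)%W = (cst c * b)%W -> a = b.
Proof.
  intros Hc E; assert (E' : (cst (/ c) * cst c)%W = cst 1).
  { rewrite <- cst_mult; f_equal; field; auto. }
  transitivity ((cst (/ c) * cst c) * a)%W; [rewrite E'; ring|].
  replace ((cst (/ c) * cst c) * a)%W with (cst (/ c) * (cst c * a))%W by ring; rewrite E.
  transitivity ((cst (/ c) * cst c) * b)%W; [ring|rewrite E'; ring].
Qed.

(** Partial fractions: [Z0 - 1] is [4 t d/dt] of [1 / (1 + A t)], so Crapper's map integrates to a
    rational function of [t] plus the identity. *)
Lemma Z0_alt A : 0 < A < 1 / 2 -> Z0 A = (cst 1 + cst 4 * - (cst A * (t * (eA A * eA A))))%W.
Proof. intros HA; wfield HA x. Qed.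

Lemma co_Z0 A n : 0 < A < 1 / 2 -> Z0 A n = (if Z.eq_dec n 0 then 1 else 0) + 4 * (IZR n * eA A n).
Proof. intros HA; rewrite Z0_alt, co_add, co_cst, co_cst_mul, (theta_eA A HA) by auto; auto. Qed.

Lemma Yop_Z0 A : 0 < A < 1 / 2 -> V0 A = (u0 A + Yop 0 (Z0 A))%W.
Proof.
  intros HA; rewrite V0_u0 by auto; f_equal; apply (cst_cancel 2); [lra|].
  rewrite (Yop_theta _ (cst 4 * (eA A - cst 1))).
  - assert (E : (cst 4 * (eA A - cst 1))%W 0%Z = 0).
    { rewrite co_cst_mul, co_add, co_opp, co_eA, co_cst by auto; simpl; ring. }
    rewrite E; replace 4 with (2 * 2) by ring; rewrite !star_mul, !star_sub, !star_mul, !star_sub, !star_cst, !cst_mult.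
    ring.
  - auto with wan.
  - intros n Hn; rewrite co_Z0, co_cst_mul, co_add, co_opp, co_cst by auto; destruct Z.eq_dec; [lia|ring].
Qed.

Lemma co_Z1 A n : 0 < A < 1 / 2 -> Z1 A n = -4 * (IZR n * (t * (eA A * eA A))%W n).
Proof.
  intros HA.
  assert (Ht := theta_mul _ _ _ _ theta_t (theta_mul _ _ _ _ (theta_eA A HA) (theta_eA A HA))).
  rewrite <- (Ht n), <- co_cst_mul; f_equal.
  replace (-4) with (- (4)) by ring; wfield HA x.
Qed.

Lemma Yop_Z1 A : 0 < A < 1 / 2 -> V1 A = (u1 A + Yop 0 (Z1 A))%W.
Proof.
  intros HA; unfold V1; f_equal; apply (cst_cancel 2); [lra|].
  set (g := (t * (eA A * eA A))%W).
  rewrite (Yop_theta _ (cst (-4) * g)).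
  - assert (E : (cst (-4) * g)%W 0%Z = 0).
    { unfold g, t; rewrite co_cst_mul, co_single_mul.
      assert (Ha : analytic (eA A * eA A)) by auto with wan; rewrite Ha by lia; ring. }
    rewrite E; replace (-4) with (- (2 * 2)) by ring; rewrite !star_sub, !star_mul, !star_cst, !cst_opp, !cst_mult; ring.
  - unfold g; auto with wan.
  - intros n _; rewrite co_Z1, co_cst_mul by auto; fold g; ring.
Qed.

(** ** A right inverse of the linearization at Crapper's wave *)

(** The differential of [Z V^2 - Q Z^*] at Crapper's wave for [G = e = 0], where [v + Yop 0 c] is
    the variation of [V]. *)
Definition Lin (A : R) (c v p : W) : W :=
  cst 2 * (Z0 A * V0 A * (v + Yop 0 c)) + V0 A * V0 A * c - Q0 A * star c - p * star (Z0 A).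

(** For analytic [a] this is the difference quotient [(a(t) - a(- A)) / (t + A)]. *)
Definition Dop (A : R) (a : W) : W := Pge 0 (kp A * a).
Definition evA (A : R) (a : W) : R := (kp A * a)%W (-1)%Z.

Lemma analytic_Dop A a : analytic (Dop A a).
Proof. apply analytic_Pge; lia. Qed.

#[global] Hint Resolve analytic_Dop : wan.

Lemma co_kp A n : 0 < A < 1 / 2 -> kp A n = if Z_le_dec n (-1) then (- A) ^ Z.to_nat (- n - 1) else 0.
Proof.
  intros HA; unfold kp, s; rewrite co_single_mul, co_star, co_eA by auto.
  destruct (Z_le_dec 0), (Z_le_dec n); try lia; auto; do 2 f_equal; lia.
Qed.

(** Division by [t + A]; [evA A a] is the value of [a] at [t = - A]. *)
Lemma kp_split A a : 0 < A < 1 / 2 -> analytic a -> (kp A * a)%W = (Dop A a + cst (evA A a) * kp A)%W.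
Proof.
  intros HA Ha.
  assert (E : (t * (kp A * a) + cst A * (kp A * a))%W = a).
  { transitivity ((tau A * kp A) * a)%W; [unfold tau; ring|rewrite tau_kp by auto; ring]. }
  (* Since [a] has no negative powers, multiplication by [t + A] leaves a two-term recursion, and
     the negative part of [kp A * a] is geometric of ratio [- A], that is, a multiple of [kp A]. *)
  assert (Hn : forall n, (n < 0)%Z -> (kp A * a)%W (n - 1)%Z = - A * (kp A * a)%W n).
  { intros n Hn; assert (K := f_equal (fun b : W => b n) E); simpl in K.
    rewrite co_add, co_cst_mul in K; unfold t in K; rewrite co_single_mul, Ha in K by auto; lra. }
  assert (Hk : forall k, (kp A * a)%W (- 1 - Z.of_nat k)%Z = evA A a * (- A) ^ k).
  { induction k as [|k IH]; [unfold evA; simpl; ring|].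
    replace (- 1 - Z.of_nat (S k))%Z with (- 1 - Z.of_nat k - 1)%Z by lia.
    rewrite Hn, IH by lia; simpl; ring. }
  apply W_eq; intros n; rewrite co_add, co_cst_mul; unfold Dop; rewrite co_Pge, co_kp by auto.
  destruct (Z_le_dec 0 n), (Z_le_dec n (-1)); try lia; [ring|].
  replace n with (- 1 - Z.of_nat (Z.to_nat (- n - 1)))%Z at 1 by lia; rewrite Hk; ring.
Qed.

Lemma tau_split A a : 0 < A < 1 / 2 -> analytic a -> a = (tau A * Dop A a + cst (evA A a))%W.
Proof.
  intros HA Ha.
  transitivity (tau A * (kp A * a))%W.
  - transitivity ((tau A * kp A) * a)%W; [rewrite tau_kp by auto; ring|ring].
  - rewrite kp_split by auto.
    transitivity (tau A * Dop A a + cst (evA A a) * (tau A * kp A))%W; [ring|rewrite tau_kp by auto; ring].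
Qed.

(** The conjugate of [kp_split]: up to nonpositive powers, [t / (1 + A t)] times [a^*] is
    [a(- A) t / (1 + A t)]. It isolates the positive powers of such products. *)
Lemma te_star A a : 0 < A < 1 / 2 -> analytic a ->
  (t * eA A * star a)%W = (star (Dop A a) + cst (evA A a) * (t * eA A))%W.
Proof.
  intros HA Ha; assert (E := f_equal star (kp_split A a HA Ha)).
  assert (Ek : star (kp A) = (t * eA A)%W) by (unfold kp; now rewrite star_mul, star_s, star_star).
  now rewrite star_mul, star_add, star_mul, star_cst, Ek in E.
Qed.

Lemma evA_m0 A : 0 < A < 1 / 2 -> evA A (m0 A) = / qq A.
Proof.
  intros HA; unfold evA; rewrite kp_m0, co_add, !co_cst_mul, co_kp by auto.
  rewrite (analytic_eB A HA (-1)%Z) by lia; simpl; ring.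
Qed.

(** The inverse of [theta + 1 / q] on power series; [n + 1 / q] is positive for every [n >= 0]. *)
Definition diag (q : R) (h : W) : W := toW (fun n => if Z_le_dec 0 n then h n / (IZR n + / q) else 0).

Lemma diag_bound q (h : W) n : 0 < q ->
  Rabs (if Z_le_dec 0 n then h n / (IZR n + / q) else 0) <= q * Rabs (h n) + 0 * Rabs (h (- n)%Z).
Proof.
  intros Hq; generalize (Rabs_pos (h n)); intros P; assert (0 < / q) by now apply Rinv_0_lt_compat.
  destruct Z_le_dec as [Hn|]; [|rewrite Rabs_R0; nra].
  apply IZR_le in Hn; unfold Rdiv; rewrite Rabs_mult.
  assert (0 < / (IZR n + / q) <= q).
  { split; [apply Rinv_0_lt_compat; lra|].
    rewrite <- (Rinv_inv q) at 2; apply Rinv_le_contravar; lra. }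
  rewrite (Rabs_pos_eq (/ _)) by lra; nra.
Qed.

Lemma co_diag q (h : W) n : 0 < q -> diag q h n = if Z_le_dec 0 n then h n / (IZR n + / q) else 0.
Proof. intros Hq; apply co_toW, (op_summable h _ q 0); intros; now apply diag_bound. Qed.

Lemma blin_diag q : 0 < q -> blin (diag q).
Proof.
  intros Hq; split.
  - intros a b; apply W_eq; intros n; rewrite co_add, !co_diag, co_add by auto; destruct Z_le_dec as [Hn|]; [|ring].
    apply IZR_le in Hn; assert (0 < / q) by now apply Rinv_0_lt_compat.
    field; split; try lra; intros E; assert (0 < q * IZR n + 1) by nra; nra.
  - exists (q + 0); split; [lra|]; intros a; apply nrm_bound; intros n; rewrite co_diag by auto; now apply diag_bound.
Qed.

Lemma theta_diag q h : 0 < q -> analytic h -> theta (diag q h) (h - cst (/ q) * diag q h).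
Proof.
  intros Hq Hh n; rewrite co_add, co_opp, co_cst_mul, co_diag by auto.
  destruct Z_le_dec as [Hn|]; [|rewrite Hh by lia; ring].
  apply IZR_le in Hn; assert (0 < / q) by now apply Rinv_0_lt_compat.
  field; split; try lra; intros E; assert (0 < q * IZR n + 1) by nra; nra.
Qed.

Lemma analytic_diag q h : 0 < q -> analytic (diag q h).
Proof. intros Hq n Hn; rewrite co_diag by auto; destruct Z_le_dec; lia || auto. Qed.

Lemma qq_pos A : 0 < A < 1 / 2 -> 0 < qq A.
Proof. intros HA; apply Rdiv_lt_0_compat; nra. Qed.

Lemma qq_inv A : 0 < A < 1 / 2 -> / qq A = (1 - A * A) / (1 + A * A).
Proof. intros HA; unfold qq; field; split; nra. Qed.

(** With [rho = rho0 + rho1 tau + rho2 tau^2 + tau^3 d3], the analytic solution [g]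
    of [q tau (1 + A t) theta g = (t - A) (1 - A t) (g + rho + P t e) + c1 t (1 - A t)]
    is [e0 + tau^2 e^2 k], where the constants [P], [c1], [e0] make the equation
    for [k] divisible by [tau^3] and hence diagonal. *)
Definition sP (A r1 r2 : R) : R :=
  (1 - A * A) * (1 - A * A) * (1 - A * A) * (2 * A * r2 - r1) / (1 + A * A).
Definition sc1 (A r1 r2 : R) : R := 4 * A * (r1 + sP A r1 r2 / ((1 - A * A) * (1 - A * A))).
Definition se0 (A r0 r1 r2 : R) : R := - r0 + sP A r1 r2 * A / (1 - A * A) - sc1 A r1 r2 / 2.

Definition r0A A rho := evA A rho.
Definition r1A A rho := evA A (Dop A rho).
Definition r2A A rho := evA A (Dop A (Dop A rho)).

Definition hA (A : R) (rho : W) : W :=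
  cst (/ qq A) * ((cst 1 + cst A * t) * (t - cst A) * (cst 1 - cst A * t) * Dop A (Dop A (Dop A rho))
   + (cst 1 - cst A * t) * (cst (A * r1A A rho + (1 - 3 * (A * A)) * r2A A rho) + cst (A * r2A A rho) * tau A)).
Definition kA (A : R) (rho : W) : W := diag (qq A) (hA A rho).
(** [M t^(- 1 / q)] solves the homogeneous ODE, because [theta M / M = 2 t (1 - A^2) / ((t + A) (1 +
    A t))]. Variation of constants [g = e0 + M k] thus turns the ODE into [theta k + k / q = h],
    which [diag] inverts. *)
Definition MA (A : R) : W := tau A * tau A * (eA A * eA A).
Definition gA (A : R) (rho : W) : W :=
  cst (se0 A (r0A A rho) (r1A A rho) (r2A A rho)) + MA A * kA A rho.
Definition cA (A : R) (rho : W) : W :=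
  cst (2 * (1 - A * A)) * (t * tau A * (eA A * eA A * eA A)) * kA A rho
  + MA A * (hA A rho - cst (/ qq A) * kA A rho).

Lemma analytic_tau A : analytic (tau A).
Proof. unfold tau; auto with wan. Qed.
#[global] Hint Resolve analytic_tau : wan.

Lemma analytic_hA A rho : 0 < A < 1 / 2 -> analytic (hA A rho).
Proof. intros HA; unfold hA; auto 10 with wan. Qed.

Lemma analytic_kA A rho : 0 < A < 1 / 2 -> analytic (kA A rho).
Proof. intros HA; apply analytic_diag, qq_pos, HA. Qed.
#[global] Hint Resolve analytic_hA analytic_kA : wan.

Lemma analytic_gA A rho : 0 < A < 1 / 2 -> analytic (gA A rho).
Proof. intros HA; unfold gA, MA; auto 10 with wan. Qed.

Lemma analytic_cA A rho : 0 < A < 1 / 2 -> analytic (cA A rho).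
Proof. intros HA; unfold cA, MA; auto 15 with wan. Qed.
#[global] Hint Resolve analytic_gA analytic_cA : wan.

Lemma theta_gA A rho : 0 < A < 1 / 2 -> theta (gA A rho) (cA A rho).
Proof.
  intros HA; unfold gA.
  assert (Tt : theta (tau A) t).
  { unfold tau; replace t with (t + cst 0)%W at 2 by ring; apply theta_add; [apply theta_t|apply theta_cst]. }
  assert (TM := theta_mul _ _ _ _ (theta_mul _ _ _ _ Tt Tt) (theta_mul _ _ _ _ (theta_eA A HA) (theta_eA A HA))).
  assert (Tk : theta (kA A rho) (hA A rho - cst (/ qq A) * kA A rho)).
  { apply theta_diag; auto using qq_pos with wan. }
  assert (T := theta_add _ _ _ _ (theta_cst (se0 A (r0A A rho) (r1A A rho) (r2A A rho))) (theta_mul _ _ _ _ TM Tk)).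
  intros n; unfold MA; rewrite <- (T n); f_equal; unfold cA, MA.
  match goal with |- (?a * ?k + ?m)%W = (cst 0 + (?b * ?k + ?m))%W => assert (E : a = b); [|rewrite E; ring] end.
  clear - HA; wfield HA x.
Qed.

(** [q c / (f0 f0^* ) = g + rho + P t e + c1 t / (t - A)] *)
Lemma gA_equation A rho : 0 < A < 1 / 2 -> analytic rho ->
  (cst (qq A) * (cA A rho * m0 A * star (m0 A)))%W =
  (gA A rho + rho + cst (sP A (r1A A rho) (r2A A rho)) * (t * eA A)
    + cst (sc1 A (r1A A rho) (r2A A rho)) * (t * km A))%W.
Proof.
  intros HA Hr.
  assert (Er : rho = (tau A * (tau A * (tau A * Dop A (Dop A (Dop A rho)) + cst (r2A A rho)) + cst (r1A A rho))
      + cst (r0A A rho))%W).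
  { rewrite (tau_split A rho) at 1 by auto; rewrite (tau_split A (Dop A rho)) at 1 by auto with wan.
    rewrite (tau_split A (Dop A (Dop A rho))) at 1 by auto with wan; reflexivity. }
  rewrite Er at 3; unfold gA, cA; generalize (kA A rho); intros k.
  unfold hA, MA; generalize (Dop A (Dop A (Dop A rho))) (r0A A rho) (r1A A rho) (r2A A rho).
  clear Er Hr rho; intros d3 r0 r1 r2.
  unfold se0, sc1, sP; rewrite qq_inv by auto; wfield HA x.
Qed.

(** The equation [Lin A c v p = r] is divided by [2 Z0 V0 = 2 q f0 f0^*], which turns [r] into
    [RA A r]. That [v] be analytic says that [v^*] has no positive powers; hence only the positive
    part [rho] of [- 2 RA^*] drives the ODE. *)
Definition RA (A : R) (r : W) : W := cst (/ (2 * qq A)) * (m0 A * star (m0 A)) * r.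
Definition rhof (A : R) (r : W) : W := - (cst 2 * star (RA A r)).
Definition rho (A : R) (r : W) : W := Pge 1 (rhof A r).
Definition Sc (A : R) (r : W) : W := cA A (rho A r).
Definition Sg (A : R) (r : W) : W := gA A (rho A r) - cst (gA A (rho A r) 0%Z).
Definition Sh (A : R) (r : W) : W := Sc A r * (m0 A * m0 A * m0 A).
(** The variation of [q^2] for which the multiples of [t / (1 + A t)] in [v^*] cancel: one comes
    from the constant [sP] of the ODE, one from [f0 Sh^*] and one from [f0 m0^*]. *)
Definition pr (A : R) (r : W) : R :=
  (sP A (r1A A (rho A r)) (r2A A (rho A r)) + 2 * A * qq A * evA A (Sh A r)) * (qq A * qq A) / (2 * A).
Definition Sp (A : R) (r : W) : W := cst (pr A r).
Definition sv (A : R) (r : W) : W :=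
  cst (/ 2) * (- rhof A r - Sg A r - star (Sg A r) - cst (qq A) * (f0 A * star (Sh A r))
   + cst (qq A) * (Sc A r * m0 A * star (m0 A)) + cst (pr A r / qq A) * (f0 A * star (m0 A))).
Definition Sv (A : R) (r : W) : W := star (sv A r).

Lemma analytic_rho A r : analytic (rho A r).
Proof. apply analytic_Pge; lia. Qed.
#[global] Hint Resolve analytic_rho : wan.

Lemma analytic_Sc A r : 0 < A < 1 / 2 -> analytic (Sc A r).
Proof. intros; unfold Sc; auto with wan. Qed.

Lemma analytic_m0 A : 0 < A < 1 / 2 -> analytic (m0 A).
Proof. intros; unfold m0; auto with wan. Qed.
#[global] Hint Resolve analytic_m0 analytic_Sc : wan.

Lemma Sc_0 A r : 0 < A < 1 / 2 -> Sc A r 0%Z = 0.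
Proof. intros HA; unfold Sc; rewrite (theta_gA A _ HA); ring. Qed.

(** Once the ODE is inserted, positive powers survive only as multiples of [t / (1 + A t)],
    extracted by [te_star], and [pr] makes their sum zero. The term with [sc1] is [t / (t - A)], a
    series in nonpositive powers. *)
Lemma coanalytic_sv A r : 0 < A < 1 / 2 -> coanalytic (sv A r).
Proof.
  intros HA.
  assert (Hq := qq_pos A HA).
  assert (Hh : analytic (Sh A r)) by (unfold Sh; auto 10 with wan).
  set (P := sP A (r1A A (rho A r)) (r2A A (rho A r))).
  set (c1 := sc1 A (r1A A (rho A r)) (r2A A (rho A r))).
  set (p := pr A r); set (h := evA A (Sh A r)).
  assert (E : sv A r = (cst (/ 2) * ((rho A r - rhof A r) + cst (gA A (rho A r) 0%Z) + cst c1 * (t * km A)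
     - star (Sg A r) - cst (qq A) * star (Sh A r) + cst (2 * A * qq A) * star (Dop A (Sh A r))
     + cst (p / qq A) * star (m0 A) - cst (2 * A * p / qq A) * star (Dop A (m0 A))))%W).
  { unfold sv; f_equal.
    transitivity ((rho A r - rhof A r) + cst (gA A (rho A r) 0%Z) + cst c1 * (t * km A) - star (Sg A r)
      + cst P * (t * eA A) - cst (qq A) * (f0 A * star (Sh A r)) + cst (p / qq A) * (f0 A * star (m0 A)))%W.
    - unfold Sc; rewrite gA_equation by auto with wan; unfold Sg; fold P c1 p; ring.
    - assert (Ef : f0 A = (cst 1 - cst (2 * A) * (t * eA A))%W) by wfield HA x.
      assert (T1 : (f0 A * star (Sh A r))%W = (star (Sh A r) - cst (2 * A) * (star (Dop A (Sh A r)) + cst h * (t * eA A)))%W).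
      { unfold h; rewrite <- te_star by auto; rewrite Ef; ring. }
      assert (T2 : (f0 A * star (m0 A))%W = (star (m0 A) - cst (2 * A) * (star (Dop A (m0 A)) + cst (/ qq A) * (t * eA A)))%W).
      { rewrite <- evA_m0, <- te_star by auto with wan; rewrite Ef; ring. }
      rewrite T1, T2.
      assert (EP : cst P = (cst (2 * A * (p / qq A) * / qq A) - cst (2 * A * qq A * h))%W).
      { rewrite <- cst_opp, <- cst_plus; f_equal; unfold p, pr; fold P h; field; lra. }
      replace (2 * A * p / qq A) with ((p / qq A) * (2 * A)) by (field; lra).
      replace (2 * A * qq A) with (qq A * (2 * A)) in * by ring.
      replace (2 * A * (p / qq A) * / qq A) with ((p / qq A) * (2 * A) * / qq A) in EP by ring.
      rewrite EP, !cst_mult; ring. }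
  rewrite E; clear E.
  assert (K1 : coanalytic (rho A r - rhof A r)).
  { intros n Hn; rewrite co_add, co_opp; unfold rho; rewrite co_Pge; destruct Z_le_dec; [ring|lia]. }
  assert (K2 : coanalytic (t * km A)).
  { replace (t * km A)%W with (star (eB A)); [auto with wan|].
    unfold km; transitivity ((t * s) * star (eB A))%W; [rewrite ts_inv; ring|ring]. }
  assert (K3 : coanalytic (star (Sg A r))) by (unfold Sg; auto 10 with wan).
  repeat first [assumption | apply coanalytic_add | apply coanalytic_opp | apply coanalytic_cst_mul]; auto with wan.
Qed.

Lemma analytic_Sv A r : 0 < A < 1 / 2 -> analytic (Sv A r).
Proof. intros; apply coanalytic_star, coanalytic_sv; auto. Qed.

(** [Sv] is the equation solved for [v]. Substituted back, it leaves a rational identity in which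
    [c], [c^*] and [p] are independent symbols. *)
Lemma Lin_S A r : 0 < A < 1 / 2 -> Lin A (Sc A r) (Sv A r) (Sp A r) = r.
Proof.
  intros HA; assert (Hq := qq_pos A HA).
  assert (EY : (cst 2 * Yop 0 (Sc A r))%W = (Sg A r + star (Sg A r))%W).
  { apply Yop_theta; [auto with wan|]; intros n _; apply (theta_gA A (rho A r) HA n). }
  assert (EV : (cst 2 * (Sv A r + Yop 0 (Sc A r)))%W = (cst 2 * RA A r - cst (qq A) * (star (f0 A) * Sh A r)
     + cst (qq A) * (star (Sc A r) * star (m0 A) * m0 A) + cst (pr A r / qq A) * (star (f0 A) * m0 A))%W).
  { transitivity (cst 2 * Sv A r + cst 2 * Yop 0 (Sc A r))%W; [ring|rewrite EY].
    unfold Sv, sv; rewrite !star_mul, !star_add, !star_mul, !star_opp, !star_mul, !star_star, !star_cst.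
    unfold rhof; rewrite star_opp, star_mul, star_star, star_cst.
    transitivity ((cst 2 * cst (/ 2)) * (- (- (cst 2 * RA A r)) - star (Sg A r) - Sg A r
      - cst (qq A) * (star (f0 A) * Sh A r) + cst (qq A) * (star (Sc A r) * star (m0 A) * m0 A)
      + cst (pr A r / qq A) * (star (f0 A) * m0 A)) + (Sg A r + star (Sg A r)))%W; [ring|].
    rewrite <- cst_mult; replace (2 * / 2) with 1 by field; ring. }
  unfold Lin.
  transitivity (Z0 A * V0 A * (cst 2 * (Sv A r + Yop 0 (Sc A r))) + V0 A * V0 A * Sc A r
     - Q0 A * star (Sc A r) - Sp A r * star (Z0 A))%W; [ring|rewrite EV].
  unfold RA, Sh, Sp; generalize (Sc A r) (star (Sc A r)) (pr A r); intros c cs p; clear EV EY.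
  replace (/ (2 * qq A)) with ((1 - A * A) / (2 * (1 + A * A))) by (unfold qq; field; split; nra).
  replace (p / qq A) with (p * ((1 - A * A) / (1 + A * A))) by (unfold qq; field; split; nra).
  wfield HA x.
Qed.

Lemma blin_mul_r F b : blin F -> blin (fun a => F a * b)%W.
Proof.
  intros H; assert (K := blin_mul b F H).
  replace (fun a => (F a * b)%W) with (fun a => (b * F a)%W); auto.
  apply functional_extensionality; intros; ring.
Qed.

Lemma flin_opp f : flin f -> flin (fun a => - f a).
Proof.
  intros H; assert (K := flin_scal (-1) f H).
  replace (fun a => - f a) with (fun a => -1 * f a); auto.
  apply functional_extensionality; intros; ring.
Qed.

Lemma flin_scal_r f c : flin f -> flin (fun a => f a * c).
Proof.
  intros H; assert (K := flin_scal c f H).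
  replace (fun a => f a * c) with (fun a => c * f a); auto.
  apply functional_extensionality; intros; ring.
Qed.

Lemma flin_minus f g : flin f -> flin g -> flin (fun a => f a - g a).
Proof. intros Hf Hg; exact (flin_add f _ Hf (flin_opp g Hg)). Qed.

Ltac lin_tac := repeat match goal with
  | |- blin (fun a => a) => apply blin_id
  | |- blin (fun a => (@?F a + @?G a)%W) => apply (blin_add F G)
  | |- blin (fun a => (- @?F a)%W) => apply (blin_opp F)
  | |- blin (fun a => (?b * @?F a)%W) => apply (blin_mul b F)
  | |- blin (fun a => (@?F a * ?b)%W) => apply (blin_mul_r F b)
  | |- blin (fun a => star (@?F a)) => apply (blin_comp star F blin_star)
  | |- blin (fun a => Pge ?m (@?F a)) => apply (blin_comp (Pge m) F (blin_Pge m))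
  | |- blin (fun a => cst (@?f a)) => apply (blin_cst f)
  | |- flin (fun a => @?f a + @?g a) => apply (flin_add f g)
  | |- flin (fun a => @?f a - @?g a) => apply (flin_minus f g)
  | |- flin (fun a => - @?f a) => apply (flin_opp f)
  | |- flin (fun a => ?c * @?f a) => apply (flin_scal c f)
  | |- flin (fun a => @?f a * ?c) => apply (flin_scal_r f c)
  | |- flin (fun a => @?f a / ?c) => apply (flin_scal_r f (/ c))
  | |- flin (fun a => co (@?F a) ?n) => apply (flin_comp (fun b : W => b n) F (flin_co n))
  end.

Lemma blin_Dop A : blin (Dop A).
Proof. change (blin (fun a => Pge 0 (kp A * a))); lin_tac. Qed.

Lemma flin_evA A : flin (evA A).
Proof. change (flin (fun a => (kp A * a)%W (-1)%Z)); lin_tac. Qed.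

Lemma flin_r0A A : flin (r0A A). Proof. apply flin_evA. Qed.
Lemma flin_r1A A : flin (r1A A). Proof. apply (flin_comp (evA A) (Dop A)); [apply flin_evA|apply blin_Dop]. Qed.
Lemma flin_r2A A : flin (r2A A). Proof. apply (flin_comp (r1A A) (Dop A)); [apply flin_r1A|apply blin_Dop]. Qed.

Lemma flin_sP A : flin (fun a => sP A (r1A A a) (r2A A a)).
Proof. unfold sP; lin_tac; [apply flin_r2A|apply flin_r1A]. Qed.

Lemma flin_sc1 A : flin (fun a => sc1 A (r1A A a) (r2A A a)).
Proof. unfold sc1; lin_tac; [apply flin_r1A|apply flin_sP]. Qed.

Lemma flin_se0 A : flin (fun a => se0 A (r0A A a) (r1A A a) (r2A A a)).
Proof. unfold se0; lin_tac; [apply flin_r0A|apply flin_sP|apply flin_sc1]. Qed.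

Lemma blin_hA A : blin (hA A).
Proof.
  unfold hA; change (blin (fun rho => cst (/ qq A) * ((cst 1 + cst A * t) * (t - cst A) * (cst 1 - cst A * t) * Dop A (Dop A (Dop A rho))
   + (cst 1 - cst A * t) * (cst (A * r1A A rho + (1 - 3 * (A * A)) * r2A A rho) + cst (A * r2A A rho) * tau A)))%W).
  lin_tac; [|apply flin_r1A|apply flin_r2A|apply flin_r2A].
  apply (blin_comp (Dop A) (fun a => Dop A (Dop A a)) (blin_Dop A)), (blin_comp (Dop A) (Dop A)); apply blin_Dop.
Qed.

Lemma blin_kA A : 0 < A < 1 / 2 -> blin (kA A).
Proof. intros HA; apply (blin_comp (diag (qq A)) (hA A)); [apply blin_diag, qq_pos, HA|apply blin_hA]. Qed.

Lemma blin_gA A : 0 < A < 1 / 2 -> blin (gA A).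
Proof.
  intros HA; change (blin (fun rho => cst (se0 A (r0A A rho) (r1A A rho) (r2A A rho)) + MA A * kA A rho)%W).
  lin_tac; [apply flin_se0|now apply blin_kA].
Qed.

Lemma blin_cA A : 0 < A < 1 / 2 -> blin (cA A).
Proof.
  intros HA; change (blin (fun rho => cst (2 * (1 - A * A)) * (t * tau A * (eA A * eA A * eA A)) * kA A rho
  + MA A * (hA A rho - cst (/ qq A) * kA A rho))%W).
  lin_tac; try now apply blin_kA.
  apply blin_hA.
Qed.

Lemma blin_rhof A : blin (rhof A).
Proof. change (blin (fun r => - (cst 2 * star (cst (/ (2 * qq A)) * (m0 A * star (m0 A)) * r)))%W); lin_tac. Qed.

Lemma blin_rho A : blin (rho A).
Proof. apply (blin_comp (Pge 1) (rhof A)); [apply blin_Pge|apply blin_rhof]. Qed.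

Lemma blin_Sc A : 0 < A < 1 / 2 -> blin (Sc A).
Proof. intros HA; apply (blin_comp (cA A) (rho A)); [now apply blin_cA|apply blin_rho]. Qed.

Lemma blin_Sg A : 0 < A < 1 / 2 -> blin (Sg A).
Proof.
  intros HA; assert (K : blin (fun r => gA A (rho A r))) by (apply (blin_comp (gA A) (rho A)); [now apply blin_gA|apply blin_rho]).
  change (blin (fun r => gA A (rho A r) - cst (gA A (rho A r) 0%Z))%W); lin_tac; exact K.
Qed.

Lemma blin_Sh A : 0 < A < 1 / 2 -> blin (Sh A).
Proof. intros HA; change (blin (fun r => Sc A r * (m0 A * m0 A * m0 A))%W); lin_tac; now apply blin_Sc. Qed.

Lemma flin_pr A : 0 < A < 1 / 2 -> flin (pr A).
Proof.
  intros HA; unfold pr; lin_tac.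
  - apply (flin_comp (fun a => sP A (r1A A a) (r2A A a)) (rho A)); [apply flin_sP|apply blin_rho].
  - apply (flin_comp (evA A) (Sh A)); [apply flin_evA|now apply blin_Sh].
Qed.

Lemma blin_Sp A : 0 < A < 1 / 2 -> blin (Sp A).
Proof. intros HA; now apply (blin_cst (pr A)), flin_pr. Qed.

Lemma blin_Sv A : 0 < A < 1 / 2 -> blin (Sv A).
Proof.
  intros HA; apply (blin_comp star (sv A)); [apply blin_star|].
  unfold sv; lin_tac; try now apply blin_Sg.
  - apply blin_rhof.
  - now apply blin_Sh.
  - now apply blin_Sc.
  - now apply flin_pr.
Qed.

(** * Solving the equation near Crapper's wave *)

(** The trace of [V = u + y] on the surface at depth parameter [e]. *)
Definition Vop (e : R) (Z u : W) : W := Kop e u + Yop e Z.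
Definition Eqn (G e : R) (Z u Q : W) : W :=
  Kop e Z * (Vop e Z u * Vop e Z u) - (Q - cst (2 * G) * Yop e Z) * star (Kop e Z).

Lemma nmul a b x y : nrm a <= x -> nrm b <= y -> nrm (a * b) <= x * y.
Proof.
  intros Ha Hb; apply Rle_trans with (1 := nrm_mul a b).
  apply Rmult_le_compat; auto; apply nrm_pos.
Qed.

Lemma nadd a b x y : nrm a <= x -> nrm b <= y -> nrm (a + b) <= x + y.
Proof. intros; generalize (nrm_add a b); lra. Qed.

Lemma nopp a x : nrm a <= x -> nrm (- a) <= x.
Proof. now rewrite nrm_opp. Qed.

Lemma nstar a x : nrm a <= x -> nrm (star a) <= x.
Proof. now rewrite nrm_star. Qed.

Lemma ncst c : nrm (cst c) <= Rabs c.
Proof. rewrite nrm_cst; lra. Qed.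

Lemma nrm_close a b x y : nrm (a - b) <= x -> nrm b <= y -> nrm a <= x + y.
Proof. intros; replace a with ((a - b) + b)%W by ring; now apply nadd. Qed.

Definition near_base (A d : R) (Z u Q : W) : Prop :=
  analytic Z /\ analytic u /\ nrm (Z - Z0 A) <= d /\ nrm (u - u0 A) <= d /\ nrm (Q - Q0 A) <= d.

Ltac nb := repeat match goal with
  | H : nrm ?a <= _ |- nrm ?b <= _ => constr_eq a b; exact H
  | |- nrm (_ + _)%W <= _ => apply nadd
  | |- nrm (- _)%W <= _ => apply nopp
  | |- nrm (_ * _)%W <= _ => apply nmul
  | |- nrm (star _) <= _ => apply nstar
  | |- nrm (cst _) <= _ => apply ncst
  end.

Lemma analytic_Z0 A : 0 < A < 1 / 2 -> analytic (Z0 A).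
Proof. intros; unfold Z0, f0; auto 10 with wan. Qed.

Lemma analytic_u0 A : 0 < A < 1 / 2 -> analytic (u0 A).
Proof. intros; unfold u0; auto 10 with wan. Qed.

(** One radius [d] controls both the distance to Crapper's wave and [e], so that all deviations
    below are multiples of the same small number. *)
Lemma near_base_bounds A : 0 < A < 1 / 2 -> exists M, 1 <= M /\
  nrm (Z0 A) <= M /\ nrm (V0 A) <= 2 * M /\ nrm (Q0 A) <= M /\
  forall d e Z u Q, 0 <= d <= 1 -> 0 <= e <= d -> near_base A d Z u Q ->
    nrm Z <= 2 * M /\ nrm Q <= 2 * M /\ nrm (Kop e Z) <= 4 * M /\ nrm (Yop e Z) <= 2 * M /\ nrm (Vop e Z u) <= 7 * M /\
    nrm (Kop e Z - Z0 A) <= 3 * M * d /\ nrm (Vop e Z u - V0 A) <= 5 * M * d.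
Proof.
  intros HA.
  exists (1 + nrm (Z0 A) + nrm (u0 A) + nrm (Q0 A)).
  generalize (nrm_pos (Z0 A)) (nrm_pos (u0 A)) (nrm_pos (Q0 A)) (nrm_Yop 0 (Z0 A) ltac:(lra)); intros P1 P2 P3 P4.
  assert (HV := nrm_add (u0 A) (Yop 0 (Z0 A))); rewrite <- Yop_Z0 in HV by auto.
  do 4 (split; [lra|]).
  intros d e Z u Q Hd He (aZ & au & nZ & nu & nQ); set (M := 1 + nrm (Z0 A) + nrm (u0 A) + nrm (Q0 A)) in *.
  assert (He1 : 0 <= e <= 1) by lra.
  assert (HM : d * 1 <= M * d) by (unfold M; nra).
  assert (HM1 : e * nrm (Z0 A) <= d * nrm (Z0 A)) by nra.
  assert (HM2 : e * nrm (u0 A) <= d * nrm (u0 A)) by nra.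
  assert (K1 : d * nrm (Z0 A) + d * nrm (u0 A) + d <= M * d) by (unfold M; nra).
  assert (K1' : 0 <= d * nrm (Z0 A)) by nra.
  assert (K1'' : 0 <= d * nrm (u0 A)) by nra.
  assert (K2 : nrm Z <= 2 * M) by (generalize (nrm_close _ _ _ _ nZ (Rle_refl _)); unfold M; lra).
  assert (K3 : nrm Q <= 2 * M) by (generalize (nrm_close _ _ _ _ nQ (Rle_refl _)); unfold M; lra).
  assert (K4 : nrm (Kop e Z - Z0 A) <= 3 * M * d).
  { replace (Kop e Z - Z0 A)%W with (Kop e (Z - Z0 A) + (Kop e (Z0 A) - Z0 A))%W
      by (rewrite Kop_add, Kop_opp by auto; ring).
    eapply Rle_trans; [apply nrm_add|].
    generalize (nrm_Kop e (Z - Z0 A)%W He1) (nrm_Kop_sub e _ He1 (analytic_Z0 A HA)); lra. }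
  assert (K5 : nrm (Vop e Z u - V0 A) <= 5 * M * d).
  { rewrite (Yop_Z0 A HA).
    replace (Vop e Z u - (u0 A + Yop 0 (Z0 A)))%W with (Kop e (u - u0 A) + (Kop e (u0 A) - u0 A) + Yop e (Z - Z0 A)
      + (Yop e (Z0 A) - Yop 0 (Z0 A)))%W by (unfold Vop; rewrite Kop_add, Kop_opp, Yop_add, Yop_opp by auto; ring).
    eapply Rle_trans; [apply nrm_add|]; eapply Rle_trans; [apply Rplus_le_compat_r, nrm_add|].
    eapply Rle_trans; [apply Rplus_le_compat_r, Rplus_le_compat_r, nrm_add|].
    generalize (nrm_Kop e (u - u0 A)%W He1) (nrm_Kop_sub e _ He1 (analytic_u0 A HA))
      (nrm_Yop e (Z - Z0 A)%W He1) (nrm_Yop_sub e (Z0 A) He1); lra. }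
  assert (Hd' : M * d <= M) by (unfold M in *; nra).
  repeat split; auto.
  - generalize (nrm_Kop e Z He1); lra.
  - generalize (nrm_Yop e Z He1); lra.
  - generalize (nrm_close _ _ _ _ K5 (Rle_refl _)); unfold M in *; lra.
Qed.

(** A mean value estimate: near Crapper's wave the increments of [Eqn] are those of [Lin] up to a
    relative error of order [d], uniformly in [G] and [e]. This is what makes the contraction
    work. *)
Lemma Eqn_diff A : 0 < A < 1 / 2 -> exists M, 1 <= M /\
  forall d G e Z u Q Z' u' Q', 0 <= d <= 1 -> Rabs G <= d -> 0 <= e <= d ->
    near_base A d Z u Q -> near_base A d Z' u' Q' ->
    nrm (Eqn G e Z' u' Q' - Eqn G e Z u Q - Lin A (Z' - Z) (u' - u) (Q' - Q))
      <= M * d * (nrm (Z' - Z) + nrm (u' - u) + nrm (Q' - Q)).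
Proof.
  intros HA; destruct (near_base_bounds A HA) as (M & HM & BZ0 & BV0 & BQ0 & HB).
  exists (300 * M * M); split; [nra|].
  intros d G e Z u Q Z' u' Q' Hd HG He N N'.
  destruct (HB d e Z u Q Hd He N) as (b1 & b2 & b3 & b4 & b5 & b6 & b7).
  destruct (HB d e Z' u' Q' Hd He N') as (b1' & b2' & b3' & b4' & b5' & b6' & b7').
  assert (He1 : 0 <= e <= 1) by lra.
  destruct N as (aZ & au & _ & _ & nQ), N' as (aZ' & au' & _ & _ & nQ').
  set (c := (Z' - Z)%W); set (v := (u' - u)%W); set (p := (Q' - Q)%W).
  assert (ac : analytic c) by (unfold c; auto with wan).
  assert (av : analytic v) by (unfold v; auto with wan).
  assert (EC : Kop e Z' = (Kop e Z + Kop e c)%W) by (unfold c; rewrite Kop_add, Kop_opp by auto; ring).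
  assert (EY : Yop e Z' = (Yop e Z + Yop e c)%W) by (unfold c; rewrite Yop_add, Yop_opp by auto; ring).
  assert (EV : Vop e Z' u' = (Vop e Z u + (Kop e v + Yop e c))%W).
  { unfold Vop, c, v; rewrite Kop_add, Kop_opp, Yop_add, Yop_opp by auto; ring. }
  assert (c1 := nrm_Kop_sub e c He1 ac); assert (c2 := nrm_Kop e v He1); assert (c3 := nrm_Yop e c He1).
  assert (c4 := nrm_Kop_sub e v He1 av); assert (c5 := nrm_Yop_sub e c He1).
  generalize (nrm_pos c) (nrm_pos v) (nrm_pos p); intros p1 p2 p3.
  set (D := nrm c + nrm v + nrm p).
  assert (nc : nrm c <= D) by (unfold D; lra). assert (nv : nrm v <= D) by (unfold D; lra).
  assert (np : nrm p <= D) by (unfold D; lra). assert (HD : 0 <= D) by lra.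
  assert (d1 : nrm (Kop e c - c) <= d * D) by (eapply Rle_trans; [exact c1|apply Rmult_le_compat; lra]).
  assert (d2 : nrm (Kop e v + Yop e c) <= 2 * D).
  { eapply Rle_trans; [apply nrm_add|unfold D; lra]. }
  assert (d3 : nrm (Kop e v + Yop e c - v - Yop 0 c) <= d * D).
  { replace (Kop e v + Yop e c - v - Yop 0 c)%W with ((Kop e v - v) + (Yop e c - Yop 0 c))%W by ring.
    eapply Rle_trans; [apply nrm_add|].
    apply Rle_trans with (d * nrm v + d * nrm c); [nra|unfold D; nra]. }
  assert (d4 : nrm (cst (2 * G) * Yop e Z') <= 4 * M * d).
  { eapply Rle_trans; [apply nmul; [apply ncst|exact b4']|].
    rewrite Rabs_mult, (Rabs_pos_eq 2) by lra; generalize (Rabs_pos G); nra. }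
  assert (d5 : nrm (cst (2 * G) * Yop e c) <= 2 * d * D).
  { eapply Rle_trans; [apply nmul; [apply ncst|exact c3]|].
    rewrite Rabs_mult, (Rabs_pos_eq 2) by lra; apply Rmult_le_compat; try lra.
    apply Rmult_le_pos; [lra|apply Rabs_pos]. }
  assert (d6 : nrm (Q' - cst (2 * G) * Yop e Z') <= 6 * M).
  { eapply Rle_trans; [apply nadd; [exact b2'|apply nopp; exact d4]|]; nra. }
  assert (d7 : nrm (Q' - Q0 A - cst (2 * G) * Yop e Z') <= 5 * M * d).
  { eapply Rle_trans; [apply nadd; [exact nQ'|apply nopp; exact d4]|]; nra. }
  (* Each of the eight products contains one factor of order [d] and one factor bounded by the
     increment [D], or a single factor of order [d D]. *)
  assert (E : (Eqn G e Z' u' Q' - Eqn G e Z u Q - Lin A c v p)%W =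
    ((Kop e c - c) * (Vop e Z' u' * Vop e Z' u')
     + c * ((Vop e Z' u' - V0 A) * (Vop e Z' u' + V0 A))
     + ((Kop e Z - Z0 A) * (Vop e Z u + Vop e Z' u') + Z0 A * ((Vop e Z u - V0 A) + (Vop e Z' u' - V0 A)))
         * (Kop e v + Yop e c)
     + cst 2 * (Z0 A * V0 A * (Kop e v + Yop e c - v - Yop 0 c))
     - (Q' - cst (2 * G) * Yop e Z') * star (Kop e c - c)
     - (Q' - Q0 A - cst (2 * G) * Yop e Z') * star c
     + cst (2 * G) * Yop e c * star (Kop e Z)
     - p * star (Kop e Z - Z0 A))%W).
  { unfold Eqn, Lin; rewrite EC, EY, EV, !star_add, !star_opp.
    replace Q' with (p + Q)%W by (unfold p; ring).
    replace (cst 2) with (1 + 1)%W by (unfold wone; rewrite <- cst_plus; f_equal; ring).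
    unfold wone; ring. }
  rewrite E; clear E EC EY EV.
  assert (h2 : nrm (cst 2) <= 2) by (rewrite nrm_cst, Rabs_pos_eq; lra).
  eapply Rle_trans; [nb|].
  assert (Up : forall y, 0 <= y -> y <= y * M).
  { intros y Hy; rewrite <- (Rmult_1_r y) at 1; apply Rmult_le_compat_l; lra. }
  assert (U0 : 0 <= d * D) by (apply Rmult_le_pos; lra).
  assert (U1 := Up _ U0); assert (U2 := Up (d * D * M) ltac:(lra)).
  lra.
Qed.

Lemma Eqn_base A : 0 < A < 1 / 2 -> exists M, 1 <= M /\
  forall d G e, 0 <= d <= 1 -> Rabs G <= d -> 0 <= e <= d -> nrm (Eqn G e (Z0 A) (u0 A) (Q0 A)) <= M * d.
Proof.
  intros HA; destruct (near_base_bounds A HA) as (M & HM & BZ0 & BV0 & BQ0 & HB).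
  exists (500 * M * M * M); split; [assert (1 <= M * M) by nra; nra|].
  intros d G e Hd HG He.
  assert (He1 : 0 <= e <= 1) by lra.
  assert (N : near_base A d (Z0 A) (u0 A) (Q0 A)).
  { repeat split; auto using analytic_Z0, analytic_u0;
      match goal with |- nrm ?x <= _ => replace x with (cst 0) by ring end; rewrite nrm_cst, Rabs_R0; lra. }
  destruct (HB d e _ _ _ Hd He N) as (b1 & b2 & b3 & b4 & b5 & b6 & b7).
  assert (d4 : nrm (cst (2 * G) * Yop e (Z0 A)) <= 4 * M * d).
  { eapply Rle_trans; [apply nmul; [apply ncst|exact b4]|].
    rewrite Rabs_mult, (Rabs_pos_eq 2) by lra; generalize (Rabs_pos G); nra. }
  assert (B := base_identity A HA).
  assert (E : Eqn G e (Z0 A) (u0 A) (Q0 A) =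
    ((Kop e (Z0 A) - Z0 A) * (Vop e (Z0 A) (u0 A) * Vop e (Z0 A) (u0 A))
    + Z0 A * ((Vop e (Z0 A) (u0 A) - V0 A) * (Vop e (Z0 A) (u0 A) + V0 A))
    - Q0 A * star (Kop e (Z0 A) - Z0 A) + cst (2 * G) * Yop e (Z0 A) * star (Kop e (Z0 A))
    + (Z0 A * (V0 A * V0 A) - Q0 A * star (Z0 A)))%W) by (unfold Eqn; rewrite star_sub; ring).
  rewrite E, B.
  replace (Q0 A * star (Z0 A) - Q0 A * star (Z0 A))%W with (cst 0) by ring.
  assert (h0 : nrm (cst 0) <= 0) by (rewrite nrm_cst, Rabs_R0; lra).
  eapply Rle_trans; [nb|].
  assert (Up : forall y, 0 <= y -> y <= y * M).
  { intros y Hy; rewrite <- (Rmult_1_r y) at 1; apply Rmult_le_compat_l; lra. }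
  assert (U0 : 0 <= d * M) by (apply Rmult_le_pos; lra).
  assert (U1 := Up _ U0); assert (U2 := Up (d * M * M) ltac:(lra)).
  lra.
Qed.

Lemma analytic_Z1 A : 0 < A < 1 / 2 -> analytic (Z1 A).
Proof. intros; unfold Z1; auto 10 with wan. Qed.

Lemma analytic_u1 A : 0 < A < 1 / 2 -> analytic (u1 A).
Proof.
  intros; unfold u1; repeat first [apply analytic_add | apply analytic_opp]; auto 10 with wan.
Qed.

Lemma Lin_add A c v p c' v' p' :
  Lin A (c + c') (v + v') (p + p') = (Lin A c v p + Lin A c' v' p')%W.
Proof. unfold Lin; rewrite Yop_add, star_add by lra; ring. Qed.

Lemma Yop_cst_mul x a : Yop 0 (cst x * a) = (cst x * Yop 0 a)%W.
Proof.
  apply W_eq; intros n; rewrite co_cst_mul, !co_Yop, co_cst_mul by lra; destruct Z.eq_dec; ring.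
Qed.

Lemma Lin_tangent A x : 0 < A < 1 / 2 -> Lin A (cst x * Z1 A) (cst x * u1 A) (cst x * Q1 A) = cst 0.
Proof.
  intros HA.
  transitivity (cst x * Lin A (Z1 A) (u1 A) (Q1 A))%W.
  - unfold Lin; rewrite Yop_cst_mul, star_mul, star_cst; ring.
  - unfold Lin; rewrite <- Yop_Z1 by auto.
    transitivity (cst x * cst 0)%W; [|ring]; f_equal; now apply tangent_identity.
Qed.

(** [x] moves along Crapper's tangent, and the unknown [w] lives in the space of right-hand sides:
    since [Lin] composed with the right inverse is the identity, [Eqn] is close to the identity in
    [w] and [w - Eqn] contracts. *)
Definition Zf (A x : R) (w : W) : W := Z0 A + cst x * Z1 A + Sc A w.
Definition uf (A x : R) (w : W) : W := u0 A + cst x * u1 A + Sv A w.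
Definition Qf (A x : R) (w : W) : W := Q0 A + cst x * Q1 A + Sp A w.

Lemma Zf_def A x w : Zf A x w = (Z0 A + cst x * Z1 A + Sc A w)%W.
Proof. reflexivity. Qed.

Lemma uf_def A x w : uf A x w = (u0 A + cst x * u1 A + Sv A w)%W.
Proof. reflexivity. Qed.

Lemma Qf_def A x w : Qf A x w = (Q0 A + cst x * Q1 A + Sp A w)%W.
Proof. reflexivity. Qed.

Lemma Qf_cst A x w : exists q, Qf A x w = cst q.
Proof.
  exists (qq A * qq A + x * (2 * qq A * q1 A) + pr A w).
  now rewrite !cst_plus, (cst_mult x).
Qed.

Lemma Q0_cst A : Q0 A = cst (qq A * qq A).
Proof. reflexivity. Qed.

Lemma Z1_0 A : 0 < A < 1 / 2 -> Z1 A 0%Z = 0.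
Proof. intros HA; rewrite co_Z1 by auto; ring. Qed.

#[global] Opaque Lin.
#[global] Opaque Zf uf Qf Sc Sv Sp Z0 u0 Q0 V0 Z1 u1 Q1 Eqn.

Lemma Zf_sub A x y a b : 0 < A < 1 / 2 ->
  (Zf A x a - Zf A y b)%W = (cst (x - y) * Z1 A + Sc A (a - b))%W.
Proof.
  intros HA; rewrite !Zf_def, (blin_sub (Sc A)) by (now apply blin_Sc).
  unfold Rminus; rewrite cst_plus, cst_opp; ring.
Qed.

Lemma uf_sub A x y a b : 0 < A < 1 / 2 ->
  (uf A x a - uf A y b)%W = (cst (x - y) * u1 A + Sv A (a - b))%W.
Proof.
  intros HA; rewrite !uf_def, (blin_sub (Sv A)) by (now apply blin_Sv).
  unfold Rminus; rewrite cst_plus, cst_opp; ring.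
Qed.

Lemma Qf_sub A x y a b : 0 < A < 1 / 2 ->
  (Qf A x a - Qf A y b)%W = (cst (x - y) * Q1 A + Sp A (a - b))%W.
Proof.
  intros HA; rewrite !Qf_def, (blin_sub (Sp A)) by (now apply blin_Sp).
  unfold Rminus; rewrite cst_plus, cst_opp; ring.
Qed.

(** The correction to [Z] is quadratic in [x], so the explicit tangent term dominates it; this is
    what later decides signs. Lipschitz dependence on [x] is what keeps the intermediate value
    argument available. *)
Theorem wave_family A : 0 < A < 1 / 2 -> exists C s0, 1 <= C /\ 0 < s0 <= 1 /\
  forall G e, Rabs G <= s0 -> 0 <= e <= s0 -> exists w : R -> W,
    (forall x, Rabs x <= s0 ->
       Eqn G e (Zf A x (w x)) (uf A x (w x)) (Qf A x (w x)) = cst 0 /\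
       nrm (Sc A (w x)) <= C * (x * x + Rabs G + e) /\
       nrm (Qf A x (w x) - Q0 A) <= C * (Rabs x + Rabs G + e)) /\
    (forall x y, Rabs x <= s0 -> Rabs y <= s0 ->
       nrm (Zf A x (w x) - Zf A y (w y)) <= C * Rabs (x - y)).
Proof.
  intros HA.
  destruct (Eqn_diff A HA) as (M & HM & HD).
  destruct (Eqn_base A HA) as (N & HN & HB).
  destruct (blin_Sc A HA) as [addc (Cc & HCc & Hc)].
  destruct (blin_Sv A HA) as [addv (Cv & HCv & Hv)].
  destruct (blin_Sp A HA) as [addp (Cp & HCp & Hp)].
  set (S := 1 + Cc + Cv + Cp).
  set (T := 1 + nrm (Z1 A) + nrm (u1 A) + nrm (Q1 A)).
  assert (HS : 1 <= S) by (unfold S; lra).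
  assert (HT : 1 <= T) by (unfold T; generalize (nrm_pos (Z1 A)) (nrm_pos (u1 A)) (nrm_pos (Q1 A)); lra).
  (* Contraction holds once all perturbations are below [d0]. *)
  set (d0 := / (4 * M * S)).
  assert (Hd0 : 0 < d0 <= 1).
  { unfold d0; split; [apply Rinv_0_lt_compat; nra|rewrite <- Rinv_1; apply Rinv_le_contravar; nra]. }
  assert (Hd0' : M * d0 * S = / 4) by (unfold d0; field; split; lra).
  (* A correction [w] in this ball moves the base point by at most [d0 / 2]; the other half of [d0]
     is reserved for the tangent shift. *)
  set (rr := d0 / (2 * S)).
  assert (Hrr : 0 < rr) by (apply Rdiv_lt_0_compat; lra).
  assert (HrrS : S * rr = d0 / 2) by (unfold rr; field; lra).
  set (K := 2 * N + 2 * M * T).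
  assert (HK : 2 <= K) by (unfold K; nra).
  assert (near : forall x w, Rabs x * T <= d0 / 2 -> nrm w <= rr -> near_base A d0 (Zf A x w) (uf A x w) (Qf A x w)).
  { intros x w Hx Hw; assert (P := Rabs_pos x); assert (Pw := nrm_pos w).
    assert (Sw : S * nrm w <= d0 / 2) by (rewrite <- HrrS; apply Rmult_le_compat_l; lra).
    assert (Tx : forall y, nrm y <= T -> nrm (cst x * y) <= d0 / 2).
    { intros y Hy; eapply Rle_trans; [apply nmul; [apply ncst|exact Hy]|auto]. }
    unfold near_base; rewrite Zf_def, uf_def, Qf_def; repeat split.
    - apply analytic_add; [apply analytic_add; [now apply analytic_Z0|]|now apply analytic_Sc].
      apply analytic_mul; [apply analytic_cst|now apply analytic_Z1].
    - apply analytic_add; [apply analytic_add; [now apply analytic_u0|]|now apply analytic_Sv].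
      apply analytic_mul; [apply analytic_cst|now apply analytic_u1].
    - replace (Z0 A + cst x * Z1 A + Sc A w - Z0 A)%W with (cst x * Z1 A + Sc A w)%W by ring.
      replace d0 with (d0 / 2 + d0 / 2) by field; apply nadd.
      + apply Tx; unfold T; generalize (nrm_pos (u1 A)) (nrm_pos (Q1 A)); lra.
      + specialize (Hc w); unfold S in Sw; nra.
    - replace (u0 A + cst x * u1 A + Sv A w - u0 A)%W with (cst x * u1 A + Sv A w)%W by ring.
      replace d0 with (d0 / 2 + d0 / 2) by field; apply nadd.
      + apply Tx; unfold T; generalize (nrm_pos (Z1 A)) (nrm_pos (Q1 A)); lra.
      + specialize (Hv w); unfold S in Sw; nra.
    - replace (Q0 A + cst x * Q1 A + Sp A w - Q0 A)%W with (cst x * Q1 A + Sp A w)%W by ring.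
      replace d0 with (d0 / 2 + d0 / 2) by field; apply nadd.
      + apply Tx; unfold T; generalize (nrm_pos (Z1 A)) (nrm_pos (u1 A)); lra.
      + specialize (Hp w); unfold S in Sw; nra. }
  assert (diff : forall G e x y a b, Rabs G <= d0 -> 0 <= e <= d0 -> Rabs x * T <= d0 / 2 -> Rabs y * T <= d0 / 2 ->
    nrm a <= rr -> nrm b <= rr ->
    nrm (Eqn G e (Zf A x a) (uf A x a) (Qf A x a) - Eqn G e (Zf A y b) (uf A y b) (Qf A y b) - (a - b))
      <= M * d0 * (Rabs (x - y) * T + S * nrm (a - b))).
  { intros G e x y a b HG He Hx Hy Ha Hb.
    assert (H := HD d0 G e _ _ _ _ _ _ ltac:(lra) HG He (near y b Hy Hb) (near x a Hx Ha)).
    assert (EZ : (Zf A x a - Zf A y b)%W = (cst (x - y) * Z1 A + Sc A (a - b))%W).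
    { now apply Zf_sub. }
    assert (Eu : (uf A x a - uf A y b)%W = (cst (x - y) * u1 A + Sv A (a - b))%W).
    { now apply uf_sub. }
    assert (EQ : (Qf A x a - Qf A y b)%W = (cst (x - y) * Q1 A + Sp A (a - b))%W).
    { now apply Qf_sub. }
    assert (EL : Lin A (Zf A x a - Zf A y b) (uf A x a - uf A y b) (Qf A x a - Qf A y b) = (cst 0 + (a - b))%W).
    { rewrite EZ, Eu, EQ; eapply eq_trans; [apply Lin_add|].
      exact (f_equal2 wadd (Lin_tangent A (x - y) HA) (Lin_S A (a - b) HA)). }
    rewrite EL, EZ, Eu, EQ in H; clear EL.
    replace (a - b)%W with (cst 0 + (a - b))%W at 1 by ring.
    eapply Rle_trans; [exact H|].
    apply Rmult_le_compat_l; [nra|].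
    assert (B : forall y, nrm (cst (x - y) * Z1 A + Sc A (a - b)) <= Rabs (x - y) * nrm (Z1 A) + Cc * nrm (a - b)).
    { intros; apply nadd; [apply nmul; [apply ncst|lra]|apply Hc]. }
    assert (B1 : nrm (cst (x - y) * Z1 A + Sc A (a - b)) <= Rabs (x - y) * nrm (Z1 A) + Cc * nrm (a - b)).
    { apply nadd; [apply nmul; [apply ncst|lra]|apply Hc]. }
    assert (B2 : nrm (cst (x - y) * u1 A + Sv A (a - b)) <= Rabs (x - y) * nrm (u1 A) + Cv * nrm (a - b)).
    { apply nadd; [apply nmul; [apply ncst|lra]|apply Hv]. }
    assert (B3 : nrm (cst (x - y) * Q1 A + Sp A (a - b)) <= Rabs (x - y) * nrm (Q1 A) + Cp * nrm (a - b)).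
    { apply nadd; [apply nmul; [apply ncst|lra]|apply Hp]. }
    generalize (Rabs_pos (x - y)) (nrm_pos (a - b)); unfold S, T; nra. }
  (* [(Z1, u1, q1)] is in the kernel of the linearization, so the residual is quadratic in [x]. *)
  assert (resid : forall G e x, Rabs G <= d0 -> 0 <= e <= d0 -> Rabs x * T <= d0 / 2 -> e <= 1 -> Rabs G <= 1 ->
    2 * nrm (Eqn G e (Zf A x (cst 0)) (uf A x (cst 0)) (Qf A x (cst 0))) <= K * (T * T) * (x * x + Rabs G + e)).
  { intros G e x HG He Hx He1 HG1.
    assert (S0 : forall F, blin F -> F (cst 0) = cst 0).
    { intros F HF; replace (cst 0) with (cst 0 - cst 0)%W at 1 by ring; rewrite blin_sub by auto; ring. }
    set (dd := Rabs x * T + Rabs G + e).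
    assert (P := Rabs_pos x); assert (PG := Rabs_pos G).
    assert (PT : 0 <= Rabs x * T) by nra.
    assert (Hb : near_base A 0 (Z0 A) (u0 A) (Q0 A)).
    { repeat split; auto using analytic_Z0, analytic_u0;
      match goal with |- nrm ?x <= _ => replace x with (cst 0) by ring end; rewrite nrm_cst, Rabs_R0; lra. }
    assert (B0 := HB (Rabs G + e) G e).
    (* [HD] and [HB] apply for radii up to 1. The other case is void, since [dd <= 5 / 2 * d0] and
       [d0 <= / 4]. *)
    destruct (Rle_dec dd 1) as [Hdd|Hdd].
    - assert (Hb' : near_base A dd (Z0 A) (u0 A) (Q0 A)).
      { destruct Hb as (? & ? & ? & ? & ?); repeat split; auto; unfold dd; lra. }
      assert (Tx : forall y, nrm y <= T -> nrm (cst x * y) <= dd).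
      { intros y Hy; eapply Rle_trans; [apply nmul; [apply ncst|exact Hy]|unfold dd; lra]. }
      assert (EZ : (Zf A x (cst 0) - Z0 A)%W = (cst x * Z1 A)%W) by (rewrite Zf_def, (S0 (Sc A)) by (now apply blin_Sc); ring).
      assert (Eu : (uf A x (cst 0) - u0 A)%W = (cst x * u1 A)%W) by (rewrite uf_def, (S0 (Sv A)) by (now apply blin_Sv); ring).
      assert (EQ : (Qf A x (cst 0) - Q0 A)%W = (cst x * Q1 A)%W) by (rewrite Qf_def, (S0 (Sp A)) by (now apply blin_Sp); ring).
      assert (T1 : nrm (Z1 A) <= T /\ nrm (u1 A) <= T /\ nrm (Q1 A) <= T).
      { unfold T; generalize (nrm_pos (Z1 A)) (nrm_pos (u1 A)) (nrm_pos (Q1 A)); lra. }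
      assert (Hx' : near_base A dd (Zf A x (cst 0)) (uf A x (cst 0)) (Qf A x (cst 0))).
      { destruct (near x (cst 0) Hx) as (a1 & a2 & _); [rewrite nrm_cst, Rabs_R0; lra|].
        unfold near_base; rewrite EZ, Eu, EQ; repeat split; auto; apply Tx; tauto. }
      assert (H := HD dd G e _ _ _ _ _ _ ltac:(unfold dd in *; lra) ltac:(unfold dd; lra) ltac:(unfold dd; lra) Hb' Hx').
      assert (EL : Lin A (Zf A x (cst 0) - Z0 A) (uf A x (cst 0) - u0 A) (Qf A x (cst 0) - Q0 A) = cst 0).
      { rewrite EZ, Eu, EQ; exact (Lin_tangent A x HA). }
      rewrite EL, EZ, Eu, EQ in H; clear EL.
      assert (B1 := nmul (cst x) (Z1 A) _ _ (ncst x) (Rle_refl _)).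
      assert (B2 := nmul (cst x) (u1 A) _ _ (ncst x) (Rle_refl _)).
      assert (B3 := nmul (cst x) (Q1 A) _ _ (ncst x) (Rle_refl _)).
      specialize (B0 ltac:(unfold dd in *; lra) ltac:(lra) ltac:(lra)).
      set (E1 := Eqn G e (Zf A x (cst 0)) (uf A x (cst 0)) (Qf A x (cst 0))) in *.
      set (E2 := Eqn G e (Z0 A) (u0 A) (Q0 A)) in *.
      assert (H' : nrm E1 <= M * dd * (Rabs x * T) + N * (Rabs G + e)).
      { replace E1 with ((E1 - E2 - cst 0) + E2)%W by ring.
        apply nadd; auto; eapply Rle_trans; [exact H|].
        apply Rmult_le_compat_l; [unfold dd; nra|unfold T; lra]. }
      assert (Q2 : x * x = Rabs x * Rabs x) by (rewrite <- Rabs_mult, Rabs_pos_eq; auto; apply Rle_0_sqr).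
      assert (Q3 : M * dd * (Rabs x * T) <= M * T * T * (x * x + Rabs G + e)).
      { rewrite Q2; unfold dd; set (X := Rabs x) in *; set (g := Rabs G) in *.
        assert (X * T <= 1) by (unfold dd in Hdd; lra).
        assert (X * T * (g + e) <= T * T * (g + e)) by (apply Rmult_le_compat_r; [lra|nra]).
        replace (M * (X * T + g + e) * (X * T)) with (M * (X * X * (T * T) + X * T * (g + e))) by ring.
        replace (M * T * T * (X * X + g + e)) with (M * (X * X * (T * T) + T * T * (g + e))) by ring.
        apply Rmult_le_compat_l; lra. }
      assert (Q4 : N * (Rabs G + e) <= N * (T * T) * (x * x + Rabs G + e)).
      { rewrite Rmult_assoc; apply Rmult_le_compat_l; [lra|].
        assert (1 <= T * T) by nra; assert (0 <= x * x) by apply Rle_0_sqr; nra. }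
      assert (Q5 : M * T * T * (x * x + Rabs G + e) <= M * T * (T * T) * (x * x + Rabs G + e)).
      { assert (0 <= x * x) by apply Rle_0_sqr.
        apply Rmult_le_compat_r; [lra|]. assert (T * T <= T * (T * T)) by nra. nra. }
      unfold K; lra.
    - exfalso; apply Hdd; unfold dd.
      assert (d0 <= / 4); [|lra].
      unfold d0; apply Rinv_le_contravar; nra. }
  set (J := K * (T * T)).
  assert (HJ : 1 <= J) by (unfold J; assert (1 <= T * T) by nra; nra).
  (* The second bound keeps the tangent shift below [d0 / 2]; the third keeps the residual, and
     hence the fixed point, in the ball of radius [rr]. *)
  set (s0 := Rmin (/ 2) (Rmin (d0 / (4 * T)) (rr / (3 * J)))).
  assert (Hs0 : 0 < s0).
  { repeat apply Rmin_glb_lt; try lra; apply Rdiv_lt_0_compat; lra. }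
  assert (Hs1 : s0 <= / 2) by apply Rmin_l.
  assert (Hs2 : s0 * T <= d0 / 4).
  { apply Rle_trans with (d0 / (4 * T) * T); [|right; field; lra].
    apply Rmult_le_compat_r; [lra|]; unfold s0; eapply Rle_trans; [apply Rmin_r|apply Rmin_l]. }
  assert (Hs3 : J * (3 * s0) <= rr).
  { apply Rle_trans with (J * (3 * (rr / (3 * J)))); [|right; field; lra].
    apply Rmult_le_compat_l; [lra|]; apply Rmult_le_compat_l; [lra|].
    unfold s0; eapply Rle_trans; [apply Rmin_r|apply Rmin_r]. }
  assert (Hs4 : s0 <= d0).
  { assert (s0 <= s0 * T) by nra; lra. }
  exists (S * J + T + S * T), s0; split; [nra|]; split; [lra|].
  intros G e HG He.
  assert (small : forall x : R, Rabs x <= s0 -> Rabs x * T <= d0 / 2).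
  { intros x Hx; assert (Rabs x * T <= s0 * T) by (apply Rmult_le_compat_r; lra); lra. }
  assert (ex : forall x : R, Rabs x <= s0 -> exists w, nrm w <= J * (x * x + Rabs G + e) /\ nrm w <= rr /\
     Eqn G e (Zf A x w) (uf A x w) (Qf A x w) = cst 0).
  { intros x Hx.
    assert (Q2 : x * x = Rabs x * Rabs x) by (rewrite <- Rabs_mult, Rabs_pos_eq; auto; apply Rle_0_sqr).
    assert (HR := resid G e x ltac:(lra) ltac:(lra) (small x Hx) ltac:(lra) ltac:(lra)); fold J in HR.
    assert (HR2 : J * (x * x + Rabs G + e) <= rr).
    { eapply Rle_trans; [|exact Hs3]; apply Rmult_le_compat_l; [lra|].
      generalize (Rabs_pos x); rewrite Q2; nra. }
    (* Fixed points of [TT] are zeros of [Eqn], and [diff] with equal parameters gives it the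
       Lipschitz constant [M d0 S = / 4]. *)
    set (TT := fun w => (w - Eqn G e (Zf A x w) (uf A x w) (Qf A x w))%W).
    assert (T0 : nrm (TT (cst 0)) = nrm (Eqn G e (Zf A x (cst 0)) (uf A x (cst 0)) (Qf A x (cst 0)))).
    { unfold TT; rewrite nrm_sub_comm; f_equal; ring. }
    destruct (W_fixed_point TT rr) as (w & Hw1 & Hw2).
    - intros a b Ha Hb.
      assert (H := diff G e x x a b ltac:(lra) ltac:(lra) (small x Hx) (small x Hx) Ha Hb).
      rewrite Rminus_diag, Rabs_R0, Rmult_0_l, Rplus_0_l, <- Rmult_assoc, Hd0' in H.
      rewrite <- nrm_opp in H.
      unfold TT; replace (_ - _)%W with (- (Eqn G e (Zf A x a) (uf A x a) (Qf A x a)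
        - Eqn G e (Zf A x b) (uf A x b) (Qf A x b) - (a - b)))%W by ring; generalize (nrm_pos (a - b)); lra.
    - rewrite T0; lra.
    - exists w; rewrite T0 in Hw1; split; [lra|split; [lra|]].
      unfold TT in Hw2; set (E := Eqn G e (Zf A x w) (uf A x w) (Qf A x w)) in *.
      transitivity (w - (w - E))%W; [ring|rewrite Hw2; ring]. }
  set (w := fun x : R => epsilon (inhabits (cst 0)) (fun w => nrm w <= J * (x * x + Rabs G + e) /\ nrm w <= rr /\
     Eqn G e (Zf A x w) (uf A x w) (Qf A x w) = cst 0)).
  exists w.
  assert (Hw : forall x : R, Rabs x <= s0 -> nrm (w x) <= J * (x * x + Rabs G + e) /\ nrm (w x) <= rr /\
     Eqn G e (Zf A x (w x)) (uf A x (w x)) (Qf A x (w x)) = cst 0).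
  { intros x Hx; unfold w; apply epsilon_spec, ex, Hx. }
  clearbody w; split.
  - intros x Hx; destruct (Hw x Hx) as (w1 & w2 & w3); split; [auto|].
    assert (PG := Rabs_pos G); assert (Px := Rabs_pos x); assert (Px2 : 0 <= x * x) by apply Rle_0_sqr.
    assert (SJ : S * nrm (w x) <= S * J * (x * x + Rabs G + e)) by (rewrite Rmult_assoc; apply Rmult_le_compat_l; lra).
    assert (Pw := nrm_pos (w x)).
    split.
    + assert (nrm (Sc A (w x)) <= S * nrm (w x)) by (specialize (Hc (w x)); unfold S; nra).
      assert (0 <= (T + S * T) * (x * x + Rabs G + e)) by (apply Rmult_le_pos; nra).
      lra.
    + rewrite Qf_def; replace (Q0 A + cst x * Q1 A + Sp A (w x) - Q0 A)%W with (cst x * Q1 A + Sp A (w x))%W by ring.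
      assert (nrm (Sp A (w x)) <= S * nrm (w x)) by (specialize (Hp (w x)); unfold S; nra).
      assert (nrm (cst x * Q1 A) <= Rabs x * T).
      { apply nmul; [apply ncst|unfold T; generalize (nrm_pos (Z1 A)) (nrm_pos (u1 A)); lra]. }
      assert (x * x <= Rabs x).
      { replace (x * x) with (Rabs x * Rabs x) by (rewrite <- Rabs_mult, Rabs_pos_eq; auto). nra. }
      assert (S * J * (x * x + Rabs G + e) <= S * J * (Rabs x + Rabs G + e)) by (apply Rmult_le_compat_l; nra).
      assert (Rabs x * T <= T * (Rabs x + Rabs G + e)) by nra.
      assert (0 <= S * T * (Rabs x + Rabs G + e)) by (apply Rmult_le_pos; nra).
      eapply Rle_trans; [apply nrm_add|]; lra.
  - intros x y Hx Hy; destruct (Hw x Hx) as (_ & w2 & w3), (Hw y Hy) as (_ & v2 & v3).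
    assert (H := diff G e x y (w x) (w y) ltac:(lra) ltac:(lra) (small x Hx) (small y Hy) w2 v2).
    rewrite w3, v3 in H.
    replace (cst 0 - cst 0 - (w x - w y))%W with (- (w x - w y))%W in H by ring.
    rewrite nrm_opp in H.
    (* Both residuals vanish, so [diff] bounds [w x - w y]; the term in its own norm on the right
       has coefficient [/ 4] and is absorbed. *)
    assert (HL : nrm (w x - w y) <= Rabs (x - y) * T).
    { assert (M * d0 * (Rabs (x - y) * T) <= / 4 * (Rabs (x - y) * T)).
      { apply Rmult_le_compat_r; [apply Rmult_le_pos; [apply Rabs_pos|lra]|].
        rewrite <- Hd0'; assert (0 <= M * d0) by nra; nra. }
      replace (M * d0 * (Rabs (x - y) * T + S * nrm (w x - w y))) with
        (M * d0 * (Rabs (x - y) * T) + M * d0 * S * nrm (w x - w y)) in H by ring.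
      rewrite Hd0' in H.
      assert (0 <= Rabs (x - y) * T) by (apply Rmult_le_pos; [apply Rabs_pos|lra]); lra. }
    assert (EZ : (Zf A x (w x) - Zf A y (w y))%W = (cst (x - y) * Z1 A + Sc A (w x - w y))%W).
    { now apply Zf_sub. }
    rewrite EZ.
    assert (nrm (cst (x - y) * Z1 A) <= Rabs (x - y) * T).
    { apply nmul; [apply ncst|unfold T; generalize (nrm_pos (Q1 A)) (nrm_pos (u1 A)); lra]. }
    assert (P := Rabs_pos (x - y)); assert (Pw := nrm_pos (w x - w y)).
    assert (nrm (Sc A (w x - w y)) <= S * (Rabs (x - y) * T)).
    { eapply Rle_trans; [apply Hc|apply Rmult_le_compat; unfold S; lra]. }
    assert (0 <= S * J * Rabs (x - y)) by (apply Rmult_le_pos; nra).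
    eapply Rle_trans; [apply nrm_add|]; lra.
Qed.

(** * Complex differentiability *)

Notation is_cderive := (is_derive (K := C_AbsRing) (V := C_NormedModule)).

Lemma cderive_iff (f : C -> C) w l : is_cderive f w l <->
  forall e, 0 < e -> exists d, 0 < d /\ forall h, Cmod h < d -> Cmod (f (w + h)%C - f w - l * h)%C <= e * Cmod h.
Proof.
  split.
  - intros [_ H] e He.
    destruct (H w (fun P HP => HP) (mkposreal e He)) as [d Hd].
    exists d; split; [apply cond_pos|]; intros h Hh.
    assert (K := Hd (w + h)%C).
    replace (Cmod h) with (Cmod ((w + h) - w)%C) by (f_equal; ring).
    replace (f (w + h)%C - f w - l * h)%C with (f (w + h)%C - f w - ((w + h) - w) * l)%C by ring.
    apply K; change (Cmod ((w + h) - w)%C < d); now replace ((w + h) - w)%C with h by ring.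
  - intros H; split; [apply is_linear_scal_l|].
    intros x Hx e.
    assert (x = w) as -> by (symmetry; apply is_filter_lim_locally_unique, Hx).
    destruct (H e (cond_pos e)) as (d & Hd & K).
    assert (Q : forall y : C, Cmod (y - w)%C < d -> Cmod (f y - f w - (y - w) * l)%C <= e * Cmod (y - w)%C).
    { intros y Hy; specialize (K (y - w)%C Hy); replace (w + (y - w))%C with y in K by ring.
      now replace ((y - w) * l)%C with (l * (y - w))%C by ring. }
    exists (mkposreal d Hd); intros y Hy; exact (Q y Hy).
Qed.

Lemma exp_taylor1 x : Rabs (exp x - 1) <= Rabs x * exp (Rabs x).
Proof.
  destruct (MVT_gen exp 0 x exp) as (c & Hc & E).
  - intros y _; apply is_derive_Reals, derivable_pt_lim_exp.
  - intros y _; apply derivable_continuous_pt, derivable_pt_exp.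
  - rewrite exp_0, Rminus_0_r in E; rewrite E, Rabs_mult, Rmult_comm.
    apply Rmult_le_compat_l; [apply Rabs_pos|].
    rewrite Rabs_pos_eq by (left; apply exp_pos); apply exp_mono.
    generalize (Rle_abs x) (Rabs_pos x); unfold Rmax in Hc; destruct Rle_dec; lra.
Qed.

Lemma exp_taylor2 x : Rabs (exp x - 1 - x) <= x * x * exp (Rabs x).
Proof.
  destruct (MVT_gen (fun y => exp y - 1 - y) 0 x (fun y => exp y - 1)) as (c & Hc & E).
  - intros y _; auto_derive; auto; ring.
  - intros y _; apply derivable_continuous_pt; reg.
  - rewrite exp_0, !Rminus_0_r in E.
    replace (exp x - 1 - x) with ((exp c - 1) * x) by (rewrite <- E; ring).
    rewrite Rabs_mult; assert (Hx : Rabs c <= Rabs x).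
    { unfold Rmin, Rmax in Hc; destruct Rle_dec; [rewrite !Rabs_pos_eq by lra|rewrite !Rabs_left1 by lra]; lra. }
    replace (x * x) with (Rabs x * Rabs x) by (rewrite <- Rabs_mult; apply Rabs_pos_eq, Rle_0_sqr).
    assert (exp (Rabs c) <= exp (Rabs x)) by now apply exp_mono.
    generalize (exp_taylor1 c) (Rabs_pos c) (Rabs_pos x) (exp_pos (Rabs c)); intros.
    assert (Rabs c * exp (Rabs c) <= Rabs x * exp (Rabs x)) by (apply Rmult_le_compat; lra).
    nra.
Qed.

Lemma sin_abs_le y : Rabs (sin y) <= Rabs y.
Proof.
  destruct (MVT_gen sin 0 y cos) as (c & Hc & E).
  - intros x _; apply is_derive_Reals, derivable_pt_lim_sin.
  - intros x _; apply derivable_continuous_pt, derivable_pt_sin.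
  - rewrite sin_0, !Rminus_0_r in E; rewrite E, Rabs_mult.
    rewrite <- (Rmult_1_l (Rabs y)) at 2; apply Rmult_le_compat_r; [apply Rabs_pos|apply Rabs_le, COS_bound].
Qed.

Lemma cos_abs_le y : Rabs (cos y - 1) <= y * y.
Proof.
  destruct (MVT_gen cos 0 y (fun x => - sin x)) as (c & Hc & E).
  - intros x _; apply is_derive_Reals, derivable_pt_lim_cos.
  - intros x _; apply derivable_continuous_pt, derivable_pt_cos.
  - rewrite cos_0, !Rminus_0_r in E; rewrite E, Rabs_mult, Rabs_Ropp.
    assert (Hx : Rabs c <= Rabs y).
    { unfold Rmin, Rmax in Hc; destruct Rle_dec; [rewrite !Rabs_pos_eq by lra|rewrite !Rabs_left1 by lra]; lra. }
    replace (y * y) with (Rabs y * Rabs y) by (rewrite <- Rabs_mult; apply Rabs_pos_eq, Rle_0_sqr).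
    apply Rmult_le_compat_r; [apply Rabs_pos|]; generalize (sin_abs_le c); lra.
Qed.

Lemma sin_taylor2 y : Rabs (sin y - y) <= y * y.
Proof.
  destruct (MVT_gen (fun x => sin x - x) 0 y (fun x => cos x - 1)) as (c & Hc & E).
  - intros x _; auto_derive; auto; ring.
  - intros x _; apply derivable_continuous_pt; reg.
  - rewrite sin_0, !Rminus_0_r in E; rewrite E, Rabs_mult.
    assert (Hx : Rabs c <= Rabs y).
    { unfold Rmin, Rmax in Hc; destruct Rle_dec; [rewrite !Rabs_pos_eq by lra|rewrite !Rabs_left1 by lra]; lra. }
    assert (Hc2 : Rabs (cos c - 1) <= Rabs c).
    { destruct (MVT_gen cos 0 c (fun x => - sin x)) as (b & Hb & E').
      - intros x _; apply is_derive_Reals, derivable_pt_lim_cos.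
      - intros x _; apply derivable_continuous_pt, derivable_pt_cos.
      - rewrite cos_0, Rminus_0_r in E'; rewrite E', Rabs_mult, Rabs_Ropp.
        rewrite <- (Rmult_1_l (Rabs c)) at 2; apply Rmult_le_compat_r; [apply Rabs_pos|apply Rabs_le, SIN_bound]. }
    replace (y * y) with (Rabs y * Rabs y) by (rewrite <- Rabs_mult; apply Rabs_pos_eq, Rle_0_sqr).
    apply Rmult_le_compat_r; [apply Rabs_pos|lra].
Qed.

Lemma cexp_taylor x y :
  Rabs (exp x * cos y - 1 - x) <= (x * x + y * y) * exp (Rabs x) /\
  Rabs (exp x * sin y - y) <= (x * x + 2 * (y * y)) * exp (Rabs x).
Proof.
  assert (H1 : 1 <= exp (Rabs x)) by (rewrite <- exp_0 at 1; apply exp_mono, Rabs_pos).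
  assert (H2 : exp x <= exp (Rabs x)) by apply exp_mono, Rle_abs.
  assert (P := exp_pos x); split.
  - replace (exp x * cos y - 1 - x) with ((exp x - 1 - x) + exp x * (cos y - 1)) by ring.
    eapply Rle_trans; [apply Rabs_triang|].
    rewrite Rabs_mult, (Rabs_pos_eq (exp x)) by lra.
    generalize (exp_taylor2 x) (cos_abs_le y) (Rabs_pos (cos y - 1)); nra.
  - replace (exp x * sin y - y) with ((exp x - 1) * sin y + (sin y - y)) by ring.
    eapply Rle_trans; [apply Rabs_triang|]; rewrite Rabs_mult.
    assert (K : Rabs (exp x - 1) * Rabs (sin y) <= Rabs x * exp (Rabs x) * Rabs y).
    { apply Rmult_le_compat; try apply Rabs_pos; [apply exp_taylor1|apply sin_abs_le]. }
    assert (Ex : x * x = Rabs x * Rabs x) by (rewrite <- Rabs_mult; symmetry; apply Rabs_pos_eq, Rle_0_sqr).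
    assert (Ey : y * y = Rabs y * Rabs y) by (rewrite <- Rabs_mult; symmetry; apply Rabs_pos_eq, Rle_0_sqr).
    generalize (sin_taylor2 y); rewrite Ex, Ey; intros K2.
    assert (Rabs x * Rabs y <= Rabs x * Rabs x + Rabs y * Rabs y) by nra.
    assert (Rabs y * Rabs y <= Rabs y * Rabs y * exp (Rabs x)) by nra.
    nra.
Qed.

Definition da (a : Z -> R) (n : Z) : R := IZR n * a n.

Lemma exp_quad x : 0 <= x -> x * x <= 4 * exp x.
Proof.
  intros Hx; replace x with (x / 2 + x / 2) at 3 by field; rewrite exp_plus.
  generalize (exp_ineq1_le (x / 2)); nra.
Qed.

(** The upper line controls nonnegative [n] and the lower line negative [n]; [eta] is the margin to
    both. *)
Lemma exp_interp n b b1 b2 eta : b1 + eta <= b -> b + eta <= b2 -> 0 <= eta ->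
  exp (IZR n * b) * exp (Rabs (IZR n) * eta) <= exp (IZR n * b1) + exp (IZR n * b2).
Proof.
  intros H1 H2 H3; rewrite <- exp_plus.
  generalize (exp_pos (IZR n * b1)) (exp_pos (IZR n * b2)); intros P1 P2.
  destruct (Rle_dec 0 (IZR n)) as [Hn|Hn].
  - rewrite Rabs_pos_eq by auto.
    assert (exp (IZR n * b + IZR n * eta) <= exp (IZR n * b2)) by (apply exp_mono; nra); lra.
  - rewrite Rabs_left1 by lra.
    assert (exp (IZR n * b + - IZR n * eta) <= exp (IZR n * b1)) by (apply exp_mono; nra); lra.
Qed.

Lemma sm_between a b1 b2 b : sm a b1 -> sm a b2 -> b1 <= b <= b2 -> sm a b.
Proof.
  intros H1 H2 Hb.
  apply (summable_le _ (fun n => Rabs (a n * exp (IZR n * b1)) + Rabs (a n * exp (IZR n * b2)))).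
  - intros n; rewrite !Rabs_mult, !(Rabs_pos_eq (exp _)) by (left; apply exp_pos).
    generalize (exp_interp n b b1 b2 0 ltac:(lra) ltac:(lra) ltac:(lra)) (Rabs_pos (a n)).
    rewrite Rmult_0_r, exp_0; nra.
  - apply summable_plus; now apply summable_abs.
Qed.

(** [n^2 <= (4 / eta^2) exp (|n| eta)] trades the polynomial factor for a second shift by [eta],
    whence the margins [2 * eta]. *)
Lemma sm_quad a b1 b2 b eta : sm a b1 -> sm a b2 -> 0 < eta -> b1 + 2 * eta <= b -> b + 2 * eta <= b2 ->
  summable (fun n => a n * (IZR n * IZR n * exp (IZR n * b) * exp (Rabs (IZR n) * eta))).
Proof.
  intros H1 H2 He Hb1 Hb2; set (K := 4 / (eta * eta)).
  apply (summable_le _ (fun n => K * (Rabs (a n * exp (IZR n * b1)) + Rabs (a n * exp (IZR n * b2))))).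
  - intros n; rewrite !Rabs_mult, !(Rabs_pos_eq (exp _)) by (left; apply exp_pos).
    assert (E := exp_interp n b b1 b2 (eta + eta) ltac:(lra) ltac:(lra) ltac:(lra)).
    rewrite Rmult_plus_distr_l, exp_plus in E.
    set (N := Rabs (IZR n)) in *; assert (HN : 0 <= N) by apply Rabs_pos.
    assert (Q := exp_quad (N * eta) ltac:(nra)).
    assert (Q' : N * N <= K * exp (N * eta)).
    { unfold K; apply Rmult_le_reg_r with (eta * eta); [nra|].
      replace (4 / (eta * eta) * exp (N * eta) * (eta * eta)) with (4 * exp (N * eta)) by (field; lra); lra. }
    assert (HK : 0 < K) by (apply Rdiv_lt_0_compat; nra).
    generalize (exp_pos (IZR n * b)) (exp_pos (N * eta)) (Rabs_pos (a n)); intros p1 p2 p3.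
    apply Rle_trans with (Rabs (a n) * (K * exp (N * eta) * exp (IZR n * b) * exp (N * eta))).
    + apply Rmult_le_compat_l; auto; apply Rmult_le_compat_r; [lra|]; apply Rmult_le_compat_r; [lra|auto].
    + replace (Rabs (a n) * (K * exp (N * eta) * exp (IZR n * b) * exp (N * eta))) with
        (K * (Rabs (a n) * (exp (IZR n * b) * (exp (N * eta) * exp (N * eta))))) by ring.
      apply Rmult_le_compat_l; [lra|]; rewrite <- Rmult_plus_distr_l; now apply Rmult_le_compat_l.
  - apply summable_scal, summable_plus; now apply summable_abs.
Qed.

Lemma sm_da a b1 b2 b : sm a b1 -> sm a b2 -> b1 < b < b2 -> sm (da a) b.
Proof.
  intros H1 H2 Hb; set (eta := Rmin (b - b1) (b2 - b) / 2).
  assert (He : 0 < Rmin (b - b1) (b2 - b)) by (apply Rmin_glb_lt; lra).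
  generalize (Rmin_l (b - b1) (b2 - b)) (Rmin_r (b - b1) (b2 - b)); intros.
  assert (S := sm_quad a b1 b2 b eta H1 H2 ltac:(unfold eta; lra) ltac:(unfold eta; lra) ltac:(unfold eta; lra)).
  apply (summable_le _ (fun n => Rabs (a n * (IZR n * IZR n * exp (IZR n * b) * exp (Rabs (IZR n) * eta))))).
  - intros n; unfold da; rewrite !Rabs_mult, !(Rabs_pos_eq (exp _)) by (left; apply exp_pos).
    assert (1 <= exp (Rabs (IZR n) * eta)).
    { rewrite <- exp_0 at 1; apply exp_mono, Rmult_le_pos; [apply Rabs_pos|unfold eta; lra]. }
    assert (Rabs (IZR n) <= Rabs (IZR n) * Rabs (IZR n)).
    { rewrite <- abs_IZR, <- mult_IZR; apply IZR_le; nia. }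
    generalize (exp_pos (IZR n * b)) (Rabs_pos (a n)) (Rabs_pos (IZR n)); intros.
    assert (Rabs (IZR n) * exp (IZR n * b) <= Rabs (IZR n) * Rabs (IZR n) * exp (IZR n * b) * exp (Rabs (IZR n) * eta)).
    { rewrite <- (Rmult_1_r (Rabs (IZR n) * exp (IZR n * b))); apply Rmult_le_compat; nra. }
    nra.
  - now apply summable_abs.
Qed.

Lemma ev_quad_component (a f g fh Kn : Z -> R) :
  summable (fun n => a n * f n) -> summable (fun n => a n * g n) -> summable (fun n => a n * fh n) ->
  (forall n, Rabs (fh n - f n - g n) <= Kn n) -> summable (fun n => a n * Kn n) ->
  Rabs (Sum (fun n => a n * fh n) - Sum (fun n => a n * f n) - Sum (fun n => a n * g n))
    <= Sum (fun n => Rabs (a n * Kn n)).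
Proof.
  intros Hf Hg Hh HK Hs.
  replace (_ - _ - _) with (Sum (fun n => a n * (fh n - f n - g n))).
  - assert (S : summable (fun n => a n * (fh n - f n - g n))).
    { apply (summable_ext (fun n => a n * fh n + (-1 * (a n * f n) + -1 * (a n * g n)))); [intros; ring|].
      apply summable_plus; auto; apply summable_plus; now apply summable_scal. }
    eapply Rle_trans; [apply Sum_abs; auto|].
    apply Sum_le; [now apply summable_abs|now apply summable_abs|].
    intros n; rewrite !Rabs_mult; apply Rmult_le_compat_l; [apply Rabs_pos|].
    apply Rle_trans with (1 := HK n), Rle_abs.
  - rewrite (Sum_ext _ (fun n => a n * fh n + (-1 * (a n * f n) + -1 * (a n * g n)))) by (intros; ring).
    rewrite !Sum_plus, !Sum_scal; auto using summable_scal; [ring|].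
    apply summable_plus; now apply summable_scal.
Qed.

Lemma Rabs_comb2 c s x y B : Rabs c <= 1 -> Rabs s <= 1 -> Rabs x <= B -> Rabs y <= B ->
  Rabs (c * x + s * y) <= B + B.
Proof.
  intros Hc Hs Hx Hy; eapply Rle_trans; [apply Rabs_triang|]; rewrite !Rabs_mult.
  generalize (Rabs_pos c) (Rabs_pos s) (Rabs_pos x) (Rabs_pos y); intros.
  apply Rplus_le_compat; nra.
Qed.

Lemma Cmod_le_sum (p q : R) : Cmod (p, q) <= Rabs p + Rabs q.
Proof.
  unfold Cmod; simpl; rewrite <- (sqrt_square (Rabs p + Rabs q)).
  - apply sqrt_le_1_alt.
    generalize (Rabs_pos p) (Rabs_pos q) (pow2_abs p) (pow2_abs q); simpl; nra.
  - generalize (Rabs_pos p) (Rabs_pos q); lra.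
Qed.

Lemma Rabs_Re_le w : Rabs (Re w) <= Cmod w.
Proof. destruct w as [p q]; simpl; eapply Rle_trans; [|apply (Rmax_Cmod (p, q))]; apply Rmax_l. Qed.

Lemma Rabs_Im_le w : Rabs (Im w) <= Cmod w.
Proof. destruct w as [p q]; simpl; eapply Rle_trans; [|apply (Rmax_Cmod (p, q))]; apply Rmax_r. Qed.

(** Differentiation under the sum: the Taylor remainder of the n-th mode is of order
    [|h|^2 n^2 exp (n y + |n| eta)], summable by [sm_quad]. *)
Lemma ev_derive a b1 b2 w : sm a b1 -> sm a b2 -> b1 < Im w < b2 ->
  is_cderive (ev a) w (- Ci * ev (da a) w)%C.
Proof.
  intros H1 H2 Hb; destruct w as [x y]; simpl in Hb.
  set (eta := Rmin (y - b1) (b2 - y) / 4).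
  assert (He : 0 < Rmin (y - b1) (b2 - y)) by (apply Rmin_glb_lt; lra).
  generalize (Rmin_l (y - b1) (b2 - y)) (Rmin_r (y - b1) (b2 - y)); intros L1 L2.
  assert (He' : 0 < eta) by (unfold eta; lra).
  assert (S := sm_quad a b1 b2 y eta H1 H2 He' ltac:(unfold eta; lra) ltac:(unfold eta; lra)).
  set (K := Sum (fun n => Rabs (a n * (IZR n * IZR n * exp (IZR n * y) * exp (Rabs (IZR n) * eta))))).
  assert (HK : 0 <= K) by (apply Sum_pos; [now apply summable_abs|intros; apply Rabs_pos]).
  apply cderive_iff; intros e Hpe.
  exists (Rmin eta (e / (12 * K + 1))); split.
  { apply Rmin_glb_lt; auto; apply Rdiv_lt_0_compat; lra. }
  intros [p k] Hh; set (h := Cmod (p, k)) in *.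
  assert (Hh1 : h < eta) by (eapply Rlt_le_trans; [exact Hh|apply Rmin_l]).
  assert (Hh2 : h * (12 * K) <= e).
  { assert (h <= e / (12 * K + 1)) by (left; eapply Rlt_le_trans; [exact Hh|apply Rmin_r]).
    assert (P : 0 <= h) by apply Cmod_ge_0.
    apply Rle_trans with (e / (12 * K + 1) * (12 * K + 1)); [nra|right; field; lra]. }
  assert (Hp : Rabs p <= h) by apply (Rabs_Re_le (p, k)).
  assert (Hk : Rabs k <= h) by apply (Rabs_Im_le (p, k)).
  assert (P0 : 0 <= h) by apply Cmod_ge_0.
  assert (sm0 : sm a y) by (apply (sm_between a b1 b2); auto; lra).
  assert (smh : sm a (y + k)).
  { apply (sm_between a b1 b2); auto; apply Rabs_le_between in Hk; unfold eta in Hh1; lra. }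
  assert (smd : sm (da a) y) by (apply (sm_da a b1 b2); auto).
  set (N := fun n => IZR n).
  set (X1 := fun n => exp (N n * k) * cos (N n * p) - 1 - N n * k).
  set (X2 := fun n => exp (N n * k) * sin (N n * p) - N n * p).
  assert (BX : forall n, Rabs (X1 n) <= 3 * (h * h) * (N n * N n) * exp (Rabs (N n) * eta) /\
                         Rabs (X2 n) <= 3 * (h * h) * (N n * N n) * exp (Rabs (N n) * eta)).
  { intros n; destruct (cexp_taylor (N n * k) (N n * p)) as [T1 T2].
    assert (E1 : exp (Rabs (N n * k)) <= exp (Rabs (N n) * eta)).
    { apply exp_mono; rewrite Rabs_mult; apply Rmult_le_compat_l; [apply Rabs_pos|lra]. }
    assert (kk : k * k <= h * h) by (generalize (pow2_abs k) (Rabs_pos k); simpl; nra).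
    assert (pp : p * p <= h * h) by (generalize (pow2_abs p) (Rabs_pos p); simpl; nra).
    assert (NN : 0 <= N n * N n) by apply Rle_0_sqr.
    generalize (exp_pos (Rabs (N n * k))); intros pe.
    split; (eapply Rle_trans; [eassumption|]); apply Rmult_le_compat; try lra; try nra. }
  assert (BG : forall n, Rabs (exp (N n * y) * (cos (N n * x) * X1 n - sin (N n * x) * X2 n)) <=
      6 * (h * h) * (N n * N n * exp (N n * y) * exp (Rabs (N n) * eta)) /\
      Rabs (exp (N n * y) * (sin (N n * x) * X1 n + cos (N n * x) * X2 n)) <=
      6 * (h * h) * (N n * N n * exp (N n * y) * exp (Rabs (N n) * eta))).
  { intros n; destruct (BX n) as [T1 T2].
    assert (c1 := Rabs_le _ _ (COS_bound (N n * x))); assert (c2 := Rabs_le _ _ (SIN_bound (N n * x))).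
    assert (pe := exp_pos (N n * y)).
    replace (6 * (h * h) * (N n * N n * exp (N n * y) * exp (Rabs (N n) * eta))) with
      (exp (N n * y) * (3 * (h * h) * (N n * N n) * exp (Rabs (N n) * eta) + 3 * (h * h) * (N n * N n) * exp (Rabs (N n) * eta))) by ring.
    rewrite !Rabs_mult, (Rabs_pos_eq (exp (N n * y))) by lra.
    split; (apply Rmult_le_compat_l; [lra|]); [|now apply Rabs_comb2].
    replace (cos (N n * x) * X1 n - sin (N n * x) * X2 n) with (cos (N n * x) * X1 n + - sin (N n * x) * X2 n) by ring.
    apply Rabs_comb2; auto; now rewrite Rabs_Ropp. }
  assert (SK : summable (fun n => a n * (6 * (h * h) * (N n * N n * exp (N n * y) * exp (Rabs (N n) * eta))))).
  { apply (summable_ext (fun n => 6 * (h * h) * (a n * (N n * N n * exp (N n * y) * exp (Rabs (N n) * eta))))); [intros; ring|].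
    now apply summable_scal. }
  assert (EK : Sum (fun n => Rabs (a n * (6 * (h * h) * (N n * N n * exp (N n * y) * exp (Rabs (N n) * eta))))) = 6 * (h * h) * K).
  { unfold K; rewrite <- Sum_scal by now apply summable_abs.
    apply Sum_ext; intros n; rewrite <- (Rabs_pos_eq (6 * (h * h))) at 2 by nra.
    rewrite <- Rabs_mult; f_equal; unfold N; ring. }
  assert (sC := sm_C a (x, y) sm0); assert (sS := sm_S a (x, y) sm0).
  assert (sCh := sm_C a (x + p, y + k) smh); assert (sSh := sm_S a (x + p, y + k) smh).
  assert (sCd := sm_C (da a) (x, y) smd); assert (sSd := sm_S (da a) (x, y) smd).
  assert (sg1 : summable (fun n => a n * (k * (N n * eC n (x, y)) + - (p * (N n * eS n (x, y)))))).
  { apply (summable_ext (fun n => k * (da a n * eC n (x, y)) + (- p) * (da a n * eS n (x, y)))); [intros; unfold da, N; ring|].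
    apply summable_plus; now apply summable_scal. }
  assert (sg2 : summable (fun n => a n * (k * (N n * eS n (x, y)) + p * (N n * eC n (x, y))))).
  { apply (summable_ext (fun n => k * (da a n * eS n (x, y)) + p * (da a n * eC n (x, y)))); [intros; unfold da, N; ring|].
    apply summable_plus; now apply summable_scal. }
  assert (R1 := ev_quad_component a _ _ _ (fun n => 6 * (h * h) * (N n * N n * exp (N n * y) * exp (Rabs (N n) * eta))) sC sg1 sCh (fun n => ltac:(
     eapply Rle_trans; [right|exact (proj1 (BG n))]; f_equal; unfold X1, X2, eC, eS, N; simpl;
     rewrite !Rmult_plus_distr_l, exp_plus, cos_plus; ring)) SK).
  assert (R2 := ev_quad_component a _ _ _ (fun n => 6 * (h * h) * (N n * N n * exp (N n * y) * exp (Rabs (N n) * eta))) sS sg2 sSh (fun n => ltac:(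
     eapply Rle_trans; [right|exact (proj2 (BG n))]; f_equal; unfold X1, X2, eC, eS, N; simpl;
     rewrite !Rmult_plus_distr_l, exp_plus, sin_plus; ring)) SK).
  cbv beta in R1, R2; rewrite EK in R1, R2.
  rewrite (Sum_ext (fun n => a n * (k * (N n * eC n (x, y)) + - (p * (N n * eS n (x, y)))))
    (fun n => k * (da a n * eC n (x, y)) + (- p) * (da a n * eS n (x, y)))), Sum_plus, !Sum_scal in R1
    by (auto using summable_scal || (intros; unfold da, N; ring)).
  rewrite (Sum_ext (fun n => a n * (k * (N n * eS n (x, y)) + p * (N n * eC n (x, y))))
    (fun n => k * (da a n * eS n (x, y)) + p * (da a n * eC n (x, y)))), Sum_plus, !Sum_scal in R2
    by (auto using summable_scal || (intros; unfold da, N; ring)).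
  unfold ev, Ci, Cplus, Cminus, Cmult, Copp; simpl.
  eapply Rle_trans; [apply Cmod_le_sum|].
  match goal with |- Rabs ?u + Rabs ?v <= _ => match type of R1 with Rabs ?u' <= _ => match type of R2 with Rabs ?v' <= _ =>
    replace u with u' by (unfold Cplus; simpl; ring); replace v with (- v') by (unfold Cplus; simpl; ring) end end end.
  rewrite Rabs_Ropp; nra.
Qed.

(** * From coefficients to a flow in the strip *)

(** [Ksym d a] says that [ev a] is real on [Im w = - d]. *)
Definition Ksym (d : R) (a : Z -> R) : Prop := forall n, a (- n)%Z = exp (- (2 * d * IZR n)) * a n.
Definition Kasym (d : R) (a : Z -> R) : Prop := forall n, a (- n)%Z = - (exp (- (2 * d * IZR n)) * a n).
(** [ev (prim a)] is a primitive of [- i (ev a - a 0)]; the zero mode is left out because its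
    primitive is not periodic. *)
Definition prim (a : Z -> R) (n : Z) : R := if Z.eq_dec n 0 then 0 else a n / IZR n.

Lemma eC_opp n w : eC (- n) w = exp (- (2 * IZR n * Im w)) * eC n w.
Proof.
  unfold eC; rewrite opp_IZR, Ropp_mult_distr_l_reverse, Ropp_mult_distr_l_reverse, cos_neg, <- Rmult_assoc, <- exp_plus.
  do 2 f_equal; ring.
Qed.

Lemma eS_opp n w : eS (- n) w = - (exp (- (2 * IZR n * Im w)) * eS n w).
Proof.
  unfold eS; rewrite opp_IZR, Ropp_mult_distr_l_reverse, Ropp_mult_distr_l_reverse, sin_neg, <- Rmult_assoc, <- exp_plus.
  rewrite <- Ropp_mult_distr_r; do 3 f_equal; ring.
Qed.

Lemma exp_cancel x y : x + y = 0 -> exp x * exp y = 1.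
Proof. intros H; rewrite <- exp_plus, H; apply exp_0. Qed.

Lemma Sum_odd (f : Z -> R) : summable f -> (forall n, f (- n)%Z = - f n) -> Sum f = 0.
Proof.
  intros Hs H; assert (E := Sum_reindex Z.opp Z.opp f ltac:(intros; lia) ltac:(intros; lia) Hs).
  rewrite (Sum_ext _ (fun n => -1 * f n)) in E by (intros; rewrite H; ring).
  rewrite Sum_scal in E by auto; lra.
Qed.

Lemma Kasym_bottom d a x : Kasym d a -> sm a (- d) -> Re (ev a (x, - d)) = 0.
Proof.
  intros H Hs; simpl; rewrite Sum_odd; [ring|now apply sm_C|].
  intros n; rewrite H, eC_opp; simpl.
  rewrite <- (Rmult_1_l (a n * eC n (x, - d))).
  rewrite <- (exp_cancel (- (2 * d * IZR n)) (- (2 * IZR n * - d))) by ring; ring.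
Qed.

Lemma Ksym_prim d a : Ksym d a -> Kasym d (prim a).
Proof.
  intros H n; unfold prim; destruct (Z.eq_dec (- n) 0), (Z.eq_dec n 0); try lia; [ring|].
  rewrite H, opp_IZR; field; apply not_0_IZR; auto.
Qed.

Lemma Ksym_cv d a b : Ksym d a -> Ksym d b -> sm a 0 -> sm b 0 -> Ksym d (cv a b).
Proof.
  intros Ha Hb Sa Sb n; unfold cv.
  rewrite <- (Sum_reindex Z.opp Z.opp (fun k => a k * b (- n - k)%Z)) by (try (intros; lia); now apply (sm_term _ _ 0)).
  rewrite <- Sum_scal by now apply (sm_term _ _ 0).
  apply Sum_ext; intros k; replace (- n - - k)%Z with (- (n - k))%Z by ring.
  rewrite Ha, Hb.
  replace (- (2 * d * IZR n)) with (- (2 * d * IZR k) + - (2 * d * IZR (n - k))) by (rewrite minus_IZR; ring).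
  rewrite exp_plus; ring.
Qed.

(** Reflection in [Im w = - d] carries convergence on one line to the mirror line, so series that
    converge slightly above the surface also converge slightly beyond the bottom. *)
Lemma sm_reflect d a y : Ksym d a -> sm a y -> sm a (- (2 * d) - y).
Proof.
  intros H Hs; apply (summable_ext (fun n => a (- n)%Z * exp (IZR (- n) * y))).
  - intros n; rewrite H, opp_IZR, (Rmult_comm (exp _) (a n)), Rmult_assoc, <- exp_plus; do 2 f_equal; ring.
  - apply (summable_inj Z.opp (fun n => a n * exp (IZR n * y))); [lia|exact Hs].
Qed.

Lemma sm_prim a y : sm a y -> sm (prim a) y.
Proof.
  intros H; apply (summable_le _ (fun n => Rabs (a n * exp (IZR n * y)))); [|now apply summable_abs].
  intros n; unfold prim; rewrite !Rabs_mult; apply Rmult_le_compat_r; [apply Rabs_pos|].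
  destruct Z.eq_dec as [|Hn]; [rewrite Rabs_R0; apply Rabs_pos|].
  unfold Rdiv; rewrite Rabs_mult; rewrite <- (Rmult_1_r (Rabs (a n))) at 2.
  apply Rmult_le_compat_l; [apply Rabs_pos|].
  rewrite Rabs_inv, <- Rinv_1; apply Rinv_le_contravar; [lra|].
  rewrite <- abs_IZR; apply (IZR_le 1); lia.
Qed.

Lemma eC_period n x y : eC n (x + 2 * PI, y) = eC n (x, y) /\ eS n (x + 2 * PI, y) = eS n (x, y).
Proof.
  unfold eC, eS; simpl.
  assert (K : cos (IZR n * (x + 2 * PI)) = cos (IZR n * x) /\ sin (IZR n * (x + 2 * PI)) = sin (IZR n * x)); [|now destruct K as [-> ->]].
  destruct (Z_le_dec 0 n) as [Hn|Hn].
  - replace (IZR n * (x + 2 * PI)) with (IZR n * x + 2 * INR (Z.to_nat n) * PI).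
    + split; [apply cos_period|apply sin_period].
    + rewrite INR_IZR_INZ, Z2Nat.id by auto; ring.
  - replace (IZR n * x) with (IZR n * (x + 2 * PI) + 2 * INR (Z.to_nat (- n)) * PI).
    + split; symmetry; [apply cos_period|apply sin_period].
    + rewrite INR_IZR_INZ, Z2Nat.id, opp_IZR by lia; ring.
Qed.

Lemma ev_period a x y : ev a (x + 2 * PI, y) = ev a (x, y).
Proof.
  unfold ev; f_equal; [|f_equal]; apply Sum_ext; intros n; destruct (eC_period n x y) as [E1 E2]; now rewrite ?E1, ?E2.
Qed.

Lemma ev_even a x y : sm a y -> Re (ev a (- x, y)) = Re (ev a (x, y)) /\ Im (ev a (- x, y)) = - Im (ev a (x, y)).
Proof.
  intros Hs; unfold ev; simpl; split.
  - apply Sum_ext; intros n; unfold eC; simpl.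
    now rewrite Ropp_mult_distr_r_reverse, cos_neg.
  - rewrite (Sum_ext _ (fun n => -1 * (a n * eS n (x, y)))).
    + rewrite Sum_scal by (now apply (sm_S a (x, y))); ring.
    + intros n; unfold eS; simpl; rewrite Ropp_mult_distr_r_reverse, sin_neg; ring.
Qed.

Lemma ev_split a w : sm a (Im w) -> ev a w = (RtoC (a 0%Z) + ev (da (prim a)) w)%C.
Proof.
  intros Hs.
  assert (S0 : sm (fun n => if Z.eq_dec n 0 then a 0%Z else 0) (Im w)).
  { apply (summable_single _ 0%Z); intros i Hi; destruct Z.eq_dec; [easy|ring]. }
  assert (E0 : ev (fun n => if Z.eq_dec n 0 then a 0%Z else 0) w = RtoC (a 0%Z)).
  { rewrite (ev_single _ _ 0) by (intros n Hn; destruct Z.eq_dec; easy).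
    simpl; unfold eC, eS, RtoC; rewrite !Rmult_0_l, exp_0, cos_0, sin_0; f_equal; ring. }
  assert (E : a = fun n => (if Z.eq_dec n 0 then a 0%Z else 0) + da (prim a) n).
  { apply functional_extensionality; intros n; unfold da, prim; destruct Z.eq_dec as [->|Hn]; [ring|].
    field; now apply not_0_IZR. }
  rewrite E at 1; rewrite ev_plus, E0; auto.
  apply (summable_le _ (fun n => Rabs (a n * exp (IZR n * Im w)))); [|now apply summable_abs].
  intros n; unfold da, prim; destruct Z.eq_dec as [->|Hn].
  - rewrite !Rmult_0_r, Rmult_0_l, Rabs_R0; apply Rabs_pos.
  - right; do 2 f_equal; field; now apply not_0_IZR.
Qed.

(** The primitive of [- i ev a]. *)
Definition evp (a : Z -> R) (w : C) : C := (- Ci * RtoC (a 0%Z) * w + ev (prim a) w)%C.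

Lemma cderive_plus (f g : C -> C) w l m : is_cderive f w l -> is_cderive g w m ->
  is_cderive (fun x => f x + g x)%C w (l + m)%C.
Proof. apply (is_derive_plus (K := C_AbsRing) (V := C_NormedModule)). Qed.

Lemma cderive_scal (f : C -> C) c w l : is_cderive f w l -> is_cderive (fun x => c * f x)%C w (c * l)%C.
Proof.
  intros H; apply cderive_iff; intros e He; apply cderive_iff with (e := e / (Cmod c + 1)) in H.
  - destruct H as (d & Hd & H); exists d; split; auto; intros h Hh; specialize (H h Hh).
    replace (c * f (w + h)%C - c * f w - c * l * h)%C with (c * (f (w + h)%C - f w - l * h))%C by ring.
    rewrite Cmod_mult; generalize (Cmod_ge_0 c) (Cmod_ge_0 h); intros P1 P2.
    apply Rle_trans with ((Cmod c + 1) * (e / (Cmod c + 1) * Cmod h)); [|right; field; lra].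
    apply Rmult_le_compat; auto; try lra; apply Cmod_ge_0.
  - apply Rdiv_lt_0_compat; auto; generalize (Cmod_ge_0 c); lra.
Qed.

Lemma cderive_id w : is_cderive (fun x => x) w (RtoC 1).
Proof.
  apply cderive_iff; intros e He; exists 1; split; [lra|]; intros h _.
  replace (w + h - w - 1 * h)%C with (RtoC 0) by ring; rewrite Cmod_0.
  apply Rmult_le_pos; [lra|apply Cmod_ge_0].
Qed.

Lemma cderive_const c w : is_cderive (fun _ => c) w (RtoC 0).
Proof.
  apply cderive_iff; intros e He; exists 1; split; [lra|]; intros h _.
  replace (c - c - 0 * h)%C with (RtoC 0) by ring; rewrite Cmod_0.
  apply Rmult_le_pos; [lra|apply Cmod_ge_0].
Qed.

Lemma evp_derive a b1 b2 w : sm a b1 -> sm a b2 -> b1 < Im w < b2 ->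
  is_cderive (evp a) w (- Ci * ev a w)%C.
Proof.
  intros H1 H2 Hb.
  rewrite (ev_split a w) by (apply (sm_between a b1 b2); auto; lra).
  replace (- Ci * (RtoC (a 0%Z) + ev (da (prim a)) w))%C with
    ((- Ci * RtoC (a 0%Z)) * RtoC 1 + (- Ci * ev (da (prim a)) w))%C by ring.
  apply (cderive_plus (fun w => - Ci * RtoC (a 0%Z) * w)%C).
  - apply cderive_scal, cderive_id.
  - apply (ev_derive _ b1 b2); auto using sm_prim.
Qed.

(** [Z], [u] and [- i u Z] are the derivatives of the conformal map [z], of the
    velocity-like function [u] and of the potential [P]; the stream function
    is [Re P + (y - yc)^2 / 2] and the vorticity constant is [Omega = -1]. *)
Record flow (d eta yc G q : R) (z Z Z' u u' P : C -> C) : Prop := {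
  fl_d : 0 < d;
  fl_eta : 0 < eta;
  fl_z : forall w, - d - eta < Im w < eta -> is_cderive z w (Z w);
  fl_Z : forall w, - d - eta < Im w < eta -> is_cderive Z w (Z' w);
  fl_u : forall w, - d - eta < Im w < eta -> is_cderive u w (u' w);
  fl_u' : forall w, - d - eta < Im w < eta -> exists l, is_cderive u' w l;
  fl_P : forall w, - d - eta < Im w < eta -> is_cderive P w (- Ci * (u w * Z w))%C;
  fl_zper : forall x y, z (x + 2 * PI, y) = (z (x, y) + RtoC (2 * PI))%C;
  fl_Zper : forall x y, Z (x + 2 * PI, y) = Z (x, y);
  fl_uper : forall x y, u (x + 2 * PI, y) = u (x, y);
  fl_Pper : forall x y, Re (P (x + 2 * PI, y)) = Re (P (x, y));
  fl_zsym : forall x y, - d - eta < y < eta -> Re (z (- x, y)) = - Re (z (x, y)) /\ Im (z (- x, y)) = Im (z (x, y));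
  fl_Zsym : forall x y, - d - eta < y < eta -> Re (Z (- x, y)) = Re (Z (x, y)) /\ Im (Z (- x, y)) = - Im (Z (x, y));
  fl_Psym : forall x y, - d - eta < y < eta -> Re (P (- x, y)) = Re (P (x, y));
  fl_zbot : forall x, Im (z (x, - d)) = yc - d;
  fl_Pbot : forall x, Re (P (x, - d)) = Re (P (0, - d));
  fl_Ptop : forall x, Re (P (x, 0)) + / 2 * (Im (z (x, 0)) - yc) ^ 2 = 0;
  fl_bern : forall x, Im (u (x, 0)) ^ 2 + (Im (z (x, 0)) - yc + Re (u (x, 0))) ^ 2
              = q - 2 * G * (Im (z (x, 0)) - yc)
}.

Lemma Re_diff a b m h : Re (a - b - m * RtoC h)%C = Re a - Re b - Re m * h.
Proof. destruct a, b, m; simpl; ring. Qed.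

Lemma Im_diff a b m h : Im (a - b - m * RtoC h)%C = Im a - Im b - Im m * h.
Proof. destruct a, b, m; simpl; ring. Qed.

Lemma cderive_curve (f : C -> C) (c : R -> C) (x : R) (l v : C) : is_cderive f (c x) l ->
  (forall h, c (x + h) = (c x + RtoC h * v)%C) ->
  is_derive (fun t => Re (f (c t))) x (Re (l * v)%C) /\ is_derive (fun t => Im (f (c t))) x (Im (l * v)%C).
Proof.
  intros Hf Hc.
  assert (K : forall e, 0 < e -> exists d, 0 < d /\ forall h, Rabs h < d ->
    Cmod (f (c (x + h)%R) - f (c x) - l * v * RtoC h)%C <= e * Rabs h).
  { intros e He; assert (Hv : 0 < Cmod v + 1) by (generalize (Cmod_ge_0 v); lra).
    destruct (proj1 (cderive_iff f (c x) l) Hf (e / (Cmod v + 1))) as (d & Hd & H); [now apply Rdiv_lt_0_compat|].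
    exists (d / (Cmod v + 1)); split; [now apply Rdiv_lt_0_compat|]; intros h Hh.
    assert (P := Rabs_pos h); assert (Pv := Cmod_ge_0 v).
    assert (E : Cmod (RtoC h * v)%C = Rabs h * Cmod v) by now rewrite Cmod_mult, Cmod_R.
    specialize (H (RtoC h * v)%C); rewrite E, <- Hc in H.
    replace (l * v * RtoC h)%C with (l * (RtoC h * v))%C by ring.
    eapply Rle_trans; [apply H|].
    - apply Rmult_lt_compat_r with (1 := Hv) in Hh.
      replace (d / (Cmod v + 1) * (Cmod v + 1)) with d in Hh by (field; lra); nra.
    - apply Rle_trans with (e / (Cmod v + 1) * (Rabs h * (Cmod v + 1))); [|right; field; lra].
      apply Rmult_le_compat_l; [left; now apply Rdiv_lt_0_compat|nra]. }
  split; apply is_derive_Reals; intros e He; destruct (K (e / 2) ltac:(lra)) as (d & Hd & H); exists (mkposreal d Hd);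
    intros h Hh0 Hh; specialize (H h Hh).
  - assert (E := Rabs_Re_le (f (c (x + h)%R) - f (c x) - l * v * RtoC h)%C); rewrite Re_diff in E.
    replace ((Re (f (c (x + h))) - Re (f (c x))) / h - Re (l * v)%C) with
      ((Re (f (c (x + h))) - Re (f (c x)) - Re (l * v)%C * h) / h) by (field; auto).
    unfold Rdiv; rewrite Rabs_mult, Rabs_inv; assert (0 < Rabs h) by now apply Rabs_pos_lt.
    apply Rle_lt_trans with (e / 2 * Rabs h * / Rabs h); [|field_simplify; lra].
    apply Rmult_le_compat_r; [left; now apply Rinv_0_lt_compat|].
    exact (Rle_trans _ _ _ E H).
  - assert (E := Rabs_Im_le (f (c (x + h)%R) - f (c x) - l * v * RtoC h)%C); rewrite Im_diff in E.
    replace ((Im (f (c (x + h))) - Im (f (c x))) / h - Im (l * v)%C) with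
      ((Im (f (c (x + h))) - Im (f (c x)) - Im (l * v)%C * h) / h) by (field; auto).
    unfold Rdiv; rewrite Rabs_mult, Rabs_inv; assert (0 < Rabs h) by now apply Rabs_pos_lt.
    apply Rle_lt_trans with (e / 2 * Rabs h * / Rabs h); [|field_simplify; lra].
    apply Rmult_le_compat_r; [left; now apply Rinv_0_lt_compat|].
    exact (Rle_trans _ _ _ E H).
Qed.

Lemma cderive_alpha (f : C -> C) x y (l : C) : is_cderive f (x, y) l ->
  is_derive (fun t => Re (f (t, y))) x (Re l) /\ is_derive (fun t => Im (f (t, y))) x (Im l).
Proof.
  intros H; replace l with (l * RtoC 1)%C by ring.
  apply (cderive_curve f (fun t => (t, y)) x l (RtoC 1) H).
  intros h; unfold Cplus, Cmult, RtoC; simpl; f_equal; ring.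
Qed.

Lemma cderive_beta (f : C -> C) x y (l : C) : is_cderive f (x, y) l ->
  is_derive (fun t => Re (f (x, t))) y (- Im l) /\ is_derive (fun t => Im (f (x, t))) y (Re l).
Proof.
  intros H.
  replace (- Im l) with (Re (l * Ci)%C) by (destruct l; simpl; ring).
  replace (Re l) with (Im (l * Ci)%C) by (destruct l; simpl; ring).
  apply (cderive_curve f (fun t => (x, t)) y l Ci H).
  intros h; unfold Cplus, Cmult, RtoC, Ci; simpl; f_equal; ring.
Qed.

Lemma Ksym_Kop d a : 0 < d -> analytic a -> Ksym d (Kop (exp (- (2 * d))) a).
Proof.
  intros Hd Ha n.
  assert (He : 0 <= exp (- (2 * d)) <= 1).
  { split; [left; apply exp_pos|rewrite <- exp_0; apply exp_mono; lra]. }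
  assert (E : forall m, (0 <= m)%Z -> eps_pow (exp (- (2 * d))) m = exp (- (2 * d * IZR m))).
  { intros m Hm; unfold eps_pow; rewrite <- (Z2Nat.id m) at 2 by auto.
    replace (Z.abs_nat m) with (Z.to_nat m) by lia.
    rewrite <- INR_IZR_INZ; induction (Z.to_nat m) as [|k IH].
    - simpl; rewrite Rmult_0_r, Ropp_0, exp_0; auto.
    - rewrite S_INR; simpl; rewrite IH, <- exp_plus; f_equal; ring. }
  assert (En : forall m, eps_pow (exp (- (2 * d))) (- m) = eps_pow (exp (- (2 * d))) m).
  { intros m; unfold eps_pow; f_equal; lia. }
  rewrite !co_Kop by auto.
  destruct (Z_le_dec 0 (- n)) as [H1|H1], (Z_le_dec 0 n) as [H2|H2]; try lia.
  - replace n with 0%Z by lia; simpl; rewrite Rmult_0_r, Ropp_0, exp_0; ring.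
  - rewrite <- (En n), E by lia; rewrite opp_IZR, <- Rmult_assoc, exp_cancel by ring; ring.
  - rewrite Z.opp_involutive, En, E by lia; ring.
Qed.

(** Ties the operator in [Eqn] to the geometry: symmetrising the coefficients of the primitive takes
    the real part of its trace on the surface. *)
Lemma evw_Yop d a x : 0 < d -> analytic a ->
  evw (Yop (exp (- (2 * d))) a) x = RtoC (Re (ev (prim (Kop (exp (- (2 * d))) a)) (x, 0))).
Proof.
  intros Hd Ha; set (e := exp (- (2 * d))).
  assert (He : 0 <= e <= 1).
  { split; [left; apply exp_pos|unfold e; rewrite <- exp_0; apply exp_mono; lra]. }
  set (p := prim (Kop e a)).
  assert (En : forall n, eps_pow e (- n) = eps_pow e n) by (intros m; unfold eps_pow; f_equal; lia).
  assert (E : forall n, Yop e a n = / 2 * (p n + p (- n)%Z)).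
  { intros n; rewrite co_Yop by auto; unfold p, prim; rewrite !co_Kop by auto.
    destruct (Z.eq_dec n 0), (Z.eq_dec (- n) 0); try lia; [ring|].
    assert (Hn : IZR n <> 0) by now apply not_0_IZR.
    rewrite opp_IZR, Z.opp_involutive, En.
    destruct (Z_le_dec 0 n), (Z_le_dec 0 (- n)); try lia.
    - rewrite Z.abs_eq by auto; field; auto.
    - rewrite Z.abs_neq, opp_IZR by lia; field; auto. }
  assert (Sp : sm p 0) by (apply sm_prim, W_sm0).
  assert (sC : summable (fun n => p n * eC n (x, 0))) by now apply sm_C.
  unfold evw, ev, RtoC; simpl; f_equal.
  - rewrite (Sum_ext _ (fun n => / 2 * (p n * eC n (x, 0)) + / 2 * (p (- n)%Z * eC (- n) (x, 0)))).
    + assert (sC' : summable (fun n => p (- n)%Z * eC (- n) (x, 0))).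
      { apply (summable_inj Z.opp (fun n => p n * eC n (x, 0))); [lia|auto]. }
      rewrite Sum_plus, !Sum_scal; auto using summable_scal.
      rewrite (Sum_reindex Z.opp Z.opp (fun n => p n * eC n (x, 0))); auto; try (intros; lia); field.
    + intros n; rewrite E, eC_opp; simpl; rewrite Rmult_0_r, Ropp_0, exp_0; ring.
  - rewrite Sum_odd; [ring|apply (sm_S _ (x, 0)), W_sm0|].
    intros n; rewrite !E, eS_opp, Z.opp_involutive; simpl; rewrite Rmult_0_r, Ropp_0, exp_0; ring.
Qed.

(** The derivative is [1 + ev a - a 0], which is [ev a] when [a 0 = 1]; this normalisation makes
    [z - w] periodic with period [2 * PI]. *)
Definition zmap (a : Z -> R) (yc : R) (w : C) : C := (w + (Ci * ev (prim a) w + (0, yc)))%C.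

Lemma Re_potential (v w : C) (r : R) : Im ((v + RtoC r) * w)%C = 0 -> Re (- Ci * (v * w))%C + r * Im w = 0.
Proof. destruct v, w; simpl; lra. Qed.

(** The single complex equation returns both surface conditions: positivity of [q - 2 G y] forces
    [V Z] to be real, so the surface is a streamline, and moduli give Bernoulli's law where [Z] does
    not vanish. *)
Lemma flow_of_solution d yc G q (Zp up : W) : 0 < d -> analytic Zp -> analytic up -> Zp 0%Z = 1 ->
  let e := exp (- (2 * d)) in
  let a := co (Kop e Zp) in
  let b := co (Kop e up) in
  Eqn G e Zp up (cst q) = cst 0 ->
  (forall x, ev a (x, 0) <> RtoC 0) ->
  (forall x, 0 < q - 2 * G * Re (ev (prim a) (x, 0))) ->
  exists P, flow d Lr yc G q (zmap a yc) (ev a) (fun w => - Ci * ev (da a) w)%C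
    (ev b) (fun w => - Ci * ev (da b) w)%C P.
Proof.
  intros Hd aZ au Z1' e a b HE HZ Hq.
  assert (He : 0 <= e <= 1).
  { split; [left; apply exp_pos|unfold e; rewrite <- exp_0; apply exp_mono; lra]. }
  assert (HL := Lr_pos).
  assert (Ka : Ksym d a) by now apply Ksym_Kop.
  assert (Kb : Ksym d b) by now apply Ksym_Kop.
  assert (sL : forall f : W, Ksym d f -> sm f Lr /\ sm f (- (2 * d) - Lr)).
  { intros f Hf; split; [apply W_sm; rewrite Rabs_pos_eq; lra|apply sm_reflect; auto].
    apply W_sm; rewrite Rabs_pos_eq; lra. }
  destruct (sL (Kop e Zp) Ka) as [sa1 sa2]; destruct (sL (Kop e up) Kb) as [sb1 sb2]; fold a in sa1, sa2; fold b in sb1, sb2.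
  set (s := cv a b).
  assert (ss1 : sm s Lr) by now apply sm_cv.
  assert (ss2 : sm s (- (2 * d) - Lr)) by now apply sm_cv.
  assert (sa0 : sm a 0) by apply W_sm0.
  assert (sb0 : sm b 0) by apply W_sm0.
  assert (Ks : Ksym d s) by now apply Ksym_cv.
  assert (bt : forall f y, sm f Lr -> sm f (- (2 * d) - Lr) -> - d - Lr < y < Lr -> sm f y).
  { intros f y H1 H2 Hy; apply (sm_between f (- (2 * d) - Lr) Lr); auto; lra. }
  assert (a0 : a 0%Z = 1) by (unfold a; rewrite co_Kop by auto; exact Z1').
  assert (dz : forall w, - d - Lr < Im w < Lr -> is_cderive (zmap a yc) w (ev a w)).
  { intros w Hw; rewrite (ev_split a w) by (apply bt; auto); rewrite a0.
    replace (RtoC 1 + ev (da (prim a)) w)%C with (RtoC 1 + (Ci * (- Ci * ev (da (prim a)) w) + RtoC 0))%C.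
    - apply (cderive_plus (fun w => w)); [apply cderive_id|].
      apply (cderive_plus (fun w => Ci * ev (prim a) w)%C); [|apply cderive_const].
      apply cderive_scal, (ev_derive _ (- (2 * d) - Lr) Lr); auto using sm_prim; lra.
    - replace (Ci * (- Ci * ev (da (prim a)) w))%C with (- (Ci * Ci) * ev (da (prim a)) w)%C by ring.
      replace (Ci * Ci)%C with (- RtoC 1)%C by (unfold Ci, Copp, Cmult, RtoC; simpl; f_equal; ring).
      ring. }
  assert (dP : forall w, - d - Lr < Im w < Lr -> is_cderive (evp s) w (- Ci * (ev b w * ev a w))%C).
  { intros w Hw; replace (ev b w * ev a w)%C with (ev s w).
    - apply (evp_derive _ (- (2 * d) - Lr) Lr); auto; lra.
    - unfold s; rewrite ev_cv by (apply bt; auto); ring. }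
  set (y := fun x => Re (ev (prim a) (x, 0))).
  assert (Imz : forall x, Im (zmap a yc (x, 0)) = y x + yc) by (intros x; unfold zmap, y; simpl; ring).
  (* On the surface, [(V Z)^2 = (q - 2 G y) |Z|^2 > 0] where [V = u + y]. *)
  assert (Bern : forall x, let V := (ev b (x, 0) + RtoC (y x))%C in
    (ev a (x, 0) * (V * V))%C = (RtoC (q - 2 * G * y x) * Cconj (ev a (x, 0)))%C).
  { intros x V; assert (E := f_equal (fun f => evw f x) HE); cbv beta in E.
    Transparent Eqn. unfold Eqn, Vop in E. Opaque Eqn.
    rewrite !evw_add, !evw_opp, !evw_mul, !evw_add, !evw_opp, !evw_mul, evw_star, !evw_cst in E.
    unfold e in E; rewrite evw_Yop in E by auto; fold e in E.
    change (evw (Kop e Zp) x) with (ev a (x, 0)) in E; change (evw (Kop e up) x) with (ev b (x, 0)) in E.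
    fold a in E; fold (y x) in E.
    unfold V; rewrite RtoC_minus, !RtoC_mult; rewrite RtoC_mult in E.
    rewrite <- (Cplus_0_r (_ * Cconj _)%C), <- E; ring. }
  assert (VZ : forall x, Im ((ev b (x, 0) + RtoC (y x)) * ev a (x, 0))%C = 0).
  { intros x; specialize (Bern x); simpl in Bern; specialize (Hq x); fold (y x) in Hq.
    set (V := (ev b (x, 0) + RtoC (y x))%C) in *; set (Zx := ev a (x, 0)) in *.
    assert (E : (V * Zx * (V * Zx))%C = RtoC ((q - 2 * G * y x) * Cmod Zx ^ 2)).
    { replace (V * Zx * (V * Zx))%C with (Zx * (Zx * (V * V)))%C by ring; rewrite Bern.
      rewrite RtoC_mult, Cmod2_conj; ring. }
    assert (Hp : 0 <= (q - 2 * G * y x) * Cmod Zx ^ 2) by (apply Rmult_le_pos; [lra|apply pow2_ge_0]).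
    destruct (V * Zx)%C as [c1 c2]; unfold Cmult, RtoC in E; simpl in E; injection E as E1 E2.
    simpl; assert (c1 * c2 = 0) by lra.
    destruct (Req_dec c2 0) as [|Hc2]; auto.
    assert (c1 = 0) by (apply Rmult_integral in H; tauto).
    subst; nra. }
  (* The additive constant of the potential for which the stream function vanishes on the
     surface. *)
  set (k0 := Re (evp s (0, 0)) + / 2 * (y 0) ^ 2).
  exists (fun w => evp s w - RtoC k0)%C.
  assert (dP' : forall w, - d - Lr < Im w < Lr -> is_cderive (fun w => evp s w - RtoC k0)%C w (- Ci * (ev b w * ev a w))%C).
  { intros w Hw; replace (- Ci * (ev b w * ev a w))%C with (- Ci * (ev b w * ev a w) + RtoC 0)%C by ring.
    apply (cderive_plus (evp s)); [now apply dP|apply cderive_const]. }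
  assert (Ptop : forall x, Re (evp s (x, 0) - RtoC k0)%C + / 2 * y x ^ 2 = 0).
  { intros x; set (F := fun x => Re (evp s (x, 0) - RtoC k0)%C + / 2 * y x ^ 2).
    assert (dF : forall x, is_derive F x 0).
    { intros t.
      assert (D1 := proj1 (cderive_alpha _ t 0 _ (dP' (t, 0) ltac:(simpl; lra)))).
      assert (D2 := proj2 (cderive_alpha _ t 0 _ (dz (t, 0) ltac:(simpl; lra)))).
      assert (D3 : is_derive y t (Im (ev a (t, 0)))).
      { apply (is_derive_ext (fun t => Im (zmap a yc (t, 0)) - yc)); [intros r; rewrite Imz; simpl; ring|].
        replace (Im (ev a (t, 0))) with (minus (Im (ev a (t, 0))) 0) by (unfold minus, plus, opp; simpl; ring).
        apply (is_derive_minus (V := R_NormedModule)); [exact D2|apply (is_derive_const (V := R_NormedModule))]. }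
      assert (D4 : is_derive (fun t => / 2 * y t ^ 2) t (y t * Im (ev a (t, 0)))).
      { auto_derive; [exists (Im (ev a (t, 0))); exact D3|].
        replace (Derive _ t) with (Im (ev a (t, 0))) by (symmetry; apply is_derive_unique; exact D3); field. }
      replace 0 with (plus (Re (- Ci * (ev b (t, 0) * ev a (t, 0)))%C) (y t * Im (ev a (t, 0)))).
      - apply (is_derive_plus (V := R_NormedModule)); [exact D1|exact D4].
      - exact (Re_potential _ _ _ (VZ t)). }
    assert (HF : F x = F 0).
    { destruct (MVT_gen F 0 x (fun _ => 0)) as (c & _ & E).
      - intros t _; apply dF.
      - intros t _; apply derivable_continuous_pt; exists 0; apply is_derive_Reals, dF.
      - lra. }
    change (F x = 0); rewrite HF; unfold F, k0; simpl; ring. }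
  assert (Pbot : forall x, Re (evp s (x, (- d)%R) - RtoC k0)%C = - d * s 0%Z - k0).
  { intros x; unfold evp.
    assert (E := Kasym_bottom d (prim s) x (Ksym_prim d s Ks) ltac:(apply sm_prim, bt; auto; lra)).
    transitivity (- d * s 0%Z + Re (ev (prim s) (x, - d)) - k0); [simpl; ring|rewrite E; ring]. }
  constructor; auto.
  - intros w Hw; apply (ev_derive _ (- (2 * d) - Lr) Lr); auto; lra.
  - intros w Hw; apply (ev_derive _ (- (2 * d) - Lr) Lr); auto; lra.
  - intros w Hw; eexists; apply cderive_scal.
    (* Summability of [da b] holds only strictly inside the strip, so [u'] is differentiated in a
       narrower band around [Im w]. *)
    set (g := Rmin (Lr - Im w) (d + Lr + Im w) / 2).
    assert (0 < Rmin (Lr - Im w) (d + Lr + Im w)) by (apply Rmin_glb_lt; lra).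
    generalize (Rmin_l (Lr - Im w) (d + Lr + Im w)) (Rmin_r (Lr - Im w) (d + Lr + Im w)); intros.
    apply (ev_derive _ (Im w - g) (Im w + g)); [| |unfold g; lra];
      apply (sm_da b (- (2 * d) - Lr) Lr); auto; unfold g; lra.
  - intros x t; unfold zmap; rewrite ev_period; unfold Cplus, RtoC; simpl; f_equal; ring.
  - intros x t; apply ev_period.
  - intros x t; apply ev_period.
  - intros x t; unfold evp; rewrite ev_period; simpl; ring.
  - intros x t Ht; unfold zmap; destruct (ev_even (prim a) x t) as [E1 E2]; [apply sm_prim, bt; auto|].
    split.
    + transitivity (- x - Im (ev (prim a) (- x, t))); [simpl; ring|rewrite E2; simpl; ring].
    + transitivity (t + Re (ev (prim a) (- x, t)) + yc); [simpl; ring|rewrite E1; simpl; ring].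
  - intros x t Ht; apply ev_even, bt; auto.
  - intros x t Ht; unfold evp; destruct (ev_even (prim s) x t) as [E1 E2]; [apply sm_prim, bt; auto|].
    transitivity (t * s 0%Z + Re (ev (prim s) (- x, t)) - k0); [simpl; ring|rewrite E1; simpl; ring].
  - intros x; unfold zmap.
    assert (E := Kasym_bottom d (prim a) x (Ksym_prim d a Ka) ltac:(apply sm_prim, bt; auto; lra)).
    transitivity (- d + Re (ev (prim a) (x, - d)) + yc); [simpl; ring|rewrite E; ring].
  - intros x; rewrite !Pbot; auto.
  - intros x; rewrite Imz; replace (y x + yc - yc) with (y x) by ring; apply Ptop.
  - intros x; rewrite Imz; replace (y x + yc - yc) with (y x) by ring.
    specialize (Bern x); simpl in Bern; specialize (Hq x); fold (y x) in Hq; specialize (HZ x).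
    apply (f_equal Cmod) in Bern; rewrite !Cmod_mult, Cmod_conj, Cmod_R, Rabs_pos_eq in Bern by lra.
    apply Cmod_gt_0 in HZ.
    assert (E : Cmod (ev b (x, 0) + RtoC (y x))%C ^ 2 = q - 2 * G * y x).
    { apply Rmult_eq_reg_l with (Cmod (ev a (x, 0))); [|lra]; simpl; lra. }
    rewrite <- E; set (V := ev b (x, 0)); unfold Cmod; rewrite pow2_sqrt.
    + destruct V as [v1 v2]; simpl; ring.
    + apply Rplus_le_le_0_compat; apply pow2_ge_0.
Qed.

(** * The touching Crapper wave *)

(** [DA = |1 + A t|^2] on the circle, and [XA] is the abscissa of Crapper's surface. Its critical
    points are given by [2 A |sin x| = 1 - A^2]. *)
Definition DA (A x : R) : R := 1 + A * A + 2 * A * cos x.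
Definition XA (A x : R) : R := x - 4 * A * sin x / DA A x.
Definition XA' (A x : R) : R := ((1 - A * A) * (1 - A * A) - 4 * (A * A) * (sin x * sin x)) / (DA A x * DA A x).

Lemma DA_pos A x : 0 < A < 1 -> (1 - A) * (1 - A) <= DA A x.
Proof. intros HA; unfold DA; generalize (COS_bound x); nra. Qed.

Lemma DA_pos' A x : 0 < A < 1 -> 0 < DA A x.
Proof. intros HA; generalize (DA_pos A x HA); nra. Qed.

Lemma DA_le A x : 0 < A < 1 -> DA A x <= 4.
Proof. intros HA; unfold DA; generalize (COS_bound x); nra. Qed.

Lemma XA_derive A x : 0 < A < 1 -> is_derive (XA A) x (XA' A x).
Proof.
  intros HA; generalize (DA_pos' A x HA); unfold XA, XA', DA; intros HD.
  auto_derive; [lra|].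
  assert (E : sin x * sin x = 1 - cos x * cos x) by (generalize (sin2_cos2 x); unfold Rsqr; lra).
  apply Rmult_eq_reg_r with ((1 + A * A + 2 * A * cos x) * (1 + A * A + 2 * A * cos x)); [|nra].
  field_simplify; try lra.
  replace (sin x ^ 2) with (1 - cos x * cos x) by (rewrite <- E; ring); ring.
Qed.

Lemma XA_pi A : XA A PI = PI.
Proof. unfold XA; rewrite sin_PI; unfold Rdiv; ring. Qed.

Lemma XA_0 A : XA A 0 = 0.
Proof. unfold XA; rewrite sin_0; unfold Rdiv; ring. Qed.

Lemma PI_upper : PI < 3.39.
Proof.
  generalize (proj2 (PI_ineq 2)); unfold tg_alt, PI_tg; simpl; lra.
Qed.

Lemma PI_lower : 3 < PI.
Proof. generalize PI2_3_2; lra. Qed.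

Lemma sin_gt_of_between x th : PI / 2 < th < PI -> PI - th < x < th -> sin th < sin x.
Proof.
  intros Hth Hx; destruct (Rle_dec x (PI / 2)).
  - rewrite <- (sin_PI_x th); apply sin_increasing_1; lra.
  - apply sin_decreasing_1; lra.
Qed.

Lemma sin_lt_outside x th : PI / 2 < th < PI -> 0 <= x < PI - th \/ th < x <= PI -> 0 <= sin x < sin th.
Proof.
  intros Hth Hx; split; [apply sin_ge_0; lra|destruct Hx].
  - rewrite <- (sin_PI_x th); apply sin_increasing_1; lra.
  - apply sin_decreasing_1; lra.
Qed.

(** The surface must meet the axis with vertical tangent, two equations in [A] and [th]. The
    tangency equation is solved for [A], and the other one by intermediate values in [th]. *)
Lemma touching_parameter : exists A th, 0 < A < 1 / 2 /\ PI / 2 < th < PI /\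
  1 - A * A = 2 * A * sin th /\ XA A th = 0.
Proof.
  (* The positive root of [A^2 + 2 A sin th - 1 = 0], the tangency equation. *)
  set (Af := fun th => - sin th + sqrt (sin th * sin th + 1)).
  assert (HAf : forall th, 1 - Af th * Af th = 2 * Af th * sin th).
  { intros th; unfold Af; set (r := sqrt _).
    assert (r * r = sin th * sin th + 1) by (apply sqrt_sqrt; generalize (Rle_0_sqr (sin th)); unfold Rsqr; lra).
    nra. }
  assert (Apos : forall th, 0 < Af th).
  { intros th; unfold Af; set (r := sqrt _).
    assert (r * r = sin th * sin th + 1) by (apply sqrt_sqrt; generalize (Rle_0_sqr (sin th)); unfold Rsqr; lra).
    assert (0 <= r) by apply sqrt_pos.
    destruct (Rlt_le_dec (sin th) r); [lra|nra]. }
  (* [sin th1 = 3 / 4] corresponds to [A = 1 / 2], the upper limit of the admissible parameters. *)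
  set (th1 := PI - asin (3 / 4)).
  assert (as1 : PI / 4 < asin (3 / 4) < PI / 2).
  { split.
    - assert (sqrt 2 < 3 / 2) by (apply Rsqr_incrst_0; [rewrite Rsqr_sqrt; unfold Rsqr; lra|apply sqrt_pos|lra]).
      assert (0 < sqrt 2) by (apply sqrt_lt_R0; lra).
      assert (1 / sqrt 2 < 3 / 4).
      { apply Rmult_lt_reg_r with (sqrt 2); [lra|].
        replace (1 / sqrt 2 * sqrt 2) with 1 by (field; lra).
        assert (sqrt 2 * sqrt 2 = 2) by (apply sqrt_sqrt; lra); nra. }
      assert (Hb := asin_bound (3 / 4)); assert (PP := PI_RGT_0).
      apply Rnot_le_lt; intros Hle; apply sin_incr_1 in Hle; try lra.
      rewrite sin_asin, sin_PI4 in Hle; lra.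
    - apply asin_bound_lt; lra. }
  assert (Hth1 : sin th1 = 3 / 4) by (unfold th1; rewrite sin_PI_x, sin_asin; lra).
  assert (Al : forall th, sin th > 3 / 4 -> Af th < 1 / 2).
  { intros th H; specialize (HAf th); specialize (Apos th); nra. }
  assert (Al1 : forall th, sin th > 0 -> Af th < 1).
  { intros th H; specialize (HAf th); specialize (Apos th); nra. }
  assert (PL := PI_lower); assert (PU := PI_upper).
  assert (Fl : 0 < XA (Af (PI / 2)) (PI / 2)).
  { assert (E1 := HAf (PI / 2)); assert (P1 := Apos (PI / 2)).
    unfold XA, DA; rewrite cos_PI2, sin_PI2 in *.
    set (a := Af (PI / 2)) in *.
    assert (4 * a * 1 / (1 + a * a + 2 * a * 0) < 3 / 2); [|lra].
    apply Rmult_lt_reg_r with (1 + a * a + 2 * a * 0); [nra|].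
    unfold Rdiv; rewrite Rmult_assoc, Rinv_l by nra; nra. }
  assert (Fr : XA (Af th1) th1 < 0).
  { assert (E1 := HAf th1); assert (P1 := Apos th1); rewrite Hth1 in E1.
    assert (Ea : Af th1 = 1 / 2) by nra.
    unfold XA, DA; rewrite Hth1, Ea.
    assert (Ec : cos th1 * cos th1 = 7 / 16) by (generalize (sin2_cos2 th1); rewrite Hth1; unfold Rsqr; lra).
    assert (Hc : cos th1 < 0) by (apply cos_lt_0; unfold th1; lra).
    assert (Hc1 : cos th1 < - (661 / 1000)) by nra.
    assert (Hc2 : - 1 <= cos th1) by apply COS_bound.
    (* [cos th1 = - sqrt 7 / 4] makes the quotient slightly larger than 2.545, whereas
       [th1 < 3 PI / 4 < 2.5425]. *)
    assert (2.545 < 4 * (1 / 2) * (3 / 4) / (1 + 1 / 2 * (1 / 2) + 2 * (1 / 2) * cos th1)).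
    { apply Rmult_lt_reg_r with (1 + 1 / 2 * (1 / 2) + 2 * (1 / 2) * cos th1); [lra|].
      unfold Rdiv; rewrite (Rmult_assoc _ (/ (1 + _ + _))), Rinv_l by lra; lra. }
    assert (th1 < 2.5425) by (unfold th1; lra); lra. }
  destruct (IVT_interv (fun th => - XA (Af th) th) (PI / 2) th1) as (th & Hth & E); [| |lra|lra|].
  - intros th Hth.
    assert (Hs : 0 < sin th) by (apply sin_gt_0; unfold th1 in Hth; lra).
    assert (HD := DA_pos' (Af th) th (conj (Apos th) (Al1 th Hs))).
    apply continuity_pt_filterlim, (ex_derive_continuous (fun th => - XA (Af th) th)).
    unfold XA, DA, Af in *; auto_derive; repeat split; auto; try lra;
      generalize (Rle_0_sqr (sin th)); unfold Rsqr; lra.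
  - unfold th1; lra.
  - assert (Hne1 : th <> PI / 2) by (intros ->; lra).
    assert (Hne2 : th <> th1) by (intros ->; lra).
    exists (Af th), th.
    assert (Hsin : 3 / 4 < sin th).
    { rewrite <- Hth1; apply sin_decreasing_1; unfold th1 in *; lra. }
    repeat split; auto; try (unfold th1 in *; lra).
Qed.

Lemma increasing_of_derive f f' a b : a < b -> (forall x, is_derive f x (f' x)) ->
  (forall x, a < x < b -> 0 < f' x) -> f a < f b.
Proof.
  intros Hab Hd Hp.
  destruct (MVT_cor2 f f' a b Hab) as (c & E & Hc); [intros; apply is_derive_Reals, Hd|].
  specialize (Hp c Hc); nra.
Qed.

Lemma XA'_sign A th x : 0 < A < 1 -> 1 - A * A = 2 * A * sin th ->
  XA' A x = 4 * (A * A) * (sin th * sin th - sin x * sin x) / (DA A x * DA A x).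
Proof. intros HA E; unfold XA'; rewrite E; f_equal; ring. Qed.

(** The sign of [XA'] is that of [sin^2 th - sin^2 x]: the abscissa rises from 0 until [PI - th],
    falls back to 0 at [th], and rises again. *)
Lemma XA_positive A th x : 0 < A < 1 -> PI / 2 < th < PI -> 1 - A * A = 2 * A * sin th -> XA A th = 0 ->
  0 < x < PI -> x <> th -> 0 < XA A x.
Proof.
  intros HA Hth E E0 Hx Hne.
  assert (dX : forall y, is_derive (XA A) y (XA' A y)) by (intros; now apply XA_derive).
  assert (pos : forall y, sin y * sin y < sin th * sin th -> 0 < XA' A y).
  { intros y Hy; rewrite (XA'_sign A th) by auto; assert (HD := DA_pos' A y HA).
    assert (0 < A * A) by nra; apply Rdiv_lt_0_compat; [apply Rmult_lt_0_compat; lra|nra]. }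
  assert (neg : forall y, sin th * sin th < sin y * sin y -> XA' A y < 0).
  { intros y Hy; rewrite (XA'_sign A th) by auto; assert (HD := DA_pos' A y HA).
    apply Ropp_lt_cancel; rewrite Ropp_0.
    replace (- (4 * (A * A) * (sin th * sin th - sin y * sin y) / (DA A y * DA A y))) with
      (4 * (A * A) * (sin y * sin y - sin th * sin th) / (DA A y * DA A y)) by (field; lra).
    assert (0 < A * A) by nra; apply Rdiv_lt_0_compat; [apply Rmult_lt_0_compat; lra|nra]. }
  assert (Hsth : 0 < sin th) by (apply sin_gt_0; lra).
  destruct (Rle_dec x (PI - th)) as [H1|H1].
  - rewrite <- (XA_0 A); apply (increasing_of_derive _ (XA' A)); auto; [lra|].
    intros y Hy; apply pos; destruct (sin_lt_outside y th Hth); [lra|nra].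
  - destruct (Rlt_dec x th) as [H2|H2].
    + rewrite <- E0; apply Ropp_lt_cancel, (increasing_of_derive (fun y => - XA A y) (fun y => - XA' A y)); auto.
      * intros y; apply (is_derive_opp (V := R_NormedModule) (XA A)), dX.
      * intros y Hy; assert (K : XA' A y < 0); [|lra].
        apply neg; assert (K := sin_gt_of_between y th Hth ltac:(lra)); nra.
    + rewrite <- E0; apply (increasing_of_derive _ (XA' A)); auto; [lra|].
      intros y Hy; apply pos; destruct (sin_lt_outside y th Hth); [lra|nra].
Qed.

(** * Perturbation estimates *)

Definition C2 : R := 4 / (Lr * Lr).

Lemma C2_pos : 0 < C2.
Proof. generalize Lr_pos; intros; apply Rdiv_lt_0_compat; nra. Qed.

Lemma sq_le_wt n : IZR n * IZR n <= C2 * wt n.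
Proof.
  assert (HL := Lr_pos).
  assert (E := exp_quad (Lr * Rabs (IZR n)) ltac:(apply Rmult_le_pos; [lra|apply Rabs_pos])).
  fold (wt n) in E; unfold C2; apply Rmult_le_reg_l with (Lr * Lr); [nra|].
  replace (Lr * Lr * (4 / (Lr * Lr) * wt n)) with (4 * wt n) by (field; lra).
  replace (IZR n * IZR n) with (Rabs (IZR n) * Rabs (IZR n)); [nra|].
  rewrite <- Rabs_mult; apply Rabs_pos_eq, Rle_0_sqr.
Qed.

#[global] Opaque C2.

Lemma abs_le_sq n : Rabs (IZR n) <= IZR n * IZR n.
Proof. rewrite <- abs_IZR, <- mult_IZR; apply IZR_le; nia. Qed.

Lemma Sum_mult_bound (a : W) f K : 0 <= K -> (forall n, Rabs (a n * f n) <= K * (Rabs (a n) * wt n)) ->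
  summable (fun n => a n * f n) /\ Rabs (Sum (fun n => a n * f n)) <= K * nrm a.
Proof.
  intros HK H.
  assert (S : summable (fun n => a n * f n)).
  { apply (summable_le _ _ H), summable_scal, W_abs_summable. }
  split; auto.
  eapply Rle_trans; [apply Sum_abs, S|].
  unfold nrm; rewrite <- Sum_scal by apply W_abs_summable.
  apply Sum_le; auto; [now apply summable_abs|apply summable_scal, W_abs_summable].
Qed.

Lemma sin_nat_bound (n : Z) x : Rabs (sin (IZR n * x)) <= Rabs (IZR n) * Rabs (sin x).
Proof.
  assert (K : forall k : nat, Rabs (sin (INR k * x)) <= INR k * Rabs (sin x)).
  { induction k as [|k IH]; [simpl; rewrite Rmult_0_l, sin_0, Rabs_R0; lra|].
    rewrite S_INR, Rmult_plus_distr_r, Rmult_1_l, sin_plus.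
    eapply Rle_trans; [apply Rabs_triang|]; rewrite !Rabs_mult.
    assert (c1 := Rabs_le _ _ (COS_bound x)); assert (c2 := Rabs_le _ _ (COS_bound (INR k * x))).
    assert (p1 := Rabs_pos (sin (INR k * x))); assert (p2 := Rabs_pos (sin x)).
    assert (d1 := Rmult_le_compat_l _ _ 1 p1 c1); assert (d2 := Rmult_le_compat_r _ _ 1 p2 c2); lra. }
  destruct (Z_le_dec 0 n).
  - rewrite (Rabs_pos_eq (IZR n)) by (apply (IZR_le 0); auto).
    rewrite <- (Z2Nat.id n), <- INR_IZR_INZ by auto; apply K.
  - replace (IZR n * x) with (- (IZR (- n) * x)) by (rewrite opp_IZR; ring).
    rewrite sin_neg, Rabs_Ropp, <- (Rabs_Ropp (IZR n)), <- opp_IZR.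
    rewrite (Rabs_pos_eq (IZR (- n))) by (apply (IZR_le 0); lia).
    rewrite <- (Z2Nat.id (- n)), <- INR_IZR_INZ by lia; apply K.
Qed.

(** [PS a x] is the horizontal displacement of the surface point with parameter [x]. *)
Definition PS (a : W) (x : R) : R := Sum (fun n => prim a n * sin (IZR n * x)).

(** The factor [|sin x|], from [|sin (n x)| <= |n| |sin x|], matters at the ends of the half period:
    near 0 the abscissa itself is only of this size. *)
Lemma PS_bound (a : W) x : summable (fun n => prim a n * sin (IZR n * x)) /\ Rabs (PS a x) <= Rabs (sin x) * nrm a.
Proof.
  unfold PS.
  assert (E : (fun n => prim a n * sin (IZR n * x)) = fun n => a n * (if Z.eq_dec n 0 then 0 else sin (IZR n * x) / IZR n)).
  { apply functional_extensionality; intros n; unfold prim; destruct Z.eq_dec; [ring|unfold Rdiv; ring]. }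
  rewrite E; apply Sum_mult_bound; [apply Rabs_pos|].
  intros n; rewrite Rabs_mult, (Rmult_comm (Rabs (sin x))), Rmult_assoc; apply Rmult_le_compat_l; [apply Rabs_pos|].
  assert (Hw := wt_ge_1 n); assert (Hs := Rabs_pos (sin x)).
  destruct Z.eq_dec as [|Hn]; [rewrite Rabs_R0; nra|].
  unfold Rdiv; rewrite Rabs_mult, Rabs_inv.
  assert (Hn' : 1 <= Rabs (IZR n)) by (rewrite <- abs_IZR; now apply IZR_abs_ge_1).
  apply Rle_trans with (Rabs (IZR n) * Rabs (sin x) * / Rabs (IZR n)).
  - apply Rmult_le_compat_r; [left; apply Rinv_0_lt_compat; lra|apply sin_nat_bound].
  - replace (Rabs (IZR n) * Rabs (sin x) * / Rabs (IZR n)) with (Rabs (sin x)) by (field; lra); nra.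
Qed.

Lemma PS_add a b x : PS (a + b) x = PS a x + PS b x.
Proof.
  unfold PS; rewrite <- Sum_plus by apply PS_bound.
  apply Sum_ext; intros n; unfold prim; rewrite co_add; destruct Z.eq_dec; [ring|unfold Rdiv; ring].
Qed.

Lemma PS_opp (a : W) x : PS (- a) x = - PS a x.
Proof.
  unfold PS; rewrite (Sum_ext _ (fun n => -1 * (prim a n * sin (IZR n * x)))).
  - rewrite Sum_scal by apply PS_bound; ring.
  - intros n; unfold prim; rewrite co_opp; destruct Z.eq_dec; [ring|unfold Rdiv; ring].
Qed.

Lemma PS_cst_mul c a x : PS (cst c * a) x = c * PS a x.
Proof.
  unfold PS; rewrite <- Sum_scal by apply PS_bound.
  apply Sum_ext; intros n; unfold prim; rewrite co_cst_mul; destruct Z.eq_dec; [ring|unfold Rdiv; ring].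
Qed.

Lemma PS_diff a b x : Rabs (PS a x - PS b x) <= Rabs (sin x) * nrm (a - b).
Proof.
  replace (PS a x - PS b x) with (PS (a - b) x) by (rewrite PS_add, PS_opp; ring); apply PS_bound.
Qed.

Lemma Im_evw a x : Im (evw a x) = - Sum (fun n => a n * sin (IZR n * x)).
Proof. unfold evw, ev, eS; simpl; f_equal; apply Sum_ext; intros; rewrite Rmult_0_r, exp_0; ring. Qed.

Lemma Re_evw a x : Re (evw a x) = Sum (fun n => a n * cos (IZR n * x)).
Proof. unfold evw, ev, eC; simpl; apply Sum_ext; intros; rewrite Rmult_0_r, exp_0; ring. Qed.

Lemma evw_eA A x : 0 < A < 1 / 2 -> evw (eA A) x = ((1 + A * cos x) / DA A x, A * sin x / DA A x).
Proof.
  intros HA; unfold eA; rewrite evw_geo by now apply HA_abs'.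
  assert (HD := DA_pos' A x ltac:(lra)).
  assert (E : (1 - (- A)%R * zeta x)%C = (1 + A * cos x, - (A * sin x))).
  { unfold zeta, Cminus, Cplus, Copp, Cmult, RtoC; simpl; f_equal; ring. }
  assert (ED : (1 + A * cos x) * (1 + A * cos x) + A * sin x * (A * sin x) = DA A x).
  { generalize (sin2_cos2 x); unfold Rsqr, DA; intros Q.
    replace (A * sin x * (A * sin x)) with (A * A * (1 - cos x * cos x)) by (rewrite <- Q; ring); ring. }
  rewrite E; unfold Cinv; simpl.
  replace ((1 + A * cos x) * ((1 + A * cos x) * 1) + - (A * sin x) * (- (A * sin x) * 1)) with (DA A x) by (rewrite <- ED; ring).
  f_equal; unfold Rdiv; ring.
Qed.

Lemma evw_Z0 A x : 0 < A < 1 / 2 ->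
  evw (Z0 A) x = (XA' A x, 4 * A * (1 - A * A) * sin x / (DA A x * DA A x)).
Proof.
  intros HA; assert (HD := DA_pos' A x ltac:(lra)).
  Transparent Z0. unfold Z0. Opaque Z0.
  unfold f0; rewrite !evw_mul, evw_add, evw_opp, evw_mul, !evw_cst, evw_t, evw_eA by auto.
  unfold zeta, XA'; generalize (sin2_cos2 x); unfold Rsqr; intros Q.
  assert (E : Cmult (Cplus (RtoC 1) (Copp (Cmult (RtoC A) (cos x, - sin x))))
     ((1 + A * cos x) / DA A x, A * sin x / DA A x) = ((1 - A * A) / DA A x, 2 * A * sin x / DA A x)).
  { unfold Cplus, Cmult, Copp, RtoC; simpl; f_equal; field_simplify_eq; try lra.
    replace (cos x ^ 2) with (1 - sin x ^ 2) by (simpl; lra); ring. }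
  rewrite E; unfold Cmult; simpl; f_equal; field; lra.
Qed.

Lemma PS_Z0 A x : 0 < A < 1 / 2 -> x + PS (Z0 A) x = XA A x.
Proof.
  intros HA; unfold PS, XA.
  rewrite (Sum_ext _ (fun n => 4 * (eA A n * sin (IZR n * x)))).
  - rewrite Sum_scal.
    + assert (E := Im_evw (eA A) x); rewrite evw_eA in E by auto; simpl in E.
      replace (Sum (fun n => eA A n * sin (IZR n * x))) with (- (A * sin x / DA A x)) by lra; unfold Rdiv; ring.
    + apply (summable_bounded_mult 1 (eA A) (fun n => sin (IZR n * x))); [|apply W_summable].
      intros; apply Rabs_le, SIN_bound.
  - intros n; unfold prim; rewrite co_Z0 by auto; destruct Z.eq_dec as [->|Hn].
    + rewrite !Rmult_0_l, sin_0; ring.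
    + field; now apply not_0_IZR.
Qed.

(** The rate at which the abscissa moves when [A] grows. It is negative over the whole open half
    period, so the tangent parameter opens or closes the neck. *)
Lemma PS_Z1 A x : 0 < A < 1 / 2 -> PS (Z1 A) x = - (4 * (1 - A * A) * sin x / (DA A x * DA A x)).
Proof.
  intros HA; unfold PS; assert (HD := DA_pos' A x ltac:(lra)).
  rewrite (Sum_ext _ (fun n => -4 * ((t * (eA A * eA A))%W n * sin (IZR n * x)))).
  - rewrite Sum_scal.
    + assert (E := Im_evw (t * (eA A * eA A)) x); rewrite !evw_mul, evw_t, evw_eA in E by auto.
      unfold zeta in E; simpl in E.
      replace (Sum (fun n => (t * (eA A * eA A))%W n * sin (IZR n * x))) with
        (- (cos x * ((1 + A * cos x) / DA A x * (A * sin x / DA A x) + A * sin x / DA A x * ((1 + A * cos x) / DA A x))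
          + - sin x * ((1 + A * cos x) / DA A x * ((1 + A * cos x) / DA A x) - A * sin x / DA A x * (A * sin x / DA A x)))) by lra.
      field_simplify_eq; [|lra].
      replace (sin x ^ 3) with (sin x * (1 - cos x ^ 2)); [ring|].
      generalize (sin2_cos2 x); unfold Rsqr; intros Q.
      replace (1 - cos x ^ 2) with (sin x * sin x) by (rewrite <- Q; ring); ring.
    + apply (summable_bounded_mult 1 (t * (eA A * eA A))%W (fun n => sin (IZR n * x))); [|apply W_summable].
      intros; apply Rabs_le, SIN_bound.
  - intros n; unfold prim; rewrite co_Z1 by auto; destruct Z.eq_dec as [->|Hn].
    + rewrite !Rmult_0_l, sin_0; ring.
    + field; now apply not_0_IZR.
Qed.

(** ** Sums in the strip *)

(** For analytic [a] and [y <= 0], [TC] and [- TS] are the real and imaginary parts of [ev a] at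
    height [y]. *)
Definition TS (a : W) (y x : R) : R := Sum (fun n => a n * (exp (IZR n * y) * sin (IZR n * x))).
Definition TC (a : W) (y x : R) : R := Sum (fun n => a n * (exp (IZR n * y) * cos (IZR n * x))).

Lemma exp_n_le n y : (0 < n)%Z -> y <= 0 -> exp (IZR n * y) <= exp y.
Proof. intros Hn Hy; apply exp_mono; assert (1 <= IZR n) by (apply (IZR_le 1); lia); nra. Qed.

Lemma TS_bound a y x : analytic a -> y <= 0 ->
  summable (fun n => a n * (exp (IZR n * y) * sin (IZR n * x))) /\
  Rabs (TS a y x) <= C2 * exp y * Rabs (sin x) * nrm a.
Proof.
  intros Ha Hy; assert (HC := C2_pos); assert (Hs := Rabs_pos (sin x)); assert (He := exp_pos y).
  apply Sum_mult_bound; [repeat apply Rmult_le_pos; lra|]; intros n.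
  rewrite Rabs_mult, (Rmult_comm (C2 * _ * _)), Rmult_assoc.
  destruct (Z_lt_dec n 0); [rewrite Ha, Rabs_R0, !Rmult_0_l by auto; lra|].
  apply Rmult_le_compat_l; [apply Rabs_pos|].
  destruct (Z.eq_dec n 0) as [->|Hn].
  - rewrite !Rmult_0_l, sin_0, Rmult_0_r, Rabs_R0; rewrite wt_0; repeat apply Rmult_le_pos; lra.
  - rewrite Rabs_mult, (Rabs_pos_eq (exp _)) by (left; apply exp_pos).
    generalize (exp_n_le n y ltac:(lia) Hy) (sin_nat_bound n x) (abs_le_sq n) (sq_le_wt n); intros H1 H2 H3 H4.
    apply Rle_trans with (exp y * (C2 * wt n * Rabs (sin x))); [|right; ring].
    apply Rmult_le_compat; auto; [left; apply exp_pos|apply Rabs_pos|].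
    eapply Rle_trans; [exact H2|]; apply Rmult_le_compat_r; lra.
Qed.

Lemma TC_bound a y x : analytic a -> y <= 0 ->
  summable (fun n => a n * (exp (IZR n * y) * cos (IZR n * x))) /\
  Rabs (TC a y x) <= nrm a /\ Rabs (TC a y x - a 0%Z) <= exp y * nrm a.
Proof.
  intros Ha Hy; assert (He := exp_pos y).
  destruct (Sum_mult_bound a (fun n => exp (IZR n * y) * cos (IZR n * x)) 1 ltac:(lra)) as [S B].
  { intros n; rewrite Rmult_1_l, Rabs_mult.
    destruct (Z_lt_dec n 0); [rewrite Ha, Rabs_R0, !Rmult_0_l by auto; lra|].
    apply Rmult_le_compat_l; [apply Rabs_pos|]; apply Rle_trans with 1; [|apply wt_ge_1].
    rewrite Rabs_mult, (Rabs_pos_eq (exp _)) by (left; apply exp_pos).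
    assert (exp (IZR n * y) <= 1).
    { rewrite <- exp_0; apply exp_mono; assert (0 <= IZR n) by (apply (IZR_le 0); lia); nra. }
    rewrite <- (Rmult_1_r 1); apply Rmult_le_compat; auto; [left; apply exp_pos|apply Rabs_pos|apply Rabs_le, COS_bound]. }
  split; [exact S|split; [unfold TC; lra|]].
  destruct (Sum_mult_bound a (fun n => if Z.eq_dec n 0 then 0 else exp (IZR n * y) * cos (IZR n * x)) (exp y) ltac:(lra)) as [S' B'].
  { intros n; rewrite Rabs_mult.
    destruct (Z_lt_dec n 0); [rewrite Ha, Rabs_R0, !Rmult_0_l by auto; lra|].
    rewrite (Rmult_comm (exp y)), Rmult_assoc.
    apply Rmult_le_compat_l; [apply Rabs_pos|]; apply Rle_trans with (exp y); [|generalize (wt_ge_1 n); nra].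
    destruct Z.eq_dec as [|Hn]; [rewrite Rabs_R0; lra|].
    rewrite Rabs_mult, (Rabs_pos_eq (exp _)) by (left; apply exp_pos).
    rewrite <- (Rmult_1_r (exp y)); apply Rmult_le_compat; [left; apply exp_pos|apply Rabs_pos|apply exp_n_le; lia || lra|apply Rabs_le, COS_bound]. }
  replace (TC a y x - a 0%Z) with (Sum (fun n => a n * (if Z.eq_dec n 0 then 0 else exp (IZR n * y) * cos (IZR n * x)))); auto.
  assert (S0 : is_sum (fun n => if Z.eq_dec n 0 then a 0%Z else 0) (a 0%Z)).
  { apply (Sum_single (fun n => if Z.eq_dec n 0 then a 0%Z else 0) 0%Z); intros i Hi; destruct Z.eq_dec; easy. }
  assert (S0' : summable (fun n => if Z.eq_dec n 0 then a 0%Z else 0)).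
  { apply (summable_single _ 0%Z); intros i Hi; destruct Z.eq_dec; easy. }
  assert (E : TC a y x = Sum (fun n => a n * (if Z.eq_dec n 0 then 0 else exp (IZR n * y) * cos (IZR n * x))) + a 0%Z).
  { rewrite <- (Sum_unique _ _ S0) at 1; rewrite <- Sum_plus by auto; apply Sum_ext; intros n.
    destruct Z.eq_dec as [->|]; [rewrite !Rmult_0_l, exp_0, cos_0; ring|ring]. }
  lra.
Qed.

Lemma TS_add a b y x : analytic a -> analytic b -> y <= 0 -> TS (a + b) y x = TS a y x + TS b y x.
Proof.
  intros Ha Hb Hy; unfold TS; rewrite <- Sum_plus by now apply TS_bound.
  apply Sum_ext; intros; rewrite co_add; ring.
Qed.

Lemma TC_add a b y x : analytic a -> analytic b -> y <= 0 -> TC (a + b) y x = TC a y x + TC b y x.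
Proof.
  intros Ha Hb Hy; unfold TC; rewrite <- Sum_plus by now apply TC_bound.
  apply Sum_ext; intros; rewrite co_add; ring.
Qed.

(** On the line at height [y], Crapper's derivative is the one with parameter [A exp y], so the
    closed formulas on the surface hold throughout the half-plane. *)
Lemma co_Z0_scale A y n : 0 < A < 1 / 2 -> y <= 0 -> Z0 A n * exp (IZR n * y) = Z0 (A * exp y) n.
Proof.
  intros HA Hy; assert (He := exp_pos y).
  assert (He1 : exp y <= 1) by (rewrite <- exp_0; now apply exp_mono).
  assert (HA' : 0 < A * exp y < 1 / 2) by nra.
  rewrite !co_Z0, !co_eA by auto.
  destruct (Z.eq_dec n 0) as [->|Hn]; [rewrite !Rmult_0_l, exp_0; ring|].
  destruct (Z_le_dec 0 n); [|ring].
  replace (- (A * exp y)) with (- A * exp y) by ring; rewrite Rpow_mult_distr.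
  assert (E : exp (IZR n * y) = exp y ^ Z.to_nat n); [|rewrite E; ring].
  rewrite <- (Z2Nat.id n) at 1 by auto; rewrite <- INR_IZR_INZ.
  induction (Z.to_nat n) as [|k IH]; [simpl; rewrite Rmult_0_l; apply exp_0|].
  rewrite S_INR, Rmult_plus_distr_r, exp_plus, IH, Rmult_1_l; simpl; ring.
Qed.

Lemma TS_Z0 A y x : 0 < A < 1 / 2 -> y <= 0 -> let B := A * exp y in
  TS (Z0 A) y x = - (4 * B * (1 - B * B) * sin x / (DA B x * DA B x)).
Proof.
  intros HA Hy B; assert (He := exp_pos y).
  assert (He1 : exp y <= 1) by (rewrite <- exp_0; now apply exp_mono).
  assert (E := f_equal Im (evw_Z0 B x ltac:(unfold B; nra))); rewrite Im_evw in E; simpl in E; rewrite <- E.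
  rewrite Ropp_involutive; apply Sum_ext; intros n; unfold B; rewrite <- co_Z0_scale by auto; ring.
Qed.

Lemma TC_Z0 A y x : 0 < A < 1 / 2 -> y <= 0 -> TC (Z0 A) y x = XA' (A * exp y) x.
Proof.
  intros HA Hy; set (B := A * exp y); assert (He := exp_pos y).
  assert (He1 : exp y <= 1) by (rewrite <- exp_0; now apply exp_mono).
  assert (E := f_equal Re (evw_Z0 B x ltac:(unfold B; nra))); rewrite Re_evw in E; simpl in E; rewrite <- E.
  apply Sum_ext; intros n; unfold B; rewrite <- co_Z0_scale by auto; ring.
Qed.

Lemma pow_diff_bound (k : nat) X Y : 0 <= Y <= X -> X <= 1 ->
  0 <= X ^ S k - Y ^ S k <= (INR k + 1) * X ^ k * (X - Y).
Proof.
  intros HY HX; induction k as [|k IH]; [simpl; lra|].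
  rewrite S_INR.
  assert (0 <= X ^ k) by (apply pow_le; lra).
  assert (0 <= Y ^ S k <= X ^ S k) by (split; [apply pow_le|apply pow_incr]; lra).
  replace (X ^ S (S k) - Y ^ S (S k)) with (X * (X ^ S k - Y ^ S k) + Y ^ S k * (X - Y)) by (simpl; ring).
  assert (E1 : 0 <= X * (X ^ S k - Y ^ S k) <= X * ((INR k + 1) * X ^ k * (X - Y))).
  { split; [apply Rmult_le_pos; lra|apply Rmult_le_compat_l; lra]. }
  assert (E2 : 0 <= Y ^ S k * (X - Y) <= X ^ S k * (X - Y)).
  { split; [apply Rmult_le_pos; lra|apply Rmult_le_compat_r; lra]. }
  replace ((INR k + 1 + 1) * X ^ S k * (X - Y)) with (X * ((INR k + 1) * X ^ k * (X - Y)) + X ^ S k * (X - Y)) by (simpl; ring).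
  lra.
Qed.

Lemma exp_diff_bound n y y' : (2 <= n)%Z -> y' <= y -> y <= 0 ->
  Rabs (exp (IZR n * y) - exp (IZR n * y')) <= IZR n * exp y * (exp y - exp y').
Proof.
  intros Hn Hy Hy0; destruct (Z2Nat.id n ltac:(lia)); remember (Z.to_nat n) as m.
  destruct m as [|[|k]]; try lia; clear Heqm.
  assert (E : forall r, exp (IZR (Z.of_nat (S (S k))) * r) = exp r ^ S (S k)).
  { intros r; rewrite <- INR_IZR_INZ; induction (S (S k)) as [|j IH]; [simpl; rewrite Rmult_0_l; apply exp_0|].
    rewrite S_INR, Rmult_plus_distr_r, exp_plus, IH, Rmult_1_l; simpl; ring. }
  rewrite !E; assert (P := exp_pos y); assert (P' := exp_pos y').
  assert (X1 : exp y <= 1) by (rewrite <- exp_0; now apply exp_mono).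
  assert (X2 : exp y' <= exp y) by now apply exp_mono.
  destruct (pow_diff_bound (S k) (exp y) (exp y') ltac:(lra) X1) as [B1 B2].
  rewrite Rabs_pos_eq by auto; eapply Rle_trans; [exact B2|].
  rewrite <- S_INR, INR_IZR_INZ; apply Rmult_le_compat_r; [lra|]; apply Rmult_le_compat_l; [apply (IZR_le 0); lia|].
  simpl; rewrite <- (Rmult_1_r (exp y)) at 3; apply Rmult_le_compat_l; [lra|].
  rewrite <- (pow1 k); apply pow_incr; lra.
Qed.

(** Far below the surface the first harmonic dominates. The remainder keeps the factor
    [exp y - exp y'], which vanishes on the bottom when [y'] is the mirror height of [y]. *)
Lemma TS_small a y y' x : analytic a -> y' <= y -> y <= 0 ->
  Rabs (TS a y x - TS a y' x - a 1%Z * (exp y - exp y') * sin x) <=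
    C2 * exp y * (exp y - exp y') * Rabs (sin x) * nrm a.
Proof.
  intros Ha Hy Hy0; assert (HC := C2_pos); assert (Hs := Rabs_pos (sin x)); assert (P := exp_pos y).
  assert (X2 : exp y' <= exp y) by now apply exp_mono.
  set (f := fun n => if Z.eq_dec n 1 then 0 else (exp (IZR n * y) - exp (IZR n * y')) * sin (IZR n * x)).
  destruct (Sum_mult_bound a f (C2 * exp y * (exp y - exp y') * Rabs (sin x))) as [S B].
  { repeat apply Rmult_le_pos; lra. }
  { intros n; rewrite Rabs_mult, (Rmult_comm (_ * Rabs (sin x))), Rmult_assoc.
    destruct (Z_lt_dec n 0); [rewrite Ha, Rabs_R0, !Rmult_0_l by auto; lra|].
    apply Rmult_le_compat_l; [apply Rabs_pos|].
    assert (Pw := wt_pos n); assert (Pos : 0 <= wt n * (C2 * exp y * (exp y - exp y') * Rabs (sin x))) by (repeat apply Rmult_le_pos; lra).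
    unfold f; destruct Z.eq_dec; [now rewrite Rabs_R0|].
    destruct (Z.eq_dec n 0) as [->|Hn]; [rewrite !Rmult_0_l, sin_0, Rmult_0_r, Rabs_R0; auto|].
    rewrite Rabs_mult.
    apply Rle_trans with ((IZR n * exp y * (exp y - exp y')) * (IZR n * Rabs (sin x))).
    - apply Rmult_le_compat; try apply Rabs_pos; [apply exp_diff_bound; lia || lra|].
      rewrite <- (Rabs_pos_eq (IZR n)) at 2 by (apply (IZR_le 0); lia); apply sin_nat_bound.
    - replace (IZR n * exp y * (exp y - exp y') * (IZR n * Rabs (sin x))) with
        (IZR n * IZR n * (exp y * (exp y - exp y') * Rabs (sin x))) by ring.
      replace (wt n * (C2 * exp y * (exp y - exp y') * Rabs (sin x))) with
        (C2 * wt n * (exp y * (exp y - exp y') * Rabs (sin x))) by ring.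
      apply Rmult_le_compat_r; [repeat apply Rmult_le_pos; lra|apply sq_le_wt]. }
  replace (TS a y x - TS a y' x - a 1%Z * (exp y - exp y') * sin x) with (Sum (fun n => a n * f n)); auto.
  set (g := fun n => if Z.eq_dec n 1 then a 1%Z * (exp y - exp y') * sin x else 0).
  assert (Eg : Sum g = a 1%Z * (exp y - exp y') * sin x).
  { apply Sum_unique, (Sum_single g 1%Z); intros i Hi; unfold g; destruct Z.eq_dec; easy. }
  assert (Sg : summable g).
  { apply (summable_single _ 1%Z); intros i Hi; unfold g; destruct Z.eq_dec; easy. }
  destruct (TS_bound a y x Ha Hy0) as [S1 _]; destruct (TS_bound a y' x Ha ltac:(lra)) as [S2 _].
  rewrite <- Eg; unfold TS.
  rewrite (Sum_ext _ (fun n => a n * (exp (IZR n * y) * sin (IZR n * x)) +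
     (-1 * (a n * (exp (IZR n * y') * sin (IZR n * x))) + -1 * g n))).
  - rewrite !Sum_plus, !Sum_scal; auto using summable_scal; [ring|].
    apply summable_plus; now apply summable_scal.
  - intros n; unfold f, g; destruct Z.eq_dec as [->|]; [rewrite !Rmult_1_l; ring|ring].
Qed.

Lemma exp_2d d : 0 < d -> 0 <= exp (- (2 * d)) <= 1.
Proof. intros Hd; split; [left; apply exp_pos|rewrite <- exp_0; apply exp_mono; lra]. Qed.

Lemma exp_2d_le d : 0 < d -> exp (- (2 * d)) <= exp (- d).
Proof. intros Hd; apply exp_mono; lra. Qed.

Lemma ev_Kop d (Z : W) x y : 0 < d -> analytic Z -> - (2 * d) <= y <= 0 ->
  Re (ev (Kop (exp (- (2 * d))) Z) (x, y)) = TC Z y x + TC Z (- (2 * d) - y) x - Z 0%Z /\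
  Im (ev (Kop (exp (- (2 * d))) Z) (x, y)) = - TS Z y x + TS Z (- (2 * d) - y) x.
Proof.
  intros Hd Ha Hy; set (a := Kop (exp (- (2 * d))) Z); assert (He := exp_2d d Hd).
  assert (Ks : Ksym d a) by now apply Ksym_Kop.
  assert (En : forall n, a n = Z n + (if Z_lt_dec n 0 then exp (2 * d * IZR n) * Z (- n)%Z else 0)).
  { intros n; destruct Z_lt_dec as [Hn|Hn].
    - rewrite (Ha n) by auto; replace n with (- (- n))%Z at 1 by lia; rewrite Ks.
      unfold a; rewrite co_Kop by auto; destruct Z_le_dec; [|lia].
      rewrite opp_IZR; replace (- (2 * d * - IZR n)) with (2 * d * IZR n) by ring; ring.
    - unfold a; rewrite co_Kop by auto; destruct Z_le_dec; [ring|lia]. }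
  set (y' := - (2 * d) - y); assert (Hy' : y' <= 0) by (unfold y'; lra).
  assert (Ex : forall n, exp (2 * d * IZR n) * exp (IZR n * y) = exp (IZR (- n) * y')).
  { intros n; rewrite <- exp_plus, opp_IZR; f_equal; unfold y'; ring. }
  destruct (TS_bound Z y x Ha ltac:(lra)) as [S1 _]; destruct (TS_bound Z y' x Ha Hy') as [S2 _].
  destruct (TC_bound Z y x Ha ltac:(lra)) as [S3 _]; destruct (TC_bound Z y' x Ha Hy') as [S4 _].
  assert (S0 : summable (fun n => if Z.eq_dec n 0 then Z 0%Z else 0)).
  { apply (summable_single _ 0%Z); intros i Hi; destruct Z.eq_dec; easy. }
  assert (V0 : Sum (fun n => if Z.eq_dec n 0 then Z 0%Z else 0) = Z 0%Z).
  { apply Sum_unique, (Sum_single (fun n => if Z.eq_dec n 0 then Z 0%Z else 0) 0%Z); intros i Hi; destruct Z.eq_dec; easy. }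
  assert (inj : forall i j, (- i = - j)%Z -> i = j) by lia.
  unfold ev, TC, TS; simpl; split.
  - rewrite <- (Sum_reindex Z.opp Z.opp (fun n => Z n * (exp (IZR n * y') * cos (IZR n * x)))) by (auto; intros; lia).
    assert (S4' := summable_inj Z.opp (fun n => Z n * (exp (IZR n * y') * cos (IZR n * x))) inj S4); cbv beta in S4'.
    rewrite <- V0; unfold Rminus; rewrite Rplus_assoc.
    replace (- Sum (fun n => if Z.eq_dec n 0 then Z 0%Z else 0)) with
      (Sum (fun n => -1 * (if Z.eq_dec n 0 then Z 0%Z else 0))) by (rewrite Sum_scal; auto; ring).
    rewrite <- !Sum_plus by (auto using summable_plus, summable_scal).
    apply Sum_ext; intros n; rewrite En; unfold eC; simpl.
    replace (cos (IZR (- n) * x)) with (cos (IZR n * x)) by (rewrite opp_IZR, Ropp_mult_distr_l_reverse, cos_neg; auto).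
    destruct (Z_lt_dec n 0), (Z.eq_dec n 0); try lia.
    + rewrite <- Ex; ring.
    + subst; simpl; rewrite !Rmult_0_l, exp_0, cos_0; ring.
    + rewrite (Ha (- n)%Z) by lia; ring.
  - rewrite <- (Sum_reindex Z.opp Z.opp (fun n => Z n * (exp (IZR n * y') * sin (IZR n * x)))) by (auto; intros; lia).
    assert (S2' := summable_inj Z.opp (fun n => Z n * (exp (IZR n * y') * sin (IZR n * x))) inj S2); cbv beta in S2'.
    replace (- Sum (fun n => a n * eS n (x, y))) with (-1 * Sum (fun n => a n * eS n (x, y))) by ring.
    replace (- Sum (fun n => Z n * (exp (IZR n * y) * sin (IZR n * x)))) with (-1 * Sum (fun n => Z n * (exp (IZR n * y) * sin (IZR n * x)))) by ring.
    rewrite <- Sum_scal.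
    + rewrite <- Sum_scal, <- Sum_plus by (auto using summable_scal).
      apply Sum_ext; intros n; rewrite En; unfold eS; simpl.
      replace (sin (IZR (- n) * x)) with (- sin (IZR n * x)) by (rewrite opp_IZR, Ropp_mult_distr_l_reverse, sin_neg; auto).
      destruct (Z_lt_dec n 0), (Z.eq_dec n 0); try lia.
      * rewrite <- Ex; ring.
      * subst; simpl; rewrite !Rmult_0_l, sin_0; ring.
      * rewrite (Ha (- n)%Z) by lia; ring.
    + apply (summable_ext (fun n => Z n * (exp (IZR n * y) * sin (IZR n * x)) + -1 * (Z (- n)%Z * (exp (IZR (- n) * y') * sin (IZR (- n) * x))))).
      * intros n; rewrite En; unfold eS; simpl.
        replace (sin (IZR (- n) * x)) with (- sin (IZR n * x)) by (rewrite opp_IZR, Ropp_mult_distr_l_reverse, sin_neg; auto).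
        destruct (Z_lt_dec n 0), (Z.eq_dec n 0); try lia.
        -- rewrite <- Ex; ring.
        -- subst; simpl; rewrite !Rmult_0_l, sin_0; ring.
        -- rewrite (Ha (- n)%Z) by lia; ring.
      * apply summable_plus; auto using summable_scal.
Qed.

(** * Signs of the derivative of the conformal map *)

Lemma nrm_near A (Z : W) r : nrm (Z - Z0 A) <= r -> nrm Z <= r + nrm (Z0 A).
Proof. intros H; apply (nrm_close Z (Z0 A)); auto; lra. Qed.

(** Positivity degenerates on the sides, where [sin x = 0], and on the bottom, where reflection
    makes [Z] real. Both zeros are factored out before estimating: [sin x] everywhere, and
    [exp y - exp y'] in deep water. *)
Lemma ImZ_pos A : 0 < A < 1 / 2 -> exists delta, 0 < delta <= 1 /\ forall d (Z : W), 0 < d -> exp (- d) <= delta ->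
  analytic Z -> nrm (Z - Z0 A) <= delta -> forall x y, 0 < x < PI -> - d < y <= 0 ->
  0 < Im (ev (Kop (exp (- (2 * d))) Z) (x, y)).
Proof.
  intros HA; set (N := nrm (Z0 A) + 1); assert (HN : 1 <= N) by (unfold N; generalize (nrm_pos (Z0 A)); lra).
  assert (HC := C2_pos).
  (* Below the level [exp y = x0] the higher harmonics are at most [A] times the common factor,
     against at least [3 A] from the first one. *)
  set (x0 := A / (C2 * N)).
  assert (Hx0 : 0 < x0) by (apply Rdiv_lt_0_compat; nra).
  set (k := A * x0 / (8 * (C2 * (1 + N)))).
  assert (Hk : 0 < k) by (apply Rdiv_lt_0_compat; nra).
  exists (Rmin A k); split; [split; [now apply Rmin_glb_lt|eapply Rle_trans; [apply Rmin_l|lra]]|].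
  intros d Z Hd Hed Ha HZ x y Hx Hy.
  assert (dA : Rmin A k <= A) by apply Rmin_l; assert (dk : Rmin A k <= k) by apply Rmin_r.
  set (dl := Rmin A k) in *.
  assert (Hdl : 0 < dl) by (generalize (exp_pos (- d)); lra).
  assert (Hs : 0 < sin x) by (apply sin_gt_0; lra).
  assert (NZ : nrm Z <= N) by (generalize (nrm_near A Z dl HZ); unfold N; lra).
  rewrite (proj2 (ev_Kop d Z x y Hd Ha ltac:(lra))); set (y' := - (2 * d) - y).
  assert (P := exp_pos y); assert (P' := exp_pos y').
  assert (X1 : exp y <= 1) by (rewrite <- exp_0; apply exp_mono; lra).
  assert (XY : exp y' < exp y) by (apply exp_increasing; unfold y'; lra).
  assert (Y1 : exp y' <= dl) by (apply Rle_trans with (2 := Hed); apply exp_mono; unfold y'; lra).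
  (* In deep water the first coefficient, close to [- 4 A], decides. Nearer the surface [Z] is
     compared with Crapper's wave, and the mirror term is as small as [exp (- d)]. *)
  destruct (Rle_dec (exp y) x0) as [Hsm|Hla].
  - assert (K := TS_small Z y y' x Ha ltac:(unfold y'; lra) ltac:(lra)).
    rewrite (Rabs_pos_eq (sin x)) in K by lra; apply Rabs_le_between in K.
    assert (c1 : Z 1%Z <= - (3 * A)).
    { assert (K1 := nrm_co' (Z - Z0 A) 1); rewrite co_add, co_opp, co_Z0, co_eA in K1 by auto; simpl in K1.
      assert (K2 := Rle_trans _ _ _ K1 HZ); apply Rabs_le_between in K2; lra. }
    assert (c2 : C2 * exp y * nrm Z <= A).
    { apply Rle_trans with (C2 * x0 * N); [|right; unfold x0; field; lra].
      apply Rmult_le_compat; try nra; apply nrm_pos. }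
    set (Q := (exp y - exp y') * sin x) in *.
    assert (HQ : 0 < Q) by (apply Rmult_lt_0_compat; lra).
    assert (K3 : C2 * exp y * (exp y - exp y') * sin x * nrm Z <= A * Q).
    { replace (C2 * exp y * (exp y - exp y') * sin x * nrm Z) with (C2 * exp y * nrm Z * Q) by (unfold Q; ring).
      apply Rmult_le_compat_r; lra. }
    assert (K4 : Z 1%Z * (exp y - exp y') * sin x <= - (3 * A) * Q).
    { rewrite Rmult_assoc; fold Q; apply Rmult_le_compat_r; lra. }
    nra.
  - assert (E : TS Z y x = TS (Z0 A) y x + TS (Z - Z0 A) y x).
    { rewrite <- TS_add by (auto using analytic_Z0 with wan || lra); f_equal; ring. }
    rewrite E, TS_Z0 by lra; set (B := A * exp y).
    assert (HB : A * x0 <= B < 1 / 2) by (unfold B; split; nra).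
    assert (HAx : 0 < A * x0) by nra.
    assert (HD := DA_pos' B x ltac:(lra)); assert (HD' := DA_le B x ltac:(lra)).
    assert (T1 := proj2 (TS_bound (Z - Z0 A) y x ltac:(auto using analytic_Z0 with wan) ltac:(lra))).
    assert (T2 := proj2 (TS_bound Z y' x Ha ltac:(unfold y'; lra))).
    rewrite (Rabs_pos_eq (sin x)) in T1, T2 by lra.
    assert (T1' : C2 * exp y * sin x * nrm (Z - Z0 A) <= C2 * dl * sin x).
    { replace (C2 * exp y * sin x * nrm (Z - Z0 A)) with (C2 * (exp y * nrm (Z - Z0 A)) * sin x) by ring.
      apply Rmult_le_compat_r; [lra|]; apply Rmult_le_compat_l; [lra|].
      generalize (nrm_pos (Z - Z0 A)); nra. }
    assert (T2' : C2 * exp y' * sin x * nrm Z <= C2 * (dl * N) * sin x).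
    { replace (C2 * exp y' * sin x * nrm Z) with (C2 * (exp y' * nrm Z) * sin x) by ring.
      apply Rmult_le_compat_r; [lra|]; apply Rmult_le_compat_l; [lra|].
      apply Rmult_le_compat; try lra; apply nrm_pos. }
    apply Rabs_le_between in T1; apply Rabs_le_between in T2.
    assert (T3 : 3 / 16 * (A * x0) * sin x <= 4 * B * (1 - B * B) * sin x / (DA B x * DA B x)).
    { apply Rmult_le_reg_r with (DA B x * DA B x); [nra|].
      replace (4 * B * (1 - B * B) * sin x / (DA B x * DA B x) * (DA B x * DA B x)) with (4 * B * (1 - B * B) * sin x) by (field; lra).
      assert (q1 : DA B x * DA B x <= 16) by nra.
      assert (q2 : 3 * (A * x0) <= 4 * B * (1 - B * B)) by nra.
      apply Rle_trans with (3 / 16 * (A * x0) * sin x * 16).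
      - apply Rmult_le_compat_l; auto; nra.
      - replace (3 / 16 * (A * x0) * sin x * 16) with (3 * (A * x0) * sin x) by field; apply Rmult_le_compat_r; lra. }
    assert (T4 : C2 * dl * (1 + N) <= 1 / 8 * (A * x0)).
    { apply Rle_trans with (C2 * k * (1 + N)); [|right; unfold k; field; lra].
      apply Rmult_le_compat_r; [lra|apply Rmult_le_compat_l; lra]. }
    assert (T5 : C2 * dl * sin x + C2 * (dl * N) * sin x <= 1 / 8 * (A * x0) * sin x).
    { replace (C2 * dl * sin x + C2 * (dl * N) * sin x) with (C2 * dl * (1 + N) * sin x) by ring; apply Rmult_le_compat_r; lra. }
    assert (0 < A * x0 * sin x) by nra.
    lra.
Qed.

(** On the sides Crapper's real part is [((1 - B^2) / DA)^2 >= 9 / 256], while the radius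
    [/ (64 (1 + N))] limits all perturbations to [/ 64]. On the bottom [Z] is close to 1. *)
Lemma sides_pos A : 0 < A < 1 / 2 -> exists delta, 0 < delta <= 1 /\ forall d (Z : W), 0 < d -> exp (- d) <= delta ->
  analytic Z -> Z 0%Z = 1 -> nrm (Z - Z0 A) <= delta ->
  (forall y, - d <= y <= 0 -> 0 < Re (ev (Kop (exp (- (2 * d))) Z) (0, y)) /\ 0 < Re (ev (Kop (exp (- (2 * d))) Z) (PI, y))) /\
  (forall x, 0 < Re (ev (Kop (exp (- (2 * d))) Z) (x, - d))).
Proof.
  intros HA; set (N := nrm (Z0 A) + 1); assert (HN : 1 <= N) by (unfold N; generalize (nrm_pos (Z0 A)); lra).
  assert (Hp : 0 < / (64 * (1 + N))) by (apply Rinv_0_lt_compat; lra).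
  exists (/ (64 * (1 + N))); split; [split; auto|].
  { rewrite <- Rinv_1; apply Rinv_le_contravar; lra. }
  intros d Z Hd Hed Ha Z1' HZ; set (dl := / (64 * (1 + N))) in *.
  assert (Hdl : dl * (1 + N) = / 64) by (unfold dl; field; lra).
  assert (NZ : nrm Z <= N).
  { generalize (nrm_near A Z dl HZ); unfold N; assert (dl <= 1) by nra; lra. }
  assert (small : forall y x, y <= - d -> Rabs (TC Z y x - 1) <= dl * N).
  { intros y x Hy; destruct (TC_bound Z y x Ha ltac:(lra)) as (_ & _ & B); rewrite Z1' in B.
    eapply Rle_trans; [exact B|]; apply Rmult_le_compat; try lra; [left; apply exp_pos|apply nrm_pos|].
    apply Rle_trans with (2 := Hed), exp_mono; lra. }
  split.
  - assert (K : forall x y, sin x = 0 -> - d <= y <= 0 -> 0 < Re (ev (Kop (exp (- (2 * d))) Z) (x, y))).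
    { intros x y Hs Hy; rewrite (proj1 (ev_Kop d Z x y Hd Ha ltac:(lra))), Z1'.
      assert (E : TC Z y x = TC (Z0 A) y x + TC (Z - Z0 A) y x).
      { rewrite <- TC_add by (auto using analytic_Z0 with wan || lra); f_equal; ring. }
      rewrite E, TC_Z0 by lra.
      assert (P := exp_pos y); assert (X1 : exp y <= 1) by (rewrite <- exp_0; apply exp_mono; lra).
      set (B := A * exp y); assert (HB : 0 < B < 1 / 2) by (unfold B; nra).
      assert (HD := DA_pos' B x ltac:(lra)); assert (HD' := DA_le B x ltac:(lra)).
      destruct (TC_bound (Z - Z0 A) y x ltac:(auto using analytic_Z0 with wan) ltac:(lra)) as (_ & B1 & _).
      assert (B2 := small (- (2 * d) - y) x ltac:(lra)).
      apply Rabs_le_between in B1; apply Rabs_le_between in B2.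
      assert (B3 : 9 / 256 <= XA' B x).
      { unfold XA'; rewrite Hs; apply Rmult_le_reg_r with (DA B x * DA B x); [nra|].
        replace (((1 - B * B) * (1 - B * B) - 4 * (B * B) * (0 * 0)) / (DA B x * DA B x) * (DA B x * DA B x))
          with ((1 - B * B) * (1 - B * B)) by (field; lra).
        assert (DA B x * DA B x <= 16) by nra; assert (3 / 4 <= 1 - B * B) by nra; nra. }
      lra. }
    intros y Hy; split; apply K; auto; [apply sin_0|apply sin_PI].
  - intros x; rewrite (proj1 (ev_Kop d Z x (- d) Hd Ha ltac:(lra))), Z1'.
    replace (- (2 * d) - - d) with (- d) by ring.
    assert (B := small (- d) x ltac:(lra)); apply Rabs_le_between in B; nra.
Qed.

Lemma Re_evw_lipschitz (b : W) x1 x2 : Rabs (Re (evw b x2) - Re (evw b x1)) <= C2 * Rabs (x2 - x1) * nrm b.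
Proof.
  rewrite !Re_evw; assert (HC := C2_pos); assert (Hx := Rabs_pos (x2 - x1)).
  assert (S : forall x, summable (fun n => b n * cos (IZR n * x))).
  { intros x; apply (summable_bounded_mult 1 b (fun n => cos (IZR n * x))); [|apply W_summable].
    intros; apply Rabs_le, COS_bound. }
  replace (Sum (fun n => b n * cos (IZR n * x2)) - Sum (fun n => b n * cos (IZR n * x1))) with
    (Sum (fun n => b n * (cos (IZR n * x2) - cos (IZR n * x1)))).
  - apply Sum_mult_bound; [nra|]; intros n; rewrite Rabs_mult, (Rmult_comm (C2 * _)), Rmult_assoc.
    apply Rmult_le_compat_l; [apply Rabs_pos|].
    apply Rle_trans with (Rabs (IZR n) * Rabs (x2 - x1)).
    + destruct (MVT_gen cos (IZR n * x1) (IZR n * x2) (fun x => - sin x)) as (c & _ & E).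
      * intros; apply is_derive_Reals, derivable_pt_lim_cos.
      * intros; apply derivable_continuous_pt, derivable_pt_cos.
      * rewrite E, Rabs_mult, Rabs_Ropp, <- Rmult_minus_distr_l, Rabs_mult.
        rewrite <- (Rmult_1_l (Rabs (IZR n) * Rabs (x2 - x1))) at 2.
        apply Rmult_le_compat_r; [apply Rmult_le_pos; apply Rabs_pos|apply Rabs_le, SIN_bound].
    + generalize (abs_le_sq n) (sq_le_wt n); nra.
  - rewrite (Sum_ext _ (fun n => b n * cos (IZR n * x2) + -1 * (b n * cos (IZR n * x1)))) by (intros; ring).
    rewrite Sum_plus, Sum_scal; auto using summable_scal; ring.
Qed.

Lemma PS_lipschitz (b : W) x1 x2 : Rabs (PS b x2 - PS b x1) <= Rabs (x2 - x1) * nrm b.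
Proof.
  assert (S := fun x => proj1 (PS_bound b x)); unfold PS.
  assert (E : Sum (fun n => prim b n * sin (IZR n * x2)) - Sum (fun n => prim b n * sin (IZR n * x1)) =
    Sum (fun n => b n * (if Z.eq_dec n 0 then 0 else (sin (IZR n * x2) - sin (IZR n * x1)) / IZR n))).
  { rewrite (Sum_ext (fun n => b n * _) (fun n => prim b n * sin (IZR n * x2) + -1 * (prim b n * sin (IZR n * x1)))).
    - rewrite Sum_plus, Sum_scal; auto using summable_scal; ring.
    - intros n; unfold prim; destruct Z.eq_dec; [ring|unfold Rdiv; ring]. }
  rewrite E; apply Sum_mult_bound; [apply Rabs_pos|]; intros n.
  rewrite Rabs_mult, (Rmult_comm (Rabs (x2 - x1))), Rmult_assoc; apply Rmult_le_compat_l; [apply Rabs_pos|].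
  apply Rle_trans with (Rabs (x2 - x1)); [|generalize (wt_ge_1 n) (Rabs_pos (x2 - x1)); nra].
  destruct Z.eq_dec as [|Hn]; [rewrite Rabs_R0; apply Rabs_pos|].
  destruct (MVT_gen sin (IZR n * x1) (IZR n * x2) cos) as (c & _ & E').
  - intros; apply is_derive_Reals, derivable_pt_lim_sin.
  - intros; apply derivable_continuous_pt, derivable_pt_sin.
  - rewrite E', <- Rmult_minus_distr_l.
    replace (cos c * (IZR n * (x2 - x1)) / IZR n) with (cos c * (x2 - x1)) by (field; now apply not_0_IZR).
    apply Rle_trans with (1 * Rabs (x2 - x1)); [|lra].
    rewrite Rabs_mult; apply Rmult_le_compat_r; [apply Rabs_pos|apply Rabs_le, COS_bound].
Qed.

(** The contact is a nondegenerate minimum: at [th] the second derivative reduces to a positive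
    multiple of [- sin th cos th], and continuity keeps half of it nearby. *)
Lemma XA'_increasing A th : 0 < A < 1 -> PI / 2 < th < PI -> 1 - A * A = 2 * A * sin th ->
  exists h c, 0 < h /\ 0 < c /\ PI / 2 < th - h /\ th + h < PI /\
  forall x1 x2, th - h <= x1 -> x1 < x2 -> x2 <= th + h -> c * (x2 - x1) <= XA' A x2 - XA' A x1.
Proof.
  intros HA Hth E.
  set (g := fun x => (- (8 * (A * A)) * (sin x * cos x) * DA A x
    + 4 * A * sin x * ((1 - A * A) * (1 - A * A) - 4 * (A * A) * (sin x * sin x))) / (DA A x * DA A x * DA A x)).
  assert (dg : forall x, is_derive (XA' A) x (g x)).
  { intros x; generalize (DA_pos' A x HA); unfold XA', g, DA; intros HD.
    auto_derive; [nra|]; field; lra. }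
  assert (cg : continuity_pt g th).
  { apply continuity_pt_filterlim, (ex_derive_continuous g).
    generalize (DA_pos' A th HA); unfold g, DA; intros HD; auto_derive; repeat split; auto.
    apply Rmult_integral_contrapositive_currified; [|lra]; apply Rmult_integral_contrapositive_currified; lra. }
  assert (gp : 0 < g th).
  { unfold g; rewrite E.
    assert (HD := DA_pos' A th HA); assert (0 < sin th) by (apply sin_gt_0; lra); assert (cos th < 0) by (apply cos_lt_0; lra).
    apply Rdiv_lt_0_compat; [|repeat apply Rmult_lt_0_compat; lra].
    replace (- (8 * (A * A)) * (sin th * cos th) * DA A th + 4 * A * sin th *
      (2 * A * sin th * (2 * A * sin th) - 4 * (A * A) * (sin th * sin th))) with (8 * (A * A) * (sin th * - cos th) * DA A th) by ring.
    repeat apply Rmult_lt_0_compat; lra. }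
  destruct (cg (g th / 2) ltac:(lra)) as (h0 & Hh0 & Hg).
  set (h := Rmin (h0 / 2) (Rmin ((th - PI / 2) / 2) ((PI - th) / 2))).
  assert (Hh : 0 < h) by (unfold h; repeat apply Rmin_glb_lt; lra).
  assert (h1 : h <= h0 / 2) by apply Rmin_l.
  assert (h2 : h <= (th - PI / 2) / 2) by (unfold h; eapply Rle_trans; [apply Rmin_r|apply Rmin_l]).
  assert (h3 : h <= (PI - th) / 2) by (unfold h; eapply Rle_trans; [apply Rmin_r|apply Rmin_r]).
  exists h, (g th / 2); repeat split; try lra.
  intros x1 x2 H1 H12 H2.
  destruct (MVT_cor2 (XA' A) g x1 x2 H12) as (c & Ec & Hc); [intros; apply is_derive_Reals, dg|].
  rewrite Ec; apply Rmult_le_compat_r; [lra|].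
  destruct (Req_dec c th) as [->|Hne]; [lra|].
  assert (K : Rabs (g c - g th) < g th / 2).
  { apply (Hg c); split; [split; [exact I|auto]|].
    apply Rabs_def1; lra. }
  apply Rabs_def2 in K; lra.
Qed.

(** Near 0 the slope of [XA] at 0 gives the bound; elsewhere it follows from compactness. The
    comparison with [sin x] matches the form of the perturbation errors. *)
Lemma XA_outside A th h : 0 < A < 1 -> PI / 2 < th < PI -> 1 - A * A = 2 * A * sin th -> XA A th = 0 ->
  0 < h -> PI / 2 < th - h -> th + h < PI ->
  exists c, 0 < c /\ forall x, 0 < x < PI -> x <= th - h \/ th + h <= x -> c * sin x <= XA A x.
Proof.
  intros HA Hth E E0 Hh Hh1 Hh2.
  assert (cX : forall x, continuity_pt (XA A) x).
  { intros x; apply derivable_continuous_pt; exists (XA' A x); apply is_derive_Reals, XA_derive; auto. }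
  assert (cX' : continuity_pt (XA' A) 0).
  { apply continuity_pt_filterlim, (ex_derive_continuous (XA' A)).
    generalize (DA_pos' A 0 HA); unfold XA', DA; intros HD; auto_derive; nra. }
  assert (p0 : 0 < XA' A 0).
  { unfold XA'; rewrite sin_0; assert (HD := DA_pos' A 0 HA); apply Rdiv_lt_0_compat; [|nra].
    assert (0 < 1 - A * A) by nra; nra. }
  destruct (cX' (XA' A 0 / 2) ltac:(lra)) as (h0 & Hh0 & Hg).
  set (x0 := Rmin h0 (th - h) / 2).
  assert (Hm : 0 < Rmin h0 (th - h)) by (apply Rmin_glb_lt; generalize PI_RGT_0; lra).
  assert (m1 : Rmin h0 (th - h) <= h0) by apply Rmin_l; assert (m2 : Rmin h0 (th - h) <= th - h) by apply Rmin_r.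
  assert (near0 : forall x, 0 < x <= x0 -> XA' A 0 / 2 * sin x <= XA A x).
  { intros x Hx.
    destruct (MVT_cor2 (XA A) (XA' A) 0 x ltac:(lra)) as (c & Ec & Hc); [intros; apply is_derive_Reals, XA_derive; auto|].
    rewrite XA_0, !Rminus_0_r in Ec; rewrite Ec.
    assert (K : Rabs (XA' A c - XA' A 0) < XA' A 0 / 2).
    { apply (Hg c); split; [split; [exact I|lra]|].
      simpl; unfold Rdist; apply Rabs_def1; unfold x0 in *; lra. }
    apply Rabs_def2 in K.
    assert (sin x < x) by (apply sin_lt_x; lra).
    apply Rle_trans with (XA' A 0 / 2 * x); [apply Rmult_le_compat_l; lra|apply Rmult_le_compat_r; lra]. }
  destruct (continuity_ab_min (XA A) x0 (th - h) ltac:(unfold x0; lra)) as (c1 & M1 & R1); [auto|].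
  destruct (continuity_ab_min (XA A) (th + h) PI ltac:(lra)) as (c2 & M2 & R2); [auto|].
  assert (q1 : 0 < XA A c1) by (apply (XA_positive A th); auto; unfold x0 in *; lra).
  assert (q2 : 0 < XA A c2).
  { destruct (Req_dec c2 PI) as [->|]; [rewrite XA_pi; apply PI_RGT_0|apply (XA_positive A th); auto; lra]. }
  exists (Rmin (XA' A 0 / 2) (Rmin (XA A c1) (XA A c2))); split; [repeat apply Rmin_glb_lt; lra|].
  intros x Hx Ho; assert (Hs : 0 < sin x) by (apply sin_gt_0; lra); assert (Hs1 : sin x <= 1) by apply SIN_bound.
  set (c := Rmin _ _).
  assert (e1 : c <= XA' A 0 / 2) by apply Rmin_l.
  assert (e2 : c <= XA A c1) by (eapply Rle_trans; [apply Rmin_r|apply Rmin_l]).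
  assert (e3 : c <= XA A c2) by (eapply Rle_trans; [apply Rmin_r|apply Rmin_r]).
  destruct (Rle_dec x x0).
  - apply Rle_trans with (XA' A 0 / 2 * sin x); [apply Rmult_le_compat_r; lra|apply near0; lra].
  - destruct Ho as [Ho|Ho].
    + apply Rle_trans with (XA A c1); [nra|apply M1; lra].
    + apply Rle_trans with (XA A c2); [nra|apply M2; lra].
Qed.

(** All that the geometry of the domain uses, stated on one half period. [sh_Im] includes the
    surface but leaves out the bottom and the sides, where [Im Z] vanishes; there the conditions on
    [Re Z] take over. *)
Record shape (d : R) (z Z : C -> C) (a : R) : Prop := {
  sh_Im : forall x y, 0 < x < PI -> - d < y <= 0 -> 0 < Im (Z (x, y));
  sh_left : forall y, - d <= y <= 0 -> 0 < Re (Z (0, y));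
  sh_right : forall y, - d <= y <= 0 -> 0 < Re (Z (PI, y));
  sh_bot : forall x, 0 < Re (Z (x, - d));
  sh_a : 0 < a < PI;
  sh_touch : Re (z (a, 0)) = 0;
  sh_nonneg : forall x, 0 <= x <= PI -> 0 <= Re (z (x, 0));
  sh_unique : forall x, 0 < x < PI -> Re (z (x, 0)) = 0 -> x = a
}.

Lemma analytic_Zf A x w : 0 < A < 1 / 2 -> analytic (Zf A x w).
Proof.
  intros HA; rewrite Zf_def.
  apply analytic_add; [apply analytic_add; [now apply analytic_Z0|]|now apply analytic_Sc].
  apply analytic_mul; [apply analytic_cst|now apply analytic_Z1].
Qed.

Lemma analytic_uf A x w : 0 < A < 1 / 2 -> analytic (uf A x w).
Proof.
  intros HA; rewrite uf_def.
  apply analytic_add; [apply analytic_add; [now apply analytic_u0|]|now apply analytic_Sv].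
  apply analytic_mul; [apply analytic_cst|now apply analytic_u1].
Qed.

Lemma Zf_0 A x w : 0 < A < 1 / 2 -> Zf A x w 0%Z = 1.
Proof.
  intros HA; rewrite Zf_def, !co_add, co_cst_mul, Z1_0, Sc_0, co_Z0 by auto; simpl; ring.
Qed.

(** [|Z0|] is at least [9 / 256], whereas a zero of [b] would force both components of [Z0] below
    [/ 100]. *)
Lemma evw_far_from_zero A (b : W) x : 0 < A < 1 / 2 -> nrm (b - Z0 A) <= / 100 -> evw b x <> RtoC 0.
Proof.
  intros HA Hb E.
  assert (HD := DA_pos' A x ltac:(lra)); assert (HD' := DA_le A x ltac:(lra)).
  assert (K : forall f : W, Rabs (Re (evw f x)) <= nrm f /\ Rabs (Im (evw f x)) <= nrm f).
  { intros f; rewrite Re_evw, Im_evw, Rabs_Ropp; split; rewrite <- (Rmult_1_l (nrm f)); apply Sum_mult_bound; try lra;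
      intros n; rewrite Rabs_mult, Rmult_1_l; apply Rmult_le_compat_l; try apply Rabs_pos;
      apply Rle_trans with 1; try apply wt_ge_1; [apply Rabs_le, COS_bound|apply Rabs_le, SIN_bound]. }
  destruct (K (b - Z0 A)%W) as [K1 K2]; rewrite evw_add, evw_opp, E, evw_Z0 in K1, K2 by auto; simpl in K1, K2.
  rewrite Rplus_0_l, Rabs_Ropp in K1, K2; apply Rle_trans with (2 := Hb) in K1; apply Rle_trans with (2 := Hb) in K2.
  set (p := XA' A x) in *; set (r := 4 * A * (1 - A * A) * sin x / (DA A x * DA A x)) in *.
  assert (Q : p * p + r * r = (((1 - A * A) * (1 - A * A) + 4 * (A * A) * (sin x * sin x)) / (DA A x * DA A x)) *
     (((1 - A * A) * (1 - A * A) + 4 * (A * A) * (sin x * sin x)) / (DA A x * DA A x))).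
  { unfold p, r, XA'; field; lra. }
  set (v := ((1 - A * A) * (1 - A * A) + 4 * (A * A) * (sin x * sin x)) / (DA A x * DA A x)) in *.
  assert (Hv : 9 / 256 <= v).
  { unfold v; apply Rmult_le_reg_r with (DA A x * DA A x); [nra|].
    replace (((1 - A * A) * (1 - A * A) + 4 * (A * A) * (sin x * sin x)) / (DA A x * DA A x) * (DA A x * DA A x)) with
      ((1 - A * A) * (1 - A * A) + 4 * (A * A) * (sin x * sin x)) by (field; lra).
    assert (DA A x * DA A x <= 16) by nra; assert (3 / 4 <= 1 - A * A) by nra; assert (0 <= sin x * sin x) by apply Rle_0_sqr.
    assert (0 <= 4 * (A * A) * (sin x * sin x)) by (apply Rmult_le_pos; [nra|assumption]); nra. }
  assert (p * p <= / 100 * / 100).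
  { rewrite <- (Rabs_pos_eq (p * p)) by apply Rle_0_sqr; rewrite Rabs_mult; apply Rmult_le_compat; try apply Rabs_pos; lra. }
  assert (r * r <= / 100 * / 100).
  { rewrite <- (Rabs_pos_eq (r * r)) by apply Rle_0_sqr; rewrite Rabs_mult; apply Rmult_le_compat; try apply Rabs_pos; lra. }
  nra.
Qed.

Lemma lipschitz_continuity f L x : 0 <= L -> (forall y, Rabs (f y - f x) <= L * Rabs (y - x)) -> continuity_pt f x.
Proof.
  intros HL H e He; exists (e / (L + 1)); split; [apply Rdiv_lt_0_compat; lra|].
  intros y [_ Hy]; simpl in *; unfold Rdist in *.
  eapply Rle_lt_trans; [apply H|].
  apply Rmult_lt_compat_l with (r := L + 1) in Hy; [|lra].
  replace ((L + 1) * (e / (L + 1))) with e in Hy by (field; lra).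
  generalize (Rabs_pos (y - x)); nra.
Qed.

Lemma qq_ge_1 A : 0 < A < 1 -> 1 <= qq A.
Proof.
  intros HA; assert (A * A < 1) by nra; unfold qq; apply Rmult_le_reg_r with (1 - A * A); [lra|].
  replace ((1 + A * A) / (1 - A * A) * (1 - A * A)) with (1 + A * A) by (field; lra); nra.
Qed.

(** The displacement caused by the tangent parameter is comparable to [sin al] from both sides, so
    it dominates errors of the form [s^2 sin al] and is dominated by [XA] away from the contact. *)
Lemma crapper_shift_bounds A al : 0 < A < 1 / 2 -> 0 <= sin al ->
  3 / 16 * sin al <= 4 * (1 - A * A) * sin al / (DA A al * DA A al) <= 64 * sin al.
Proof.
  intros HA Hsin; assert (HA1 : 0 < A < 1) by lra.
  assert (HD := DA_pos' A al HA1); assert (HD' := DA_le A al HA1); assert (HD2 := DA_pos A al HA1).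
  assert (q1 : 3 / 4 <= 1 - A * A <= 1) by nra.
  assert (q2 : 1 / 4 <= DA A al) by nra.
  assert (q3 : 1 / 16 <= DA A al * DA A al <= 16) by nra.
  split; apply Rmult_le_reg_r with (DA A al * DA A al); try lra;
    replace (4 * (1 - A * A) * sin al / (DA A al * DA A al) * (DA A al * DA A al)) with (4 * (1 - A * A) * sin al) by (field; lra).
  - apply Rle_trans with (3 / 16 * sin al * 16); [apply Rmult_le_compat_l; lra|nra].
  - apply Rle_trans with (64 * sin al * (1 / 16)); [nra|apply Rmult_le_compat_l; lra].
Qed.

(** The scales are [x] of order [s] against [G] and [e] of order [s^2]: the abscissa is [XA - x k]
    up to [O(s^2) sin], so the ends [x = - s] and [x = s] force opposite signs of its minimum near
    [th]. *)
Theorem touching_flow : exists eps d, 0 < eps /\ 0 < d /\ forall G yc, Rabs G < eps ->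
  exists q z Z Z' u u' P a, flow d Lr yc G q z Z Z' u u' P /\ shape d z Z a.
Proof.
  destruct touching_parameter as (A & th & HA & Hth & EA & E0).
  assert (HA1 : 0 < A < 1) by lra.
  destruct (ImZ_pos A HA) as (dI & HdI & LI).
  destruct (sides_pos A HA) as (dS & HdS & LS).
  destruct (XA'_increasing A th HA1 Hth EA) as (h & c & Hh & Hc & Hh1 & Hh2 & Linc).
  destruct (XA_outside A th h HA1 Hth EA E0 Hh Hh1 Hh2) as (c0 & Hc0 & Lout).
  destruct (wave_family A HA) as (C & s0 & HC & Hs0 & Fam).
  assert (HC2 := C2_pos).
  set (N := nrm (Z0 A) + 1); assert (HN : 1 <= N) by (unfold N; generalize (nrm_pos (Z0 A)); lra).
  set (N1 := nrm (Z1 A)); assert (HN1 : 0 <= N1) by apply nrm_pos.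
  set (dl := Rmin dI (Rmin dS (Rmin (c / (2 * C2 * (2 + N))) (/ (100 * (2 + N)))))).
  assert (Hdl : 0 < dl).
  { unfold dl; repeat (apply Rmin_glb_lt; [try lra|]); [apply Rdiv_lt_0_compat; nra|apply Rinv_0_lt_compat; lra]. }
  assert (dl1 : dl <= dI) by apply Rmin_l.
  assert (dl2 : dl <= dS) by (unfold dl; eapply Rle_trans; [apply Rmin_r|apply Rmin_l]).
  assert (dl3 : C2 * ((2 + N) * dl) <= c / 2).
  { apply Rle_trans with (C2 * ((2 + N) * (c / (2 * C2 * (2 + N))))); [|right; field; lra].
    apply Rmult_le_compat_l; [lra|]; apply Rmult_le_compat_l; [lra|].
    unfold dl; eapply Rle_trans; [apply Rmin_r|eapply Rle_trans; [apply Rmin_r|apply Rmin_l]]. }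
  assert (dl4 : (2 + N) * dl <= / 100).
  { apply Rle_trans with ((2 + N) * (/ (100 * (2 + N)))); [|right; field; lra].
    apply Rmult_le_compat_l; [lra|].
    unfold dl; eapply Rle_trans; [apply Rmin_r|eapply Rle_trans; [apply Rmin_r|apply Rmin_r]]. }
  set (m := Rmin s0 (Rmin dl (Rmin (/ 16) (c0 / 4)))).
  assert (Hm : 0 < m) by (unfold m; repeat (apply Rmin_glb_lt; [lra|]); lra).
  assert (m1 : m <= s0) by apply Rmin_l.
  assert (m2 : m <= dl) by (unfold m; eapply Rle_trans; [apply Rmin_r|apply Rmin_l]).
  assert (m3 : m <= / 16) by (unfold m; eapply Rle_trans; [apply Rmin_r|eapply Rle_trans; [apply Rmin_r|apply Rmin_l]]).
  assert (m4 : m <= c0 / 4) by (unfold m; eapply Rle_trans; [apply Rmin_r|eapply Rle_trans; [apply Rmin_r|apply Rmin_r]]).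
  set (K := 65 + N1 + 16 * C + 16 * N).
  set (s := m / K).
  assert (HK : 65 < K) by (unfold K; lra).
  assert (EsK : s * K = m) by (unfold s; field; lra).
  assert (Hs : 0 < s) by (apply Rdiv_lt_0_compat; lra).
  assert (Es : s * 65 + s * N1 + 16 * (s * C) + 16 * (s * N) = m) by (rewrite <- EsK; unfold K; ring).
  assert (p1 : 0 <= s * N1) by (apply Rmult_le_pos; lra).
  assert (p2 : s <= s * C) by (rewrite <- (Rmult_1_r s) at 1; apply Rmult_le_compat_l; lra).
  assert (p3 : s <= s * N) by (rewrite <- (Rmult_1_r s) at 1; apply Rmult_le_compat_l; lra).
  assert (Hss : s * s <= s) by nra.
  assert (pC : C * (s * s) <= s * C) by (rewrite (Rmult_comm s C); apply Rmult_le_compat_l; lra).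
  assert (pN : N * (s * s) <= s * N) by (rewrite (Rmult_comm s N); apply Rmult_le_compat_l; lra).
  exists (s * s), (- ln (s * s)).
  (* Chosen so that [exp (- d) = s^2], hence [e = exp (- 2 d) <= s^2]. *)
  set (d := - ln (s * s)).
  assert (Ed : exp (- d) = s * s) by (unfold d; rewrite Ropp_involutive; apply exp_ln; nra).
  assert (Hd : 0 < d) by (unfold d; rewrite <- Ropp_0; apply Ropp_lt_contravar; rewrite <- ln_1; apply ln_increasing; nra).
  split; [nra|split; [auto|]]; intros G yc HG.
  set (e := exp (- (2 * d))).
  assert (He : 0 <= e <= s * s) by (split; [left; apply exp_pos|rewrite <- Ed; now apply exp_2d_le]).
  assert (He1 : 0 <= e <= 1) by lra.
  assert (PG := Rabs_pos G).
  destruct (Fam G e ltac:(lra) ltac:(lra)) as (w & Fam1 & Fam2).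
  set (Zx := fun x => Zf A x (w x)).
  assert (near : forall x, Rabs x <= s -> nrm (Zx x - Z0 A) <= dl /\ nrm (Sc A (w x)) <= 3 * C * (s * s)).
  { intros x Hx; destruct (Fam1 x ltac:(lra)) as (_ & F & _).
    assert (xx : x * x <= s * s) by (generalize (Rsqr_le_abs_1 x s); rewrite (Rabs_pos_eq s) by lra; intros Q; now apply Q).
    assert (F' : nrm (Sc A (w x)) <= 3 * C * (s * s)).
    { eapply Rle_trans; [exact F|].
      replace (3 * C * (s * s)) with (C * (s * s + s * s + s * s)) by ring; apply Rmult_le_compat_l; lra. }
    split; auto; unfold Zx; rewrite Zf_def.
    replace (Z0 A + cst x * Z1 A + Sc A (w x) - Z0 A)%W with (cst x * Z1 A + Sc A (w x))%W by ring.
    apply Rle_trans with (s * N1 + 3 * C * (s * s)); [|lra].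
    apply nadd; auto; apply nmul; [eapply Rle_trans; [apply ncst|exact Hx]|unfold N1; lra]. }
  assert (aZ : forall x, analytic (Zx x)) by (intros; now apply analytic_Zf).
  assert (nZ : forall x, Rabs x <= s -> nrm (Zx x) <= N).
  { intros x Hx; generalize (nrm_near A _ _ (proj1 (near x Hx))); unfold N; lra. }
  assert (nK : forall x, Rabs x <= s -> nrm (Kop e (Zx x) - Z0 A) <= (2 + N) * dl).
  { intros x Hx; destruct (near x Hx) as [F1 _].
    replace (Kop e (Zx x) - Z0 A)%W with (Kop e (Zx x - Z0 A) + (Kop e (Z0 A) - Z0 A))%W
      by (rewrite Kop_add, Kop_opp by auto; ring).
    eapply Rle_trans; [apply nrm_add|].
    generalize (nrm_Kop e (Zx x - Z0 A) He1) (nrm_Kop_sub e _ He1 (analytic_Z0 A HA)).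
    assert (e * nrm (Z0 A) <= dl * N) by (apply Rmult_le_compat; try lra; [apply nrm_pos|unfold N; lra]); lra. }
  set (X := fun x al => al + PS (Kop e (Zx x)) al).
  set (k := fun al => 4 * (1 - A * A) * sin al / (DA A al * DA A al)).
  (* First-order expansion of the abscissa: the errors come from the quadratic correction [Sc] and
     from the finite depth. *)
  assert (F1 : forall x al, Rabs x <= s -> 0 <= sin al ->
    Rabs (X x al - (XA A al - x * k al)) <= sin al * ((3 * C + N) * (s * s))).
  { intros x al Hx Hsin; destruct (near x Hx) as [_ F].
    assert (B1 := PS_diff (Kop e (Zx x)) (Zx x) al); rewrite (Rabs_pos_eq (sin al)) in B1 by auto.
    assert (B2 := nrm_Kop_sub e (Zx x) He1 (aZ x)).
    assert (B3 := proj2 (PS_bound (Sc A (w x)) al)); rewrite (Rabs_pos_eq (sin al)) in B3 by auto.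
    assert (EP : PS (Zx x) al = PS (Z0 A) al + x * - k al + PS (Sc A (w x)) al).
    { unfold Zx; rewrite Zf_def, !PS_add, PS_cst_mul, PS_Z1 by auto; reflexivity. }
    assert (EX := PS_Z0 A al HA).
    replace (X x al - (XA A al - x * k al)) with ((PS (Kop e (Zx x)) al - PS (Zx x) al) + PS (Sc A (w x)) al)
      by (unfold X; rewrite EP, <- EX; ring).
    eapply Rle_trans; [apply Rabs_triang|].
    assert (B4 : nrm (Kop e (Zx x) - Zx x) <= N * (s * s)).
    { eapply Rle_trans; [exact B2|]; rewrite (Rmult_comm N); apply Rmult_le_compat; try lra; [apply nrm_pos|now apply nZ]. }
    assert (B5 := Rmult_le_compat_l _ _ _ Hsin B4); assert (B6 := Rmult_le_compat_l _ _ _ Hsin F); lra. }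
  assert (F2 : forall x y al, Rabs x <= s0 -> Rabs y <= s0 -> Rabs (X x al - X y al) <= 2 * C * Rabs (x - y)).
  { intros x y al Hx Hy; unfold X.
    replace (al + PS (Kop e (Zx x)) al - (al + PS (Kop e (Zx y)) al)) with (PS (Kop e (Zx x)) al - PS (Kop e (Zx y)) al) by ring.
    eapply Rle_trans; [apply PS_diff|].
    replace (Kop e (Zx x) - Kop e (Zx y))%W with (Kop e (Zx x - Zx y)) by (rewrite Kop_add, Kop_opp by auto; ring).
    assert (B1 := nrm_Kop e (Zx x - Zx y) He1); assert (B2 := Fam2 x y Hx Hy); fold (Zx x) (Zx y) in B2.
    assert (B3 : Rabs (sin al) <= 1) by apply Rabs_le, SIN_bound.
    assert (B4 := Rmult_le_compat_r (nrm (Kop e (Zx x - Zx y))) _ _ (nrm_pos _) B3); lra. }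
  assert (cX : forall x al, continuity_pt (X x) al).
  { intros x al; apply (lipschitz_continuity _ (1 + nrm (Kop e (Zx x)))); [generalize (nrm_pos (Kop e (Zx x))); lra|].
    intros y; unfold X; replace (y + PS (Kop e (Zx x)) y - (al + PS (Kop e (Zx x)) al)) with
      ((y - al) + (PS (Kop e (Zx x)) y - PS (Kop e (Zx x)) al)) by ring.
    eapply Rle_trans; [apply Rabs_triang|]; generalize (PS_lipschitz (Kop e (Zx x)) al y); lra. }
  assert (kb : forall al, 0 <= sin al -> 3 / 16 * sin al <= k al <= 64 * sin al) by (intros al; now apply crapper_shift_bounds).
  assert (out : forall x al, Rabs x <= s -> 0 < al < PI -> al <= th - h \/ th + h <= al -> 0 < X x al).
  { intros x al Hx Hal Ho; assert (Hsin : 0 < sin al) by (apply sin_gt_0; lra).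
    assert (B := F1 x al Hx ltac:(lra)); apply Rabs_le_between in B.
    assert (B1 := Lout al Hal Ho); destruct (kb al ltac:(lra)) as [_ B2]; assert (B3 : 0 <= k al) by (generalize (kb al ltac:(lra)); lra).
    assert (B4 : Rabs (x * k al) <= s * (64 * sin al)) by (rewrite Rabs_mult, (Rabs_pos_eq (k al)) by auto; apply Rmult_le_compat; try lra; apply Rabs_pos).
    apply Rabs_le_between in B4.
    assert (B5 : sin al * ((3 * C + N) * (s * s)) <= sin al * (3 * (s * C) + s * N)) by (apply Rmult_le_compat_l; lra).
    assert (B6 : 0 < sin al * (c0 - 64 * s - (3 * (s * C) + s * N))) by (apply Rmult_lt_0_compat; lra).
    lra. }
  assert (exm : forall x, exists v, exists al, th - h <= al <= th + h /\ X x al = v /\ forall b, th - h <= b <= th + h -> v <= X x b).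
  { intros x; destruct (continuity_ab_min (X x) (th - h) (th + h) ltac:(lra)) as (al & H1 & H2); [auto|].
    exists (X x al), al; auto. }
  (* The minimum of the abscissa near the contact, as a function of the tangent parameter; it
     inherits the Lipschitz continuity of the family. *)
  set (mm := fun x => epsilon (inhabits 0) (fun v => exists al, th - h <= al <= th + h /\ X x al = v /\ forall b, th - h <= b <= th + h -> v <= X x b)).
  assert (Hmm : forall x, exists al, th - h <= al <= th + h /\ X x al = mm x /\ forall b, th - h <= b <= th + h -> mm x <= X x b).
  { intros x; unfold mm; apply epsilon_spec, exm. }
  assert (cmm : forall x, - s <= x <= s -> continuity_pt mm x).
  { assert (L : forall x y, Rabs x <= s0 -> Rabs y <= s0 -> mm y - mm x <= 2 * C * Rabs (x - y)).
    { intros x y Hx Hy; destruct (Hmm x) as (al & H1 & H2 & _), (Hmm y) as (_ & _ & _ & H3).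
      specialize (H3 al H1); assert (B := F2 x y al Hx Hy); apply Rabs_le_between in B; lra. }
    intros x Hx ee Hee; exists (Rmin (s0 - s) (ee / (2 * C))); split.
    - apply Rmin_glb_lt; [lra|apply Rdiv_lt_0_compat; lra].
    - intros y [_ Hy]; simpl in *; unfold Rdist in *.
      assert (y1 : Rabs (y - x) < s0 - s) by (eapply Rlt_le_trans; [exact Hy|apply Rmin_l]).
      assert (y2 : Rabs (y - x) < ee / (2 * C)) by (eapply Rlt_le_trans; [exact Hy|apply Rmin_r]).
      assert (Hx0 : Rabs x <= s0) by (apply Rabs_le; lra).
      assert (Hy0 : Rabs y <= s0) by (apply Rabs_def2 in y1; apply Rabs_le; lra).
      assert (L1 := L x y Hx0 Hy0); assert (L2 := L y x Hy0 Hx0); rewrite (Rabs_minus_sym x y) in L1.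
      assert (2 * C * Rabs (y - x) < ee).
      { apply Rmult_lt_compat_l with (r := 2 * C) in y2; [|lra].
        replace (2 * C * (ee / (2 * C))) with ee in y2 by (field; lra); auto. }
      apply Rabs_def1; lra. }
  assert (ml : 0 < mm (- s)).
  { destruct (Hmm (- s)) as (al & H1 & H2 & _); rewrite <- H2.
    assert (Hsin : 0 < sin al) by (apply sin_gt_0; lra).
    assert (B := F1 (- s) al ltac:(rewrite Rabs_Ropp, Rabs_pos_eq; lra) ltac:(lra)); apply Rabs_le_between in B.
    assert (B1 : 0 <= XA A al) by (destruct (Req_dec al th) as [->|Hne]; [lra|left; apply (XA_positive A th); auto; lra]).
    destruct (kb al ltac:(lra)) as [B2 _]; assert (B3 := Rmult_le_compat_l s _ _ ltac:(lra) B2).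
    assert (B6 : 0 < sin al * (s * (3 / 16 - (3 * (s * C) + s * N)))) by (apply Rmult_lt_0_compat; [lra|apply Rmult_lt_0_compat; lra]).
    lra. }
  assert (mr : mm s < 0).
  { destruct (Hmm s) as (_ & _ & _ & H3); specialize (H3 th ltac:(lra)).
    assert (Hsin : 0 < sin th) by (apply sin_gt_0; lra).
    assert (B := F1 s th ltac:(rewrite Rabs_pos_eq; lra) ltac:(lra)); apply Rabs_le_between in B; rewrite E0 in B.
    destruct (kb th ltac:(lra)) as [B2 _]; assert (B3 := Rmult_le_compat_l s _ _ ltac:(lra) B2).
    assert (B6 : 0 < sin th * (s * (3 / 16 - (3 * (s * C) + s * N)))) by (apply Rmult_lt_0_compat; [lra|apply Rmult_lt_0_compat; lra]).
    lra. }
  destruct (IVT_interv (fun x => - mm x) (- s) s) as (x & Hx & Ex); try lra.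
  { intros x Hx; apply continuity_pt_opp, cmm, Hx. }
  destruct (Hmm x) as (al & Hal1 & Hal2 & Hal3).
  assert (mm0 : mm x = 0) by lra; rewrite mm0 in Hal2, Hal3; clear Ex.
  assert (Hxs : Rabs x <= s) by (apply Rabs_le; lra).
  destruct (near x Hxs) as [nx _]; destruct (Fam1 x ltac:(lra)) as (EQ & _ & FQ).
  destruct (Qf_cst A x (w x)) as (q & Eq); rewrite Eq in EQ, FQ.
  assert (Hal4 : th - h < al < th + h).
  { assert (K1 : ~ (al <= th - h)) by (intros Q; generalize (out x al Hxs ltac:(lra) ltac:(lra)); lra).
    assert (K2 : ~ (th + h <= al)) by (intros Q; generalize (out x al Hxs ltac:(lra) ltac:(lra)); lra). lra. }
  assert (nonneg : forall b, 0 <= b <= PI -> 0 <= X x b).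
  { intros b Hb; destruct (Req_dec b 0) as [->|]; [unfold X, PS; rewrite Sum_zero; [lra|intros; rewrite Rmult_0_r, sin_0; ring]|].
    destruct (Req_dec b PI) as [->|].
    - unfold X; assert (B := proj2 (PS_bound (Kop e (Zx x)) PI)); rewrite sin_PI, Rabs_R0, Rmult_0_l in B.
      apply Rabs_le_between in B; lra.
    - destruct (Rle_dec b (th - h)); [left; apply out; auto; lra|].
      destruct (Rle_dec (th + h) b); [left; apply out; auto; lra|apply Hal3; lra]. }
  assert (Hq : forall b, 0 < q - 2 * G * Re (ev (prim (Kop e (Zx x))) (b, 0))).
  { intros b.
    assert (B1 : 3 / 4 <= q).
    { rewrite Q0_cst in FQ; replace (cst q - cst (qq A * qq A))%W with (cst (q - qq A * qq A)) in FQ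
        by (unfold Rminus; rewrite cst_plus, cst_opp; ring).
      rewrite nrm_cst in FQ.
      assert (q1 := qq_ge_1 A ltac:(lra)); assert (q2 : 1 * 1 <= qq A * qq A) by (apply Rmult_le_compat; lra).
      assert (B2 : C * (Rabs x + Rabs G + e) <= 3 * (s * C)).
      { replace (3 * (s * C)) with (C * (s + s + s)) by ring; apply Rmult_le_compat_l; lra. }
      apply Rabs_le_between in FQ; lra. }
    assert (B2 : Rabs (Re (ev (prim (Kop e (Zx x))) (b, 0))) <= 2 * N).
    { unfold e; rewrite <- (re_RtoC (Re _)), <- evw_Yop by auto; fold e.
      rewrite Re_evw; apply Rle_trans with (1 * nrm (Yop e (Zx x))).
      - apply Sum_mult_bound; [lra|]; intros n; rewrite Rabs_mult, Rmult_1_l; apply Rmult_le_compat_l; [apply Rabs_pos|].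
        apply Rle_trans with 1; [apply Rabs_le, COS_bound|apply wt_ge_1].
      - generalize (nrm_Yop e (Zx x) He1) (nZ x Hxs); lra. }
    assert (B3 : Rabs (2 * G * Re (ev (prim (Kop e (Zx x))) (b, 0))) <= 2 * (s * s) * (2 * N)).
    { rewrite !Rabs_mult, (Rabs_pos_eq 2) by lra; apply Rmult_le_compat; try lra; try apply Rabs_pos. }
    apply Rabs_le_between in B3; lra. }
  destruct (flow_of_solution d yc G q (Zx x) (uf A x (w x)) Hd (aZ x) (analytic_uf A x (w x) HA) (Zf_0 A x (w x) HA) EQ)
    as (P & HF).
  { intros b; apply (evw_far_from_zero A (Kop e (Zx x)) b HA); eapply Rle_trans; [now apply nK|lra]. }
  { exact Hq. }
  fold e in HF.
  exists q, (zmap (Kop e (Zx x)) yc), (ev (Kop e (Zx x))), (fun w0 => - Ci * ev (da (Kop e (Zx x))) w0)%C.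
  exists (ev (Kop e (uf A x (w x)))), (fun w0 => - Ci * ev (da (Kop e (uf A x (w x)))) w0)%C, P, al.
  split; [exact HF|].
  assert (EX : forall b, Re (zmap (Kop e (Zx x)) yc (b, 0)) = X x b).
  { intros b; unfold zmap, X, PS; simpl.
    replace (Sum (fun n => prim (Kop e (Zx x)) n * eS n (b, 0))) with (Sum (fun n => prim (Kop e (Zx x)) n * sin (IZR n * b))); [ring|].
    apply Sum_ext; intros n; unfold eS; simpl; rewrite Rmult_0_r, exp_0; ring. }
  assert (ed : exp (- d) <= dl) by lra.
  destruct (LS d (Zx x) Hd ltac:(lra) (aZ x) (Zf_0 A x (w x) HA) ltac:(lra)) as [LS1 LS2]; fold e in LS1, LS2.
  assert (Hal : 0 < al < PI) by lra.
  constructor; auto.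
  - intros b y Hb Hy; apply (LI d (Zx x)); auto; lra.
  - intros y Hy; now apply LS1.
  - intros y Hy; now apply LS1.
  - now rewrite EX.
  - intros b Hb; rewrite EX; now apply nonneg.
  - intros b Hb Hb0; rewrite EX in Hb0.
    assert (Hb4 : th - h < b < th + h).
    { assert (K1 : ~ (b <= th - h)) by (intros Q; generalize (out x b Hxs ltac:(lra) ltac:(lra)); lra).
      assert (K2 : ~ (th + h <= b)) by (intros Q; generalize (out x b Hxs ltac:(lra) ltac:(lra)); lra). lra. }
    (* Both zeros are minima of [X x], where the derivative vanishes; but the derivative increases. *)
    assert (crit : forall v, 0 < v < PI -> X x v = 0 -> Re (evw (Kop e (Zx x)) v) = 0).
    { intros v Hv Hv0; assert (HL := Lr_pos).
      assert (D := proj1 (cderive_alpha _ v 0 _ (fl_z _ _ _ _ _ _ _ _ _ _ _ HF (v, 0) ltac:(simpl; lra)))).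
      apply (is_derive_ext _ (X x)) in D; [|exact EX]; apply is_derive_Reals in D.
      set (pr := exist (fun l => derivable_pt_abs (X x) v l) _ D : derivable_pt (X x) v).
      assert (E1 : derive_pt (X x) v pr = Re (ev (Kop e (Zx x)) (v, 0))) by reflexivity.
      unfold evw; rewrite <- E1.
      apply (deriv_minimum (X x) 0 PI v pr); try lra.
      intros b' H1 H2; rewrite Hv0; apply nonneg; lra. }
    assert (mono : forall v1 v2, th - h <= v1 -> v1 < v2 -> v2 <= th + h -> Re (evw (Kop e (Zx x)) v1) < Re (evw (Kop e (Zx x)) v2)).
    { intros v1 v2 H1 H2 H3; assert (B1 := Linc v1 v2 H1 H2 H3).
      assert (B2 := Re_evw_lipschitz (Kop e (Zx x) - Z0 A) v1 v2).
      rewrite !evw_add, !evw_opp, !evw_Z0 in B2 by auto.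
      change (Rabs ((Re (evw (Kop e (Zx x)) v2) - XA' A v2) - (Re (evw (Kop e (Zx x)) v1) - XA' A v1)) <=
        C2 * Rabs (v2 - v1) * nrm (Kop e (Zx x) - Z0 A)) in B2.
      rewrite (Rabs_pos_eq (v2 - v1)) in B2 by lra.
      assert (B3 : C2 * (v2 - v1) * nrm (Kop e (Zx x) - Z0 A) <= (v2 - v1) * (c / 2)).
      { replace (C2 * (v2 - v1) * nrm (Kop e (Zx x) - Z0 A)) with ((v2 - v1) * (C2 * nrm (Kop e (Zx x) - Z0 A))) by ring.
        apply Rmult_le_compat_l; [lra|]; apply Rle_trans with (2 := dl3); apply Rmult_le_compat_l; [lra|now apply nK]. }
      apply Rabs_le_between in B2.
      assert (0 < c * (v2 - v1)) by (apply Rmult_lt_0_compat; lra).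
      lra. }
    assert (C1 := crit b Hb Hb0); assert (C3 := crit al Hal Hal2).
    destruct (Rtotal_order b al) as [Q|[Q|Q]]; auto.
    + generalize (mono b al ltac:(lra) Q ltac:(lra)); lra.
    + generalize (mono al b ltac:(lra) Q ltac:(lra)); lra.
Qed.

(** * Plane topology in terms of the modulus *)

(** [locally] on [R * R] uses squares; discs fit the modulus and complex derivatives. *)
Definition near (p : C) (P : C -> Prop) : Prop :=
  exists r, 0 < r /\ forall q, Cmod (q - p)%C < r -> P q.

Lemma locally_near (p : C) (P : C -> Prop) : locally p P <-> near p P.
Proof.
  split.
  - intros [e He]; exists e; split; [apply cond_pos|]; intros q Hq; apply He.
    split; [change (Rabs (Re (q - p)%C) < e); eapply Rle_lt_trans; [apply Rabs_Re_le|exact Hq]|].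
    change (Rabs (Im (q - p)%C) < e); eapply Rle_lt_trans; [apply Rabs_Im_le|exact Hq].
  - intros (r & Hr & H); assert (H2 : 0 < r / 2) by lra; exists (mkposreal _ H2); intros q [H3 H4]; apply H.
    change (Rabs (Re (q - p)%C) < r / 2) in H3; change (Rabs (Im (q - p)%C) < r / 2) in H4.
    eapply Rle_lt_trans; [apply (Cmod_le_sum (Re (q - p)%C) (Im (q - p)%C))|lra].
Qed.

Lemma near_self p P : near p P -> P p.
Proof. intros (r & Hr & H); apply H; replace (p - p)%C with (RtoC 0) by ring; now rewrite Cmod_0. Qed.

Lemma near_imp p (P Q : C -> Prop) : near p P -> (forall q, P q -> Q q) -> near p Q.
Proof. intros (r & Hr & H) HI; exists r; auto. Qed.

Lemma near_and p (P Q : C -> Prop) : near p P -> near p Q -> near p (fun q => P q /\ Q q).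
Proof.
  intros (r & Hr & H) (s & Hs & K); exists (Rmin r s); split; [now apply Rmin_glb_lt|].
  intros q Hq; split; [apply H|apply K]; eapply Rlt_le_trans; try exact Hq; [apply Rmin_l|apply Rmin_r].
Qed.

Lemma open_near (U : C -> Prop) : open U <-> forall p, U p -> near p U.
Proof. split; intros H p Hp; [apply locally_near; now apply H|apply locally_near; now apply H]. Qed.

Lemma adherent_near D p : adherent D p <-> forall r, 0 < r -> exists q, Cmod (q - p)%C < r /\ D q.
Proof.
  unfold adherent; rewrite locally_near; split.
  - intros H r Hr; apply NNPP; intros K; apply H; exists r; split; auto; intros q Hq HD; apply K; eauto.
  - intros H (r & Hr & K); destruct (H r Hr) as (q & Hq & HD); exact (K q Hq HD).
Qed.

(** Continuity relative to [S], as needed at boundary points of the strip. *)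
Definition cts (S : C -> Prop) (f : C -> C) (w : C) : Prop :=
  forall e, 0 < e -> near w (fun v => S v -> Cmod (f v - f w)%C < e).

Lemma cts_on S f : (forall w, S w -> cts S f w) <-> continuous_on S f.
Proof.
  split; intros H w Hw.
  - intros P HP; apply locally_near in HP; destruct HP as (r & Hr & HP).
    apply locally_near; eapply near_imp; [apply (H w Hw r Hr)|]; intros v Hv Sv; auto.
  - intros e He; apply locally_near; apply (H w Hw (fun q => Cmod (q - f w)%C < e)).
    apply locally_near; exists e; auto.
Qed.

Lemma cts_cderive S f w l : is_cderive f w l -> cts S f w.
Proof.
  intros H e He; destruct (proj1 (cderive_iff f w l) H 1 ltac:(lra)) as (r & Hr & K).
  assert (Pl := Cmod_ge_0 l).
  exists (Rmin r (e / (Cmod l + 2))); split; [apply Rmin_glb_lt; [auto|apply Rdiv_lt_0_compat; lra]|].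
  intros v Hv _; specialize (K (v - w)%C); replace (w + (v - w))%C with v in K by ring.
  assert (H1 : Cmod (v - w)%C < r) by (eapply Rlt_le_trans; [exact Hv|apply Rmin_l]).
  assert (H2 : Cmod (v - w)%C < e / (Cmod l + 2)) by (eapply Rlt_le_trans; [exact Hv|apply Rmin_r]).
  specialize (K H1).
  replace (f v - f w)%C with ((f v - f w - l * (v - w)) + l * (v - w))%C by ring.
  eapply Rle_lt_trans; [apply Cmod_triangle|]; rewrite (Cmod_mult l).
  apply Rmult_lt_compat_r with (r := Cmod l + 2) in H2; [|lra].
  replace (e / (Cmod l + 2) * (Cmod l + 2)) with e in H2 by (field; lra).
  generalize (Cmod_ge_0 (v - w)%C); nra.
Qed.

Definition convex (S : C -> Prop) : Prop :=
  forall v w t, S v -> S w -> 0 <= t <= 1 -> S (v + RtoC t * (w - v))%C.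

Lemma Cmod_line (v w : C) (s t : R) :
  Cmod ((v + RtoC s * (w - v)) - (v + RtoC t * (w - v)))%C = Rabs (s - t) * Cmod (w - v)%C.
Proof.
  replace ((v + RtoC s * (w - v)) - (v + RtoC t * (w - v)))%C with ((RtoC s - RtoC t) * (w - v))%C by ring.
  now rewrite Cmod_mult, <- RtoC_minus, Cmod_R.
Qed.

(** At the supremum of the initial segments contained in [U], openness of whichever set contains it
    yields a common point. *)
Lemma segment_connected (U V : R -> Prop) :
  (forall t, U t -> exists r, 0 < r /\ forall s, Rabs (s - t) < r -> 0 <= s <= 1 -> U s) ->
  (forall t, V t -> exists r, 0 < r /\ forall s, Rabs (s - t) < r -> 0 <= s <= 1 -> V s) ->
  (forall t, 0 <= t <= 1 -> U t \/ V t) -> U 0 -> V 1 -> exists t, 0 <= t <= 1 /\ U t /\ V t.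
Proof.
  intros HU HV HUV H0 H1.
  set (E := fun t => 0 <= t <= 1 /\ forall s, 0 <= s <= t -> U s).
  assert (E0 : E 0) by (split; [lra|]; intros s Hs; now replace s with 0 by lra).
  destruct (completeness E) as (m & Hm1 & Hm2); [exists 1; intros t [Ht _]; lra|now exists 0|].
  assert (B : 0 <= m <= 1) by (split; [now apply Hm1|apply Hm2; intros t [Ht _]; lra]).
  assert (below : forall s, 0 <= s < m -> U s).
  { intros s Hs; apply NNPP; intros K; assert (m <= s); [|lra].
    apply Hm2; intros t [Ht Ht2]; apply Rnot_lt_le; intros Q; apply K, Ht2; lra. }
  destruct (HUV m B) as [Um|Vm].
  - destruct (Rle_lt_or_eq_dec m 1 (proj2 B)) as [Q| ->]; [|exists 1; auto].
    destruct (HU m Um) as (r & Hr & K); exfalso.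
    set (s := Rmin 1 (m + r / 2)).
    assert (Hs : m < s) by (apply Rmin_glb_lt; lra).
    assert (s1 : s <= 1) by apply Rmin_l; assert (s2 : s <= m + r / 2) by apply Rmin_r.
    assert (s <= m); [|lra].
    apply Hm1; split; [lra|]; intros t Ht; destruct (Rlt_dec t m); [apply below; lra|].
    apply K; [rewrite Rabs_pos_eq; lra|lra].
  - destruct (HV m Vm) as (r & Hr & K); destruct (Req_dec m 0) as [->|Hne]; [exists 0; auto|].
    set (s := Rmax 0 (m - r / 2)).
    assert (Hs : s < m) by (apply Rmax_lub_lt; lra).
    assert (s1 : 0 <= s) by apply Rmax_l; assert (s2 : m - r / 2 <= s) by apply Rmax_r.
    exists s; split; [lra|split; [apply below; lra|apply K; [rewrite Rabs_left1; lra|lra]]].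
Qed.

Lemma image_connected (S : C -> Prop) (f : C -> C) : convex S -> (forall w, S w -> cts S f w) ->
  connected (fun p => exists w, S w /\ p = f w).
Proof.
  intros HS Hf U V HU HV HUV (p & (v & Sv & ->) & Up) (q & (w & Sw & ->) & Vq).
  set (c := fun t : R => (v + RtoC t * (w - v))%C).
  assert (Sc : forall t, 0 <= t <= 1 -> S (c t)) by (intros; now apply HS).
  assert (key : forall W : C -> Prop, open W -> forall t, 0 <= t <= 1 -> W (f (c t)) ->
    exists r, 0 < r /\ forall s, Rabs (s - t) < r -> 0 <= s <= 1 -> W (f (c s))).
  { intros W HW t Ht Wt; destruct (proj1 (open_near W) HW _ Wt) as (e & He & K).
    destruct (Hf (c t) (Sc t Ht) e He) as (r & Hr & K2).
    assert (P := Cmod_ge_0 (w - v)%C).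
    exists (r / (Cmod (w - v)%C + 1)); split; [apply Rdiv_lt_0_compat; lra|].
    intros s Hs Hs1; apply K, K2; [|now apply Sc].
    unfold c; rewrite Cmod_line.
    apply Rmult_lt_compat_r with (r := Cmod (w - v)%C + 1) in Hs; [|lra].
    replace (r / (Cmod (w - v)%C + 1) * (Cmod (w - v)%C + 1)) with r in Hs by (field; lra).
    generalize (Rabs_pos (s - t)); nra. }
  destruct (segment_connected (fun t => 0 <= t <= 1 /\ U (f (c t))) (fun t => 0 <= t <= 1 /\ V (f (c t)))) as (t & Ht & [_ H1] & [_ H2]).
  - intros t [Ht Ut]; destruct (key U HU t Ht Ut) as (r & Hr & K); exists r; split; auto.
  - intros t [Ht Ut]; destruct (key V HV t Ht Ut) as (r & Hr & K); exists r; split; auto.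
  - intros t Ht; destruct (HUV (f (c t))) as [K|K]; [now exists (c t); auto|left; auto|right; auto].
  - split; [lra|]; unfold c; replace (v + RtoC 0 * (w - v))%C with v by ring; auto.
  - split; [lra|]; unfold c; replace (v + RtoC 1 * (w - v))%C with w by ring; auto.
  - exists (f (c t)); split; [exists (c t); auto|auto].
Qed.

Lemma adherent_image (S T : C -> Prop) (f : C -> C) v w : S v -> cts T f w -> (forall x, S x -> T x) ->
  (forall t, 0 < t <= 1 -> S (w + RtoC t * (v - w))%C) -> adherent (fun p => exists w, S w /\ p = f w) (f w).
Proof.
  intros Sv Hf ST HS; apply adherent_near; intros e He.
  destruct (Hf e He) as (r & Hr & K); assert (P := Cmod_ge_0 (v - w)%C).
  set (t := Rmin 1 (r / (Cmod (v - w)%C + 1))).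
  assert (Ht : 0 < t) by (apply Rmin_glb_lt; [lra|apply Rdiv_lt_0_compat; lra]).
  assert (t1 : t <= 1) by apply Rmin_l; assert (t2 : t <= r / (Cmod (v - w)%C + 1)) by apply Rmin_r.
  exists (f (w + RtoC t * (v - w))%C); split; [|exists (w + RtoC t * (v - w))%C; split; auto].
  apply K; [|apply ST; auto].
  replace (w + RtoC t * (v - w) - w)%C with (RtoC t * (v - w))%C by ring.
  rewrite Cmod_mult, Cmod_R, Rabs_pos_eq by lra.
  apply Rmult_le_compat_r with (r := Cmod (v - w)%C + 1) in t2; [|lra].
  replace (r / (Cmod (v - w)%C + 1) * (Cmod (v - w)%C + 1)) with r in t2 by (field; lra).
  nra.
Qed.

(** * Geometry of the conformal map *)

(** [[0, PI]] is a fundamental domain for the group generated by the period and the reflection; [k]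
    and [s] record the group element. *)
Lemma fold_exists x : exists (k : Z) (s r : R), 0 <= r <= PI /\ (s = 1 \/ s = - 1) /\ x = 2 * PI * IZR k + s * r.
Proof.
  assert (HP := PI_RGT_0).
  set (k := Int_part (x / (2 * PI))).
  destruct (base_Int_part (x / (2 * PI))) as [B1 B2]; fold k in B1, B2.
  assert (E : x = 2 * PI * (x / (2 * PI))) by (field; lra).
  assert (B3 : 0 <= x - 2 * PI * IZR k < 2 * PI) by (rewrite E; split; nra).
  destruct (Rle_dec (x - 2 * PI * IZR k) PI).
  - exists k, 1, (x - 2 * PI * IZR k); split; [lra|split; [auto|ring]].
  - exists (k + 1)%Z, (- 1), (2 * PI - (x - 2 * PI * IZR k)); rewrite plus_IZR; split; [lra|split; [auto|ring]].
Qed.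

Lemma fold_unique k1 k2 s1 s2 r1 r2 : 0 <= r1 <= PI -> 0 <= r2 <= PI -> s1 = 1 \/ s1 = - 1 -> s2 = 1 \/ s2 = - 1 ->
  2 * PI * IZR k1 + s1 * r1 = 2 * PI * IZR k2 + s2 * r2 ->
  r1 = r2 /\ (r1 = PI \/ k1 = k2 /\ (s1 = s2 \/ r1 = 0)).
Proof.
  intros H1 H2 S1 S2 E; assert (HP := PI_RGT_0).
  assert (E' : 2 * PI * IZR (k1 - k2) = s2 * r2 - s1 * r1) by (rewrite minus_IZR; lra).
  assert (B : - 2 * PI <= s2 * r2 - s1 * r1 <= 2 * PI) by (destruct S1 as [-> | ->], S2 as [-> | ->]; lra).
  assert (K : (-1 <= k1 - k2 <= 1)%Z).
  { split; apply le_IZR; apply Rmult_le_reg_l with (2 * PI); lra. }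
  destruct (Z.eq_dec (k1 - k2) 0) as [Q|Q].
  - rewrite Q in E'; assert (k1 = k2) by lia.
    destruct S1 as [-> | ->], S2 as [-> | ->]; split; auto; try lra; right; split; auto; right; lra.
  - assert (Q' : (k1 - k2 = 1 \/ k1 - k2 = -1)%Z) by lia.
    destruct Q' as [Q'|Q']; rewrite Q' in E'; destruct S1 as [-> | ->], S2 as [-> | ->]; split; try lra; left; lra.
Qed.

Record geometry (d eta H a : R) (z Z : C -> C) : Prop := {
  ge_d : 0 < d;
  ge_eta : 0 < eta;
  ge_z : forall w, - d - eta < Im w < eta -> is_cderive z w (Z w);
  ge_Z : forall w, - d - eta < Im w < eta -> exists l, is_cderive Z w l;
  ge_per : forall x y, z (x + 2 * PI, y) = (z (x, y) + RtoC (2 * PI))%C;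
  ge_Zper : forall x y, Z (x + 2 * PI, y) = Z (x, y);
  ge_sym : forall x y, - d - eta < y < eta -> Re (z (- x, y)) = - Re (z (x, y)) /\ Im (z (- x, y)) = Im (z (x, y));
  ge_Zsym : forall x y, - d - eta < y < eta -> Re (Z (- x, y)) = Re (Z (x, y)) /\ Im (Z (- x, y)) = - Im (Z (x, y));
  ge_bot : forall x, Im (z (x, - d)) = - H;
  ge_shape : shape d z Z a
}.

Lemma ge_perk d eta H a z Z : geometry d eta H a z Z ->
  forall k x y, z (x + 2 * PI * IZR k, y) = (z (x, y) + RtoC (2 * PI * IZR k))%C.
Proof.
  intros g.
  assert (S : forall k x y, z (x + 2 * PI * (IZR k + 1), y) = (z ((x + 2 * PI * IZR k)%R, y) + RtoC (2 * PI))%C).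
  { intros k x y; rewrite <- (ge_per _ _ _ _ _ _ g); do 2 f_equal; ring. }
  intros k; induction k as [|k K|k K] using Z.peano_ind; intros x y.
  - change (z (x + 2 * PI * 0, y) = (z (x, y) + RtoC (2 * PI * 0)%R)%C); rewrite Rmult_0_r, Rplus_0_r; ring.
  - unfold Z.succ; rewrite plus_IZR, S, K.
    replace (2 * PI * (IZR k + 1)) with (2 * PI * IZR k + 2 * PI) by ring; rewrite (RtoC_plus (2 * PI * IZR k)); ring.
  - specialize (S (Z.pred k) x y); replace (IZR (Z.pred k) + 1) with (IZR k) in S
      by (unfold Z.pred; rewrite plus_IZR; ring).
    rewrite K in S; unfold Z.pred in *; rewrite plus_IZR in *.
    replace (2 * PI * IZR k) with (2 * PI * (IZR k + -1) + 2 * PI) in S by ring; rewrite (RtoC_plus (2 * PI * (IZR k + -1))) in S.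
    replace (z (x + 2 * PI * (IZR k + -1), y)) with (z ((x + 2 * PI * (IZR k + -1))%R, y) + RtoC (2 * PI) - RtoC (2 * PI))%C by ring.
    rewrite <- S; ring.
Qed.

Lemma ge_fold d eta H a z Z k s x y : geometry d eta H a z Z -> - d - eta < y < eta -> s = 1 \/ s = - 1 ->
  Re (z (2 * PI * IZR k + s * x, y)) = 2 * PI * IZR k + s * Re (z (x, y)) /\
  Im (z (2 * PI * IZR k + s * x, y)) = Im (z (x, y)).
Proof.
  intros g Hy Hs; rewrite Rplus_comm, (ge_perk _ _ _ _ _ _ g).
  change (Re (z (s * x, y)) + 2 * PI * IZR k = 2 * PI * IZR k + s * Re (z (x, y)) /\ Im (z (s * x, y)) + 0 = Im (z (x, y))).
  destruct Hs as [-> | ->].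
  - rewrite !Rmult_1_l; split; ring.
  - replace (-1 * x) with (- x) by ring; destruct (ge_sym _ _ _ _ _ _ g x y Hy) as [-> ->]; split; ring.
Qed.

(** Noshiro-Warschawski: along a chord, [Im (conj (w - v) * z)] has derivative [|w - v|^2 * Im z']. *)
Lemma noshiro_warschawski (z Z : C -> C) (v w : C) :
  (forall t : R, 0 <= t <= 1 -> is_cderive z (v + RtoC t * (w - v))%C (Z (v + RtoC t * (w - v))%C)) ->
  (forall t : R, 0 < t < 1 -> 0 < Im (Z (v + RtoC t * (w - v))%C)) -> v <> w ->
  0 < Re (w - v)%C * Im (z w - z v)%C - Im (w - v)%C * Re (z w - z v)%C.
Proof.
  intros Hz HZ Hne.
  set (c := fun t : R => (v + RtoC t * (w - v))%C).
  assert (Hc : forall t h, c (t + h) = (c t + RtoC h * (w - v))%C) by (intros; unfold c; rewrite RtoC_plus; ring).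
  set (p := Re (w - v)%C); set (q := Im (w - v)%C).
  assert (Hpq : 0 < p * p + q * q).
  { destruct (Req_dec p 0) as [E1|], (Req_dec q 0) as [E2|]; try nra.
    exfalso; apply Hne; destruct v, w; unfold p, q in *; simpl in *; f_equal; lra. }
  set (g := fun t => p * Im (z (c t)) - q * Re (z (c t))).
  assert (D : forall t, 0 <= t <= 1 -> is_derive g t ((p * p + q * q) * Im (Z (c t)))).
  { intros t Ht; destruct (cderive_curve z c t _ _ (Hz t Ht) (Hc t)) as [D1 D2].
    replace ((p * p + q * q) * Im (Z (c t))) with
      (p * Im (Z (c t) * (w - v))%C - q * Re (Z (c t) * (w - v))%C)
      by (unfold p, q; generalize (Z (c t)) (w - v)%C; intros [] []; simpl; ring).
    apply (is_derive_minus (fun t => p * Im (z (c t))) (fun t => q * Re (z (c t)))); now apply is_derive_scal. }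
  destruct (MVT_cor2 g (fun t => (p * p + q * q) * Im (Z (c t))) 0 1 Rlt_0_1) as (t & E & Ht).
  { intros t Ht; apply is_derive_Reals, D, Ht. }
  assert (0 < (p * p + q * q) * Im (Z (c t))) by (apply Rmult_lt_0_compat; [auto|apply HZ; lra]).
  assert (c0 : c 0 = v) by (unfold c; ring); assert (c1 : c 1 = w) by (unfold c; ring).
  unfold g in E; rewrite c0, c1 in E.
  replace (p * Im (z w - z v)%C - q * Re (z w - z v)%C) with (p * Im (z w) - q * Re (z w) - (p * Im (z v) - q * Re (z v)))
    by (destruct (z w), (z v); simpl; ring).
  lra.
Qed.

Section Geometry.
Context (d eta H a : R) (z Z : C -> C) (g : geometry d eta H a z Z).
Let Hd : 0 < d := ge_d _ _ _ _ _ _ g.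
Let He : 0 < eta := ge_eta _ _ _ _ _ _ g.
Let Sh : shape d z Z a := ge_shape _ _ _ _ _ _ g.

(** A chord of the closed half rectangle has its interior in the region [Im Z > 0] unless it lies in
    a side or in the bottom; these are the two exceptional alternatives. *)
Lemma half_chord x1 y1 x2 y2 : 0 <= x1 <= PI -> 0 <= x2 <= PI -> - d <= y1 <= 0 -> - d <= y2 <= 0 ->
  (x1, y1) <> (x2, y2) ->
  0 < (x2 - x1) * (Im (z (x2, y2)) - Im (z (x1, y1))) - (y2 - y1) * (Re (z (x2, y2)) - Re (z (x1, y1))) \/
  x1 = x2 /\ (x1 = 0 \/ x1 = PI) \/ y1 = y2 /\ y1 = - d.
Proof.
  intros X1 X2 Y1 Y2 Hne; assert (HP := PI_RGT_0).
  destruct (classic (x1 = x2 /\ (x1 = 0 \/ x1 = PI))) as [|NX]; [auto|].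
  destruct (classic (y1 = y2 /\ y1 = - d)) as [|NY]; [auto|left].
  apply (noshiro_warschawski z Z (x1, y1) (x2, y2)); auto.
  - intros t Ht; apply (ge_z _ _ _ _ _ _ g); unfold RtoC; simpl; nra.
  - intros t Ht.
    replace ((x1, y1) + RtoC t * ((x2, y2) - (x1, y1)))%C with (x1 + t * (x2 - x1), y1 + t * (y2 - y1))
      by (unfold RtoC, Cplus, Cminus, Cmult, Copp; simpl; f_equal; ring).
    (* An interior point of a segment lies strictly beyond the level [b] unless both end points are
       on it. *)
    assert (K : forall m n b c, b <= m <= c -> b <= n <= c -> ~ (m = n /\ m = b) -> b < m + t * (n - m)).
    { intros m n b c Hm Hn HN; destruct (Req_dec m b); [assert (b < n) by (destruct (Req_dec n b); [exfalso; apply HN; lra|lra])|]; nra. }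
    assert (K' : forall m n b c, b <= m <= c -> b <= n <= c -> m + t * (n - m) <= c) by (intros; nra).
    apply (sh_Im _ _ _ _ Sh).
    + split; [apply (K x1 x2 0 PI); auto; intros [? ?]; apply NX; auto|].
      assert (Q := K (- x1) (- x2) (- PI) 0 ltac:(lra) ltac:(lra) ltac:(intros [? ?]; apply NX; lra)); lra.
    + split; [apply (K y1 y2 (- d) 0); auto|apply (K' y1 y2 (- d) 0); auto].
Qed.

Lemma side_monotone x y1 y2 : x = 0 \/ x = PI -> - d <= y1 -> y1 < y2 -> y2 <= 0 -> Im (z (x, y1)) < Im (z (x, y2)).
Proof.
  intros Hx H1 H2 H3.
  destruct (MVT_cor2 (fun y => Im (z (x, y))) (fun y => Re (Z (x, y))) y1 y2 H2) as (c & E & Hc).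
  { intros c Hc; apply is_derive_Reals, (cderive_beta z x c), (ge_z _ _ _ _ _ _ g); simpl; lra. }
  assert (0 < Re (Z (x, c))).
  { destruct Hx as [-> | ->]; [apply (sh_left _ _ _ _ Sh)|apply (sh_right _ _ _ _ Sh)]; lra. }
  assert (0 < Re (Z (x, c)) * (y2 - y1)) by (apply Rmult_lt_0_compat; lra); lra.
Qed.

Lemma bottom_monotone x1 x2 : x1 < x2 -> Re (z (x1, - d)) < Re (z (x2, - d)).
Proof.
  intros H1.
  destruct (MVT_cor2 (fun x => Re (z (x, - d))) (fun x => Re (Z (x, - d))) x1 x2 H1) as (c & E & Hc).
  { intros c Hc; apply is_derive_Reals, (cderive_alpha z c (- d)), (ge_z _ _ _ _ _ _ g); simpl; lra. }
  assert (0 < Re (Z (c, - d))) by apply (sh_bot _ _ _ _ Sh).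
  assert (0 < Re (Z (c, - d)) * (x2 - x1)) by (apply Rmult_lt_0_compat; lra); lra.
Qed.

Lemma half_injective x1 y1 x2 y2 : 0 <= x1 <= PI -> 0 <= x2 <= PI -> - d <= y1 <= 0 -> - d <= y2 <= 0 ->
  Re (z (x1, y1)) = Re (z (x2, y2)) -> Im (z (x1, y1)) = Im (z (x2, y2)) -> x1 = x2 /\ y1 = y2.
Proof.
  intros X1 X2 Y1 Y2 E1 E2.
  destruct (classic ((x1, y1) = (x2, y2))) as [Q|Q]; [injection Q; auto|].
  destruct (half_chord x1 y1 x2 y2 X1 X2 Y1 Y2 Q) as [K|[[-> K]|[-> ->]]].
  - rewrite E1, E2 in K; lra.
  - split; auto; destruct (Rtotal_order y1 y2) as [L|[L|L]]; auto.
    + generalize (side_monotone x2 y1 y2 K ltac:(lra) L ltac:(lra)); lra.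
    + generalize (side_monotone x2 y2 y1 K ltac:(lra) L ltac:(lra)); lra.
  - split; auto; destruct (Rtotal_order x1 x2) as [L|[L|L]]; auto.
    + generalize (bottom_monotone x1 x2 L); lra.
    + generalize (bottom_monotone x2 x1 L); lra.
Qed.

Lemma Re_axis y : - d <= y <= 0 -> Re (z (0, y)) = 0.
Proof. intros Hy; destruct (ge_sym _ _ _ _ _ _ g 0 y ltac:(lra)) as [E _]; rewrite Ropp_0 in E; lra. Qed.

Lemma Re_side y : - d <= y <= 0 -> Re (z (PI, y)) = PI.
Proof.
  intros Hy; destruct (ge_fold _ _ _ _ _ _ 1%Z (-1) PI y g ltac:(lra) ltac:(auto)) as [E _].
  replace (2 * PI * 1 + -1 * PI) with PI in E by ring; lra.
Qed.

(** By vertical chords the abscissa decreases upwards, so it lies between its surface value, at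
    least 0, and its bottom value, less than [PI]. *)
Lemma Re_half x y : 0 < x < PI -> - d <= y <= 0 -> 0 <= Re (z (x, y)) < PI /\ (Re (z (x, y)) = 0 -> x = a /\ y = 0).
Proof.
  intros Hx Hy; assert (HP := PI_RGT_0).
  assert (dec : forall y1 y2, - d <= y1 -> y1 < y2 -> y2 <= 0 -> Re (z (x, y2)) < Re (z (x, y1))).
  { intros y1 y2 H1 H2 H3; destruct (half_chord x y1 x y2 ltac:(lra) ltac:(lra) ltac:(lra) ltac:(lra)) as [K|[[_ K]|[K _]]]; try lra.
    - injection; lra.
    - rewrite Rminus_diag in K; nra. }
  assert (B1 := bottom_monotone 0 x ltac:(lra)); assert (B2 := bottom_monotone x PI ltac:(lra)).
  rewrite Re_axis in B1 by lra; rewrite Re_side in B2 by lra.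
  assert (T := sh_nonneg _ _ _ _ Sh x ltac:(lra)).
  destruct (Req_dec y 0) as [->|N0].
  - split; [split; [auto|]|intros E; split; auto; now apply (sh_unique _ _ _ _ Sh)].
    generalize (dec (- d) 0 ltac:(lra) ltac:(lra) ltac:(lra)); lra.
  - assert (K := dec y 0 ltac:(lra) ltac:(lra) ltac:(lra)).
    split; [|lra]; split; [lra|]; destruct (Req_dec y (- d)) as [->|]; [lra|].
    generalize (dec (- d) y ltac:(lra) ltac:(lra) ltac:(lra)); lra.
Qed.

Lemma Re_half_bounds x y : 0 <= x <= PI -> - d <= y <= 0 -> 0 <= Re (z (x, y)) <= PI.
Proof.
  intros Hx Hy; assert (HP := PI_RGT_0).
  destruct (Req_dec x 0) as [->|]; [rewrite Re_axis; lra|].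
  destruct (Req_dec x PI) as [->|]; [rewrite Re_side; lra|].
  destruct (Re_half x y) as [K _]; lra.
Qed.

Lemma Im_increasing x1 x2 y : 0 <= x1 -> x1 < x2 -> x2 <= PI -> - d < y <= 0 -> Im (z (x1, y)) < Im (z (x2, y)).
Proof.
  intros H1 H2 H3 Hy; destruct (half_chord x1 y x2 y ltac:(lra) ltac:(lra) ltac:(lra) ltac:(lra)) as [K|[[K _]|[_ K]]]; try lra.
  - injection; lra.
  - rewrite Rminus_diag in K; nra.
Qed.

Lemma above_bottom x y : - d < y <= 0 -> - H < Im (z (x, y)).
Proof.
  intros Hy; destruct (fold_exists x) as (k & s & r & Hr & Hs & ->).
  destruct (ge_fold _ _ _ _ _ _ k s r y g ltac:(lra) Hs) as [_ ->].
  assert (K := side_monotone 0 (- d) y ltac:(auto) ltac:(lra) ltac:(lra) ltac:(lra)); rewrite (ge_bot _ _ _ _ _ _ g) in K.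
  destruct (Req_dec r 0) as [->|]; [auto|].
  generalize (Im_increasing 0 r y ltac:(lra) ltac:(lra) ltac:(lra) ltac:(lra)); lra.
Qed.

(** Folding commutes with [z], and the half strip maps into the half strip, so equal images fold to
    the same point. The group elements can differ only if that image is on a symmetry axis, which
    off the sides occurs at the contact point alone. *)
Lemma strip_injective x1 y1 x2 y2 : - d <= y1 <= 0 -> - d <= y2 <= 0 -> z (x1, y1) = z (x2, y2) ->
  y1 = y2 /\ (x1 = x2 \/ y1 = 0 /\
    exists k : BinNums.Z, x1 = 2 * PI * IZR k - a /\ x2 = 2 * PI * IZR k + a \/ x1 = 2 * PI * IZR k + a /\ x2 = 2 * PI * IZR k - a).
Proof.
  intros Y1 Y2 E; assert (HP := PI_RGT_0).
  destruct (fold_exists x1) as (k1 & s1 & r1 & Hr1 & Hs1 & ->), (fold_exists x2) as (k2 & s2 & r2 & Hr2 & Hs2 & ->).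
  destruct (ge_fold _ _ _ _ _ _ k1 s1 r1 y1 g ltac:(lra) Hs1) as [A1 A2].
  destruct (ge_fold _ _ _ _ _ _ k2 s2 r2 y2 g ltac:(lra) Hs2) as [B1 B2].
  rewrite E in A1, A2; rewrite A1 in B1; rewrite A2 in B2.
  destruct (fold_unique k1 k2 s1 s2 _ _ (Re_half_bounds r1 y1 Hr1 Y1) (Re_half_bounds r2 y2 Hr2 Y2) Hs1 Hs2 B1) as [E1 Q].
  destruct (half_injective r1 y1 r2 y2 Hr1 Hr2 Y1 Y2 E1 B2) as [<- <-]; split; auto.
  destruct (Req_dec r1 PI) as [->|NP]; [left; rewrite (Re_side y1 Y1) in B1; lra|].
  destruct (Req_dec r1 0) as [->|N0]; [left; rewrite (Re_axis y1 Y1) in B1; lra|].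
  destruct (Re_half r1 y1 ltac:(lra) Y1) as [R1 R2].
  destruct Q as [Q|[<- [<-|Q]]]; [lra|auto|].
  destruct (R2 Q) as [-> ->].
  destruct Hs1 as [-> | ->], Hs2 as [-> | ->]; auto; right; split; auto; exists k1; [right|left]; lra.
Qed.

Lemma cts_z S x y : - d <= y <= 0 -> cts S z (x, y).
Proof. intros Hy; apply (cts_cderive S z (x, y) (Z (x, y))), (ge_z _ _ _ _ _ _ g); simpl; lra. Qed.

(** Points near [p] have their preimages near the preimages of [p]. Closure, frontier and continuity
    of the inverse all follow from this, even at the contact point with its two preimages. *)
Lemma proper (O : C -> Prop) (p : C) :
  (forall w, closed_strip d w -> z w = p -> near w (fun v => closed_strip d v -> O v)) ->
  near p (fun q => forall w, closed_strip d w -> z w = q -> O w).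
Proof.
  intros HO; assert (HP := PI_RGT_0).
  (* Locally, either [O] holds or [z] stays away from [p]; compactness makes the radius uniform. *)
  set (good := fun (u v : R) (e : R) => 0 < e /\ forall x y, - d <= y <= 0 -> Rabs (x - u) < e -> Rabs (y - v) < e ->
    O (x, y) \/ e <= Cmod (z (x, y) - p)%C).
  assert (ex : forall u v, exists e : posreal, - d <= v <= 0 -> good u v e).
  { intros u v; destruct (classic (- d <= v <= 0)) as [Hv|]; [|exists (mkposreal 1 Rlt_0_1); tauto].
    assert (K : exists e, good u v e); [|destruct K as (e & K); exists (mkposreal e (proj1 K)); auto].
    assert (box : forall r (x y : R), Rabs (x - u) < r / 2 -> Rabs (y - v) < r / 2 -> Cmod ((x, y) - (u, v))%C < r).
    { intros r x y Hx Hy; replace ((x, y) - (u, v))%C with (x - u, y - v) by reflexivity.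
      eapply Rle_lt_trans; [apply Cmod_le_sum|lra]. }
    destruct (classic (z (u, v) = p)) as [E|E].
    - destruct (HO (u, v) Hv E) as (r & Hr & K); exists (r / 2); split; [lra|].
      intros x y Hy H1 H2; left; apply K; auto.
    - set (m := Cmod (z (u, v) - p)%C).
      assert (Hm : 0 < m).
      { apply Cmod_gt_0; intros Q; apply E; replace (z (u, v)) with ((z (u, v) - p) + p)%C by ring; rewrite Q; ring. }
      destruct (cts_z (fun _ => True) u v Hv (m / 2) ltac:(lra)) as (r & Hr & K).
      exists (Rmin (r / 2) (m / 2)); split; [apply Rmin_glb_lt; lra|].
      intros x y Hy H1 H2; right; apply Rle_trans with (m / 2); [apply Rmin_r|].
      assert (K1 : Cmod (z (x, y) - z (u, v))%C < m / 2).
      { apply K; auto; apply box; (eapply Rlt_le_trans; [eassumption|apply Rmin_l]). }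
      assert (T := Cmod_triangle (z (u, v) - z (x, y))%C (z (x, y) - p)%C).
      replace ((z (u, v) - z (x, y)) + (z (x, y) - p))%C with (z (u, v) - p)%C in T by ring; fold m in T.
      replace (z (u, v) - z (x, y))%C with (- (z (x, y) - z (u, v)))%C in T by ring; rewrite Cmod_opp in T; lra. }
  set (delta := fun u v => epsilon (inhabits (mkposreal 1 Rlt_0_1)) (fun e : posreal => - d <= v <= 0 -> good u v e)).
  assert (Hdelta : forall u v, - d <= v <= 0 -> good u v (delta u v)).
  { intros u v; unfold delta; apply epsilon_spec, ex. }
  destruct (compactness_value_2d (Re p - 1 - PI) (Re p + 1 + PI) (- d) 0 delta) as (e & K).
  exists (Rmin 1 e); split; [apply Rmin_glb_lt; [lra|apply cond_pos]|]; intros q Hq [x y] Hw E.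
  unfold closed_strip in Hw; simpl in Hw.
  assert (q1 : Cmod (q - p)%C < 1) by (eapply Rlt_le_trans; [exact Hq|apply Rmin_l]).
  assert (q2 : Cmod (q - p)%C < e) by (eapply Rlt_le_trans; [exact Hq|apply Rmin_r]).
  (* The horizontal displacement of [z] is at most [PI], which confines all preimages to a compact
     rectangle. *)
  assert (Hx : Rabs (x - Re q) <= PI).
  { destruct (fold_exists x) as (k & s & r & Hr & Hs & ->); rewrite <- E.
    destruct (ge_fold _ _ _ _ _ _ k s r y g ltac:(lra) Hs) as [-> _].
    assert (B := Re_half_bounds r y Hr Hw); apply Rabs_le; destruct Hs as [-> | ->]; lra. }
  assert (Hq2 := Rle_lt_trans _ _ _ (Rabs_Re_le (q - p)%C) q1).
  change (Re (q - p)%C) with (Re q - Re p) in Hq2; apply Rabs_def2 in Hq2; apply Rabs_le_between in Hx.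
  apply NNPP; intros N; apply (K x y ltac:(lra) Hw); intros (u & v & Hu & Hv & H1 & H2 & H3).
  destruct (Hdelta u v Hv) as [_ G]; destruct (G x y Hw H1 H2) as [Q|Q]; [auto|rewrite E in Q; lra].
Qed.

End Geometry.

(** * Open mapping and inverse functions in the complex plane *)

Lemma Cmod_Re_Im (w : C) : Cmod w <= Rabs (Re w) + Rabs (Im w).
Proof. destruct w; apply Cmod_le_sum. Qed.

Lemma C_complete (u : nat -> C) K : (forall k, Cmod (u (S k) - u k)%C <= K * (/ 2) ^ k) ->
  exists l : C, forall k, Cmod (l - u k)%C <= 4 * K * (/ 2) ^ k.
Proof.
  intros H.
  assert (HK : 0 <= K) by (generalize (H 0%nat) (Cmod_ge_0 (u 1%nat - u 0%nat)%C); simpl; lra).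
  assert (H1 : forall k m, Cmod (u (k + m)%nat - u k)%C <= 2 * K * ((/ 2) ^ k - (/ 2) ^ (k + m))).
  { intros k m; induction m as [|m IH].
    - rewrite Nat.add_0_r, Rminus_diag, Rmult_0_r; right.
      replace (u k - u k)%C with (RtoC 0) by ring; apply Cmod_0.
    - rewrite Nat.add_succ_r.
      replace (u (S (k + m)) - u k)%C with ((u (S (k + m)) - u (k + m)%nat) + (u (k + m)%nat - u k))%C by ring.
      eapply Rle_trans; [apply Cmod_triangle|]; specialize (H (k + m)%nat); simpl; lra. }
  assert (H2 : forall k m, (k <= m)%nat -> Cmod (u m - u k)%C <= 2 * K * (/ 2) ^ k).
  { intros k m Hkm; replace m with (k + (m - k))%nat by lia.
    eapply Rle_trans; [apply H1|]; apply Rmult_le_compat_l; [lra|].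
    generalize (pow_le (/ 2) (k + (m - k)) ltac:(lra)); lra. }
  assert (lim : forall x : nat -> R, (forall k m, (k <= m)%nat -> Rabs (x m - x k) <= 2 * K * (/ 2) ^ k) ->
    exists l, forall k, Rabs (l - x k) <= 2 * K * (/ 2) ^ k).
  { intros x Hx; destruct (Rcomplete.R_complete x) as [l Hl].
    - intros e He; destruct (pow_half_small e (4 * K) He) as [N HN].
      exists N; intros p q Hp Hq; unfold Rdist; specialize (HN N (le_n _)).
      replace (x p - x q) with ((x p - x N) - (x q - x N)) by ring.
      eapply Rle_lt_trans; [apply Rabs_triang|rewrite Rabs_Ropp]; generalize (Hx N p Hp) (Hx N q Hq); lra.
    - exists l; intros k; apply le_epsilon; intros e He; destruct (Hl e He) as [N HN].
      specialize (HN (N + k)%nat ltac:(lia)); unfold Rdist in HN; specialize (Hx k (N + k)%nat ltac:(lia)).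
      rewrite Rabs_minus_sym in HN.
      replace (l - x k) with ((l - x (N + k)%nat) + (x (N + k)%nat - x k)) by ring.
      eapply Rle_trans; [apply Rabs_triang|lra]. }
  destruct (lim (fun k => Re (u k))) as [l1 L1].
  { intros k m Hkm; eapply Rle_trans; [apply (Rabs_Re_le (u m - u k)%C)|auto]. }
  destruct (lim (fun k => Im (u k))) as [l2 L2].
  { intros k m Hkm; eapply Rle_trans; [apply (Rabs_Im_le (u m - u k)%C)|auto]. }
  exists (l1, l2); intros k; eapply Rle_trans; [apply (Cmod_le_sum (l1 - Re (u k)) (l2 - Im (u k)))|].
  generalize (L1 k) (L2 k); lra.
Qed.

(** The real mean value theorem is applied to both components separately, which costs the factor
    2. *)
Lemma mean_value (f f' : C -> C) (m v w : C) e :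
  (forall t : R, 0 <= t <= 1 -> is_cderive f (v + RtoC t * (w - v))%C (f' (v + RtoC t * (w - v))%C)) ->
  (forall t : R, 0 <= t <= 1 -> Cmod (f' (v + RtoC t * (w - v))%C - m)%C <= e) ->
  Cmod (f w - f v - m * (w - v))%C <= 2 * (e * Cmod (w - v)%C).
Proof.
  intros Hf He; set (c := fun t : R => (v + RtoC t * (w - v))%C) in *.
  assert (Hc : forall t h, c (t + h) = (c t + RtoC h * (w - v))%C) by (intros; unfold c; rewrite RtoC_plus; ring).
  assert (c0 : c 0 = v) by (unfold c; ring); assert (c1 : c 1 = w) by (unfold c; ring).
  assert (B : forall t, 0 <= t <= 1 -> Cmod ((f' (c t) - m) * (w - v))%C <= e * Cmod (w - v)%C).
  { intros t Ht; rewrite Cmod_mult; apply Rmult_le_compat_r; [apply Cmod_ge_0|now apply He]. }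
  assert (R1 : Rabs (Re (f w - f v - m * (w - v))%C) <= e * Cmod (w - v)%C).
  { destruct (MVT_cor2 (fun t => Re (f (c t))) (fun t => Re (f' (c t) * (w - v))%C) 0 1 Rlt_0_1) as (t & E & Ht).
    { intros t Ht; apply is_derive_Reals, (cderive_curve f c t _ _ (Hf t Ht) (Hc t)). }
    rewrite c0, c1 in E; eapply Rle_trans; [|apply (B t); lra].
    eapply Rle_trans; [|apply Rabs_Re_le]; right; f_equal.
    replace (Re (f w - f v - m * (w - v))%C) with (Re (f w) - Re (f v) - Re (m * (w - v))%C)
      by (generalize (f w) (f v) (m * (w - v))%C; intros [] [] []; simpl; ring).
    rewrite E; generalize (f' (c t)) (w - v)%C m; intros [] [] []; simpl; ring. }
  assert (R2 : Rabs (Im (f w - f v - m * (w - v))%C) <= e * Cmod (w - v)%C).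
  { destruct (MVT_cor2 (fun t => Im (f (c t))) (fun t => Im (f' (c t) * (w - v))%C) 0 1 Rlt_0_1) as (t & E & Ht).
    { intros t Ht; apply is_derive_Reals, (cderive_curve f c t _ _ (Hf t Ht) (Hc t)). }
    rewrite c0, c1 in E; eapply Rle_trans; [|apply (B t); lra].
    eapply Rle_trans; [|apply Rabs_Im_le]; right; f_equal.
    replace (Im (f w - f v - m * (w - v))%C) with (Im (f w) - Im (f v) - Im (m * (w - v))%C)
      by (generalize (f w) (f v) (m * (w - v))%C; intros [] [] []; simpl; ring).
    rewrite E; generalize (f' (c t)) (w - v)%C m; intros [] [] []; simpl; ring. }
  eapply Rle_trans; [apply Cmod_Re_Im|lra].
Qed.

Lemma ball_chord (w0 v w : C) r t : Cmod (v - w0)%C < r -> Cmod (w - w0)%C < r -> 0 <= t <= 1 ->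
  Cmod (v + RtoC t * (w - v) - w0)%C < r.
Proof.
  intros Hv Hw Ht; replace (v + RtoC t * (w - v) - w0)%C with (RtoC (1 - t) * (v - w0) + RtoC t * (w - w0))%C
    by (rewrite RtoC_minus; ring).
  eapply Rle_lt_trans; [apply Cmod_triangle|]; rewrite !Cmod_mult, !Cmod_R, (Rabs_pos_eq (1 - t)), (Rabs_pos_eq t) by lra.
  destruct (Req_dec t 0) as [->|]; [lra|]; assert (t * Cmod (w - w0)%C < t * r) by (apply Rmult_lt_compat_l; lra).
  assert ((1 - t) * Cmod (v - w0)%C <= (1 - t) * r) by (apply Rmult_le_compat_l; lra); lra.
Qed.

(** Newton's method with frozen derivative. *)
Lemma open_mapping (f f' : C -> C) (w0 : C) (S : C -> Prop) : near w0 S ->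
  (forall w, S w -> is_cderive f w (f' w)) -> cts S f' w0 -> f' w0 <> RtoC 0 ->
  near (f w0) (fun q => exists w, S w /\ f w = q).
Proof.
  intros HS Hf Hf' Hm0; set (m := f' w0) in *.
  assert (Hm : 0 < Cmod m) by now apply Cmod_gt_0.
  destruct (near_and _ _ _ HS (Hf' (Cmod m / 4) ltac:(lra))) as (r & Hr & K).
  assert (KS : forall w, Cmod (w - w0)%C < r -> S w) by (intros; now apply K).
  assert (Kf : forall w, Cmod (w - w0)%C < r -> Cmod (f' w - m)%C <= Cmod m / 4) by (intros w Hw; left; now apply K; [|apply KS]).
  exists (Cmod m * r / 8); split; [nra|]; intros q Hq.
  set (T := fun w => (w - (f w - q) / m)%C).
  assert (HT : forall v w, Cmod (v - w0)%C < r -> Cmod (w - w0)%C < r -> Cmod (T w - T v)%C <= / 2 * Cmod (w - v)%C).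
  { intros v w Hv Hw.
    assert (M := mean_value f f' m v w (Cmod m / 4)
      ltac:(intros; apply Hf, KS, ball_chord; auto) ltac:(intros; apply Kf, ball_chord; auto)).
    apply Rmult_le_reg_l with (Cmod m); [auto|]; rewrite <- Cmod_mult.
    replace (m * (T w - T v))%C with (- (f w - f v - m * (w - v)))%C by (unfold T; field; auto).
    rewrite Cmod_opp; lra. }
  assert (T0 : Cmod (T w0 - w0)%C < r / 8).
  { apply Rmult_lt_reg_l with (Cmod m); [auto|]; rewrite <- Cmod_mult.
    replace (m * (T w0 - w0))%C with (q - f w0)%C by (unfold T; field; auto); lra. }
  set (D := Cmod (T w0 - w0)%C) in *; assert (HD : 0 <= D) by apply Cmod_ge_0.
  set (u := fun k => Nat.iter k T w0).
  assert (I : forall k, Cmod (u k - w0)%C <= 2 * D * (1 - (/ 2) ^ k) /\ Cmod (u (Datatypes.S k) - w0)%C <= 2 * D * (1 - (/ 2) ^ (Datatypes.S k)) /\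
    Cmod (u (Datatypes.S k) - u k)%C <= D * (/ 2) ^ k).
  { assert (Hb : forall k, 2 * D * (1 - (/ 2) ^ k) < r) by (intros k; generalize (pow_le (/ 2) k ltac:(lra)); nra).
    induction k as [|k (I1 & I2 & I3)].
    - simpl; replace (w0 - w0)%C with (RtoC 0) by ring; rewrite Cmod_0; fold D; lra.
    - assert (I4 : Cmod (u (Datatypes.S (Datatypes.S k)) - u (Datatypes.S k))%C <= D * (/ 2) ^ (Datatypes.S k)).
      { eapply Rle_trans; [apply (HT (u k) (u (Datatypes.S k)))|].
        - eapply Rle_lt_trans; [exact I1|apply Hb].
        - eapply Rle_lt_trans; [exact I2|apply Hb].
        - simpl in *; lra. }
      split; [auto|split; [|auto]].
      replace (u (Datatypes.S (Datatypes.S k)) - w0)%C with ((u (Datatypes.S (Datatypes.S k)) - u (Datatypes.S k)) + (u (Datatypes.S k) - w0))%C by ring.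
      eapply Rle_trans; [apply Cmod_triangle|]; simpl in *; lra. }
  destruct (C_complete u D (fun k => proj2 (proj2 (I k)))) as [l Hl].
  assert (Lr : Cmod (l - w0)%C < r).
  { specialize (Hl 0%nat); simpl in Hl; lra. }
  exists l; split; [auto|].
  assert (Z : Cmod (T l - l)%C <= 0).
  { apply le_epsilon; intros e He; destruct (pow_half_small e (4 * D) He) as [N HN].
    specialize (HN N (le_n _)).
    replace (T l - l)%C with ((T l - T (u N)) - (l - u (Datatypes.S N)))%C by (simpl; ring).
    eapply Rle_trans; [apply Cmod_triangle|]; rewrite Cmod_opp.
    assert (Q : Cmod (T l - T (u N))%C <= / 2 * Cmod (l - u N)%C).
    { apply HT; auto; generalize (proj1 (I N)) (pow_le (/ 2) N ltac:(lra)); nra. }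
    generalize (Hl N) (Hl (Datatypes.S N)); rewrite <- tech_pow_Rmult; lra. }
  assert (E : (T l - l)%C = RtoC 0) by (apply Cmod_eq_0; generalize (Cmod_ge_0 (T l - l)%C); lra).
  replace (f l) with (q - m * (T l - l))%C by (unfold T; field; auto); rewrite E; ring.
Qed.

(** A continuous local solution [h] of [z (h v) = f v] is differentiable where [z'] is nonzero; for
    [f] the identity, [h] is the inverse of [z]. *)
Lemma cderive_lift (f h z : C -> C) (w m l : C) : is_cderive f w l -> is_cderive z (h w) m -> m <> RtoC 0 ->
  near w (fun v => z (h v) = f v) -> (forall e, 0 < e -> near w (fun v => Cmod (h v - h w)%C < e)) ->
  is_cderive h w (l / m)%C.
Proof.
  intros Hf Hz Hm0 HE Hc; assert (Hm : 0 < Cmod m) by now apply Cmod_gt_0.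
  assert (Pl := Cmod_ge_0 l).
  apply cderive_iff; intros e He.
  set (e1 := Rmin (Cmod m / 2) (e * Cmod m * Cmod m / (4 * (Cmod l + 1)))).
  assert (He1 : 0 < e1).
  { apply Rmin_glb_lt; [lra|apply Rdiv_lt_0_compat; [repeat apply Rmult_lt_0_compat; auto|lra]]. }
  assert (e11 : e1 <= Cmod m / 2) by apply Rmin_l.
  assert (e12 : e1 * (Cmod l + 1) <= e * Cmod m * Cmod m / 4).
  { apply Rle_trans with (e * Cmod m * Cmod m / (4 * (Cmod l + 1)) * (Cmod l + 1)); [|right; field; lra].
    apply Rmult_le_compat_r; [lra|apply Rmin_r]. }
  set (e2 := Rmin 1 (e * Cmod m / 4)).
  assert (He2 : 0 < e2) by (apply Rmin_glb_lt; [lra|nra]).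
  assert (e21 : e2 <= 1) by apply Rmin_l; assert (e22 : e2 <= e * Cmod m / 4) by apply Rmin_r.
  destruct (proj1 (cderive_iff _ _ _) Hz e1 He1) as (r1 & Hr1 & K1).
  destruct (proj1 (cderive_iff _ _ _) Hf e2 He2) as (r2 & Hr2 & K2).
  destruct (near_and _ _ _ HE (Hc r1 Hr1)) as (r3 & Hr3 & K3).
  assert (EW := near_self _ _ HE).
  exists (Rmin r2 r3); split; [now apply Rmin_glb_lt|]; intros x Hx.
  assert (x2 : Cmod x < r2) by (eapply Rlt_le_trans; [exact Hx|apply Rmin_l]).
  assert (x3 : Cmod x < r3) by (eapply Rlt_le_trans; [exact Hx|apply Rmin_r]).
  assert (Q := K3 (w + x)%C); replace (w + x - w)%C with x in Q by ring; destruct (Q x3) as [E Hk]; clear Q.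
  set (k := (h (w + x)%C - h w)%C) in *.
  specialize (K1 k Hk); replace (h w + k)%C with (h (w + x)%C) in K1 by (unfold k; ring); rewrite E, EW in K1.
  specialize (K2 x x2).
  set (F := (f (w + x)%C - f w)%C) in *.
  assert (Pk := Cmod_ge_0 k); assert (Px := Cmod_ge_0 x).
  assert (BF : Cmod F <= (Cmod l + 1) * Cmod x).
  { replace F with ((F - l * x) + l * x)%C by ring; eapply Rle_trans; [apply Cmod_triangle|]; rewrite (Cmod_mult l); nra. }
  assert (Bk : Cmod m * Cmod k <= 2 * Cmod F).
  { assert (Cmod m * Cmod k <= Cmod (F - m * k)%C + Cmod F).
    { rewrite <- Cmod_mult; assert (Tr := Cmod_triangle (- (F - m * k))%C F); rewrite Cmod_opp in Tr.
      now replace (- (F - m * k) + F)%C with (m * k)%C in Tr by ring. }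
    nra. }
  apply Rmult_le_reg_l with (Cmod m); [auto|]; rewrite <- Cmod_mult.
  replace (m * (k - l / m * x))%C with ((F - l * x) - (F - m * k))%C by (field; auto).
  eapply Rle_trans; [apply Cmod_triangle|]; rewrite Cmod_opp.
  assert (B1 : Cmod m * (e1 * Cmod k) <= e1 * (2 * ((Cmod l + 1) * Cmod x))).
  { replace (Cmod m * (e1 * Cmod k)) with (e1 * (Cmod m * Cmod k)) by ring; apply Rmult_le_compat_l; lra. }
  assert (B2 : e1 * (2 * ((Cmod l + 1) * Cmod x)) <= Cmod m * (e * Cmod m / 2 * Cmod x)).
  { replace (e1 * (2 * ((Cmod l + 1) * Cmod x))) with (e1 * (Cmod l + 1) * (2 * Cmod x)) by ring.
    replace (Cmod m * (e * Cmod m / 2 * Cmod x)) with (e * Cmod m * Cmod m / 4 * (2 * Cmod x)) by field.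
    apply Rmult_le_compat_r; lra. }
  assert (B3 : e1 * Cmod k <= e * Cmod m / 2 * Cmod x) by (apply Rmult_le_reg_l with (Cmod m); lra).
  assert (B4 : e2 * Cmod x <= e * Cmod m / 4 * Cmod x) by (apply Rmult_le_compat_r; lra).
  assert (0 <= e * Cmod m * Cmod x) by (apply Rmult_le_pos; [apply Rmult_le_pos; lra|auto]).
  lra.
Qed.

Lemma between_convex b c m n t : b < m < c -> b < n < c -> 0 <= t <= 1 -> b < m + t * (n - m) < c.
Proof.
  intros Hm Hn Ht.
  assert (K : forall x y, 0 < x -> 0 < y -> 0 < (1 - t) * x + t * y).
  { intros x y Hx Hy; destruct (Req_dec t 0) as [->|]; [lra|].
    assert (0 < t * y) by (apply Rmult_lt_0_compat; lra); assert (0 <= (1 - t) * x) by (apply Rmult_le_pos; lra); lra. }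
  generalize (K (m - b) (n - b) ltac:(lra) ltac:(lra)) (K (c - m) (c - n) ltac:(lra) ltac:(lra)); lra.
Qed.

(** * The fluid domain and the inverse of the conformal map *)

Definition region (d : R) (z : C -> C) (p : C) : Prop := exists w, strip d w /\ p = z w.

(** Defined on the closure of the domain; at the contact point one of two preimages on the surface
    is chosen, elsewhere there is only one. *)
Definition inverse (d : R) (z : C -> C) (p : C) : C :=
  epsilon (inhabits (RtoC 0)) (fun w => closed_strip d w /\ z w = p).

Section Region.
Context (d eta H a : R) (z Z : C -> C) (g : geometry d eta H a z Z).
Let Hd : 0 < d := ge_d _ _ _ _ _ _ g.
Let He : 0 < eta := ge_eta _ _ _ _ _ _ g.
Let Sh : shape d z Z a := ge_shape _ _ _ _ _ _ g.
Let D := region d z.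
Let zi := inverse d z.

Lemma Z_fold (k : BinNums.Z) s x y : - d - eta < y < eta -> s = 1 \/ s = - 1 ->
  Re (Z (2 * PI * IZR k + s * x, y)) = Re (Z (x, y)) /\ Im (Z (2 * PI * IZR k + s * x, y)) = s * Im (Z (x, y)).
Proof.
  intros Hy Hs.
  assert (P : forall (k : BinNums.Z) x, Z (x + 2 * PI * IZR k, y) = Z (x, y)).
  { clear k x; intros k; induction k as [|k K|k K] using BinInt.Z.peano_ind; intros x.
    - do 2 f_equal; change (IZR 0) with 0; ring.
    - unfold BinInt.Z.succ; rewrite plus_IZR.
      replace (x + 2 * PI * (IZR k + 1)) with (x + 2 * PI * IZR k + 2 * PI) by ring; rewrite (ge_Zper _ _ _ _ _ _ g); auto.
    - rewrite <- (ge_Zper _ _ _ _ _ _ g); unfold BinInt.Z.pred; rewrite plus_IZR.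
      replace (x + 2 * PI * (IZR k + -1) + 2 * PI) with (x + 2 * PI * IZR k) by ring; auto. }
  rewrite Rplus_comm, P; destruct Hs as [-> | ->].
  - rewrite !Rmult_1_l; auto.
  - replace (-1 * x) with (- x) by ring; destruct (ge_Zsym _ _ _ _ _ _ g x y Hy) as [-> ->]; split; ring.
Qed.

Lemma Z_nonzero w : closed_strip d w -> Z w <> RtoC 0.
Proof.
  destruct w as [x y]; unfold closed_strip; simpl; intros Hy E.
  destruct (fold_exists x) as (k & s & r & Hr & Hs & ->).
  destruct (Z_fold k s r y ltac:(lra) Hs) as [E1 E2]; rewrite E in E1, E2; simpl in E1, E2.
  destruct (Req_dec r 0) as [->|]; [generalize (sh_left _ _ _ _ Sh y Hy); lra|].
  destruct (Req_dec r PI) as [->|]; [generalize (sh_right _ _ _ _ Sh y Hy); lra|].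
  destruct (Req_dec y (- d)) as [->|]; [generalize (sh_bot _ _ _ _ Sh r); lra|].
  assert (K := sh_Im _ _ _ _ Sh r y ltac:(lra) ltac:(lra)).
  destruct Hs as [-> | ->]; lra.
Qed.

Lemma strip_near w : strip d w -> near w (strip d).
Proof.
  intros [H1 H2]; exists (Rmin (Im w + d) (- Im w)); split; [apply Rmin_glb_lt; lra|].
  intros v Hv; assert (K := Rle_lt_trans _ _ _ (Rabs_Im_le (v - w)%C) Hv); change (Im (v - w)%C) with (Im v - Im w) in K.
  assert (K1 := Rlt_le_trans _ _ _ K (Rmin_l _ _)); assert (K2 := Rlt_le_trans _ _ _ K (Rmin_r _ _)).
  apply Rabs_def2 in K1; apply Rabs_def2 in K2; unfold strip; lra.
Qed.

Lemma strip_closed w : strip d w -> closed_strip d w.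
Proof. unfold strip, closed_strip; lra. Qed.

Lemma z_derive w : closed_strip d w -> is_cderive z w (Z w).
Proof. intros Hw; apply (ge_z _ _ _ _ _ _ g); unfold closed_strip in Hw; lra. Qed.

Lemma Z_cts S w : closed_strip d w -> cts S Z w.
Proof.
  intros Hw; destruct (ge_Z _ _ _ _ _ _ g w) as [l Hl]; [unfold closed_strip in Hw; lra|]; now apply (cts_cderive S Z w l).
Qed.

Lemma strip_unique v w : closed_strip d v -> strip d w -> z v = z w -> v = w.
Proof.
  destruct v as [x1 y1], w as [x2 y2]; unfold closed_strip, strip; simpl; intros H1 H2 E.
  destruct (strip_injective d eta H a z Z g x1 y1 x2 y2 H1 ltac:(lra) E) as [<- [<-|[K _]]]; [auto|lra].
Qed.

Lemma region_near p : D p -> near p D.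
Proof.
  intros (w & Hw & ->).
  apply near_imp with (fun q => exists v, strip d v /\ z v = q); [|intros q (v & Hv & E); exists v; auto].
  apply (open_mapping z Z w (strip d)); [now apply strip_near|intros v Hv; now apply z_derive, strip_closed| |].
  - now apply Z_cts, strip_closed.
  - now apply Z_nonzero, strip_closed.
Qed.

Lemma inverse_spec p : (exists w, closed_strip d w /\ p = z w) -> closed_strip d (zi p) /\ z (zi p) = p.
Proof. intros (w & Hw & ->); unfold zi, inverse; apply epsilon_spec; exists w; auto. Qed.

Lemma inverse_strip w : strip d w -> zi (z w) = w.
Proof.
  intros Hw; destruct (inverse_spec (z w)) as [K1 K2]; [exists w; split; auto; now apply strip_closed|].
  now apply strip_unique.
Qed.

Lemma inverse_cts w e : strip d w -> 0 < e -> near (z w) (fun q => D q -> Cmod (zi q - w)%C < e).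
Proof.
  intros Hw Hp.
  apply near_imp with (fun q => forall v, closed_strip d v -> z v = q -> Cmod (v - w)%C < e).
  - apply (proper d eta H a z Z g); intros v Hv E; rewrite (strip_unique v w Hv Hw E); exists e; auto.
  - intros q K (v & Hv & ->); rewrite inverse_strip by auto; apply K; auto; now apply strip_closed.
Qed.

Lemma inverse_derive w : strip d w -> is_cderive zi (z w) (/ Z w)%C.
Proof.
  intros Hw; replace (/ Z w)%C with (RtoC 1 / Z w)%C by (unfold Cdiv; ring).
  assert (DW : D (z w)) by (exists w; auto).
  apply (cderive_lift (fun q => q) zi z).
  - apply cderive_id.
  - rewrite inverse_strip by auto; now apply z_derive, strip_closed.
  - now apply Z_nonzero, strip_closed.
  - apply near_imp with D; [now apply region_near|]; intros q (v & Hv & ->); now rewrite inverse_strip.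
  - intros e Hp; rewrite inverse_strip by auto.
    apply near_imp with (fun q => D q /\ (D q -> Cmod (zi q - w)%C < e)); [|intros q [Q1 Q2]; auto].
    apply near_and; [now apply region_near|now apply inverse_cts].
Qed.

(** If [p] has no preimage in the closed strip, [proper] applied to the empty set separates it from
    the domain. *)
Lemma adherent_region p : adherent D p <-> exists w, closed_strip d w /\ p = z w.
Proof.
  split.
  - intros K; apply NNPP; intros N; apply K, locally_near.
    apply near_imp with (fun q => forall w, closed_strip d w -> z w = q -> False).
    + apply (proper d eta H a z Z g); intros w Hw E; exfalso; apply N; exists w; auto.
    + intros q Q (w & Hw & ->); apply (Q w); auto; now apply strip_closed.
  - intros (w & Hw & ->).
    apply (adherent_image (strip d) (fun _ => True) z (Re w, - d / 2) w); auto.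
    + unfold strip; simpl; lra.
    + apply (cts_cderive _ z w (Z w)); now apply z_derive.
    + intros t Ht; destruct w as [x y]; unfold strip, closed_strip in *; simpl in *; nra.
Qed.

Lemma surface_outside x : ~ D (z (x, 0)).
Proof.
  intros (w & Hw & E); assert (K := strip_unique (x, 0) w); rewrite <- K in Hw; auto.
  - unfold strip in Hw; simpl in Hw; lra.
  - unfold closed_strip; simpl; lra.
Qed.

Lemma region_above p : D p -> - H < Im p.
Proof. intros ([x y] & Hw & ->); unfold strip in Hw; simpl in Hw; apply (above_bottom d eta H a z Z g); lra. Qed.

Lemma bottom_onto p : Im p = - H <-> exists w, Im w = - d /\ p = z w.
Proof.
  assert (HP := PI_RGT_0); split.
  - intros Ep; assert (Hf : continuity (fun x => Re (z (x, - d)))).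
    { intros x; apply derivable_continuous_pt; exists (Re (Z (x, - d))); apply is_derive_Reals.
      apply (cderive_alpha z x (- d)), z_derive; unfold closed_strip; simpl; lra. }
    destruct (fold_exists (Re p)) as (k & s & r & Hr & Hs & E).
    destruct (IVT_gen (fun x => Re (z (x, - d))) 0 PI r Hf) as (x & _ & Ex).
    { rewrite (Re_axis d eta H a z Z g), (Re_side d eta H a z Z g), Rmin_left, Rmax_right by lra; auto. }
    exists (2 * PI * IZR k + s * x, - d); split; auto.
    destruct (ge_fold _ _ _ _ _ _ k s x (- d) g ltac:(lra) Hs) as [E1 E2].
    apply injective_projections; [change (Re p = Re (z (2 * PI * IZR k + s * x, - d))); rewrite E1; congruence|change (Im p = Im (z (2 * PI * IZR k + s * x, - d))); now rewrite (ge_bot _ _ _ _ _ _ g)].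
  - intros ([u v] & Hw & ->); simpl in Hw; subst v; apply (ge_bot _ _ _ _ _ _ g).
Qed.

Lemma region_domain : is_domain D.
Proof.
  split; [exists (z (0, - d / 2)), (0, - d / 2); split; auto; unfold strip; simpl; lra|split].
  - apply (proj2 (open_near D)), region_near.
  - apply (image_connected (strip d) z).
    + intros [p1 q1] [p2 q2] u; unfold strip; simpl; intros H1 H2 Ht.
      replace (q1 + (u * (q2 + - q1) + 0 * (p2 + - p1))) with (q1 + u * (q2 - q1)) by ring; now apply between_convex.
    + intros w Hw; apply (cts_cderive _ z w (Z w)); now apply z_derive, strip_closed.
Qed.

Lemma frontier_region p : frontier D p <-> Im p = - H \/ surface z p.
Proof.
  unfold frontier; rewrite adherent_region, locally_near; split.
  - intros [([x y] & Hw & ->) K]; unfold closed_strip in Hw; simpl in Hw.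
    destruct (Req_dec y (- d)) as [->|]; [left; apply (ge_bot _ _ _ _ _ _ g)|].
    destruct (Req_dec y 0) as [->|]; [right; now exists x|].
    exfalso; apply K, region_near; exists (x, y); split; auto; unfold strip; simpl; lra.
  - intros [K|[x ->]].
    + split; [|intros N; generalize (region_above p (near_self _ _ N)); lra].
      apply bottom_onto in K; destruct K as (w & Hw & ->); exists w; split; auto; unfold closed_strip; lra.
    + split; [exists (x, 0); split; auto; unfold closed_strip; simpl; lra|].
      intros N; exact (surface_outside x (near_self _ _ N)).
Qed.

Lemma surface_regular x : is_derive (fun t : R => z (t, 0)) x (Z (x, 0)).
Proof.
  assert (K := z_derive (x, 0) ltac:(unfold closed_strip; simpl; lra)).
  assert (Q : forall e, 0 < e -> exists r, 0 < r /\ forall h : R, Rabs h < r -> Cmod (z ((x + h)%R, 0%R) - z (x, 0%R) - Z (x, 0%R) * RtoC h)%C <= e * Rabs h).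
  { intros e Hp; destruct (proj1 (cderive_iff _ _ _) K e Hp) as (r & Hr & Q); exists r; split; auto.
    intros h Hh; specialize (Q (RtoC h)); rewrite Cmod_R in Q; specialize (Q Hh).
    replace ((x, 0) + RtoC h)%C with (x + h, 0) in Q by (unfold RtoC, Cplus; simpl; f_equal; ring); exact Q. }
  split; [apply is_linear_scal_l|].
  intros y Hy e.
  assert (y = x) as -> by (symmetry; apply is_filter_lim_locally_unique, Hy).
  destruct (Q (e / 2) ltac:(generalize (cond_pos e); lra)) as (r & Hr & K2); exists (mkposreal r Hr); intros t Ht.
  assert (Ht' : Rabs (t - x) < r) by exact Ht; specialize (K2 (t - x) Ht').
  replace (x + (t - x))%R with t in K2 by (change (t = x + (t - x))%R; unfold Rminus; rewrite Rplus_comm, Rplus_assoc, Rplus_opp_l, Rplus_0_r; reflexivity).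
  set (v := (z (t, 0%R) - z (x, 0%R) - Z (x, 0%R) * RtoC (t - x)%R)%C) in *.
  match goal with |- norm ?A <= _ => assert (E : A = v) end.
  { unfold v.
    unfold minus, plus, opp, scal; simpl; unfold prod_plus, prod_opp, prod_scal, RtoC, Cminus, Cplus, Copp, Cmult; simpl.
    unfold minus, plus, opp, scal, mult; simpl; unfold mult; simpl; f_equal; ring. }
  rewrite E; change (norm (minus t x)) with (Rabs (t - x)).
  (* The norm of the product module is Euclidean, hence equal to the modulus. *)
  assert (N : @norm R_AbsRing (prod_NormedModule R_AbsRing R_NormedModule R_NormedModule) v = Cmod v).
  { unfold norm, Cmod; simpl; unfold prod_norm, norm; simpl; unfold abs; simpl; now rewrite !Rmult_1_r, <- !Rabs_mult, !(Rabs_pos_eq (_ * _)) by apply Rle_0_sqr. }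
  rewrite N; apply Rle_trans with (1 := K2), Rmult_le_compat_r; [apply Rabs_pos|generalize (cond_pos e); lra].
Qed.

Lemma region_conformal : conformal_description D H d z Z.
Proof.
  constructor.
  - exact Hd.
  - intros w Hw; split; [now apply z_derive, strip_closed|now apply Z_nonzero, strip_closed].
  - intros w1 w2 H1 H2 E; apply strip_unique; auto; now apply strip_closed.
  - reflexivity.
  - apply cts_on; intros w Hw; apply (cts_cderive _ z w (Z w)); now apply z_derive.
  - exact bottom_onto.
  - apply cts_on; intros w Hw; apply Z_cts; unfold strip_with_top, closed_strip in *; lra.
  - intros x; split; [apply surface_regular|apply Z_nonzero; unfold closed_strip; simpl; lra].
  - intros x y _; rewrite (ge_per _ _ _ _ _ _ g).
    change (Re (z (x, y)) + 2 * PI - (x + 2 * PI) = Re (z (x, y)) - x /\ Im (z (x, y)) + 0 = Im (z (x, y))); split; ring.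
  - intros p [x ->]; apply (above_bottom d eta H a z Z g); lra.
Qed.

Lemma closed_fold_image (S : R -> Prop) (k : BinNums.Z) s p : (forall y, S y -> - d <= y <= 0) -> s = 1 \/ s = - 1 ->
  (exists w, S (Im w) /\ p = z w) -> exists w, S (Im w) /\ (2 * PI * IZR k + s * Re p, Im p) = z w.
Proof.
  intros HS Hs ([x y] & Hw & ->); simpl in Hw; exists (2 * PI * IZR k + s * x, y); split; auto.
  destruct (ge_fold _ _ _ _ _ _ k s x y g ltac:(generalize (HS y Hw); lra) Hs) as [E1 E2].
  rewrite <- E1, <- E2; now destruct (z _).
Qed.

Lemma region_fold (k : BinNums.Z) s x y : s = 1 \/ s = - 1 -> D (x, y) <-> D (2 * PI * IZR k + s * x, y).
Proof.
  intros Hs; assert (F : forall (k : BinNums.Z) x, D (x, y) -> D (2 * PI * IZR k + s * x, y)).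
  { intros j u Hu; apply (closed_fold_image (fun v => - d < v < 0) j s (u, y)); auto; intros; lra. }
  split; [apply F|]; intros Q; destruct Hs as [-> | ->].
  - apply (F (- k)%Z) in Q; rewrite opp_IZR in Q; now replace (2 * PI * - IZR k + 1 * (2 * PI * IZR k + 1 * x)) with x in Q by ring.
  - apply (F k) in Q; now replace (2 * PI * IZR k + -1 * (2 * PI * IZR k + -1 * x)) with x in Q by ring.
Qed.

Lemma crest_trough : is_crest z PI /\ is_trough z 0.
Proof.
  assert (HP := PI_RGT_0); split; intros x; destruct (fold_exists x) as (k & s & r & Hr & Hs & ->);
    destruct (ge_fold _ _ _ _ _ _ k s r 0 g ltac:(lra) Hs) as [_ ->].
  - destruct (Req_dec r PI) as [->|]; [lra|left; apply (Im_increasing d eta H a z Z g); lra].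
  - destruct (Req_dec r 0) as [->|]; [lra|left; apply (Im_increasing d eta H a z Z g); lra].
Qed.

(** The closure carries the quotient topology of the closed strip, by [proper]: a continuous [Psi]
    that respects the identification at the contact descends. *)
Lemma continuous_on_adherent (F Psi : C -> R) : (forall w, closed_strip d w -> F (z w) = Psi w) ->
  (forall w e, closed_strip d w -> 0 < e -> near w (fun v => closed_strip d v -> Rabs (Psi v - Psi w) < e)) ->
  continuous_on (adherent D) F.
Proof.
  intros HF HP p Hp; apply adherent_region in Hp; destruct Hp as (w0 & Hw0 & ->).
  intros P [e HPe]; unfold filtermap, within; apply locally_near.
  apply near_imp with (fun q => forall w, closed_strip d w -> z w = q -> Rabs (Psi w - Psi w0) < e).
  - apply (proper d eta H a z Z g); intros w Hw E.
    replace (Psi w0) with (Psi w) by (rewrite <- HF, <- HF, E by auto; auto).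
    apply HP; [auto|apply cond_pos].
  - intros q K Hq; apply adherent_region in Hq; destruct Hq as (w & Hw & ->).
    apply HPe; change (Rabs (F (z w) - F (z w0)) < e); rewrite !HF by auto; now apply K.
Qed.

End Region.

(** * Composition and continuity of real-valued functions on the plane *)

Lemma cderive_comp (f h : C -> C) w l m : is_cderive h w m -> is_cderive f (h w) l -> is_cderive (fun x => f (h x)) w (l * m)%C.
Proof.
  intros Hh Hf; apply cderive_iff; intros e He.
  assert (Pl := Cmod_ge_0 l); assert (Pm := Cmod_ge_0 m).
  set (e1 := e / (2 * (Cmod m + 1))); set (e2 := Rmin 1 (e / (2 * (Cmod l + 1)))).
  assert (He1 : 0 < e1) by (apply Rdiv_lt_0_compat; lra).
  assert (He2 : 0 < e2) by (apply Rmin_glb_lt; [lra|apply Rdiv_lt_0_compat; lra]).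
  assert (E1 : e1 * (Cmod m + 1) = e / 2) by (unfold e1; field; lra).
  assert (E2 : e2 <= 1) by apply Rmin_l.
  assert (E3 : e2 * (Cmod l + 1) <= e / 2).
  { apply Rle_trans with (e / (2 * (Cmod l + 1)) * (Cmod l + 1)); [apply Rmult_le_compat_r; [lra|apply Rmin_r]|right; field; lra]. }
  destruct (proj1 (cderive_iff _ _ _) Hf e1 He1) as (r1 & Hr1 & K1).
  destruct (proj1 (cderive_iff _ _ _) Hh e2 He2) as (r2 & Hr2 & K2).
  exists (Rmin r2 (r1 / (Cmod m + 1))); split; [apply Rmin_glb_lt; [auto|apply Rdiv_lt_0_compat; lra]|].
  intros x Hx; assert (Px := Cmod_ge_0 x).
  specialize (K2 x ltac:(eapply Rlt_le_trans; [exact Hx|apply Rmin_l])).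
  assert (Hx2 : Cmod x < r1 / (Cmod m + 1)) by (eapply Rlt_le_trans; [exact Hx|apply Rmin_r]).
  apply Rmult_lt_compat_r with (r := Cmod m + 1) in Hx2; [|lra].
  replace (r1 / (Cmod m + 1) * (Cmod m + 1)) with r1 in Hx2 by (field; lra).
  set (k := (h (w + x) - h w)%C) in *.
  assert (Bk : Cmod k <= (Cmod m + 1) * Cmod x).
  { replace k with ((k - m * x) + m * x)%C by ring; eapply Rle_trans; [apply Cmod_triangle|]; rewrite (Cmod_mult m); nra. }
  specialize (K1 k ltac:(lra)); replace (h w + k)%C with (h (w + x)%C) in K1 by (unfold k; ring).
  replace (f (h (w + x)%C) - f (h w) - l * m * x)%C with ((f (h (w + x)%C) - f (h w) - l * k) + l * (k - m * x))%C by ring.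
  eapply Rle_trans; [apply Cmod_triangle|]; rewrite (Cmod_mult l).
  assert (B1 : e1 * Cmod k <= e / 2 * Cmod x) by (rewrite <- E1, Rmult_assoc; apply Rmult_le_compat_l; lra).
  assert (B2 : Cmod l * Cmod (k - m * x)%C <= Cmod l * (e2 * Cmod x)) by (apply Rmult_le_compat_l; lra).
  assert (B3 : e2 * (Cmod l + 1) * Cmod x <= e / 2 * Cmod x) by (apply Rmult_le_compat_r; lra).
  assert (0 <= e2 * Cmod x) by (apply Rmult_le_pos; lra).
  lra.
Qed.

Lemma continuous_near (F : C -> R) w : continuous F w <-> forall e, 0 < e -> near w (fun v => Rabs (F v - F w) < e).
Proof.
  split.
  - intros H e He; apply locally_near, (H (fun q => Rabs (q - F w) < e)); exists (mkposreal e He); auto.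
  - intros H P [e HP]; apply locally_near; eapply near_imp; [apply (H e (cond_pos e))|]; intros v Hv; now apply HP.
Qed.

Lemma continuous_cderive (f : C -> C) w l : is_cderive f w l -> continuous (fun v => Re (f v)) w /\ continuous (fun v => Im (f v)) w.
Proof.
  intros H; split; apply continuous_near; intros e He; eapply near_imp; try apply (cts_cderive (fun _ => True) f w l H e He);
    intros v Hv; specialize (Hv I); eapply Rle_lt_trans; try exact Hv; [apply (Rabs_Re_le (f v - f w)%C)|apply (Rabs_Im_le (f v - f w)%C)].
Qed.

Lemma continuous_lift (h : C -> C) (F : C -> R) w l : is_cderive h w l -> continuous F (h w) -> continuous (fun v => F (h v)) w.
Proof.
  intros H HF; apply continuous_near; intros e He.
  destruct (proj1 (continuous_near _ _) HF e He) as (r & Hr & K).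
  eapply near_imp; [apply (cts_cderive (fun _ => True) h w l H r Hr)|]; intros v Hv; apply K; auto.
Qed.

Lemma continuous_bilinear (f1 f2 g1 g2 h : C -> R) w : continuous f1 w -> continuous f2 w -> continuous g1 w ->
  continuous g2 w -> continuous h w -> continuous (fun v => f1 v * (g1 v * h v) + f2 v * (g2 v * h v)) w.
Proof.
  intros F1 F2 G1 G2 H.
  apply (continuous_plus (fun v => f1 v * (g1 v * h v)) (fun v => f2 v * (g2 v * h v))).
  - apply (continuous_mult (K := R_AbsRing) f1); [exact F1|now apply (continuous_mult (K := R_AbsRing) g1)].
  - apply (continuous_mult (K := R_AbsRing) f2); [exact F2|now apply (continuous_mult (K := R_AbsRing) g2)].
Qed.

Lemma continuous_Cdiv (f h : C -> C) w : continuous (fun v => Re (f v)) w -> continuous (fun v => Im (f v)) w ->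
  continuous (fun v => Re (h v)) w -> continuous (fun v => Im (h v)) w -> h w <> RtoC 0 ->
  continuous (fun v => Re (f v / h v)%C) w /\ continuous (fun v => Im (f v / h v)%C) w.
Proof.
  intros A1 A2 B1 B2 HZ.
  assert (N : Re (h w) ^ 2 + Im (h w) ^ 2 <> 0).
  { intros E; apply HZ; destruct (h w) as [r s]; simpl in *; unfold RtoC; f_equal; nra. }
  assert (I : continuous (fun v => / (Re (h v) ^ 2 + Im (h v) ^ 2)) w).
  { apply (continuous_comp (fun v => Re (h v) ^ 2 + Im (h v) ^ 2) Rinv); [|now apply continuous_Rinv].
    apply (continuous_plus (fun v => Re (h v) ^ 2) (fun v => Im (h v) ^ 2)); [apply (continuous_comp (fun v => Re (h v)) (fun t => t ^ 2))|
      apply (continuous_comp (fun v => Im (h v)) (fun t => t ^ 2))]; auto; apply continuity_pt_filterlim; reg. }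
  split.
  - apply (continuous_ext (fun v => Re (f v) * (Re (h v) * / (Re (h v) ^ 2 + Im (h v) ^ 2)) + Im (f v) * (Im (h v) * / (Re (h v) ^ 2 + Im (h v) ^ 2)))).
    + intros v; unfold Cdiv, Cinv, Cmult, Re, Im; simpl; unfold Rdiv; ring.
    + now apply continuous_bilinear.
  - apply (continuous_ext (fun v => Im (f v) * (Re (h v) * / (Re (h v) ^ 2 + Im (h v) ^ 2)) + - Re (f v) * (Im (h v) * / (Re (h v) ^ 2 + Im (h v) ^ 2)))).
    + intros v; unfold Cdiv, Cinv, Cmult, Re, Im; simpl; unfold Rdiv; ring.
    + apply continuous_bilinear; auto; now apply (continuous_opp (fun v => Re (f v))).
Qed.

Lemma near_line (P : C -> Prop) x y : near (x, y) P -> locally x (fun t => P (t, y)) /\ locally y (fun t => P (x, t)).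
Proof.
  intros (r & Hr & K); split; exists (mkposreal r Hr); intros t Ht; apply K.
  - replace ((t, y) - (x, y))%C with (RtoC (t - x)) by (unfold RtoC, Cminus, Cplus, Copp; simpl; f_equal; ring).
    rewrite Cmod_R; exact Ht.
  - eapply Rle_lt_trans; [apply Cmod_Re_Im|]; simpl; replace (x + - x) with 0 by ring; rewrite Rabs_R0, Rplus_0_l; exact Ht.
Qed.

Lemma near_2d (P : C -> Prop) x y : near (x, y) P -> locally_2d (fun s t => P (s, t)) x y.
Proof.
  intros K; apply locally_near in K; apply locally_2d_locally.
  revert K; apply filter_imp; intros [s t] Q; exact Q.
Qed.

Lemma continuous_2d (F : C -> R) x y : continuous F (x, y) -> continuity_2d_pt (fun s t => F (s, t)) x y.
Proof.
  intros H e; apply (near_2d (fun p => Rabs (F p - F (x, y)) < e)); apply continuous_near; [auto|apply cond_pos].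
Qed.

(** Explicit partial derivatives on an open set replace iterated [Derive] terms, so that smoothness
    is established one order at a time. *)
Lemma ex_diff_succ (D : C -> Prop) (f fa fb : R -> R -> R) n x y : (forall p, D p -> near p D) -> D (x, y) ->
  (forall s t, D (s, t) -> is_derive (fun r => f r t) s (fa s t) /\ is_derive (fun r => f s r) t (fb s t)) ->
  continuity_2d_pt f x y -> ex_diff_n fa n x y -> ex_diff_n fb n x y -> ex_diff_n f (S n) x y.
Proof.
  intros HD Hp Hf Hc Ha Hb; split; [exact Hc|].
  destruct (Hf x y Hp) as [F1 F2].
  split; [now exists (fa x y)|split; [now exists (fb x y)|]].
  assert (N := near_2d D x y (HD _ Hp)).
  split.
  - apply ex_diff_n_ext_loc with (2 := Ha); revert N; apply locally_2d_impl, locally_2d_forall; intros s t Q.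
    symmetry; now apply is_derive_unique, Hf.
  - apply ex_diff_n_ext_loc with (2 := Hb); revert N; apply locally_2d_impl, locally_2d_forall; intros s t Q.
    symmetry; now apply is_derive_unique, Hf.
Qed.

Lemma geometry_of_flow d eta yc G q z Z Z' u u' P a : flow d eta yc G q z Z Z' u u' P -> shape d z Z a ->
  geometry d eta (d - yc) a z Z.
Proof.
  intros F S; assert (B := fl_zbot _ _ _ _ _ _ _ _ _ _ _ F); destruct F; constructor; auto.
  - intros w Hw; exists (Z' w); auto.
  - intros x; rewrite B; ring.
Qed.

(** * The stream function *)

Section Stream.
Context (d eta yc G q : R) (z Z Z' u u' P : C -> C) (a : R).
Context (F : flow d eta yc G q z Z Z' u u' P) (Sh : shape d z Z a).
Let g := geometry_of_flow d eta yc G q z Z Z' u u' P a F Sh.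
Let Hd : 0 < d := ge_d _ _ _ _ _ _ g.
Let He : 0 < eta := ge_eta _ _ _ _ _ _ g.
Let D := region d z.
Let zi := inverse d z.

Definition stream (d yc : R) (z P : C -> C) (x y : R) : R := / 2 * (y - yc) ^ 2 + Re (P (inverse d z (x, y))).
Let psi := stream d yc z P.

Lemma in_strip w : closed_strip d w -> - d - eta < Im w < eta.
Proof. unfold closed_strip; lra. Qed.

(** The value does not depend on the chosen preimage: two distinct ones both lie on the surface,
    where [fl_Ptop] determines the potential from the height. *)
Lemma stream_z w : closed_strip d w -> psi (Re (z w)) (Im (z w)) = / 2 * (Im (z w) - yc) ^ 2 + Re (P w).
Proof.
  intros Hw; unfold psi, stream; f_equal.
  replace (Re (z w), Im (z w)) with (z w) by now destruct (z w).
  destruct (inverse_spec d z (z w)) as [K1 K2]; [exists w; auto|].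
  destruct (inverse d z (z w)) as [x1 y1], w as [x2 y2]; unfold closed_strip in Hw, K1; simpl in Hw, K1.
  destruct (strip_injective _ _ _ _ _ _ g x1 y1 x2 y2 K1 Hw K2) as [<- [<-|[-> _]]]; auto.
  assert (T1 := fl_Ptop _ _ _ _ _ _ _ _ _ _ _ F x1); assert (T2 := fl_Ptop _ _ _ _ _ _ _ _ _ _ _ F x2); rewrite K2 in T1; lra.
Qed.

Lemma stream_continuous : continuous_on (adherent D) (fun p : C => psi (Re p) (Im p)).
Proof.
  apply (continuous_on_adherent _ _ _ _ _ _ g _ (fun w => / 2 * (Im (z w) - yc) ^ 2 + Re (P w))); [exact stream_z|].
  intros w e Hw Hp.
  assert (K : continuous (fun w => / 2 * (Im (z w) - yc) ^ 2 + Re (P w)) w).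
  { apply (continuous_plus (fun w => / 2 * (Im (z w) - yc) ^ 2) (fun w => Re (P w))).
    - apply (continuous_comp (fun w => Im (z w)) (fun y => / 2 * (y - yc) ^ 2)).
      + apply (continuous_cderive z w (Z w)), (fl_z _ _ _ _ _ _ _ _ _ _ _ F), in_strip, Hw.
      + apply continuity_pt_filterlim; reg.
    - apply (continuous_cderive P w _ (fl_P _ _ _ _ _ _ _ _ _ _ _ F w (in_strip w Hw))). }
  eapply near_imp; [apply (proj1 (continuous_near _ _) K e Hp)|]; auto.
Qed.

Let fx (x y : R) : R := Im (u (zi (x, y))).
Let fy (x y : R) : R := y - yc + Re (u (zi (x, y))).
(** The complex derivative of [u] with respect to the physical variable [z]. *)
Let V (p : C) : C := (u' (zi p) / Z (zi p))%C.

Lemma region_inverse p : D p -> exists w, strip d w /\ p = z w /\ zi p = w.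
Proof. intros (w & Hw & ->); exists w; repeat (split; auto); now apply (inverse_strip _ _ _ _ _ _ g). Qed.

Lemma inverse_derive' p : D p -> is_cderive zi p (/ Z (zi p))%C.
Proof. intros Hp; destruct (region_inverse p Hp) as (w & Hw & -> & ->); now apply (inverse_derive _ _ _ _ _ _ g). Qed.

Lemma inverse_in p : D p -> closed_strip d (zi p).
Proof. intros Hp; destruct (region_inverse p Hp) as (w & Hw & -> & ->); now apply strip_closed. Qed.

Lemma velocity_derive x y : D (x, y) ->
  (is_derive (fun t => fx t y) x (Im (V (x, y))) /\ is_derive (fun t => fx x t) y (Re (V (x, y)))) /\
  (is_derive (fun t => fy t y) x (Re (V (x, y))) /\ is_derive (fun t => fy x t) y (1 - Im (V (x, y)))).
Proof.
  intros Hp; assert (Hw := in_strip _ (inverse_in _ Hp)).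
  assert (K := cderive_comp u zi _ _ _ (inverse_derive' _ Hp) (fl_u _ _ _ _ _ _ _ _ _ _ _ F _ Hw)); fold (Cdiv (u' (zi (x, y))) (Z (zi (x, y)))) in K.
  destruct (cderive_alpha _ _ _ _ K) as [A1 A2], (cderive_beta _ _ _ _ K) as [B1 B2].
  split; split; auto.
  - unfold fy; replace (Re (V (x, y))) with (0 + Re (V (x, y))) by ring.
    apply (is_derive_plus (fun _ => y - yc)); [apply is_derive_Reals, derivable_pt_lim_const|exact A1].
  - apply (is_derive_plus (fun t => t - yc)); [auto_derive; auto|exact B1].
Qed.

Lemma stream_derive x y : D (x, y) -> is_derive (fun t => psi t y) x (fx x y) /\ is_derive (fun t => psi x t) y (fy x y).
Proof.
  intros Hp; assert (Hw := inverse_in _ Hp).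
  assert (HZ := Z_nonzero _ _ _ _ _ _ g _ Hw).
  assert (K := cderive_comp P zi _ _ _ (inverse_derive' _ Hp) (fl_P _ _ _ _ _ _ _ _ _ _ _ F _ (in_strip _ Hw))).
  replace (- Ci * (u (zi (x, y)) * Z (zi (x, y))) * / Z (zi (x, y)))%C with (- Ci * u (zi (x, y)))%C in K by (field; auto).
  destruct (cderive_alpha _ _ _ _ K) as [A1 _], (cderive_beta _ _ _ _ K) as [B1 _].
  replace (Re (- Ci * u (zi (x, y)))%C) with (fx x y) in A1 by (unfold fx; destruct (u _); simpl; ring).
  replace (- Im (- Ci * u (zi (x, y)))%C) with (Re (u (zi (x, y)))) in B1 by (destruct (u _); simpl; ring).
  split.
  - replace (fx x y) with (0 + fx x y) by ring.
    apply (is_derive_plus (fun _ => / 2 * (y - yc) ^ 2)); [apply is_derive_Reals, derivable_pt_lim_const|exact A1].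
  - apply (is_derive_plus (fun t => / 2 * (t - yc) ^ 2)); [auto_derive; auto; field|exact B1].
Qed.

Lemma V_continuous p : D p -> continuous (fun p => Re (V p)) p /\ continuous (fun p => Im (V p)) p.
Proof.
  intros Hp; assert (Hw := inverse_in _ Hp); assert (HZ := Z_nonzero _ _ _ _ _ _ g _ Hw).
  destruct (fl_u' _ _ _ _ _ _ _ _ _ _ _ F _ (in_strip _ Hw)) as [l Hl].
  destruct (continuous_cderive _ _ _ Hl) as [A1 A2].
  destruct (continuous_cderive _ _ _ (fl_Z _ _ _ _ _ _ _ _ _ _ _ F _ (in_strip _ Hw))) as [B1 B2].
  destruct (continuous_Cdiv u' Z (zi p) A1 A2 B1 B2 HZ) as [K1 K2].
  split; [apply (continuous_lift zi (fun w => Re (u' w / Z w)%C) p _ (inverse_derive' p Hp) K1)|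
    apply (continuous_lift zi (fun w => Im (u' w / Z w)%C) p _ (inverse_derive' p Hp) K2)].
Qed.

Lemma stream_C2 x y : D (x, y) -> ex_diff_n psi 2 x y.
Proof.
  intros Hp; assert (HD : forall p, D p -> near p D) by apply (region_near _ _ _ _ _ _ g).
  assert (Hw := inverse_in _ Hp).
  destruct (V_continuous _ Hp) as [V1 V2].
  destruct (continuous_cderive _ _ _ (fl_u _ _ _ _ _ _ _ _ _ _ _ F _ (in_strip _ Hw))) as [U1 U2].
  apply (continuous_lift zi _ _ _ (inverse_derive' _ Hp)) in U1.
  apply (continuous_lift zi _ _ _ (inverse_derive' _ Hp)) in U2.
  assert (lin : forall h : R -> R, continuity_pt h y -> continuous (fun p : C => h (Im p)) (x, y)).
  { intros h Hh; apply (continuous_comp (fun p : C => Im p) h); [apply continuous_snd|now apply continuity_pt_filterlim]. }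
  apply (ex_diff_succ D psi fx fy 1 x y HD Hp stream_derive).
  - apply (continuous_2d (fun p => / 2 * (Im p - yc) ^ 2 + Re (P (zi p)))).
    apply (continuous_plus (fun p : C => / 2 * (Im p - yc) ^ 2)); [apply (lin (fun t => / 2 * (t - yc) ^ 2)); reg|].
    apply (continuous_lift zi (fun w => Re (P w)) _ _ (inverse_derive' _ Hp)).
    apply (continuous_cderive P _ _ (fl_P _ _ _ _ _ _ _ _ _ _ _ F _ (in_strip _ Hw))).
  - apply (ex_diff_succ D fx (fun s t => Im (V (s, t))) (fun s t => Re (V (s, t))) 0 x y HD Hp).
    + intros; now apply velocity_derive.
    + now apply (continuous_2d (fun p => Im (u (zi p)))).
    + split; auto; now apply (continuous_2d (fun p => Im (V p))).
    + split; auto; now apply (continuous_2d (fun p => Re (V p))).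
  - apply (ex_diff_succ D fy (fun s t => Re (V (s, t))) (fun s t => 1 - Im (V (s, t))) 0 x y HD Hp).
    + intros; now apply velocity_derive.
    + apply (continuous_2d (fun p => (Im p - yc) + Re (u (zi p)))).
      apply (continuous_plus (fun p : C => Im p - yc)); [apply (lin (fun t => t - yc)); reg|exact U1].
    + split; auto; now apply (continuous_2d (fun p => Re (V p))).
    + split; auto; apply (continuous_2d (fun p => 1 - Im (V p))).
      apply (continuous_minus (fun _ : C => 1)); [apply continuous_const|exact V2].
Qed.

(** The potential part is harmonic, so its second derivatives cancel, and [(y - yc)^2 / 2]
    contributes 1. *)
Lemma stream_laplacian x y : D (x, y) -> laplacian psi x y = 1.
Proof.
  intros Hp; destruct (near_line D x y (region_near _ _ _ _ _ _ g _ Hp)) as [N1 N2].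
  destruct (velocity_derive x y Hp) as [[A1 _] [_ B2]].
  unfold laplacian, partial_derive.
  change (Derive (fun s => Derive (fun t => psi t y) s) x + Derive (fun s => Derive (fun t => psi x t) s) y = 1).
  rewrite (Derive_ext_loc _ (fun s => fx s y)), (Derive_ext_loc (fun s => Derive (fun t => psi x t) s) (fun s => fy x s)).
  - apply is_derive_unique in A1; apply is_derive_unique in B2.
    eapply eq_trans; [apply (f_equal2 Rplus A1 B2)|ring].
  - revert N2; apply filter_imp; intros t Q; now apply is_derive_unique, stream_derive.
  - revert N1; apply filter_imp; intros t Q; now apply is_derive_unique, stream_derive.
Qed.

(** The gradient is a continuous function of the strip variable up to the top. The limit is thus
    attached to the parameter, and the two branches at the contact do not interfere. *)
Lemma stream_bernoulli (x : R) : exists v : C,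
  filterlim (fun w => grad psi (z w)) (within (strip d) (locally (x, 0))) (locally v) /\
  / 2 * Cmod v ^ 2 + G * Im (z (x, 0)) = q / 2 + G * yc.
Proof.
  set (v := fun w => (Im (u w), Im (z w) - yc + Re (u w)) : C).
  exists (v (x, 0)); split.
  - assert (Hw : closed_strip d (x, 0)) by (unfold closed_strip; simpl; lra).
    destruct (continuous_cderive _ _ _ (fl_u _ _ _ _ _ _ _ _ _ _ _ F _ (in_strip _ Hw))) as [U1 U2].
    destruct (continuous_cderive _ _ _ (fl_z _ _ _ _ _ _ _ _ _ _ _ F _ (in_strip _ Hw))) as [_ Y2].
    assert (C2 : continuous (fun w => Im (z w) - yc + Re (u w)) (x, 0)).
    { apply (continuous_plus (fun w => Im (z w) - yc)); [apply (continuous_minus (fun w => Im (z w)) (fun _ => yc)); auto; apply continuous_const|exact U1]. }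
    intros S HS; apply locally_near in HS; destruct HS as (r & Hr & K).
    apply locally_near.
    apply near_imp with (fun w => Rabs (Im (u w) - Im (u (x, 0))) < r / 2 /\
      Rabs ((Im (z w) - yc + Re (u w)) - (Im (z (x, 0)) - yc + Re (u (x, 0)))) < r / 2).
    + apply near_and; [apply (proj1 (continuous_near _ _) U2)|apply (proj1 (continuous_near _ _) C2)]; lra.
    + intros w [Q1 Q2] Sw.
      assert (E : grad psi (z w) = v w).
      { assert (Dw : D (Re (z w), Im (z w))) by (exists w; split; auto; now destruct (z w)).
        unfold grad; destruct (stream_derive _ _ Dw) as [E1 E2].
        apply is_derive_unique in E1; apply is_derive_unique in E2.
        eapply eq_trans; [apply (f_equal2 (fun s t : R => (s, t)) E1 E2)|].
        unfold fx, fy, v; replace (Re (z w), Im (z w)) with (z w) by now destruct (z w).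
        unfold zi; rewrite (inverse_strip _ _ _ _ _ _ g w Sw); reflexivity. }
      rewrite E; apply K; eapply Rle_lt_trans; [apply Cmod_Re_Im|].
      change (Rabs (Im (u w) - Im (u (x, 0))) + Rabs ((Im (z w) - yc + Re (u w)) - (Im (z (x, 0)) - yc + Re (u (x, 0)))) < r); lra.
  - assert (B := fl_bern _ _ _ _ _ _ _ _ _ _ _ F x).
    assert (E : Cmod (v (x, 0)) ^ 2 = Im (u (x, 0)) ^ 2 + (Im (z (x, 0)) - yc + Re (u (x, 0))) ^ 2).
    { unfold Cmod; rewrite <- Rsqr_pow2, Rsqr_sqrt; [reflexivity|]; apply Rplus_le_le_0_compat; apply pow2_ge_0. }
    rewrite E; unfold Rdiv; lra.
Qed.

Lemma stream_surface x y : surface z (x, y) -> psi x y = 0.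
Proof.
  intros [t E]; assert (K := stream_z (t, 0) ltac:(unfold closed_strip; simpl; lra)).
  rewrite <- E in K at 1 2; simpl in K; rewrite K.
  assert (T := fl_Ptop _ _ _ _ _ _ _ _ _ _ _ F t); lra.
Qed.

Lemma stream_bottom x y : y = - (d - yc) -> psi x y = / 2 * d ^ 2 + Re (P (0, - d)).
Proof.
  intros ->; destruct (proj1 (bottom_onto _ _ _ _ _ _ g (x, - (d - yc))) eq_refl) as ([s t] & Hw & E); simpl in Hw; subst t.
  assert (K := stream_z (s, - d) ltac:(unfold closed_strip; simpl; lra)); rewrite <- E in K; simpl in K; rewrite K.
  rewrite (fl_Pbot _ _ _ _ _ _ _ _ _ _ _ F s); f_equal; f_equal; ring.
Qed.

Lemma stream_fold (k : BinNums.Z) s x y : s = 1 \/ s = - 1 -> adherent D (x, y) -> psi (2 * PI * IZR k + s * x) y = psi x y.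
Proof.
  intros Hs Hp; apply (adherent_region _ _ _ _ _ _ g) in Hp; destruct Hp as ([b c] & Hw & E).
  assert (Hc : - d <= c <= 0) by exact Hw.
  destruct (ge_fold _ _ _ _ _ _ k s b c g ltac:(lra) Hs) as [E1 E2].
  assert (K1 := stream_z (b, c) Hw); assert (K2 := stream_z (2 * PI * IZR k + s * b, c) Hw).
  rewrite E1, E2, <- E in K2; rewrite <- E in K1; simpl in K1, K2; rewrite K1, K2; f_equal.
  assert (per : forall (j : BinNums.Z) t, Re (P (t + 2 * PI * IZR j, c)) = Re (P (t, c))).
  { intros j; induction j as [|j IH|j IH] using BinInt.Z.peano_ind; intros t.
    - do 3 f_equal; change (IZR 0) with 0; ring.
    - unfold BinInt.Z.succ; rewrite plus_IZR.
      replace (t + 2 * PI * (IZR j + 1)) with (t + 2 * PI * IZR j + 2 * PI) by ring; rewrite (fl_Pper _ _ _ _ _ _ _ _ _ _ _ F); auto.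
    - rewrite <- (fl_Pper _ _ _ _ _ _ _ _ _ _ _ F); unfold BinInt.Z.pred; rewrite plus_IZR.
      replace (t + 2 * PI * (IZR j + -1) + 2 * PI) with (t + 2 * PI * IZR j) by ring; auto. }
  rewrite Rplus_comm, per; destruct Hs as [-> | ->]; [now rewrite Rmult_1_l|].
  replace (-1 * b) with (- b) by ring; apply (fl_Psym _ _ _ _ _ _ _ _ _ _ _ F); lra.
Qed.

End Stream.

(** * Uniqueness of the conformal depth *)

Lemma continuity_2d_section (f : R -> R -> R) x t : continuity_2d_pt f x t -> continuous (f x) t.
Proof.
  intros H; apply continuity_pt_filterlim; intros e He.
  destruct (locally_2d_1d_const_x _ _ _ (H (mkposreal e He))) as [r Hr].
  exists r; split; [apply cond_pos|]; intros y [_ Hy]; now apply Hr.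
Qed.

Lemma RInt_param_continuous (f : R -> R -> R) a b : a <= b -> (forall x t, continuity_2d_pt f x t) ->
  forall x, continuity_pt (fun x => RInt (f x) a b) x.
Proof.
  intros Hab Hf x e He.
  assert (ex : forall y, ex_RInt (f y) a b).
  { intros y; apply (ex_RInt_continuous (V := R_CompleteNormedModule)); intros t _; now apply continuity_2d_section. }
  assert (He1 : 0 < e / (b - a + 1)) by (apply Rdiv_lt_0_compat; lra).
  destruct (uniform_continuity_2d f (x - 1) (x + 1) a b) with (eps := mkposreal _ He1) as [r Hr]; [auto|].
  exists (Rmin 1 r); split; [apply Rmin_glb_lt; [lra|apply cond_pos]|].
  intros y [_ Hy]; simpl in *; unfold Rdist in *.
  assert (y1 : Rabs (y - x) < 1) by (eapply Rlt_le_trans; [exact Hy|apply Rmin_l]).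
  assert (y2 : Rabs (y - x) < r) by (eapply Rlt_le_trans; [exact Hy|apply Rmin_r]).
  apply Rabs_def2 in y1.
  assert (E : RInt (f y) a b - RInt (f x) a b = RInt (fun t => f y t - f x t) a b).
  { symmetry; apply (RInt_minus (V := R_CompleteNormedModule) (f y) (f x) a b); auto. }
  rewrite E; apply Rle_lt_trans with ((b - a) * (e / (b - a + 1))).
  - apply abs_RInt_le_const; [auto|apply (ex_RInt_minus (V := R_NormedModule) (f y) (f x)); auto|].
    intros t Ht; left; apply Hr; try lra; rewrite Rminus_diag, Rabs_R0; apply cond_pos.
  - apply Rmult_lt_reg_r with (b - a + 1); [lra|].
    replace ((b - a) * (e / (b - a + 1)) * (b - a + 1)) with ((b - a) * e) by (field; lra); nra.
Qed.

Lemma continuous_on_near (S : C -> Prop) (f : C -> C) w : continuous_on S f -> near w S ->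
  continuous (fun v => Re (f v)) w /\ continuous (fun v => Im (f v)) w.
Proof.
  intros Hf HS; assert (Sw := near_self _ _ HS).
  assert (K : forall e, 0 < e -> near w (fun v => Cmod (f v - f w)%C < e)).
  { intros e He; eapply near_imp; [apply (near_and _ _ _ HS (proj2 (cts_on S f) Hf w Sw e He))|]; intros v [H1 H2]; auto. }
  split; apply continuous_near; intros e He; eapply near_imp; try apply (K e He); intros v Hv; eapply Rle_lt_trans; try exact Hv;
    [apply (Rabs_Re_le (f v - f w)%C)|apply (Rabs_Im_le (f v - f w)%C)].
Qed.

(** A retraction onto [[- d, 0]]. It extends functions of the closed strip to the whole plane, where
    the results on integrals with a parameter apply. *)
Definition clamp (d y : R) : R := Rmax (- d) (Rmin y 0).

Lemma clamp_bounds d y : 0 < d -> - d <= clamp d y <= 0.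
Proof. intros Hd; split; [apply Rmax_l|apply Rmax_lub; [lra|apply Rmin_r]]. Qed.

Lemma clamp_id d y : - d <= y <= 0 -> clamp d y = y.
Proof. intros Hy; unfold clamp; rewrite Rmin_left, Rmax_right; lra. Qed.

Lemma clamp_lipschitz d x y : Rabs (clamp d x - clamp d y) <= Rabs (x - y).
Proof.
  unfold clamp, Rmax, Rmin; repeat destruct Rle_dec; try lra; unfold Rabs; repeat destruct Rcase_abs; lra.
Qed.

Section Depth.
Context (d eta H a : R) (z Z : C -> C) (g : geometry d eta H a z Z).
Context (d' : R) (z' dz' : C -> C) (cd : conformal_description (region d z) H d' z' dz').
Let D := region d z.
Let zi := inverse d z.
Let Hd' : 0 < d' := cd_depth _ _ _ _ _ cd.
Let phi (w : C) : C := zi (z' w).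

Lemma near_strip w : strip d' w -> near w (strip d').
Proof. apply strip_near. Qed.

Lemma image_in w : strip d' w -> D (z' w).
Proof. intros Hw; apply (cd_image _ _ _ _ _ cd); exists w; auto. Qed.

Lemma closed_cts w : closed_strip d' w -> cts (closed_strip d') z' w.
Proof. apply (proj2 (cts_on _ _)), (cd_continuous _ _ _ _ _ cd). Qed.

Lemma image_adherent w : closed_strip d' w -> adherent D (z' w).
Proof.
  intros Hw.
  assert (K : adherent (fun p => exists v, strip d' v /\ p = z' v) (z' w)).
  { apply (adherent_image (strip d') (closed_strip d') z' (Re w, - d' / 2) w).
    - unfold strip; simpl; lra.
    - now apply closed_cts.
    - intros v; apply strip_closed.
    - intros t Ht; destruct w as [x y]; unfold strip, closed_strip in *; simpl in *; nra. }
  apply adherent_near; intros r Hr; destruct (proj1 (adherent_near _ _) K r Hr) as (q & Hq & v & Hv & ->).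
  exists (z' v); split; auto; now apply image_in.
Qed.

Lemma dz_near w : strip d' w -> cts (strip d') dz' w.
Proof.
  intros Hw e He; eapply near_imp; [apply (proj2 (cts_on _ _) (cd_dz_continuous _ _ _ _ _ cd) w)|].
  - unfold strip, strip_with_top in *; lra.
  - exact He.
  - intros v K Sv; apply K; unfold strip, strip_with_top in *; lra.
Qed.

(** Otherwise [z' (x, 0) = z' w] with [w] in the open strip. By the open mapping theorem, points
    just below [(x, 0)] then share their images with points near [w], which lie deeper; this
    contradicts injectivity. *)
Lemma top_outside x : ~ D (z' (x, 0)).
Proof.
  intros K; apply (cd_image _ _ _ _ _ cd) in K; destruct K as (w & Hw & E).
  set (S := fun v => strip d' v /\ Im v < Im w / 2).
  assert (HS : near w S).
  { apply near_and; [now apply near_strip|].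
    exists (- Im w / 2); split; [unfold strip in Hw; lra|]; intros v Hv.
    assert (K := Rle_lt_trans _ _ _ (Rabs_Im_le (v - w)%C) Hv); change (Im (v - w)%C) with (Im v - Im w) in K.
    apply Rabs_def2 in K; lra. }
  destruct (open_mapping z' dz' w S HS) as (r & Hr & K).
  - intros v [Hv _]; now apply (cd_holomorphic _ _ _ _ _ cd).
  - intros e He; eapply near_imp; [apply (dz_near w Hw e He)|]; intros v Q [Sv _]; auto.
  - now apply (cd_holomorphic _ _ _ _ _ cd).
  - rewrite <- E in K.
    destruct (closed_cts (x, 0) ltac:(unfold closed_strip; simpl; lra) r Hr) as (s & Hs & K2).
    set (t := Rmin (s / 2) (- Im w / 2)).
    assert (Ht : 0 < t) by (apply Rmin_glb_lt; unfold strip in Hw; lra).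
    assert (t1 : t <= s / 2) by apply Rmin_l; assert (t2 : t <= - Im w / 2) by apply Rmin_r.
    assert (St : strip d' (x, - t)) by (unfold strip in *; simpl; lra).
    destruct (K (z' (x, - t))) as (v & [Hv1 Hv2] & Ev).
    { apply K2; [|now apply strip_closed].
      replace ((x, (- t)%R) - (x, 0%R))%C with (0, - t) by (unfold Cminus, Cplus, Copp; simpl; f_equal; ring).
      eapply Rle_lt_trans; [apply Cmod_le_sum|]; rewrite Rabs_R0, Rabs_Ropp, Rabs_pos_eq; lra. }
    apply (cd_injective _ _ _ _ _ cd) in Ev; auto; subst v; simpl in Hv2; lra.
Qed.

(** The point is in the closure, not in the domain by [top_outside], and above the bottom; only the
    surface is left. *)
Lemma preimage_top x : Im (phi (x, 0)) = 0.
Proof.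
  assert (Hx : closed_strip d' (x, 0)) by (unfold closed_strip; simpl; lra).
  destruct (inverse_spec d z (z' (x, 0))) as [K1 K2].
  { apply (adherent_region _ _ _ _ _ _ g); now apply image_adherent. }
  fold zi in K1, K2; fold (phi (x, 0)) in K1, K2.
  destruct (phi (x, 0)) as [s t]; unfold closed_strip in K1; simpl in K1 |- *.
  destruct (Req_dec t 0) as [|N0]; auto.
  destruct (Req_dec t (- d)) as [->|N1].
  - assert (Q := cd_surface_above_bottom _ _ _ _ _ cd (z' (x, 0)) (ex_intro _ x eq_refl)).
    rewrite <- K2, (ge_bot _ _ _ _ _ _ g) in Q; lra.
  - exfalso; apply (top_outside x); exists (s, t); split; auto; unfold strip; simpl; lra.
Qed.

Lemma preimage_bottom x : Im (phi (x, - d')) = - d.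
Proof.
  assert (Hx : closed_strip d' (x, - d')) by (unfold closed_strip; simpl; lra).
  destruct (inverse_spec d z (z' (x, - d'))) as [K1 K2].
  { apply (adherent_region _ _ _ _ _ _ g); now apply image_adherent. }
  fold zi in K1, K2; fold (phi (x, - d')) in K1, K2.
  assert (E : Im (z' (x, - d')) = - H) by (apply (cd_bottom _ _ _ _ _ cd); exists (x, - d'); auto).
  destruct (phi (x, - d')) as [s t]; unfold closed_strip in K1; simpl in K1 |- *.
  destruct (Req_dec t (- d)) as [|N1]; auto.
  assert (Q := above_bottom _ _ _ _ _ _ g s t ltac:(lra)); rewrite K2 in Q; lra.
Qed.

Let f (y x : R) : R := Im (phi (x, clamp d' y)).

(** The inverse itself may jump at the contact point, but its imaginary part does not, since both
    preimages have height 0. *)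
Lemma preimage_continuous y x : continuity_2d_pt f y x.
Proof.
  intros e.
  assert (CO : continuous_on (adherent D) (fun p => Im (zi p))).
  { apply (continuous_on_adherent _ _ _ _ _ _ g _ (fun w => Im w)).
    - intros w Hw; destruct (inverse_spec d z (z w)) as [K1 K2]; [exists w; auto|].
      fold zi in K1, K2; destruct (zi (z w)) as [x1 y1], w as [x2 y2].
      now destruct (strip_injective _ _ _ _ _ _ g x1 y1 x2 y2 K1 Hw K2).
    - intros w r _ Hr; exists r; split; auto; intros v Hv _.
      eapply Rle_lt_trans; [apply (Rabs_Im_le (v - w)%C)|exact Hv]. }
  set (w := (x, clamp d' y) : C).
  assert (Hw : closed_strip d' w) by (apply clamp_bounds, Hd').
  assert (Q := CO (z' w) (image_adherent w Hw) (fun s => Rabs (s - Im (phi w)) < e) (ex_intro _ e (fun s Hs => Hs))).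
  apply locally_near in Q; destruct Q as (r & Hr & Q).
  destruct (closed_cts w Hw r Hr) as (s & Hs & K).
  assert (Hs2 : 0 < s / 2) by lra.
  exists (mkposreal _ Hs2); intros v u Hv Hu; simpl in Hv, Hu.
  assert (Hc : closed_strip d' (u, clamp d' v)) by (apply clamp_bounds, Hd').
  apply (Q (z' (u, clamp d' v))); [|now apply image_adherent].
  apply K; auto; eapply Rle_lt_trans; [apply (Cmod_le_sum (u - x) (clamp d' v - clamp d' y))|].
  generalize (clamp_lipschitz d' v y); lra.
Qed.

Lemma phi_derive w : strip d' w -> is_cderive phi w (dz' w / Z (phi w))%C.
Proof.
  intros Hw; destruct (image_in w Hw) as (v & Hv & E).
  replace (dz' w / Z (phi w))%C with (/ Z (phi w) * dz' w)%C by (unfold Cdiv; ring).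
  apply (cderive_comp zi z'); [now apply (cd_holomorphic _ _ _ _ _ cd)|].
  unfold phi, zi; rewrite E, (inverse_strip _ _ _ _ _ _ g v Hv); now apply (inverse_derive _ _ _ _ _ _ g).
Qed.

Lemma phi_period y : - d' < y < 0 -> Re (phi (0 + 2 * PI, y)) = Re (phi (0, y)) + 2 * PI.
Proof.
  intros Hy; destruct (image_in (0, y) Hy) as ([s t] & Hv & E).
  destruct (cd_periodic _ _ _ _ _ cd 0 y) as [P1 P2]; [unfold closed_strip; simpl; lra|].
  assert (E2 : z' (0 + 2 * PI, y) = z (s + 2 * PI, t)).
  { rewrite (ge_per _ _ _ _ _ _ g), <- E; apply injective_projections.
    - change (Re (z' (0 + 2 * PI, y)) = Re (z' (0, y)) + 2 * PI); lra.
    - change (Im (z' (0 + 2 * PI, y)) = Im (z' (0, y)) + 0); lra. }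
  unfold phi, zi; rewrite E2, E, (inverse_strip _ _ _ _ _ _ g (s, t) Hv), (inverse_strip _ _ _ _ _ _ g (s + 2 * PI, t)); auto.
Qed.

Lemma phi'_continuous w : strip d' w -> continuous (fun v => Re (dz' v / Z (phi v))%C) w.
Proof.
  intros Hw; destruct (image_in w Hw) as (v & Hv & E).
  assert (Ew : phi w = v) by (unfold phi, zi; rewrite E; now apply (inverse_strip _ _ _ _ _ _ g)).
  destruct (continuous_on_near (strip d') dz' w) as [A1 A2].
  { apply cts_on; intros; now apply dz_near. }
  { now apply near_strip. }
  destruct (ge_Z _ _ _ _ _ _ g (phi w)) as [l Hl].
  { rewrite Ew; unfold strip in Hv; generalize (ge_eta _ _ _ _ _ _ g); lra. }
  destruct (continuous_cderive Z (phi w) l Hl) as [B1 B2].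
  apply (continuous_lift phi _ w _ (phi_derive w Hw)) in B1; apply (continuous_lift phi _ w _ (phi_derive w Hw)) in B2.
  apply (continuous_Cdiv dz' (fun v => Z (phi v)) w); auto.
  rewrite Ew; apply (Z_nonzero _ _ _ _ _ _ g); now apply strip_closed.
Qed.

Lemma f_derive y x : - d' < y < 0 -> is_derive (fun t => f t x) y (Re (dz' (x, y) / Z (phi (x, y)))%C).
Proof.
  intros Hy; destruct (cderive_beta _ _ _ _ (phi_derive (x, y) Hy)) as [_ K].
  apply is_derive_ext_loc with (2 := K).
  assert (Hr : 0 < Rmin (y + d') (- y)) by (apply Rmin_glb_lt; lra).
  exists (mkposreal _ Hr); intros t Ht; assert (Ht' : Rabs (t - y) < Rmin (y + d') (- y)) by exact Ht.
  assert (K1 := Rlt_le_trans _ _ _ Ht' (Rmin_l _ _)); assert (K2 := Rlt_le_trans _ _ _ Ht' (Rmin_r _ _)).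
  apply Rabs_def2 in K1; apply Rabs_def2 in K2; unfold f; rewrite clamp_id by lra; reflexivity.
Qed.

(** The mean of [Im (z^-1 o z')] over a horizontal period grows linearly with slope 1, from [- d] to [0]. *)
Lemma depth_unique : d' = d.
Proof.
  assert (HP := PI_RGT_0).
  set (I := fun y => RInt (f y) 0 (2 * PI)).
  assert (cI : forall y, continuity_pt I y) by (apply RInt_param_continuous; [lra|apply preimage_continuous]).
  assert (dI : forall y, - d' < y < 0 -> is_derive I y (2 * PI)).
  { intros y Hy.
    assert (loc : locally y (fun t => - d' < t < 0)).
    { assert (Hr : 0 < Rmin (y + d') (- y)) by (apply Rmin_glb_lt; lra).
      exists (mkposreal _ Hr); intros t Ht; assert (Ht' : Rabs (t - y) < Rmin (y + d') (- y)) by exact Ht.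
      assert (K1 := Rlt_le_trans _ _ _ Ht' (Rmin_l _ _)); assert (K2 := Rlt_le_trans _ _ _ Ht' (Rmin_r _ _)).
      apply Rabs_def2 in K1; apply Rabs_def2 in K2; lra. }
    (* By the Cauchy-Riemann equations the vertical derivative of [Im phi] is the horizontal
       derivative of [Re phi], whose integral is the period. *)
    assert (E : RInt (fun t => Derive (fun s => f s t) y) 0 (2 * PI) = 2 * PI).
    { transitivity (RInt (fun t => Re (dz' (t, y) / Z (phi (t, y)))%C) 0 (2 * PI)).
      - apply RInt_ext; intros t _; now apply is_derive_unique, f_derive.
      - replace (2 * PI) with (minus (Re (phi (2 * PI, y))) (Re (phi (0, y)))) at 2.
        + apply is_RInt_unique, (is_RInt_derive (fun t => Re (phi (t, y)))).
          * intros t _; apply (cderive_alpha phi t y), phi_derive, Hy.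
          * intros t _; apply (continuous_comp (fun t : R => (t, y)) (fun v : C => Re (dz' v / Z (phi v))%C)); [|now apply phi'_continuous].
            intros Q HQ; apply locally_near in HQ; destruct (near_line _ _ _ HQ) as [L _]; exact L.
        + assert (Q := phi_period y Hy); rewrite Rplus_0_l in Q; rewrite Q; unfold minus, plus, opp; simpl; ring. }
    rewrite <- E; apply is_derive_RInt_param.
    - revert loc; apply filter_imp; intros t Ht x _; eexists; now apply f_derive.
    - intros x _.
      apply continuity_2d_pt_ext_loc with (fun t s => Re (dz' (s, t) / Z (phi (s, t)))%C).
      + destruct loc as [r Hr]; exists r; intros t s Ht _; symmetry; apply is_derive_unique, f_derive, Hr, Ht.
      + intros e; assert (K := continuous_2d _ _ _ (phi'_continuous (x, y) Hy) e).
        destruct K as [r Hr]; exists r; intros t s Ht Hs; now apply Hr.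
    - exists (mkposreal 1 Rlt_0_1); intros t _; apply (ex_RInt_continuous (V := R_CompleteNormedModule)); intros s _.
      apply continuity_2d_section, preimage_continuous. }
  destruct (MVT_gen I (- d') 0 (fun _ => 2 * PI)) as (c & _ & E).
  - intros y Hy; rewrite Rmin_left, Rmax_right in Hy by lra; now apply dI.
  - intros y _; apply cI.
  - assert (I0 : I 0 = 0).
    { unfold I; rewrite (RInt_ext _ (fun _ => 0)), RInt_const; [unfold scal; simpl; unfold mult; simpl; ring|].
      intros x _; unfold f; rewrite clamp_id by lra; apply preimage_top. }
    assert (I1 : I (- d') = 2 * PI * - d).
    { unfold I; rewrite (RInt_ext _ (fun _ => - d)), RInt_const; [unfold scal; simpl; unfold mult; simpl; ring|].
      intros x _; unfold f; rewrite clamp_id by lra; apply preimage_bottom. }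
    rewrite I0, I1 in E; apply Rmult_eq_reg_l with (2 * PI); lra.
Qed.

End Depth.

(** * The bubble *)

Lemma near_coordinates (q p : C) r : Cmod (q - p)%C < r -> Rabs (Re q - Re p) < r /\ Rabs (Im q - Im p) < r.
Proof.
  intros Hq; split; eapply Rle_lt_trans; try exact Hq; [apply (Rabs_Re_le (q - p)%C)|apply (Rabs_Im_le (q - p)%C)].
Qed.

Section Bubble.
Context (d eta H a : R) (z Z : C -> C) (g : geometry d eta H a z Z).
Let Hd : 0 < d := ge_d _ _ _ _ _ _ g.
Let He : 0 < eta := ge_eta _ _ _ _ _ _ g.
Let Sh : shape d z Z a := ge_shape _ _ _ _ _ _ g.
Let Ha : 0 < a < PI := sh_a _ _ _ _ Sh.
Let X (x : R) : R := Re (z (x, 0)).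
Let Y (x : R) : R := Im (z (x, 0)).

(** Open horizontal segments between mirror points of the surface below the contact. As the height
    increases along the arc, each level carries exactly one of them. *)
Definition bubble (z : C -> C) (a : R) (p : C) : Prop :=
  exists t, 0 < t < a /\ Im p = Im (z (t, 0)) /\ Rabs (Re p) < Re (z (t, 0)).

Lemma Y_increasing s t : 0 <= s -> s < t -> t <= PI -> Y s < Y t.
Proof. intros; apply (Im_increasing _ _ _ _ _ _ g); lra. Qed.

Lemma Y_le s t : 0 <= s -> s <= t -> t <= PI -> Y s <= Y t.
Proof. intros H1 H2 H3; destruct H2 as [H2| ->]; [left; now apply Y_increasing|lra]. Qed.

Lemma surface_derive x : is_derive X x (Re (Z (x, 0))) /\ is_derive Y x (Im (Z (x, 0))).
Proof. apply cderive_alpha, (ge_z _ _ _ _ _ _ g); simpl; lra. Qed.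

Lemma X_continuous : continuity X.
Proof. intros x; apply derivable_continuous_pt; exists (Re (Z (x, 0))); apply is_derive_Reals, surface_derive. Qed.

Lemma Y_continuous : continuity Y.
Proof. intros x; apply derivable_continuous_pt; exists (Im (Z (x, 0))); apply is_derive_Reals, surface_derive. Qed.

Lemma X_near t e : 0 < e -> exists r, 0 < r /\ forall s, Rabs (s - t) < r -> Rabs (X s - X t) < e.
Proof.
  intros Hp; destruct (X_continuous t e Hp) as (r & Hr & K); exists r; split; auto; intros s Hs.
  destruct (Req_dec s t) as [->|N]; [rewrite Rminus_diag, Rabs_R0; auto|].
  apply K; split; [split; [exact I|auto]|exact Hs].
Qed.

Lemma Y_onto s t y : 0 <= s -> s <= t -> t <= PI -> Y s <= y <= Y t -> exists x, s <= x <= t /\ Y x = y.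
Proof.
  intros H1 H2 H3 Hy; destruct (IVT_gen Y s t y Y_continuous) as (x & Hx & E).
  - now rewrite Rmin_left, Rmax_right by lra.
  - rewrite Rmin_left, Rmax_right in Hx by lra; exists x; auto.
Qed.

Lemma X_ends : X 0 = 0 /\ X a = 0.
Proof. split; [apply (Re_axis _ _ _ _ _ _ g); lra|apply (sh_touch _ _ _ _ Sh)]. Qed.

Lemma X_bounds t : 0 <= t <= a -> 0 <= X t < PI.
Proof.
  intros Ht; destruct (Req_dec t 0) as [->|]; [destruct X_ends as [-> _]; lra|].
  apply (Re_half _ _ _ _ _ _ g); lra.
Qed.

Lemma X_positive t : 0 < t < a -> 0 < X t.
Proof.
  intros Ht; destruct (Re_half _ _ _ _ _ _ g t 0 ltac:(lra) ltac:(lra)) as [K1 K2].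
  destruct (Req_dec (X t) 0) as [E|]; [destruct (K2 E); lra|unfold X in *; lra].
Qed.

(** The abscissa has an interior minimum at the contact parameter. *)
Lemma tangent_vertical : Re (Z (a, 0)) = 0.
Proof.
  destruct (surface_derive a) as [D _]; apply is_derive_Reals in D.
  set (pr := exist (fun l => derivable_pt_abs X a l) _ D : derivable_pt X a).
  change (derive_pt X a pr = 0).
  apply (deriv_minimum X 0 PI a pr); try lra.
  intros x H1 H2; rewrite (proj2 X_ends); apply (sh_nonneg _ _ _ _ Sh); lra.
Qed.

Lemma bubble_near p : bubble z a p -> near p (bubble z a).
Proof.
  intros (t & Ht & Ep & Hp).
  set (e := (X t - Rabs (Re p)) / 2); assert (H0 : 0 < e) by (unfold e, X; lra).
  destruct (X_near t e H0) as (r & Hr & K).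
  set (s := Rmin (r / 2) (Rmin (t / 2) ((a - t) / 2))).
  assert (Hs : 0 < s) by (repeat (apply Rmin_glb_lt; [lra|]); lra).
  assert (s1 : s <= r / 2) by apply Rmin_l.
  assert (s2 : s <= t / 2) by (eapply Rle_trans; [apply Rmin_r|apply Rmin_l]).
  assert (s3 : s <= (a - t) / 2) by (eapply Rle_trans; [apply Rmin_r|apply Rmin_r]).
  assert (L := Y_increasing (t - s) t ltac:(lra) ltac:(lra) ltac:(lra)).
  assert (R := Y_increasing t (t + s) ltac:(lra) ltac:(lra) ltac:(lra)).
  exists (Rmin e (Rmin (Y t - Y (t - s)) (Y (t + s) - Y t))); split; [repeat (apply Rmin_glb_lt; [lra|]); lra|].
  intros q Hq; destruct (near_coordinates _ _ _ Hq) as [Q1 Q2].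
  assert (q1 := Rlt_le_trans _ _ _ Q1 (Rmin_l _ _)).
  assert (q2 := Rlt_le_trans _ _ _ Q2 (Rmin_r _ _)).
  assert (q3 := Rlt_le_trans _ _ _ q2 (Rmin_l _ _)); assert (q4 := Rlt_le_trans _ _ _ q2 (Rmin_r _ _)).
  apply Rabs_def2 in q3; apply Rabs_def2 in q4; fold (Y t) in Ep.
  destruct (Y_onto (t - s) (t + s) (Im q) ltac:(lra) ltac:(lra) ltac:(lra) ltac:(lra)) as (x & Hx & Ex).
  exists x; split; [lra|split; [now symmetry|]].
  specialize (K x ltac:(apply Rabs_def1; lra)); apply Rabs_def2 in K.
  assert (T := Rabs_triang (Re q - Re p) (Re p)); replace (Re q - Re p + Re p) with (Re q) in T by ring.
  fold (X x); unfold e in *; lra.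
Qed.

(** Parametrises the bubble by a rectangle, which gives its connectedness and the points needed for
    its closure. *)
Definition bubble_map (w : C) : C := (Re w * X (Im w), Y (Im w)).
Let box (w : C) : Prop := - 1 < Re w < 1 /\ 0 < Im w < a.

Lemma bubble_image p : bubble z a p <-> exists w, box w /\ p = bubble_map w.
Proof.
  split.
  - intros (t & Ht & E & Hp); assert (HX := X_positive t Ht); fold (X t) in Hp.
    apply Rabs_def2 in Hp; exists (Re p / X t, t); split.
    + split; [split; simpl|exact Ht]; apply Rmult_lt_reg_r with (X t); auto; unfold Rdiv; rewrite Rmult_assoc, Rinv_l; lra.
    + apply injective_projections; simpl; [change (Re p = Re p / X t * X t); field; lra|exact E].
  - intros ([l t] & [H1 H2] & ->); simpl in H1, H2; exists t; split; [auto|split; [reflexivity|]].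
    assert (HX := X_positive t H2); simpl; fold (X t); rewrite Rabs_mult, (Rabs_pos_eq (X t)) by lra.
    rewrite <- (Rmult_1_l (X t)) at 2; apply Rmult_lt_compat_r; auto; apply Rabs_def1; lra.
Qed.

Lemma bubble_map_cts S w : cts S bubble_map w.
Proof.
  assert (K : forall h : R -> R, continuity h -> continuous (fun p : C => h (Im p)) w).
  { intros h Hh; apply (continuous_comp (fun p : C => Im p) h); [apply continuous_snd|apply continuity_pt_filterlim, Hh]. }
  assert (K1 : continuous (fun p : C => Re p * X (Im p)) w).
  { apply (continuous_mult (K := R_AbsRing) (fun p : C => Re p)); [apply continuous_fst|apply (K X X_continuous)]. }
  intros e Hp; destruct (near_and _ _ _ (proj1 (continuous_near _ _) K1 (e / 2) ltac:(lra))
    (proj1 (continuous_near _ _) (K Y Y_continuous) (e / 2) ltac:(lra))) as (r & Hr & Q).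
  exists r; split; auto; intros v Hv _; destruct (Q v Hv) as [Q1 Q2].
  eapply Rle_lt_trans; [apply (Cmod_le_sum (Re v * X (Im v) - Re w * X (Im w)) (Y (Im v) - Y (Im w)))|lra].
Qed.

(** Strict monotonicity of the height confines the parameters of nearby bubble points to a
    neighbourhood of [t], where the width is continuous. *)
Lemma adherent_bubble p : adherent (bubble z a) p <-> exists t, 0 <= t <= a /\ Im p = Y t /\ Rabs (Re p) <= X t.
Proof.
  split.
  - intros Q; apply NNPP; intros N; apply Q, locally_near.
    destruct (Rlt_dec (Im p) (Y 0)) as [L|L].
    { exists (Y 0 - Im p); split; [lra|]; intros q Hq (t & Ht & E & _).
      destruct (near_coordinates _ _ _ Hq) as [_ K]; apply Rabs_def2 in K.
      assert (B := Y_le 0 t ltac:(lra) ltac:(lra) ltac:(lra)); unfold Y in *; lra. }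
    destruct (Rlt_dec (Y a) (Im p)) as [L'|L'].
    { exists (Im p - Y a); split; [lra|]; intros q Hq (t & Ht & E & _).
      destruct (near_coordinates _ _ _ Hq) as [_ K]; apply Rabs_def2 in K.
      assert (B := Y_le t a ltac:(lra) ltac:(lra) ltac:(lra)); unfold Y in *; lra. }
    destruct (Y_onto 0 a (Im p) ltac:(lra) ltac:(lra) ltac:(lra) ltac:(lra)) as (t & Ht & E).
    assert (Hp : X t < Rabs (Re p)).
    { apply Rnot_le_lt; intros K; apply N; exists t; auto. }
    set (e := (Rabs (Re p) - X t) / 2); assert (H0 : 0 < e) by (unfold e; lra).
    destruct (X_near t e H0) as (r & Hr & K).
    set (s := Rmin (r / 2) ((PI - a) / 2)).
    assert (Hs : 0 < s) by (apply Rmin_glb_lt; lra).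
    assert (s1 : s <= r / 2) by apply Rmin_l; assert (s2 : s <= (PI - a) / 2) by apply Rmin_r.
    assert (R1 := Y_increasing t (t + s) ltac:(lra) ltac:(lra) ltac:(lra)).
    assert (L1 : exists m, 0 < m /\ forall x, 0 <= x -> x <= t - s -> Y x <= Y t - m).
    { destruct (Rle_dec 0 (t - s)) as [B|B]; [|exists 1; split; [lra|]; intros; lra].
      exists (Y t - Y (t - s)); split; [generalize (Y_increasing (t - s) t B ltac:(lra) ltac:(lra)); lra|].
      intros x H1 H2; generalize (Y_le x (t - s) H1 H2 ltac:(lra)); lra. }
    destruct L1 as (m & Hm & L1).
    exists (Rmin e (Rmin m (Y (t + s) - Y t))); split; [repeat (apply Rmin_glb_lt; [lra|]); lra|].
    intros q Hq (x & Hx & Eq & Hq2); fold (Y x) in Eq; fold (X x) in Hq2; destruct (near_coordinates _ _ _ Hq) as [Q1 Q2].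
    assert (q1 := Rlt_le_trans _ _ _ Q1 (Rmin_l _ _)).
    assert (q2 := Rlt_le_trans _ _ _ Q2 (Rmin_r _ _)).
    assert (q3 := Rlt_le_trans _ _ _ q2 (Rmin_l _ _)); assert (q4 := Rlt_le_trans _ _ _ q2 (Rmin_r _ _)).
    apply Rabs_def2 in q3; apply Rabs_def2 in q4.
    assert (x1 : t - s < x).
    { apply Rnot_le_lt; intros B; generalize (L1 x ltac:(lra) B); lra. }
    assert (x2 : x < t + s).
    { apply Rnot_le_lt; intros B; generalize (Y_le (t + s) x ltac:(lra) B ltac:(lra)); lra. }
    specialize (K x ltac:(apply Rabs_def1; lra)); apply Rabs_def2 in K.
    assert (T := Rabs_triang (Re p - Re q) (Re q)); replace (Re p - Re q + Re q) with (Re p) in T by ring.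
    rewrite Rabs_minus_sym in q1; unfold e in *; lra.
  - intros (t & Ht & E & Hp).
    assert (Q : exists l, - 1 <= l <= 1 /\ p = bubble_map (l, t)).
    { destruct (X_bounds t Ht) as [B _]; destruct (Req_dec (X t) 0) as [E0|N0].
      - exists 0; split; [lra|]; rewrite E0 in Hp; assert (Hp0 : Re p = 0).
        { destruct (Req_dec (Re p) 0); auto; generalize (Rabs_pos_lt (Re p)); lra. }
        apply injective_projections; simpl; [rewrite Rmult_0_l; exact Hp0|exact E].
      - apply Rabs_le_between in Hp; exists (Re p / X t); split.
        + split; apply Rmult_le_reg_r with (X t); try lra; unfold Rdiv; rewrite Rmult_assoc, Rinv_l; lra.
        + apply injective_projections; simpl; [change (Re p = Re p / X t * X t); field; lra|exact E]. }
    destruct Q as (l & Hl & ->).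
    assert (K : adherent (fun q => exists w, box w /\ q = bubble_map w) (bubble_map (l, t))).
    { apply (adherent_image box (fun _ => True) bubble_map (0, a / 2) (l, t)); auto.
      - split; simpl; lra.
      - apply bubble_map_cts.
      - intros s Hs; split; simpl; nra. }
    apply adherent_near; intros r Hr; destruct (proj1 (adherent_near _ _) K r Hr) as (q & Hq & B).
    exists q; split; auto; now apply bubble_image.
Qed.

Lemma loop_shape p : loop z (- a) a p <-> exists t, 0 <= t <= a /\ Im p = Y t /\ Rabs (Re p) = X t.
Proof.
  split.
  - intros (x & Hx & ->); exists (Rabs x).
    assert (Hr : 0 <= Rabs x <= a) by (split; [apply Rabs_pos|apply Rabs_le; lra]).
    split; [auto|].
    assert (E : Im (z (x, 0)) = Y (Rabs x) /\ (Re (z (x, 0)) = X (Rabs x) \/ Re (z (x, 0)) = - X (Rabs x))).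
    { unfold Rabs; destruct Rcase_abs; [|auto].
      destruct (ge_sym _ _ _ _ _ _ g x 0 ltac:(lra)) as [S1 S2]; unfold X, Y; rewrite S1, S2; split; auto; right; ring. }
    destruct E as [E1 [E2|E2]]; split; auto; rewrite E2; [|rewrite Rabs_Ropp]; apply Rabs_pos_eq, X_bounds, Hr.
  - intros (t & Ht & E & Hp); destruct (Rle_dec 0 (Re p)) as [B|B].
    + exists t; split; [lra|]; rewrite Rabs_pos_eq in Hp by auto; now apply injective_projections.
    + exists (- t); split; [lra|]; rewrite Rabs_left1 in Hp by lra.
      destruct (ge_sym _ _ _ _ _ _ g t 0 ltac:(lra)) as [S1 S2].
      apply injective_projections; [change (Re p = Re (z (- t, 0))); unfold X in Hp; lra|].
      change (Im p = Im (z (- t, 0))); unfold Y in E; lra.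
Qed.

Lemma bubble_enclosed : encloses (loop z (- a) a) (bubble z a).
Proof.
  split; [split; [|split]|split].
  - exists (0, Y (a / 2)), (a / 2); split; [lra|split; [reflexivity|]]; simpl; rewrite Rabs_R0; apply (X_positive (a / 2)); lra.
  - apply (proj2 (open_near (bubble z a))), bubble_near.
  - intros U V HU HV HUV HA HB.
    assert (C : connected (fun p => exists w, box w /\ p = bubble_map w)).
    { apply image_connected; [|intros; apply bubble_map_cts].
      intros [p1 q1] [p2 q2] u [H1 H2] [H3 H4] Hu; split; simpl in *.
      - replace (p1 + (u * (p2 + - p1) - 0 * (q2 + - q1))) with (p1 + u * (p2 - p1)) by ring; now apply between_convex.
      - replace (q1 + (u * (q2 + - q1) + 0 * (p2 + - p1))) with (q1 + u * (q2 - q1)) by ring; now apply between_convex. }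
    destruct (C U V HU HV) as (p & Hp & HUp).
    + intros p Hp; apply HUV; now apply bubble_image.
    + destruct HA as (p & Hp & Up); exists p; split; auto; now apply bubble_image.
    + destruct HB as (p & Hp & Up); exists p; split; auto; now apply bubble_image.
    + exists p; split; auto; now apply bubble_image.
  - exists (PI + (Rabs (Y 0) + Rabs (Y a))); intros p (t & Ht & E & Hp); fold (X t) in Hp; fold (Y t) in E.
    eapply Rle_trans; [apply Cmod_Re_Im|]; destruct (X_bounds t ltac:(lra)) as [_ B].
    assert (B1 := Y_le 0 t ltac:(lra) ltac:(lra) ltac:(lra)); assert (B2 := Y_le t a ltac:(lra) ltac:(lra) ltac:(lra)).
    assert (Rabs (Im p) <= Rabs (Y 0) + Rabs (Y a)); [|lra].
    apply Rabs_le; rewrite E; generalize (Rle_abs (Y a)) (Rle_abs (- Y 0)); rewrite Rabs_Ropp; generalize (Rabs_pos (Y a)) (Rabs_pos (Y 0)); lra.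
  - intros p; rewrite loop_shape; unfold frontier; rewrite adherent_bubble, locally_near; split.
    + intros [(t & Ht & E & Hp) N]; exists t; split; [auto|split; [auto|]].
      destruct Hp as [Hp|]; auto; exfalso; apply N, bubble_near; exists t; split; auto.
      destruct X_ends as [X0 Xa]; assert (K := Rabs_pos (Re p)).
      destruct (Req_dec t 0) as [->|]; [lra|]; destruct (Req_dec t a) as [->|]; lra.
    + intros (t & Ht & E & Hp); split; [exists t; split; [|split]; auto; lra|].
      intros N; destruct (near_self _ _ N) as (s & Hs & E2 & Hp2); fold (Y s) in E2; fold (X s) in Hp2.
      destruct (Rtotal_order s t) as [Q|[->|Q]]; [|lra|].
      * generalize (Y_increasing s t ltac:(lra) Q ltac:(lra)); lra.
      * generalize (Y_increasing t s ltac:(lra) Q ltac:(lra)); lra.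
Qed.

(** At equal height, the chord inequality from [(t, 0)] to a point of the open half strip says that
    the fluid point has the larger abscissa, whereas bubble points have a smaller one. The bound by
    [PI] on the width excludes other periods. *)
Lemma bubble_outside p : bubble z a p -> ~ region d z p.
Proof.
  intros (t & Ht & E & Hp) ([x y] & Hw & ->); unfold strip in Hw; simpl in Hw.
  assert (HP := PI_RGT_0); fold (X t) in Hp; fold (Y t) in E; destruct (X_bounds t ltac:(lra)) as [_ B].
  destruct (fold_exists x) as (k & s & r & Hr & Hs & ->).
  destruct (ge_fold _ _ _ _ _ _ k s r y g ltac:(lra) Hs) as [E1 E2]; rewrite E1 in Hp; rewrite E2 in E.
  assert (Br := Re_half_bounds _ _ _ _ _ _ g r y Hr ltac:(lra)).
  apply Rabs_def2 in Hp.
  assert (Hk : k = 0%Z).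
  { assert (K1 : (-1 < k)%Z) by (apply lt_IZR; apply Rmult_lt_reg_l with (2 * PI); [lra|]; destruct Hs as [-> | ->]; lra).
    assert (K2 : (k < 1)%Z) by (apply lt_IZR; apply Rmult_lt_reg_l with (2 * PI); [lra|]; destruct Hs as [-> | ->]; lra).
    lia. }
  subst k; change (IZR 0) with 0 in Hp.
  destruct (half_chord _ _ _ _ _ _ g t 0 r y ltac:(lra) Hr ltac:(lra) ltac:(lra)) as [K|[[_ K]|[K _]]]; try lra.
  - injection; lra.
  - fold (X t) (Y t) in K; rewrite <- E, Rminus_diag, Rmult_0_r in K.
    assert (X t < Re (z (r, y))) by nra; destruct Hs as [-> | ->]; lra.
Qed.

Lemma tangent_line_vertical x p : Re (z (x, 0)) = 0 -> Re (Z (x, 0)) = 0 -> (tangent_line z Z x p <-> Re p = 0).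
Proof.
  intros E1 E2; assert (N := Z_nonzero _ _ _ _ _ _ g (x, 0) ltac:(unfold closed_strip; simpl; lra)).
  assert (N2 : Im (Z (x, 0)) <> 0) by (intros E3; apply N, injective_projections; [exact E2|exact E3]).
  split.
  - intros [t ->].
    change (Re (z (x, 0)) + (t * Re (Z (x, 0)) - 0 * Im (Z (x, 0))) = 0); rewrite E1, E2; ring.
  - intros Hp; exists ((Im p - Im (z (x, 0))) / Im (Z (x, 0))); apply injective_projections.
    + change (Re p = Re (z (x, 0)) + ((Im p - Im (z (x, 0))) / Im (Z (x, 0)) * Re (Z (x, 0)) - 0 * Im (Z (x, 0)))).
      rewrite E1, E2, Hp; ring.
    + change (Im p = Im (z (x, 0)) + ((Im p - Im (z (x, 0))) / Im (Z (x, 0)) * Im (Z (x, 0)) + 0 * Re (Z (x, 0)))).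
      field; auto.
Qed.

(** The two parameters are [- a] and [a]. By symmetry both tangents are vertical, and both branches
    pass through the same point of the axis. *)
Lemma region_touches : touches_enclosing_bubble (region d z) z Z.
Proof.
  destruct (ge_sym _ _ _ _ _ _ g a 0 ltac:(lra)) as [S1 S2]; assert (Xa := proj2 X_ends).
  unfold X in Xa; rewrite Xa, Ropp_0 in S1.
  exists (- a), a; split; [lra|split; [|split; [|split]]].
  - apply injective_projections; [change (Re (z (- a, 0)) = Re (z (a, 0))); lra|exact S2].
  - intros b1 b2 Hb E; destruct (strip_injective _ _ _ _ _ _ g b1 0 b2 0 ltac:(lra) ltac:(lra) E) as [_ [K|[_ (k & [[K1 K2]|[K1 K2]])]]];
      try lra.
    exists k; split; lra.
  - intros p; rewrite (tangent_line_vertical a p Xa tangent_vertical).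
    rewrite (tangent_line_vertical (- a) p S1); [reflexivity|].
    destruct (ge_Zsym _ _ _ _ _ _ g a 0 ltac:(lra)) as [-> _]; apply tangent_vertical.
  - exists (bubble z a); split; [apply bubble_enclosed|apply bubble_outside].
Qed.

End Bubble.

(** * Assembly of the solution *)

Lemma water_wave_of_flow d eta yc G q z Z Z' u u' P a : flow d eta yc G q z Z Z' u u' P -> shape d z Z a ->
  water_wave G (d - yc) (- 1) (q / 2 + G * yc) (/ 2 * d ^ 2 + Re (P (0, - d))) (region d z) (stream d yc z P) d z Z.
Proof.
  intros F Sh; set (g := geometry_of_flow _ _ _ _ _ _ _ _ _ _ _ _ F Sh).
  assert (Hd := fl_d _ _ _ _ _ _ _ _ _ _ _ F).
  assert (sym : forall (k : BinNums.Z) x y, region d z (x, y) <-> region d z (2 * PI * IZR k + -1 * x, y)).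
  { intros; apply (region_fold _ _ _ _ _ _ g); auto. }
  constructor.
  - apply (region_domain _ _ _ _ _ _ g).
  - intros x y; rewrite (region_fold _ _ _ _ _ _ g 1%Z 1) by auto.
    now replace (2 * PI * 1 + 1 * x) with (x + 2 * PI) by ring.
  - apply (region_above _ _ _ _ _ _ g).
  - apply (frontier_region _ _ _ _ _ _ g).
  - apply (region_conformal _ _ _ _ _ _ g).
  - intros d' z' dz' cd; now apply (depth_unique _ _ _ _ _ _ g d' z' dz').
  - apply (stream_continuous _ _ _ _ _ _ _ _ _ _ _ _ F Sh).
  - apply (stream_C2 _ _ _ _ _ _ _ _ _ _ _ _ F Sh).
  - intros x y Hp; rewrite <- (stream_fold _ _ _ _ _ _ _ _ _ _ _ _ F Sh 1%Z 1 x y) by auto.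
    f_equal; change (IZR 1) with 1; ring.
  - destruct (crest_trough _ _ _ _ _ _ g) as [K1 K2]; exists PI, 0; split; [auto|split; [auto|]].
    rewrite (Re_side _ _ _ _ _ _ g), (Re_axis _ _ _ _ _ _ g) by lra; split; split; intros x y.
    + rewrite (sym 1%Z x y); now replace (2 * PI * 1 + -1 * x) with (2 * PI - x) by ring.
    + intros Hp; rewrite <- (stream_fold _ _ _ _ _ _ _ _ _ _ _ _ F Sh 1%Z (-1) x y) by auto.
      f_equal; change (IZR 1) with 1; ring.
    + rewrite (sym 0%Z x y); now replace (2 * PI * 0 + -1 * x) with (2 * 0 - x) by ring.
    + intros Hp; rewrite <- (stream_fold _ _ _ _ _ _ _ _ _ _ _ _ F Sh 0%Z (-1) x y) by auto.
      f_equal; change (IZR 0) with 0; ring.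
  - intros x y Hp; rewrite (stream_laplacian _ _ _ _ _ _ _ _ _ _ _ _ F Sh x y Hp); ring.
  - apply (stream_surface _ _ _ _ _ _ _ _ _ _ _ _ F Sh).
  - apply (stream_bernoulli _ _ _ _ _ _ _ _ _ _ _ _ F Sh).
  - apply (stream_bottom _ _ _ _ _ _ _ _ _ _ _ _ F Sh).
Qed.

Theorem theorem5 :
  exists eps : R, 0 < eps /\
  exists H0 : R, 0 < H0 /\
  forall G H : R, - eps < G < eps -> H0 < H ->
  exists (Omega B Q : R) (D : C -> Prop) (psi : R -> R -> R) (d : R) (z dz : C -> C),
    water_wave G H Omega B Q D psi d z dz /\
    touches_enclosing_bubble D z dz.
Proof.
  destruct touching_flow as (eps & d & Heps & Hd & Fam).
  exists eps; split; auto; exists 1; split; [lra|]; intros G H HG _.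
  (* The flat bottom lies at height [yc - d], so the shift [yc = d - H] places it at [- H]. *)
  destruct (Fam G (d - H)) as (q & z & Z & Z' & u & u' & P & a & F & Sh); [apply Rabs_def1; lra|].
  assert (W := water_wave_of_flow _ _ _ _ _ _ _ _ _ _ _ _ F Sh).
  assert (T := region_touches _ _ _ _ _ _ (geometry_of_flow _ _ _ _ _ _ _ _ _ _ _ _ F Sh)).
  replace (d - (d - H)) with H in W by ring.
  now exists (- 1), (q / 2 + G * (d - H)), (/ 2 * d ^ 2 + Re (P (0, - d))), (region d z), (stream d (d - H) z P), d, z, Z.
Qed.
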